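(* Let $(f,\Lambda)$ be a generic pair on $[0,L]$ and consider the magnetic geodesic flow $S(f,\Lambda)$ on the sphere $M$. 1. The flow has exactly two points of rank $0$; these are $(0,N)$ and $(0,S)$ (zero covectors at the poles), both of which are non-degenerate and have the center-center type. 2. The points of rank $1$ form the following two one-parameter families of critical orbits: $\mathcal{C}_1^k=\bigcup_{r\in I\cap(0,L)}\mathcal{O}_{r,k(r)}$ and $\mathcal{C}_1^\Lambda=\bigcup_{r\in(0,L)}\mathcal{O}_{r,\Lambda(r)}$. The critical orbit $\mathcal{O}_{r,k(r)}$, $r\in I\cap(0,L)$, is non-degenerate if and only if $k'(r)\Lambda'(r)\neq0$. The latter condition is equivalent to $r\in I\setminus\{r_j^*,r_\ell^\circ\}=[0,L]\setminus\{r_i,r_j^*,r_\ell^\circ\}$. If this orbit is non-degenerate then it has elliptic (respectively hyperbolic) type if and only if the sign of $-k'(r)\Lambda'(r)$ is ''$+$'' (respectively ''$-$''). This sign coincides with the sign of the Gaussian curvature at the point $(f(r),\Lambda(r))$ of the surface obtained by rotating the planar curve $(f,\Lambda)$ about the line $f=0$. The Gaussian curvature at the point $(a(r),k(r))$ of the surface obtained by rotating the planar curve $(a,k)$ about the line $a=0$ has the same sign, where $\gamma_1=(h,k)=(a^2/2,k)$. The signs near the special parameter values are as follows. - Near $r_j^*\in(0,L)$: ''$+$'' on the side where $f(r)>f(r_j^* )$ and ''$-$'' on the side where $f(r)<f(r_j^* )$. Near $r=0$ and near $r=L$: ''$+$''. - Near $r_i$: the same sign on both sides, namely ''$+$'' if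 $r_i$ is a local maximum of $f$ and ''$-$'' if it is a local minimum of $f$. - Near $r_\ell^\circ$: opposite signs on the two sides. The side with ''$+$'' is the one with larger $f$ if $|a|$ has a local minimum at $r_\ell^\circ$, and the one with smaller $f$ if $|a|$ has a local maximum at $r_\ell^\circ$ (one of these always holds). The critical orbit $\mathcal{O}_{r,\Lambda(r)}$, $r\in(0,L)$, is non-degenerate if and only if $\Lambda'(r)\ne0$. If this orbit is non-degenerate then it is of elliptic type. 3. Degenerate critical orbits have the form $\mathcal{O}_{r,k(r)}$, $r\in\{r_j^*,r_\ell^\circ\}$, i.e., they correspond to the points $\Gamma(r_j^* )$ of the curve $\Gamma=(f,\Lambda,1)$ with horizontal tangent line ($\Lambda'(r_j^* )=0$) and to the inflection points $\Gamma(r_\ell^\circ)$ of this curve. The curve $\Gamma$, the curve $\gamma=(a,-1,k)$ and the bifurcation curve $\gamma_1=(h,k)$ have the following local forms. - Near $r_j^*\in(0,L)$: $\Gamma$ is regular with non-zero curvature and horizontal tangent; $\gamma$ is regular and crosses the line $a=0$ transversally at $(a,k)=(0,\Lambda(r_j^* ))$ with slope $-f(r_j^* )<0$; $\gamma_1$ lies in $h\ge0$ and is (quadratically) tangent to the line $h=0$ at $(0,\Lambda(r_j^* ))$. At the endpoints $r=0$ and $r=L$: $\Gamma$ and $\gamma$ start, respectively end, on the vertical axis ($f=0$, respectively $a=0$) at the height $\Lambda(0)$, respectively $\Lambda(L)$, with horizontal tangent and non-zero curvature. - Near $r_i$: $\Gamma$ is regular with non-zero curvature and vertical tangent; $\gamma$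 goes to infinity on both sides of $r_i$, in opposite directions, along the common two-sided asymptote $f(r_i)a-\Lambda(r_i)+k=0$, the two arcs lying in different half-planes relative to it; correspondingly, both arcs of $\gamma_1$ go to infinity with $h\to+\infty$ and $k\to\pm\infty$ (opposite signs), and have the common asymptotic parabola $h=\frac{(k-\Lambda(r_i))^2}{2f^2(r_i)}$. - Near $r_\ell^\circ$: $\Gamma$ has an inflection point whose tangent is neither horizontal nor vertical; $\gamma$ has an ordinary cusp (semi-cubic parabola) at a finite point with $a\ne0$, with tangent of slope $-f(r_\ell^\circ)$; $\gamma_1$ has an ordinary cusp (semi-cubic parabola) at a point with $h>0$. Four options occur, according to whether $a(r_\ell^\circ)>0$ or $a(r_\ell^\circ)<0$ and whether $|a|$ has a local minimum or a local maximum at $r_\ell^\circ$. - Near points corresponding to hyperbolic saddle 3-atoms: let $\mathcal O_{\rho_1,k_*}$ and $\mathcal O_{\rho_2,k_*}$, $\rho_1<\rho_2$, be two hyperbolic critical circles in one singular fibre, at the levels $H=h_*>0$, $K=k_*$, and put $\sigma_i=-\operatorname{sgn}a(\rho_i)$, where $(\sigma_1,\sigma_2)$ is $(+,+)$, $(-,-)$, $(-,+)$ or $(+,-)$. Then the two arcs of $\gamma_1$ near $\rho_1$ and $\rho_2$ meet at $(h_*,k_* )$, with $h'(\rho_i)/k'(\rho_i)=\sigma_i\sqrt{2h_*}/f(\rho_i)$ having sign $\sigma_i$. The tangent line to $\Gamma$ at $\Gamma(\rho_i)$ is $\Lambda=k_*-\sigma_i\sqrt{2h_*}\,f$, and near $\Gamma(\rho_i)$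 the curve $\Gamma$ lies in the sector $|\Lambda-k_*|\le\sqrt{2h_*}\,f$, touching its lower boundary ray if $\sigma_i=+$ and its upper boundary ray if $\sigma_i=-$. If $\sigma_1=\sigma_2$, the two tangent lines coincide and the two arcs of $\gamma$ meet at one point; if $\sigma_1\ne\sigma_2$, the tangent lines are mirror images of each other in the line $f=0$ and the arcs of $\gamma$ pass through the points $(a,k)=(\pm\sqrt{2h_*},k_* )$. 4. The Reeb graph of the function $K|_{\{H=0\}}$ coincides with the Reeb graph of the function $\Lambda(r)$ on $[0,L]$, so it is a broken line $r_1^*,\dots,r_N^*$ obtained from the segment $[0,L]$ by adding vertices at the critical points $r_j^*$ of $\Lambda$, and $$K\Big(\bigcup_{r\in[r_j^*,r_{j+1}^*]}\mathcal{O}_{r,\Lambda(r)}\Big)=\Lambda([r_j^*,r_{j+1}^*])=[\Lambda(r_j^* ),\Lambda(r_{j+1}^* )].$$ For any point $p$ of the bifurcation complex, the intersection of a small circular neighbourhood of $p$ in the bifurcation complex with the set $\{h>h(p),\ k=k(p)\}$ is connected. In other words, for any vertex of the bifurcation complex (respectively any edge corresponding to a 1-parameter family of non-degenerate singular fibres), there exists a unique face of the bifurcation complex adjacent to this vertex (respectively edge) on the right.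
   Context: Generic pairs. Fix $L>0$. A pair of $C^\infty$ functions $f,\Lambda:[0,L]\to\mathbb R$ is generic if: (1) $f>0$ on $(0,L)$ and $f$ extends to a smooth odd $2L$-periodic function on $\mathbb R$; (2) $\Lambda$ extends to a smooth even $2L$-periodic function on $\mathbb R$; (3) $f'(0)=1$, $f'(L)=-1$; (4) $f$ and $\Lambda$ are Morse functions (all critical points on $[0,L]$, endpoints included, are non-degenerate); (5) $(\Lambda'(r))^2+(f'(r))^2>0$ on $[0,L]$; (6) the function $f'\Lambda''-f''\Lambda'$ has only simple zeros. The system. $M$ is a 2-sphere with poles $N$ ($r=0$) and $S$ ($r=L$), with coordinates $(r,\varphi)\in(0,L)\times\mathbb R/2\pi\mathbb Z$ on $M\setminus\{N,S\}$, with the Riemannian metric $ds^2=dr^2+f^2(r)d\varphi^2$ and the closed 2-form $\beta=\Lambda'(r)dr\wedge d\varphi$, both extending smoothly to $M$. The magnetic geodesic flow $S(f,\Lambda)$ is the Hamiltonian system on $T^*M$ given (over $M\setminus\{N,S\}$, extended by continuity to $T^*M$) by $$H=\frac{p_r^2}{2}+\frac{p_\varphi^2}{2f^2(r)},\qquad \widetilde\omega=dp_r\wedge dr+dp_\varphi\wedge d\varphi+\Lambda'(r)dr\wedge d\varphi ,$$ with additional first integral $K=p_\varphi+\Lambda(r)$, whose Hamiltonian flow is $2\pi$-periodic. The momentum mapping is $\mathcal F=(H,K):T^*M\to\mathbb R^2$ with values $(h,k)$. The rank of a point is the rank of $d\mathcal F$ there; points of rank $<2$ are critical, and the bifurcation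 diagram is the image of the critical points under $\mathcal F$. The Liouville foliation has as fibres the connected components of the level sets of $\mathcal F$. A hyperbolic saddle 3-atom is a neighbourhood, within a level $\{H=h_*\}$, of a singular fibre containing hyperbolic critical circles. The bifurcation complex is the base (space of fibres) of the Liouville foliation; $h,k$ are regarded as functions on it, and it maps to $\mathbb R^2$ by $(h,k)$. Its vertices and edges are the points and arcs lying over the bifurcation diagram that correspond to singular fibres. A small circular neighbourhood of $p$ is the connected component containing $p$ of the preimage, in the bifurcation complex, of a sufficiently small disc centred at $(h(p),k(p))$. ''On the right'' means in the direction of increasing $h$. Notation. $\{r_i\}_{i=1}^n$ are the critical points of $f$, $r_1^*=0<r_2^*<\dots<r_N^*=L$ the critical points of $\Lambda$, and $\{r_\ell^\circ\}$ the zeros of $f'\Lambda''-f''\Lambda'$ on $[0,L]$ (these three finite sets are pairwise disjoint); $I=[0,L]\setminus\{r_i\}$. In the coordinates $(p_r,K,r,\varphi)$, $\mathcal{O}_{\rho,\kappa}=\{p_r=0,\ K=\kappa,\ r=\rho,\ \varphi\in\mathbb R/2\pi\mathbb Z\}$ for $\rho\in(0,L)$; $\mathcal{O}_{0,\Lambda(0)}$ and $\mathcal{O}_{L,\Lambda(L)}$ denote the points $(0,N)$ and $(0,S)$. For $r\in I$: $a(r)=\frac{\Lambda'(r)}{f'(r)}$, $h(r)=\frac12a(r)^2$, $k(r)=\Lambda(r)-f(r)\frac{\Lambda'(r)}{f'(r)}$, $\gamma_1(r)=(h(r),k(r))$, $\gamma(r)=(a(r),-1,k(r))$. The curve $\Gamma=(f,\Lambda,1)$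 is regarded as a curve in the plane with horizontal coordinate $f$ and vertical coordinate $\Lambda$, the curve $\gamma$ as a curve in the plane with horizontal coordinate $a$ and vertical coordinate $k$. In the second statement of item 4, $h(p),k(p)$ are the values at $p$ of the functions $h,k$ on the bifurcation complex. $[\Lambda(r_j^* ),\Lambda(r_{j+1}^* )]$ denotes the segment with these endpoints, irrespective of their order. Non-degeneracy. A rank-0 point is non-degenerate if the linearizations of the Hamiltonian vector fields of $H$ and $K$ at it span a Cartan subalgebra of $\mathfrak{sp}(4,\mathbb R)$; it is of center-center type if the eigenvalues of the operators in this subalgebra are all purely imaginary. A rank-1 point $x$, with $\alpha\,dH+\beta\,dK=0$ at $x$, $(\alpha,\beta)\ne(0,0)$, is non-degenerate if the linearization at $x$ of the Hamiltonian vector field of $\alpha H+\beta K$ induces an invertible operator on $W^\perp/W$, where $W$ is the line spanned by the Hamiltonian vector fields of $H,K$ at $x$ and $W^\perp$ is its $\widetilde\omega$-orthogonal complement; it is elliptic (respectively hyperbolic) if the eigenvalues of this operator are purely imaginary (respectively real). An orbit is non-degenerate, elliptic or hyperbolic if its points are. An inflection point of a planar curve is a point where its velocity is nonzero, velocity and acceleration are collinear, and the first and third derivatives are linearly independent. An ordinary cusp is a point where the velocity vanishes and the second and third derivatives are linearly independent. *)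

(* Defs.v *)
From HB Require Import structures.
From mathcomp Require Export all_boot all_order all_algebra.
From mathcomp Require Import complex.
From mathcomp Require Export all_classical all_reals all_analysis.
From mathcomp Require Import ring lra.

Set Implicit Arguments.
Unset Strict Implicit.
Unset Printing Implicit Defensive.

Import Order.TTheory GRing.Theory Num.Theory.
Import numFieldNormedType.Exports.

Local Open Scope classical_set_scope.
Local Open Scope ring_scope.

(* No formal polynomials here: these notations are for functions R -> R. *)
Notation "f ^` ()" := (derive1 f) : ring_scope.
Notation "f ^` ( n )" := (derive1n n f) : ring_scope.

Section GenericPairs.
Context {R : realType}.
Implicit Types (L r : R) (f Lam g : R -> R).

Definition smooth g := forall n r, derivable g^`(n) r 1.

Definition crit L g : set R := [set r | 0 <= r <= L /\ g^`() r = 0].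

Definition morse L g := forall r, crit L g r -> g^`(2) r != 0.

Definition wronsk f Lam r : R := f^`() r * Lam^`(2) r - f^`(2) r * Lam^`() r.

Definition simple_zeros L g :=
  forall r, 0 <= r <= L -> g r = 0 -> g^`() r != 0.

(* A pair on [0, L] is represented by its odd, resp. even, 2L-periodic
   extension, which is determined by the values on [0, L]. *)
Record generic L f Lam : Prop := Generic {
  generic_f_pos : forall r, 0 < r < L -> 0 < f r;
  generic_f_smooth : smooth f;
  generic_f_odd : forall r, f (- r) = - f r;
  generic_f_per : forall r, f (r + 2 * L) = f r;
  generic_Lam_smooth : smooth Lam;
  generic_Lam_even : forall r, Lam (- r) = Lam r;
  generic_Lam_per : forall r, Lam (r + 2 * L) = Lam r;
  generic_f'0 : f^`() 0 = 1;
  generic_f'L : f^`() L = -1;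
  generic_f_morse : morse L f;
  generic_Lam_morse : morse L Lam;
  generic_immersed :
    forall r, 0 <= r <= L -> 0 < Lam^`() r ^+ 2 + f^`() r ^+ 2;
  generic_simple : simple_zeros L (wronsk f Lam) }.

Definition infl L f Lam : set R := [set r | 0 <= r <= L /\ wronsk f Lam r = 0].

Definition Ireg L f : set R := [set r | 0 <= r <= L] `\` crit L f.

Definition afun f Lam r : R := Lam^`() r / f^`() r.
Definition hfun f Lam r : R := afun f Lam r ^+ 2 / 2.
Definition kfun f Lam r : R := Lam r - f r * (Lam^`() r / f^`() r).

Definition local_min g r := \forall s \near r, g r <= g s.
Definition local_max g r := \forall s \near r, g s <= g r.

End GenericPairs.

Section Geometry.
Context {R : realType}.
Implicit Types (x z : R -> R) (t : R).

Definition regular x z t := (x^`() t, z^`() t) <> (0, 0).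

Definition curvature x z t : R :=
  (x^`() t * z^`(2) t - z^`() t * x^`(2) t)
  / Num.sqrt (x^`() t ^+ 2 + z^`() t ^+ 2) ^+ 3.

Definition inflection x z t :=
  [/\ regular x z t,
      x^`() t * z^`(2) t - z^`() t * x^`(2) t = 0 &
      x^`() t * z^`(3) t - z^`() t * x^`(3) t != 0].

Definition ordinary_cusp x z t :=
  [/\ x^`() t = 0, z^`() t = 0 &
      x^`(2) t * z^`(3) t - z^`(2) t * x^`(3) t != 0].

Definition horizontal_tangent x z t := regular x z t /\ z^`() t = 0.
Definition vertical_tangent x z t := regular x z t /\ x^`() t = 0.

(* Meaningful when the curve is regular at t. *)
Definition tangent_line x z t : set (R * R) :=
  [set P | exists s : R, P = (x t + s * x^`() t, z t + s * z^`() t)].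

Definition dist2 (P Q : R * R) : R :=
  Num.sqrt ((P.1 - Q.1) ^+ 2 + (P.2 - Q.2) ^+ 2).

(* The distance from the moving point c(t) to the set S tends to 0 along F. *)
Definition asymptotic (F : set_system R) (c : R -> R * R) (S : set (R * R)) :=
  forall e : R, 0 < e -> \forall t \near F, exists2 Q, S Q & dist2 (c t) Q < e.

Definition row3 (a b c : R) : 'rV[R]_3 := \row_i nth 0 [:: a; b; c] i.
Definition dot3 (v w : 'rV[R]_3) : R := (v *m w^T) 0 0.
Definition det3 (u v w : 'rV[R]_3) : R :=
  \det (col_mx u (col_mx v w) : 'M[R]_(1 + (1 + 1))).

Definition du (X : R -> R -> 'rV[R]_3) (u v : R) : 'rV[R]_3 :=
  \row_i derive1 (fun s => X s v 0 i) u.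
Definition dv (X : R -> R -> 'rV[R]_3) (u v : R) : 'rV[R]_3 :=
  \row_i derive1 (fun s => X u s 0 i) v.

(* (L N - M^2) / (E G - F^2).  With the unit normal n = X_u x X_v / |X_u x X_v|
   one has <w, n> = det (w, X_u, X_v) / sqrt (E G - F^2). *)
Definition gauss_curvature (X : R -> R -> 'rV[R]_3) (u v : R) : R :=
  let Xu := du X u v in let Xv := dv X u v in
  let W := dot3 Xu Xu * dot3 Xv Xv - dot3 Xu Xv ^+ 2 in
  let second w := det3 w Xu Xv / Num.sqrt W in
  (second (du (du X) u v) * second (dv (dv X) u v)
   - second (dv (du X) u v) ^+ 2) / W.

Definition revolution x z (t phi : R) : 'rV[R]_3 :=
  row3 (x t * cos phi) (x t * sin phi) (z t).

End Geometry.

(* M is the sphere of radius L / pi in R^3, N = (0, 0, L / pi); a point of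
  T^*M is a pair (x, p) with x in M and p orthogonal to x, p acting on tangent
  vectors by the scalar product of R^3.  The metric ds^2 is not the one induced
  from R^3: it enters through H only.  The coordinate r is rad0 times the
  colatitude; it is 0 at N and L at S. *)

Section PhaseSpace.
Context {R : realType}.
Variables (L : R) (f Lam : R -> R).

Definition phase : Type := ('rV[R]_3 * 'rV[R]_3)%type.

HB.instance Definition _ := Topological.on phase.

Definition rad0 : R := L / pi.

Definition TM : set phase :=
  [set z | dot3 z.1 z.1 = rad0 ^+ 2 /\ dot3 z.1 z.2 = 0].

Definition northM : 'rV[R]_3 := row3 0 0 rad0.
Definition southM : 'rV[R]_3 := row3 0 0 (- rad0).
Definition zeroN : phase := (northM, 0).
Definition zeroS : phase := (southM, 0).

(* The covector with coordinates p_r = pr, p_phi = pf at the point with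
   coordinates r and phi, where (c, s) = (cos phi, sin phi), 0 < r < L. *)
Definition covector_at (r c s pr pf : R) : phase :=
  let sn := sin (r / rad0) in let cs := cos (r / rad0) in
  (row3 (rad0 * sn * c) (rad0 * sn * s) (rad0 * cs),
   pr *: row3 (cs * c) (cs * s) (- sn)
   + (pf / (rad0 * sn) ^+ 2) *: row3 (- (rad0 * sn * s)) (rad0 * sn * c) 0).

Definition rcoord (z : phase) : R := rad0 * acos (z.1 0 2 / rad0).

Definition p_phi (z : phase) : R := z.1 0 0 * z.2 0 1 - z.1 0 1 * z.2 0 0.

(* The value of p on d/dr; meaningful away from the poles. *)
Definition p_r (z : phase) : R :=
  let t := rcoord z / rad0 in
  cos t * (z.1 0 0 * z.2 0 0 + z.1 0 1 * z.2 0 1) / (rad0 * sin t)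
  - sin t * z.2 0 2.

(* Over the poles this is the continuous extension, because f'(0) = 1 and
   f'(L) = -1. *)
Definition Hfun (z : phase) : R :=
  if (z.1 == northM) || (z.1 == southM) then dot3 z.2 z.2 / 2
  else p_r z ^+ 2 / 2 + p_phi z ^+ 2 / (2 * f (rcoord z) ^+ 2).

Definition Kfun (z : phase) : R := p_phi z + Lam (rcoord z).

Definition momentum (z : phase) : R * R := (Hfun z, Kfun z).

(* At the poles only kappa = Lam 0, resp. kappa = Lam L, makes sense. *)
Definition circle_orbit (rho kappa : R) : set phase :=
  if rho == 0 then [set zeroN] else if rho == L then [set zeroS] else
  [set z | exists phi : R,
     z = covector_at rho (cos phi) (sin phi) 0 (kappa - Lam rho)].

(* Chart coordinates are (momenta, positions): (p_r, p_phi, r, phi) in [Cyl];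
   (q_u, q_v, u, v) in [PoleN] and [PoleS], where (u, v) = rho (cos phi, sin phi)
   with rho = r, resp. rho = L - r, the geodesic distance to the pole. *)
Inductive chart_name := Cyl | PoleN | PoleS.

Definition rho (y : 'rV[R]_4) : R := Num.sqrt (y 0 2 ^+ 2 + y 0 3 ^+ 2).

Definition chart (c : chart_name) (y : 'rV[R]_4) : phase :=
  let q_rho := (y 0 0 * y 0 2 + y 0 1 * y 0 3) / rho y in
  let q_phi := y 0 2 * y 0 1 - y 0 3 * y 0 0 in
  match c with
  | Cyl => covector_at (y 0 2) (cos (y 0 3)) (sin (y 0 3)) (y 0 0) (y 0 1)
  | PoleN => if rho y == 0 then (northM, row3 (y 0 0) (y 0 1) 0) else
      covector_at (rho y) (y 0 2 / rho y) (y 0 3 / rho y) q_rho q_phi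
  | PoleS => if rho y == 0 then (southM, row3 (y 0 0) (y 0 1) 0) else
      covector_at (L - rho y) (y 0 2 / rho y) (y 0 3 / rho y) (- q_rho) q_phi
  end.

(* The notions below do not depend on the chart.  The pole charts are used only
   at the points over the poles, and [Cyl] everywhere else. *)
Definition coords_at (z : phase) (c : chart_name) (y : 'rV[R]_4) : Prop :=
  chart c y = z /\
  match c with Cyl => 0 < y 0 2 < L | _ => y 0 2 = 0 /\ y 0 3 = 0 end.

(* The 2-form beta in a chart is [twist] times the area form of the position
   coordinates: dr /\ dphi = du /\ dv / rho near N, - du /\ dv / rho near S. *)
Definition twist (c : chart_name) (y : 'rV[R]_4) : R :=
  match c with
  | Cyl => Lam^`() (y 0 2)
  | PoleN => if rho y == 0 then Lam^`(2) 0 else Lam^`() (rho y) / rho y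
  | PoleS =>
      if rho y == 0 then Lam^`(2) L else - Lam^`() (L - rho y) / rho y
  end.

Definition wedge (i j : 'I_4) : 'M[R]_4 := delta_mx i j - delta_mx j i.

(* omega (v, w) = v *m Omega *m w^T on row vectors. *)
Definition Omega (c : chart_name) (y : 'rV[R]_4) : 'M[R]_4 :=
  wedge 0 2 + wedge 1 3 + twist c y *: wedge 2 3.

Definition dloc (G : phase -> R) (c : chart_name) (y : 'rV[R]_4) : 'rV[R]_4 :=
  \row_i 'D_(delta_mx 0 i) (G \o chart c) y.

(* omega (hamvf G, .) = - dG *)
Definition hamvf (G : phase -> R) (c : chart_name) (y : 'rV[R]_4) :
  'rV[R]_4 := - dloc G c y *m invmx (Omega c y).

(* Meaningful at a zero of the Hamiltonian field of G; it acts on row vectors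
   from the right. *)
Definition linearization (G : phase -> R) (c : chart_name) (y : 'rV[R]_4) :
  'M[R]_4 := \matrix_(i, j) 'D_(delta_mx 0 i) (fun w => hamvf G c w 0 j) y.

Definition has_rank (n : nat) : set phase :=
  [set z | exists c y, coords_at z c y /\
     \rank (col_mx (dloc Hfun c y) (dloc Kfun c y)) = n].

Definition rank0 : set phase := TM `&` has_rank 0.
Definition rank1 : set phase := TM `&` has_rank 1.

Definition lie_bracket (A B : 'M[R]_4) : 'M[R]_4 := A *m B - B *m A.

Definition sp (Om : 'M[R]_4) : set 'M[R]_4 :=
  [set A | A *m Om + Om *m A^T = 0].

(* Nilpotency: some term of the lower central series, which is spanned by the
   iterated brackets [x1, [x2, ..., [xn, a]]], vanishes. *)
Definition cartan_subalgebra (g h : set 'M[R]_4) : Prop :=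
  [/\ h `<=` g,
      h 0 /\ (forall (s t : R) A B, h A -> h B -> h (s *: A + t *: B)),
      forall A B, h A -> h B -> h (lie_bracket A B),
      exists n : nat, forall (xs : seq 'M[R]_4) (a : 'M[R]_4),
        size xs = n -> (forall x, x \in xs -> h x) -> h a ->
        foldr lie_bracket a xs = 0 &
      forall A, g A -> (forall B, h B -> h (lie_bracket A B)) -> h A].

Definition span2 (A B : 'M[R]_4) : set 'M[R]_4 :=
  [set C | exists s t : R, C = s *: A + t *: B].

Definition imaginary_spectrum n (A : 'M[R]_n) :=
  forall z : R[i],
    eigenvalue (map_mx (real_complex R) A) z -> complex.Re z = 0.

Definition real_spectrum n (A : 'M[R]_n) :=
  forall z : R[i],
    eigenvalue (map_mx (real_complex R) A) z -> complex.Im z = 0.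

Definition lin_span (c : chart_name) (y : 'rV[R]_4) : set 'M[R]_4 :=
  span2 (linearization Hfun c y) (linearization Kfun c y).

Definition nondegenerate0 : set phase :=
  [set z | exists c y, coords_at z c y /\
     cartan_subalgebra (sp (Omega c y)) (lin_span c y)].

Definition center_center : set phase :=
  [set z | exists c y, [/\ coords_at z c y,
     cartan_subalgebra (sp (Omega c y)) (lin_span c y) &
     forall A, lin_span c y A -> imaginary_spectrum A]].

(* At a rank-1 point z, C is the matrix, in some basis of Wo / W (given by the
   rows of B), of the operator induced by the linearization of the field of
   alpha H + beta K, for some (alpha, beta) != 0 with alpha dH + beta dK = 0. *)
Definition induced_operator (z : phase) (C : 'M[R]_2) : Prop :=
  exists c y (alpha beta : R) (B : 'M[R]_(2, 4)),
  let G := fun w => alpha * Hfun w + beta * Kfun w in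
  let A := linearization G c y in
  let W := col_mx (hamvf Hfun c y) (hamvf Kfun c y) in
  let Wo := kermx (Omega c y *m W^T) in
  [/\ coords_at z c y /\ \rank W = 1%N,
      (alpha, beta) <> (0, 0) /\
      alpha *: dloc Hfun c y + beta *: dloc Kfun c y = 0,
      (W + B == Wo)%MS /\ \rank (W + B)%MS = (\rank W + 2)%N,
      stablemx W A &
      (B *m A - C *m B <= W)%MS].

Definition nondegenerate1 : set phase :=
  [set z | exists2 C, induced_operator z C & C \in unitmx].

Definition elliptic : set phase :=
  [set z | exists C, [/\ induced_operator z C, C \in unitmx &
                         imaginary_spectrum C]].

Definition hyperbolic : set phase :=
  [set z | exists C, [/\ induced_operator z C, C \in unitmx &
                         real_spectrum C]].

(* Critical points of the restriction of K to the submanifold {H = 0}, i.e. to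
   the zero section, on which the position coordinates are coordinates. *)
Definition critK0 : set phase :=
  [set z | [/\ TM z, Hfun z = 0 &
     exists c y, [/\ coords_at z c y,
       'D_(delta_mx 0 2) (Kfun \o chart c) y = 0 &
       'D_(delta_mx 0 3) (Kfun \o chart c) y = 0]]].

End PhaseSpace.

Section Reeb.
Context {T : topologicalType} {S : Type}.
Variables (X : set T) (g : T -> S).

Definition fibre (x : T) : set T :=
  connected_component (X `&` [set y | g y = g x]) x.

Definition reeb : Type := {C : set T | exists2 x, X x & C = fibre x}.

Definition reeb_fibre (p : reeb) : set T := sval p.

Definition reeb_union (U : set reeb) : set T :=
  [set x | exists2 p, U p & reeb_fibre p x].

(* The quotient topology of the subspace X. *)
Definition reeb_open (U : set reeb) : Prop :=
  exists2 O : set T, open O & X `&` O = reeb_union U.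

Definition reeb_val (p : reeb) : S := g (projT1 (cid2 (svalP p))).

Lemma reeb_fibre_sub p : reeb_fibre p `<=` X.
Proof.
case: p => C /= [x Xx ->] y [A [Ax sA _] Ay].
by case: (sA _ Ay).
Qed.

Lemma reeb_fibre_eq p x : reeb_fibre p x -> reeb_fibre p = fibre x.
Proof.
case: p => C /= [y Xy ->] yx.
have gx : g x = g y by case: yx => A [_ sA _] /sA[].
rewrite /fibre gx; exact: same_connected_component.
Qed.

Lemma reeb_inj p q x : reeb_fibre p x -> reeb_fibre q x -> p = q.
Proof.
move=> px qx; have : reeb_fibre p = reeb_fibre q.
  by rewrite (reeb_fibre_eq px) (reeb_fibre_eq qx).
case: p q {px qx} => C hC [D hD] /= CD; subst D.
by congr exist; exact: Prop_irrelevance.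
Qed.

Lemma fibre_refl x : X x -> fibre x x.
Proof. by move=> Xx; apply: connected_component_refl. Qed.

Lemma reeb_valE p x : reeb_fibre p x -> reeb_val p = g x.
Proof.
rewrite /reeb_val; case: cid2 => y Xy /= pE px.
have : fibre y x by rewrite -pE.
by case=> A [_ sA _] /sA[].
Qed.

Lemma reeb_openT : reeb_open setT.
Proof.
exists setT; first exact: openT.
rewrite setIT eqEsubset; split=> [x Xx | x [p _] /reeb_fibre_sub //].
have h : exists2 y, X y & fibre x = fibre y by exists x.
by exists (exist _ (fibre x) h) => //=; exact: fibre_refl.
Qed.

Lemma reeb_openI : setI_closed reeb_open.
Proof.
move=> U V [A oA UA] [B oB VB]; exists (A `&` B); first exact: openI.
rewrite setIIr UA VB eqEsubset; split=> [x [[p Up px] [q Vq qx]]|x [p [Up Vp] px]].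
  by exists p => //; split=> //; rewrite (reeb_inj px qx).
by split; exists p.
Qed.

Lemma reeb_open_bigU (I : Type) (U : I -> set reeb) :
  (forall i, reeb_open (U i)) -> reeb_open (\bigcup_i U i).
Proof.
move=> oU; exists (\bigcup_i projT1 (cid2 (oU i))).
  by apply: bigcup_open => i _; case: cid2.
have hE i : X `&` projT1 (cid2 (oU i)) = reeb_union (U i) by case: cid2.
rewrite setI_bigcupr eqEsubset; split=> [x [i _]|x [p [i _ Uip] px]].
  by rewrite hE => -[p Up px]; exists p => //; exists i.
by exists i => //; rewrite hE; exists p.
Qed.

HB.instance Definition _ := gen_eqMixin reeb.
HB.instance Definition _ := gen_choiceMixin reeb.
HB.instance Definition _ :=
  isOpenTopological.Build reeb reeb_openT reeb_openI reeb_open_bigU.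

Definition reeb_vertices (C : set T) : set reeb :=
  [set p | exists2 x, C x & reeb_fibre p x].

End Reeb.

Definition homeomorphism (T U : topologicalType) (phi : T -> U) :=
  exists psi : U -> T,
    [/\ continuous phi, continuous psi, cancel phi psi & cancel psi phi].

(* Via j, the space T with its set of vertices V and its height function v is
   the segment [0, L] with the vertices rs and the height function g. *)
Definition broken_line {R : realType} (T : topologicalType) (j : T -> R)
    (V : set T) (v : T -> R) (L : R) (rs : seq R) (g : R -> R) :=
  exists b : R -> T,
    [/\ {within `[0, L], continuous b} /\ continuous j,
        forall r, 0 <= r <= L -> j (b r) = r,
        forall t, 0 <= j t <= L /\ b (j t) = t,
        V = b @` [set` rs] &
        forall t, v t = g (j t)].

Section Complex.
Context {R : realType}.
Variables (L : R) (f Lam : R -> R).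

Definition bcomplex : Type := reeb (TM L) (momentum L f Lam).

HB.instance Definition _ := Topological.on bcomplex.

Implicit Types (p q : bcomplex) (A E : set bcomplex).

Definition bh p : R := (reeb_val p).1.
Definition bk p : R := (reeb_val p).2.

Definition circular_nbhd p (e : R) : set bcomplex :=
  connected_component [set q | dist2 (bh q, bk q) (bh p, bk p) < e] p.

Definition right_of p : set bcomplex := [set q | bh p < bh q /\ bk q = bk p].

Definition singular : set bcomplex :=
  [set p | exists2 z, reeb_fibre p z & (rank0 L f Lam `|` rank1 L f Lam) z].

Definition nondegenerate_singular : set bcomplex :=
  [set p | [/\ singular p,
     reeb_fibre p `&` rank0 L f Lam = set0 &
     reeb_fibre p `&` rank1 L f Lam `<=` nondegenerate1 L f Lam]].

Definition face A :=
  exists2 p, ~ singular p & A = connected_component (~` singular) p.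

(* An open arc of non-degenerate singular fibres, relatively open in the set of
   all singular fibres (so that no other such arc branches off or crosses). *)
Definition edge E :=
  [/\ E `<=` nondegenerate_singular,
      exists2 O, open O & E = O `&` singular &
      exists (c : R -> bcomplex) (j : bcomplex -> R),
      [/\ E = c @` `]0, 1[, {within `]0, 1[, continuous c},
          {within E, continuous j} & forall t, 0 < t < 1 -> j (c t) = t]].

Definition vertex p := singular p /\ ~ exists2 E, edge E & E p.

Definition adjacent_right A p := closure (A `&` right_of p) p.

End Complex.

Section Check.
Context {R : realType}.
Variables (L : R) (f Lam : R -> R).
Hypothesis L0 : 0 < L.

Let rad0_gt0 : 0 < @rad0 R L.
Proof. by rewrite divr_gt0 // pi_gt0. Qed.

Lemma rcoord_point (r c s pr pf : R) :
  0 <= r <= L -> rcoord L (covector_at L r c s pr pf) = r.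
Proof.
move=> /andP[r0 rL]; have z0 := lt0r_neq0 rad0_gt0.
rewrite /rcoord /= mxE /= [_ * cos _]mulrC mulfK // cosK; first by field.
rewrite in_itv /= divr_ge0 ?(ltW rad0_gt0) //= ler_pdivrMr //.
by rewrite /rad0 mulrCA divff ?mulr1 // lt0r_neq0 // pi_gt0.
Qed.

Lemma HK_point (r phi pr pf : R) : 0 < r < L ->
  let z := covector_at L r (cos phi) (sin phi) pr pf in
  [/\ TM L z, Hfun L f z = pr ^+ 2 / 2 + pf ^+ 2 / (2 * f r ^+ 2) &
      Kfun L Lam z = pf + Lam r].
Proof.
move=> /andP[r0 rL] z; have z0 := lt0r_neq0 rad0_gt0.
have rE : rcoord L z = r by rewrite rcoord_point // !ltW.
have s0 : sin (r / rad0 L) != 0.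
  rewrite lt0r_neq0 // sin_gt0_pi // divr_gt0 //= ltr_pdivrMr //.
  by rewrite /rad0 mulrCA divff ?mulr1 // lt0r_neq0 // pi_gt0.
have e1 := cos2Dsin2 phi; have e2 := cos2Dsin2 (r / rad0 L).
have pE : p_phi z = pf.
  rewrite /p_phi /z /covector_at /= !mxE /=.
  transitivity (pf * (cos phi ^+ 2 + sin phi ^+ 2)); first by field; apply/andP.
  by rewrite e1 mulr1.
have prE : p_r L z = pr.
  rewrite /p_r rE /z /covector_at /= !mxE /=.
  transitivity (pr * (cos (r / rad0 L) ^+ 2 * (cos phi ^+ 2 + sin phi ^+ 2)
                + sin (r / rad0 L) ^+ 2)); first by field; apply/andP.
  by rewrite e1 mulr1 e2 mulr1.
split.
- rewrite /TM /dot3 /z /covector_at /= !mxE !big_ord_recl !big_ord0 !mxE /=.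
  split; last first.
    transitivity (pr * rad0 L * sin (r / rad0 L) * cos (r / rad0 L)
      * (cos phi ^+ 2 + sin phi ^+ 2 - 1)); first by field; apply/andP.
    by rewrite e1 subrr mulr0.
  transitivity (rad0 L ^+ 2 * (sin (r / rad0 L) ^+ 2 *
     (cos phi ^+ 2 + sin phi ^+ 2) + cos (r / rad0 L) ^+ 2)); first by ring.
  by rewrite e1 mulr1 [X in _ * X]addrC e2 mulr1.
- rewrite /Hfun ifF ?rE ?prE ?pE //.
  apply/negP => h.
  have : z.1 0 0 ^+ 2 + z.1 0 1 ^+ 2 = 0.
    by case/orP: h => /eqP ->; rewrite !mxE /= expr0n addr0.
  rewrite /z /= !mxE /= => h0.
  have : (rad0 L * sin (r / rad0 L)) ^+ 2 * (cos phi ^+ 2 + sin phi ^+ 2) = 0.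
    by rewrite -h0; ring.
  by move/eqP; rewrite e1 mulr1 sqrf_eq0 mulf_eq0 (negbTE z0) (negbTE s0).
- by rewrite /Kfun rE pE.
Qed.

End Check.

(* Main.v *)
(* For fixed K = kappa put v = (kappa - Lam) / f.  Then v^2 <= 2 H, and p_r = +- sqrt (2 H - v^2),
   so a fibre over (h, kappa) lies over a connected component of {r | v^2 <= 2 h}.  Conversely
   each component carries a single fibre: the two sheets are glued at its ends, at a pole by the
   rotation by pi.  With q = kappa - Lam a circle is critical iff q (q f' + f Lam') = 0, that is
   q = 0 or kappa = k, and the eigenvalues of the induced operator are, up to a real factor, the
   square roots of - (Lam' / f)^2, respectively of k' Lam' / f^2.  With W = f' Lam'' - f'' Lam'
   one has a' = W / f'^2, k' = - f a' and h' = a a', which gives the signs and the local forms of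
   the curves.

   For the bifurcation complex, v' = N / f^2 where N, N' and N'' have no common zero on [0, L].
   Hence v is monotone on both sides of every point, and as h increases from h (p) the component
   below p only grows: right of p, a small circular neighbourhood is a ray h |-> component.  The
   zeros of N are isolated, so this ray consists of regular fibres for h close to h (p); its face
   is the unique one adjacent to p on the right, and moving the ray along an edge shows that this
   face is constant on the edge. *)

(* Two obstacles shape the proof. The first is the poles, where cylindrical coordinates degenerate.
   The linearizations there depend only on H and K along the axes of a pole chart, and this reduces
   to the fact that (t / f t)^2, extended by 1, has derivative 0 at 0; the south pole is treated as
   the pole at 0 of the reflected pair. For the topology, T^*M is parametrized by [lift], which is
   total because division by 0 gives 0, and which is continuous up to the poles at fixed kappa
   because Lam' vanishes there. The second obstacle is that an edge comes with an arbitrary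
   topological parametrization. It is compared with the explicit family of critical circles: the
   composite of the family with the inverse parametrization is continuous and injective, hence
   monotone, so the family fills a neighbourhood in the edge. N, N' and N'' have no common zero
   because f' N' - f'' N = - f W and W has simple zeros; at the poles Lam'' != 0 takes over. *)
Require Import Defs.
From mathcomp Require Import complex.
From mathcomp Require Import ring lra.

Set Implicit Arguments.
Unset Strict Implicit.
Unset Printing Implicit Defensive.

Import Order.TTheory GRing.Theory Num.Theory.
Import numFieldNormedType.Exports.

Local Open Scope classical_set_scope.
Local Open Scope ring_scope.

(** * Real calculus *)

(* [ring], [field] and [lra] compare their atoms up to conversion, which diverges
   on iterated derivatives; hence the generalization of these atoms. *)
Ltac gen_jets :=
  repeat match goal with
  | H : context [derive1n _ _ _] |- _ => revert H
  | H : context [derive1 _ _] |- _ => revert H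
  | H : context [wronsk _ _ _] |- _ => revert H
  | H : context [afun _ _ _] |- _ => revert H
  | H : context [kfun _ _ _] |- _ => revert H
  | H : context [hfun _ _ _] |- _ => revert H
  end;
  repeat match goal with
  | |- context [derive1n ?n ?g ?x] => generalize (derive1n n g x)
  | |- context [derive1 ?g ?x] => generalize (derive1 g x)
  | |- context [wronsk ?g ?l ?x] => generalize (wronsk g l x)
  | |- context [afun ?g ?l ?x] => generalize (afun g l x)
  | |- context [kfun ?g ?l ?x] => generalize (kfun g l x)
  | |- context [hfun ?g ?l ?x] => generalize (hfun g l x)
  end; intros.
Ltac jring := gen_jets; ring.
Ltac jfield := gen_jets; field.
Ltac jlra := gen_jets; lra.

Section RealCalculus.
Context {R : realType}.
Implicit Types (f g : R -> R) (x y d a b : R).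

Lemma isd_cst (c x : R) : is_derive x 1 (fun=> c) 0.
Proof. exact: is_derive_cst. Qed.

Lemma isd_id x : is_derive x 1 (fun t : R => t) 1.
Proof. exact: is_derive_id. Qed.

Lemma isdD f g x a b : is_derive x 1 f a -> is_derive x 1 g b ->
  is_derive x 1 (fun t => f t + g t) (a + b).
Proof. by move=> fa gb; exact: (is_deriveD (f := f) (g := g)). Qed.

Lemma isdN f x a : is_derive x 1 f a -> is_derive x 1 (fun t => - f t) (- a).
Proof. by move=> fa; exact: (is_deriveN (f := f)). Qed.

Lemma isdM f g x a b : is_derive x 1 f a -> is_derive x 1 g b ->
  is_derive x 1 (fun t => f t * g t) (a * g x + f x * b).
Proof.
move=> fa gb; apply: (@is_derive_eq _ _ _ (f * g)).
by change (f x * b + g x * a = a * g x + f x * b); ring.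
Qed.

Lemma isdV f x a : f x != 0 -> is_derive x 1 f a ->
  is_derive x 1 (fun t => (f t)^-1) (- a / f x ^+ 2).
Proof.
move=> f0 fa; apply: (is_derive_eq (is_deriveV f0 fa)).
by change (- (f x ^+ 2)^-1 * a = - a / f x ^+ 2); ring.
Qed.

Lemma isd_comp f g x a b : is_derive x 1 g b -> is_derive (g x) 1 f a ->
  is_derive x 1 (fun t => f (g t)) (a * b).
Proof. by move=> gb fa; exact: (is_derive1_comp (f := f) (g := g)). Qed.

Lemma isd_near f g x d : (\forall t \near x, f t = g t) ->
  is_derive x 1 g d -> is_derive x 1 f d.
Proof.
move=> fg; have gf : \forall t \near x, g t = f t.
  by apply: filterS fg => t ->.
exact: near_eq_is_derive gf.
Qed.

Lemma isdX n f x a : is_derive x 1 f a ->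
  is_derive x 1 (fun t => f t ^+ n.+1) (n.+1%:R * f x ^+ n * a).
Proof.
move=> fa; elim: n => [|n ih].
  by apply: (is_derive_eq fa); rewrite expr0 !mul1r.
have -> : (fun t => f t ^+ n.+2) = (fun t => f t * f t ^+ n.+1).
  by apply/funext => t; rewrite exprS.
apply: (is_derive_eq (isdM fa ih)).
by rewrite exprS; ring.
Qed.

Lemma isd_derive1 f x d : is_derive x 1 f d -> f^`() x = d.
Proof. by move=> fd; rewrite derive1E; exact: derive_val. Qed.

Lemma isd_near_derive1 f g x d : (\forall t \near x, is_derive (t : R) 1 f (g t)) ->
  is_derive x 1 g d -> is_derive x 1 f^`() d.
Proof.
move=> fg; have gf : \forall t \near x, f^`() t = g t.
  by apply: filterS fg => t; exact: isd_derive1.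
exact: isd_near gf.
Qed.

Lemma isd_cvg f x d : is_derive x 1 f d -> f t @[t --> x] --> f x.
Proof.
by move=> fd; exact/differentiable_continuous/derivable1_diffP/ex_derive.
Qed.

Lemma isd_slope f x d : is_derive x 1 f d ->
  (f t - f x) / (t - x) @[t --> x^'] --> d.
Proof.
move=> fd; rewrite -(isd_derive1 fd).
have /cvg_ex[l] : derivable f x 1 by exact: ex_derive.
move=> fl; have lE : f^`() x = l by rewrite derive1E; exact: cvg_lim.
rewrite lE; apply/cvgrPdist_lt => e e0.
move/cvgrPdist_lt: fl => /(_ e e0).
rewrite /= !near_withinE => H.
have : \forall h \near (0 : R), h != 0 ->
   `|l - h^-1 *: (f (h *: 1 + x) - f x)| < e by [].
move=> /nbhs_ballP[d0 /= d00 H0]; apply/nbhs_ballP; exists d0 => // t tx tnx.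
have := H0 (t - x); rewrite /ball /= in tx *.
rewrite sub0r normrN distrC tx subr_eq0 => /(_ isT tnx).
have -> : (t - x) *: 1 + x = t by rewrite /GRing.scale /= mulr1 subrK.
by rewrite /GRing.scale /= [in X in _ -> X]mulrC.
Qed.

Lemma near_pos_cvg (T : Type) (F : set_system T) {FF : Filter F} (u : T -> R) l :
  u t @[t --> F] --> l -> 0 < l -> \forall t \near F, 0 < u t.
Proof. by move=> ul l0; exact: (cvgr_gt l ul). Qed.

(** Throughout, a sign is recorded as positivity of a product with a nonzero constant. Such facts
    can be multiplied together, and [sq_factor_gt0] then strips the squares. *)
Lemma cvg_near_neq0 f x : f t @[t --> x] --> f x -> f x != 0 ->
  \forall t \near x, 0 < f x * f t.
Proof.
move=> fc f0; have H : f x * f t @[t --> x] --> f x * f x by exact: cvgMl_tmp.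
apply: (near_pos_cvg H).
by rewrite -expr2 exprn_even_gt0.
Qed.

Lemma isd_near_sign f x d : is_derive x 1 f d -> f x = 0 -> d != 0 ->
  \forall t \near x^', 0 < d * (t - x) * f t.
Proof.
move=> fd f0 d0.
have H : d * ((f t - f x) / (t - x)) @[t --> x^'] --> d * d.
  by apply: cvgMl_tmp; exact: isd_slope.
have : \forall t \near x^', 0 < d * ((f t - f x) / (t - x)).
  by apply: (near_pos_cvg H); rewrite -expr2 exprn_even_gt0.
apply: filterS2 (nbhs_dnbhs_neq x) => t tx; rewrite f0 subr0 => {}H.
have e : d * (t - x) * f t = d * (f t / (t - x)) * (t - x) ^+ 2.
  by field; rewrite subr_eq0.
by rewrite e mulr_gt0 // exprn_even_gt0 //= subr_eq0.
Qed.

(** The mean value theorem writes f t as g c * (t - x) with c between x and t. By the first-order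
    lemma g c has the sign of d * (c - x), and c - x has the sign of t - x. *)
Lemma isd_near_sign2 f g x d : (\forall t \near x, is_derive (t : R) 1 f (g t)) ->
  is_derive x 1 g d -> f x = 0 -> g x = 0 -> d != 0 ->
  \forall t \near x^', 0 < d * f t.
Proof.
move=> fg gd f0 g0 d0.
have := isd_near_sign gd g0 d0.
rewrite !near_withinE => gs.
have /nbhs_ballP[e /= e0 H] : \forall t \near x, is_derive (t : R) 1 f (g t) /\
    (t != x -> 0 < d * (t - x) * g t).
  by apply: filterS2 fg gs => t.
apply/nbhs_ballP; exists e => //= t tx tnx.
have fc s : ball x e s -> f u @[u --> s] --> f s.
  by move=> /H[/isd_cvg].
have bt s : (x <= s <= t) || (t <= s <= x) -> ball x e s.
  move=> hs; rewrite /ball /= in tx *; apply: le_lt_trans tx.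
  case/orP: hs => /andP[h1 h2].
    by rewrite !ler0_norm ?subr_le0 //; lra.
  by rewrite !ger0_norm ?subr_ge0 //; lra.
have Hd s : (x <= s <= t) || (t <= s <= x) -> is_derive s 1 f (g s).
  by move=> /bt /H [].
have Hs s : (x <= s <= t) || (t <= s <= x) -> s != x -> 0 < d * (s - x) * g s.
  by move=> /bt /H [].
have [xt|xt|/esym/eqP] := ltgtP x t; last by rewrite (negbTE tnx).
- have [s||c] := @MVT R f g x t xt.
  + rewrite in_itv /= => /andP[h1 h2].
    by apply: Hd; rewrite (ltW h1) (ltW h2).
  + apply: continuous_in_subspaceT => s; rewrite inE /= in_itv /= => h.
    by apply: fc; apply: bt; rewrite h.
  rewrite in_itv /= => /andP[h1 h2]; rewrite f0 subr0 => ->.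
  have : 0 < d * (c - x) * g c.
    by apply: Hs; [rewrite (ltW h1) (ltW h2) | rewrite gt_eqF].
  have : 0 < c - x by rewrite subr_gt0.
  have : 0 < t - x by rewrite subr_gt0.
  by move=> p1 p2; rewrite mulrAC pmulr_lgt0 // => p3; rewrite mulrA mulr_gt0.
- have [s||c] := @MVT R f g t x xt.
  + rewrite in_itv /= => /andP[h1 h2].
    by apply: Hd; rewrite (ltW h1) (ltW h2) orbT.
  + apply: continuous_in_subspaceT => s; rewrite inE /= in_itv /= => h.
    by apply: fc; apply: bt; rewrite h orbT.
  rewrite in_itv /= => /andP[h1 h2]; rewrite f0 sub0r => /(congr1 -%R).
  rewrite opprK => ->.
  have : 0 < d * (c - x) * g c.
    by apply: Hs; [rewrite (ltW h1) (ltW h2) orbT | rewrite lt_eqF].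
  have : 0 < x - c by rewrite subr_gt0.
  have : 0 < x - t by rewrite subr_gt0.
  move=> p1 p2 p3; have p4 : 0 < - (d * g c).
    rewrite -(pmulr_rgt0 _ p2); move: p3; congr (_ < _); ring.
  have -> : d * - (g c * (x - t)) = - (d * g c) * (x - t) by ring.
  exact: mulr_gt0.
Qed.

End RealCalculus.

(** * The functions a, k and h *)

Section GenericPair.
Context {R : realType}.
Variables (L : R) (f Lam : R -> R).
Hypotheses (L_gt0 : 0 < L) (gen : generic L f Lam).

Local Notation f1 := (f^`()).
Local Notation f2 := (f^`(2)).
Local Notation f3 := (f^`(3)).
Local Notation f4 := (f^`(4)).
Local Notation l1 := (Lam^`()).
Local Notation l2 := (Lam^`(2)).
Local Notation l3 := (Lam^`(3)).
Local Notation l4 := (Lam^`(4)).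
Local Notation W := (wronsk f Lam).

Lemma isd_smooth (g : R -> R) (n : nat) (x : R) : smooth g ->
  is_derive x 1 g^`(n) (g^`(n.+1) x).
Proof.
by move=> gs; rewrite derive1nS derive1E; apply: derivableP; exact: gs.
Qed.

Lemma isd_f (x : R) : is_derive x 1 f (f1 x).
Proof. exact: (isd_smooth 0 x (generic_f_smooth gen)). Qed.
Lemma isd_f1 (x : R) : is_derive x 1 f1 (f2 x).
Proof. exact: (isd_smooth 1 x (generic_f_smooth gen)). Qed.
Lemma isd_f2 (x : R) : is_derive x 1 f2 (f3 x).
Proof. exact: (isd_smooth 2 x (generic_f_smooth gen)). Qed.
Lemma isd_f3 (x : R) : is_derive x 1 f3 (f4 x).
Proof. exact: (isd_smooth 3 x (generic_f_smooth gen)). Qed.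
Lemma isd_l (x : R) : is_derive x 1 Lam (l1 x).
Proof. exact: (isd_smooth 0 x (generic_Lam_smooth gen)). Qed.
Lemma isd_l1 (x : R) : is_derive x 1 l1 (l2 x).
Proof. exact: (isd_smooth 1 x (generic_Lam_smooth gen)). Qed.
Lemma isd_l2 (x : R) : is_derive x 1 l2 (l3 x).
Proof. exact: (isd_smooth 2 x (generic_Lam_smooth gen)). Qed.
Lemma isd_l3 (x : R) : is_derive x 1 l3 (l4 x).
Proof. exact: (isd_smooth 3 x (generic_Lam_smooth gen)). Qed.

Lemma f_continuous : continuous f.
Proof. by move=> x; exact: isd_cvg (isd_f x). Qed.
Lemma l_continuous : continuous Lam.
Proof. by move=> x; exact: isd_cvg (isd_l x). Qed.
Lemma f1_continuous : continuous f1.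
Proof. by move=> x; exact: isd_cvg (isd_f1 x). Qed.
Lemma l1_continuous : continuous l1.
Proof. by move=> x; exact: isd_cvg (isd_l1 x). Qed.

Lemma f_0 : f 0 = 0.
Proof. by have := generic_f_odd gen 0; rewrite oppr0 => h; jlra. Qed.

Lemma f_L : f L = 0.
Proof.
have := generic_f_per gen (- L); rewrite (generic_f_odd gen).
by rewrite (_ : - L + 2 * L = L); [move=> h; jlra | ring].
Qed.

Lemma f_reflect r : f (L + r) = - f (L - r).
Proof.
rewrite -(generic_f_odd gen (L - r)) -(generic_f_per gen (- _)); congr f; ring.
Qed.

Lemma Lam_reflect r : Lam (L + r) = Lam (L - r).
Proof.
rewrite -(generic_Lam_even gen (L - r)) -(generic_Lam_per gen (- _)).
congr Lam; ring.
Qed.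

Lemma l1_odd r : l1 (- r) = - l1 r.
Proof.
have h : is_derive r 1 (fun t => Lam (- t)) (l1 (- r) * - 1).
  exact: (isd_comp (isdN (isd_id r)) (isd_l (- r))).
have e : (fun t => Lam (- t)) = Lam.
  by apply/funext => t; rewrite (generic_Lam_even gen).
by move: h; rewrite e => /isd_derive1 ->; ring.
Qed.

Lemma l1_reflect r : l1 (L + r) = - l1 (L - r).
Proof.
have h : is_derive r 1 (fun t => Lam (L + t)) (l1 (L + r) * (0 + 1)).
  exact: (isd_comp (isdD (isd_cst L r) (isd_id r)) (isd_l (L + r))).
have h' : is_derive r 1 (fun t => Lam (L - t)) (l1 (L - r) * (0 + - 1)).
  exact: (isd_comp (isdD (isd_cst L r) (isdN (isd_id r))) (isd_l (L - r))).
have e : (fun t => Lam (L + t)) = (fun t => Lam (L - t)).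
  by apply/funext => t; rewrite Lam_reflect.
move: h; rewrite e => /isd_derive1; move/isd_derive1: h' => -> h; jlra.
Qed.

Lemma l1_0 : l1 0 = 0.
Proof.
have /eqP := l1_odd 0; rewrite oppr0 -addr_eq0 -mulr2n mulrn_eq0.
by move=> /eqP.
Qed.

Lemma l1_L : l1 L = 0.
Proof. by have := l1_reflect 0; rewrite addr0 subr0 => h; jlra. Qed.

Lemma f2_odd r : f2 (- r) = - f2 r.
Proof.
have e1 : forall t, f1 (- t) = f1 t.
  move=> t; have h : is_derive t 1 (fun t => f (- t)) (f1 (- t) * - 1).
    exact: (isd_comp (isdN (isd_id t)) (isd_f (- t))).
  have e : (fun t => f (- t)) = (fun t => - f t).
    by apply/funext => u; rewrite (generic_f_odd gen).
  move: h; rewrite e => /isd_derive1; have /isd_derive1 -> := isdN (isd_f t).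
  by move=> h; jlra.
have h : is_derive r 1 (fun t => f1 (- t)) (f2 (- r) * - 1).
  exact: (isd_comp (isdN (isd_id r)) (isd_f1 (- r))).
have e : (fun t => f1 (- t)) = f1 by apply/funext.
move: h; rewrite e => /isd_derive1; have /isd_derive1 -> := isd_f1 r.
by move=> h; jlra.
Qed.

Lemma f2_0 : f2 0 = 0.
Proof.
have /eqP := f2_odd 0; rewrite oppr0 -addr_eq0 -mulr2n mulrn_eq0.
by move=> /eqP.
Qed.

Lemma l2_0 : l2 0 != 0.
Proof.
apply: (generic_Lam_morse gen); split; last exact: l1_0.
by rewrite lexx ltW.
Qed.

Lemma l2_L : l2 L != 0.
Proof.
apply: (generic_Lam_morse gen); split; last exact: l1_L.
by rewrite lexx ltW.
Qed.

Lemma f_gt0 r : 0 < r < L -> 0 < f r.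
Proof. exact: (generic_f_pos gen). Qed.

Lemma f_neq0 r : 0 < r < L -> f r != 0.
Proof. by move=> /f_gt0 /lt0r_neq0. Qed.

Lemma not_both_zero r : 0 <= r <= L -> f1 r = 0 -> l1 r = 0 -> False.
Proof.
by move=> /(generic_immersed gen) + e1 e2; rewrite e1 e2 expr0n /= addr0 ltxx.
Qed.

Lemma crit_f_itv r : crit L f r -> 0 < r < L.
Proof.
move=> [/andP[]]; rewrite !le_eqVlt => /orP[/eqP <-|r0].
  by rewrite (generic_f'0 gen) => _ /eqP; rewrite oner_eq0.
move=> /orP[/eqP ->|rL]; first by rewrite (generic_f'L gen) => h; exfalso; jlra.
by rewrite r0 rL.
Qed.

Lemma crit_f_f2 r : crit L f r -> f2 r != 0.
Proof. exact: (generic_f_morse gen). Qed.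

Lemma crit_f_l1 r : crit L f r -> l1 r != 0.
Proof. by move=> [h e]; apply/eqP => h1; exact: (not_both_zero h e h1). Qed.

Lemma crit_l_f1 r : crit L Lam r -> f1 r != 0.
Proof. by move=> [h e]; apply/eqP => h1; exact: (not_both_zero h h1 e). Qed.

Lemma crit_l_l2 r : crit L Lam r -> l2 r != 0.
Proof. exact: (generic_Lam_morse gen). Qed.

Lemma crit_l_wronsk r : crit L Lam r -> W r != 0.
Proof.
move=> cr; rewrite /wronsk; case: (cr) => _ ->; rewrite mulr0 subr0.
by rewrite mulf_neq0 ?crit_l_f1 ?crit_l_l2.
Qed.

Lemma crit_f_wronsk r : crit L f r -> W r != 0.
Proof.
move=> cr; rewrite /wronsk; case: (cr) => _ ->; rewrite mul0r sub0r oppr_eq0.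
by rewrite mulf_neq0 ?crit_f_f2 ?crit_f_l1.
Qed.

Lemma infl_f1 r : infl L f Lam r -> f1 r != 0.
Proof.
move=> [h W0]; apply/eqP => e.
by have /eqP := @crit_f_wronsk r (conj h e).
Qed.

Lemma infl_l1 r : infl L f Lam r -> l1 r != 0.
Proof.
move=> [h W0]; apply/eqP => e.
by have /eqP := @crit_l_wronsk r (conj h e).
Qed.

Lemma infl_itv r : infl L f Lam r -> 0 < r < L.
Proof.
move=> ir; have [/andP[]] := ir; have := infl_l1 ir.
rewrite !le_eqVlt => h /orP[/eqP r0|->]; first by move: h; rewrite -r0 l1_0 eqxx.
by move=> /orP[/eqP rL|->] //; move: h; rewrite rL l1_L eqxx.
Qed.

Lemma isd_wronsk (x : R) : is_derive x 1 W (f1 x * l3 x - f3 x * l1 x).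
Proof.
apply: (is_derive_eq (isdD (isdM (isd_f1 x) (isd_l2 x))
  (isdN (isdM (isd_f2 x) (isd_l1 x))))).
jring.
Qed.

Lemma wronsk_continuous : continuous W.
Proof. by move=> x; exact: isd_cvg (isd_wronsk x). Qed.

Lemma infl_wronsk1 r : infl L f Lam r -> f1 r * l3 r - f3 r * l1 r != 0.
Proof.
move=> [h e]; rewrite -(isd_derive1 (isd_wronsk r)).
exact: (generic_simple gen).
Qed.

Local Notation a := (afun f Lam).
Local Notation h := (hfun f Lam).
Local Notation k := (kfun f Lam).

Lemma near_f1_neq0 r : f1 r != 0 -> \forall t \near r, f1 t != 0.
Proof.
move=> fr; have := cvg_near_neq0 (@f1_continuous r) fr; apply: filterS => t.
by apply: contraTN => /eqP ->; rewrite mulr0 ltxx.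
Qed.

(** Closed forms of a', a'' and a''', valid where f' != 0. Only the terms without W survive at an
    inflection point. *)
Definition da r := W r / f1 r ^+ 2.
Definition dda r :=
  (f1 r * l3 r - f3 r * l1 r) / f1 r ^+ 2 - 2 * f2 r * W r / f1 r ^+ 3.
Definition ddda r :=
  (f2 r * l3 r + f1 r * l4 r - f4 r * l1 r - f3 r * l2 r) / f1 r ^+ 2
  - 4 * f2 r * (f1 r * l3 r - f3 r * l1 r) / f1 r ^+ 3
  - 2 * f3 r * W r / f1 r ^+ 3 + 6 * f2 r ^+ 2 * W r / f1 r ^+ 4.

Lemma isd_a (r : R) : f1 r != 0 -> is_derive r 1 a (da r).
Proof.
move=> fr; apply: (is_derive_eq (isdM (isd_l1 r) (isdV fr (isd_f1 r)))).
by rewrite /da /wronsk; jfield.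
Qed.

Lemma isd_W1 (r : R) : is_derive r 1 (fun r => f1 r * l3 r - f3 r * l1 r)
  (f2 r * l3 r + f1 r * l4 r - f4 r * l1 r - f3 r * l2 r).
Proof.
apply: (is_derive_eq (isdD (isdM (isd_f1 r) (isd_l3 r))
  (isdN (isdM (isd_f3 r) (isd_l1 r))))).
jring.
Qed.

Lemma isd_invX (g : R -> R) r d n : g r != 0 -> is_derive r 1 g d ->
  is_derive r 1 (fun t => (g t ^+ n.+1)^-1) (- (n.+1%:R * d) / g r ^+ n.+2).
Proof.
move=> g0 gd; apply: (is_derive_eq
  (@isdV _ (fun t => g t ^+ n.+1) r _ (expf_neq0 n.+1 g0) (isdX n gd))).
by rewrite !exprS; jfield; rewrite g0 expf_neq0.
Qed.

Lemma isd_da (r : R) : f1 r != 0 -> is_derive r 1 da (dda r).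
Proof.
move=> fr; apply: (is_derive_eq (isdM (isd_wronsk r) (isd_invX 1 fr (isd_f1 r)))).
by rewrite /dda /wronsk; jfield.
Qed.

Lemma isd_dda (r : R) : f1 r != 0 -> is_derive r 1 dda (ddda r).
Proof.
move=> fr; apply: (is_derive_eq (isdD (isdM (isd_W1 r) (isd_invX 1 fr (isd_f1 r)))
  (isdN (isdM (isdM (isdM (isd_cst 2 r) (isd_f2 r)) (isd_wronsk r))
    (isd_invX 2 fr (isd_f1 r)))))).
by rewrite /ddda /wronsk; jfield.
Qed.

Lemma isd_k (r : R) : f1 r != 0 -> is_derive r 1 k (- (f r * da r)).
Proof.
move=> fr; apply: (is_derive_eq (isdD (isd_l r) (isdN (isdM (isd_f r) (isd_a fr))))).
by rewrite /da /afun /wronsk; jfield.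
Qed.

Lemma isd_dk (r : R) : f1 r != 0 ->
  is_derive r 1 (fun r => - (f r * da r)) (- (f1 r * da r + f r * dda r)).
Proof.
by move=> fr; exact: (isdN (isdM (isd_f r) (isd_da fr))).
Qed.

Lemma isd_ddk (r : R) : f1 r != 0 ->
  is_derive r 1 (fun r => - (f1 r * da r + f r * dda r))
    (- (f2 r * da r + 2 * f1 r * dda r + f r * ddda r)).
Proof.
move=> fr; apply: (is_derive_eq (isdN (isdD (isdM (isd_f1 r) (isd_da fr))
  (isdM (isd_f r) (isd_dda fr))))).
jring.
Qed.

Lemma isd_h (r : R) : f1 r != 0 -> is_derive r 1 h (a r * da r).
Proof.
move=> fr; apply: (is_derive_eq (isdM (isdX 1 (isd_a fr)) (isd_cst 2^-1 r))).
by rewrite expr1; jfield.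
Qed.

Lemma isd_dh (r : R) : f1 r != 0 ->
  is_derive r 1 (fun r => a r * da r) (da r ^+ 2 + a r * dda r).
Proof.
move=> fr; apply: (is_derive_eq (isdM (isd_a fr) (isd_da fr))).
by rewrite expr2.
Qed.

Lemma isd_ddh (r : R) : f1 r != 0 ->
  is_derive r 1 (fun r => da r ^+ 2 + a r * dda r)
    (3 * da r * dda r + a r * ddda r).
Proof.
move=> fr; apply: (is_derive_eq (isdD (isdX 1 (isd_da fr)) (isdM (isd_a fr) (isd_dda fr)))).
by rewrite expr1; jring.
Qed.

(** Higher derivatives at r need the closed forms on a neighbourhood of r; the condition f' != 0 is
    open, so it supplies one. *)
Lemma derive1n_chain (g g1 g2 g3 : R -> R) r :
  (forall t, f1 t != 0 -> is_derive t 1 g (g1 t)) ->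
  (forall t, f1 t != 0 -> is_derive t 1 g1 (g2 t)) ->
  (forall t, f1 t != 0 -> is_derive t 1 g2 (g3 t)) ->
  f1 r != 0 -> [/\ g^`() r = g1 r, g^`(2) r = g2 r & g^`(3) r = g3 r].
Proof.
move=> h1 h2 h3 fr.
have n1 t : f1 t != 0 -> is_derive t 1 g^`() (g2 t).
  move=> ft; apply: isd_near_derive1 (h2 t ft).
  by apply: filterS (near_f1_neq0 ft).
have n2 t : f1 t != 0 -> is_derive t 1 g^`(2) (g3 t).
  move=> ft; apply: isd_near_derive1 (h3 t ft).
  by apply: filterS (near_f1_neq0 ft).
split; first exact: isd_derive1 (h1 r fr).
  exact: isd_derive1 (n1 r fr).
exact: isd_derive1 (n2 r fr).
Qed.

Lemma derive_a r : f1 r != 0 ->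
  [/\ a^`() r = da r, a^`(2) r = dda r & a^`(3) r = ddda r].
Proof. exact: derive1n_chain isd_a isd_da isd_dda. Qed.

Lemma derive_k r : f1 r != 0 ->
  [/\ k^`() r = - (f r * da r), k^`(2) r = - (f1 r * da r + f r * dda r) &
      k^`(3) r = - (f2 r * da r + 2 * f1 r * dda r + f r * ddda r)].
Proof. exact: derive1n_chain isd_k isd_dk isd_ddk. Qed.

Lemma derive_h r : f1 r != 0 ->
  [/\ h^`() r = a r * da r, h^`(2) r = da r ^+ 2 + a r * dda r &
      h^`(3) r = 3 * da r * dda r + a r * ddda r].
Proof. exact: derive1n_chain isd_h isd_dh isd_ddh. Qed.

Definition sgn_type r := - k^`() r * l1 r.

(** Since k' = - f a' and a' = W / f'^2, the sign on (0, L) is that of W * Lam'. *)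
Lemma sgn_typeE r : f1 r != 0 -> sgn_type r = f r * W r * l1 r / f1 r ^+ 2.
Proof. by move=> fr; rewrite /sgn_type; case: (derive_k fr) => -> _ _; rewrite /da; jfield. Qed.

Lemma sgn_type_da r : f1 r != 0 -> sgn_type r = f r * da r * l1 r.
Proof. by move=> fr; rewrite /sgn_type; case: (derive_k fr) => -> _ _; rewrite opprK. Qed.

End GenericPair.

(** * The sign of - k' Lam' *)

Section Signs.
Context {R : realType}.
Implicit Types (x y c : R) (P D A B : set R).

(** This reduces a sign claim to an algebraic identity: a quantity already known to be positive is
    exhibited as a square times the one in question. *)
Lemma sq_factor_gt0 c x y : 0 < y -> y = c ^+ 2 * x -> 0 < x.
Proof.
move=> y0 e; have [c0|c0] := eqVneq c 0.
  by move: y0; rewrite e c0 expr0n mul0r ltxx.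
by move: y0; rewrite e pmulr_rgt0 // exprn_even_gt0.
Qed.

Lemma norm_le_sqr_half x y : (`|x| <= `|y|) = (x ^+ 2 / 2 <= y ^+ 2 / 2).
Proof.
rewrite ler_pM2r ?invr_gt0 // -(real_normK (num_real x)) -(real_normK (num_real y)).
by rewrite ler_pXn2r // nnegrE.
Qed.

Lemma same_sign x y : 0 < x * y -> [/\ 0 < x <-> 0 < y, x < 0 <-> y < 0 & x != 0].
Proof.
move=> h; have x0 : x != 0 by apply: contraTN h => /eqP ->; rewrite mul0r ltxx.
have y0 : y != 0 by apply: contraTN h => /eqP ->; rewrite mulr0 ltxx.
split => //; have [xp|xn|/eqP] := ltgtP x 0; rewrite ?(negbTE x0) //.
- by rewrite nmulr_rgt0 // in h; split => // yp; have := lt_trans yp h; rewrite ltxx.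
- by rewrite pmulr_rgt0 // in h; split.
- by rewrite nmulr_rgt0 // in h; split.
by rewrite pmulr_rgt0 // in h; split => // yp; have := lt_trans yp h; rewrite ltxx.
Qed.

Lemma opposite_sign x y : x * y < 0 -> Num.sg x * Num.sg y = -1.
Proof. by move=> h; rewrite -sgrM ltr0_sg. Qed.

Lemma within_and x D A B : within D (nbhs x) A -> within D (nbhs x) B ->
  within D (nbhs x) (A `&` B).
Proof. exact: filterI. Qed.

Lemma dnbhs_and x A B : (\forall t \near x^', A t) -> (\forall t \near x^', B t) ->
  \forall t \near x^', A t /\ B t.
Proof. exact: within_and. Qed.

Lemma right_and x A B : (\forall t \near x^'+, A t) -> (\forall t \near x^'+, B t) ->
  \forall t \near x^'+, A t /\ B t.
Proof. exact: within_and. Qed.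

Lemma left_and x A B : (\forall t \near x^'-, A t) -> (\forall t \near x^'-, B t) ->
  \forall t \near x^'-, A t /\ B t.
Proof. exact: within_and. Qed.

Lemma dnbhs_right x P : (\forall t \near x^', P t) -> \forall t \near x^'+, P t.
Proof.
rewrite /at_right !near_withinE; apply: filterS => t h xt; apply: h => /=.
by rewrite gt_eqF.
Qed.

Lemma dnbhs_left x P : (\forall t \near x^', P t) -> \forall t \near x^'-, P t.
Proof.
rewrite /at_left !near_withinE; apply: filterS => t h xt; apply: h => /=.
by rewrite lt_eqF.
Qed.

Lemma near_dnbhs x P : (\forall t \near x, P t) -> \forall t \near x^', P t.
Proof. by rewrite near_withinE; apply: filterS => t h _. Qed.

Lemma near_itv x y (z : R) : x < z < y -> \forall t \near z, x < t < y.
Proof.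
move=> h; have : z \in `]x, y[ by rewrite in_itv.
by move=> /near_in_itvoo; apply: filterS => t; rewrite in_itv.
Qed.

Lemma dnbhs_false x P : (\forall t \near x^', P t) -> (forall t, ~ P t) -> False.
Proof.
move=> H n; have [t Pt] := @filter_ex _ _ (Proper_dnbhs_numFieldType x) _ H.
exact: n Pt.
Qed.

(** The function h orders points against x exactly as g does but is differentiable: it is used with
    g = |a| and h = a^2 / 2. The strict sign on the punctured neighbourhood excludes the other kind
    of extremum. *)
Lemma local_extremum_dnbhs (g h : R -> R) x c : c != 0 ->
  (\forall t \near x^', 0 < c * (h t - h x)) ->
  (forall t, (g x <= g t) = (h x <= h t)) -> (forall t, (g t <= g x) = (h t <= h x)) ->
  [/\ local_min g x <-> 0 < c, local_max g x <-> c < 0,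
      local_min g x \/ local_max g x & ~ (local_min g x /\ local_max g x)].
Proof.
move=> c0 H e1 e2.
have hx : forall t, 0 < c * (h t - h x) -> 0 < c -> h x < h t.
  by move=> t h0 cp; rewrite pmulr_rgt0 // subr_gt0 in h0.
have hx' : forall t, 0 < c * (h t - h x) -> c < 0 -> h t < h x.
  by move=> t h0 cp; rewrite nmulr_rgt0 // subr_lt0 in h0.
have mn : 0 < c -> local_min g x.
  move=> cp; move: H; rewrite near_withinE /local_min; apply: filterS => t ht.
  have [->//|tx] := eqVneq t x; rewrite e1 ltW //; apply: hx => //.
  exact: ht.
have mx : c < 0 -> local_max g x.
  move=> cp; move: H; rewrite near_withinE /local_max; apply: filterS => t ht.
  have [->//|tx] := eqVneq t x; rewrite e2 ltW //; apply: hx' => //.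
  exact: ht.
have nmn : c < 0 -> ~ local_min g x.
  move=> cp /near_dnbhs m.
  have : \forall t \near x^', h t < h x /\ g x <= g t.
    by apply: filterS2 H m => t h0; split => //; exact: hx'.
  by move/dnbhs_false; apply => t []; rewrite e1 => /lt_le_trans h1 /h1; rewrite ltxx.
have nmx : 0 < c -> ~ local_max g x.
  move=> cp /near_dnbhs m.
  have : \forall t \near x^', h x < h t /\ g t <= g x.
    by apply: filterS2 H m => t h0; split => //; exact: hx.
  by move/dnbhs_false; apply => t []; rewrite e2 => /lt_le_trans h1 /h1; rewrite ltxx.
have [cn|cp|/eqP] := ltgtP c 0; last by rewrite (negbTE c0).
  split; [split => // m | split => // _ | right | case].
  - by case: (nmn cn m).
  - exact: mx.
  - exact: mx.
  - by move=> m; case: (nmn cn m).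
split; [split => // _ | split => // m | left | case].
- exact: mn.
- by case: (nmx cp m).
- exact: mn.
- by move=> _ m; case: (nmx cp m).
Qed.

End Signs.

(** * Signs near the special parameter values *)

Section LocalForms.
Context {R : realType}.
Variables (L : R) (f Lam : R -> R).
Hypotheses (L_gt0 : 0 < L) (gen : generic L f Lam).

Local Notation f1 := (f^`()).
Local Notation f2 := (f^`(2)).
Local Notation f3 := (f^`(3)).
Local Notation l1 := (Lam^`()).
Local Notation l2 := (Lam^`(2)).
Local Notation l3 := (Lam^`(3)).
Local Notation W := (wronsk f Lam).
Local Notation W1 r := (f1 r * l3 r - f3 r * l1 r).
Local Notation a := (afun f Lam).
Local Notation h := (hfun f Lam).
Local Notation sgn := (sgn_type f Lam).
Local Notation da := (da f Lam).
Local Notation dda := (dda f Lam).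

Lemma near_same_sign (g : R -> R) r : continuous g -> g r != 0 ->
  \forall t \near r^', 0 < g r * g t.
Proof. by move=> gc gr; apply: near_dnbhs; exact: cvg_near_neq0 (gc r) gr. Qed.

Lemma near_f_gt0 r : 0 < r < L -> \forall t \near r^', 0 < f t.
Proof.
move=> hr; apply: near_dnbhs; apply: filterS (near_itv hr) => t.
exact: (f_gt0 gen).
Qed.

Lemma near_diff_sign (g : R -> R) (r d : R) : is_derive r 1 g d -> d != 0 ->
  \forall t \near r^', 0 < d * (t - r) * (g t - g r).
Proof.
move=> gd d0; apply: (isd_near_sign (f := fun t => g t - g r)) d0.
  by apply: (is_derive_eq (isdD gd (isdN (isd_cst (g r) r)))); rewrite subr0.
by rewrite subrr.
Qed.

Lemma neq0_mul_gt0 (x y : R) : 0 < x * y -> y != 0.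
Proof. by apply: contraTN => /eqP ->; rewrite mulr0 ltxx. Qed.

Lemma sgn_type_gt0E t c : f1 t != 0 -> 0 < f t -> 0 < c * (W t * l1 t) ->
  0 < c * sgn t.
Proof.
move=> ft fp hc; rewrite (sgn_typeE gen ft).
have -> : c * (f t * W t * l1 t / f1 t ^+ 2) =
          (c * (W t * l1 t)) * (f t / f1 t ^+ 2) by jring.
by rewrite mulr_gt0 // divr_gt0 // exprn_even_gt0.
Qed.

(** At r0 one has W = f' Lam'', and Lam' behaves like Lam'' * (t - r0), so W * Lam' has the sign of
    f'(r0) * (t - r0). Positivity of f t stays a premise because at r0 = 0 and r0 = L it holds on
    one side only. *)
Lemma sgn_near_crit_l_aux r0 : crit L Lam r0 ->
  \forall t \near r0^', 0 < f t -> 0 < f1 r0 * (t - r0) * sgn t.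
Proof.
move=> cr; have [_ l10] := cr.
have F := crit_l_f1 gen cr; have W0 := crit_l_wronsk gen cr.
have H1 := near_same_sign (f1_continuous gen) F.
have H2 := near_same_sign (wronsk_continuous gen) W0.
have H3 := isd_near_sign (isd_l1 gen r0) l10 (crit_l_l2 gen cr).
apply: filterS2 H1 (dnbhs_and H2 H3) => t h1 [h2 h3] ft.
apply: sgn_type_gt0E => //; first exact: neq0_mul_gt0 h1.
apply: (sq_factor_gt0 (c := l2 r0) (mulr_gt0 h2 h3)).
by rewrite {1}/wronsk l10; jring.
Qed.

Lemma sgn_near_crit_l r0 : crit L Lam r0 -> 0 < r0 < L ->
  \forall r \near r0^', [/\ f r <> f r0, f r0 < f r -> 0 < sgn r &
                            f r < f r0 -> sgn r < 0].
Proof.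
move=> cr hr; have F := crit_l_f1 gen cr.
have H1 := near_diff_sign (isd_f gen r0) F.
apply: filterS2 (dnbhs_and (near_f_gt0 hr) H1) (sgn_near_crit_l_aux cr).
move=> t [h1 h2] /(_ h1) h3.
have : 0 < (f t - f r0) * sgn t.
  apply: (sq_factor_gt0 (c := f1 r0 * (t - r0)) (mulr_gt0 h2 h3)).
  by move: (sgn t) => y; jring.
move=> /same_sign[[e1 _] [e2 _] e3]; split.
- by apply/eqP; rewrite -subr_eq0.
- by rewrite -subr_gt0.
- by rewrite -subr_lt0.
Qed.

Lemma sgn_near_0 : \forall r \near 0^'+, 0 < sgn r.
Proof.
have c0 : crit L Lam 0 by split; [rewrite lexx ltW | exact: (l1_0 gen)].
have H := dnbhs_right (sgn_near_crit_l_aux c0).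
have Hx := right_and (nbhs_right_gt 0) (nbhs_right_lt L_gt0).
apply: filterS2 H Hx => t + [t0 tL].
rewrite (generic_f'0 gen) mul1r subr0 pmulr_rgt0 //; apply.
by apply: (f_gt0 gen); rewrite t0 tL.
Qed.

Lemma sgn_near_L : \forall r \near L^'-, 0 < sgn r.
Proof.
have c0 : crit L Lam L by split; [rewrite lexx ltW | exact: (l1_L gen)].
have H := dnbhs_left (sgn_near_crit_l_aux c0).
have Hx := left_and (nbhs_left_lt L) (nbhs_left_gt L_gt0).
apply: filterS2 H Hx => t + [tL t0].
rewrite (generic_f'L gen) mulN1r opprB pmulr_rgt0 ?subr_gt0 //; apply.
by apply: (f_gt0 gen); rewrite t0 tL.
Qed.

Lemma crit_f_extremum ri : crit L f ri ->
  [/\ local_min f ri <-> 0 < f2 ri, local_max f ri <-> f2 ri < 0,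
      local_min f ri \/ local_max f ri & ~ (local_min f ri /\ local_max f ri)].
Proof.
move=> cr; have [_ f10] := cr; have f20 := crit_f_f2 gen cr.
apply: (@local_extremum_dnbhs _ f f) => //.
have gd : \forall t \near ri, is_derive (t : R) 1 (fun t => f t - f ri) (f1 t).
  near=> t; apply: (is_derive_eq (isdD (isd_f gen t) (isdN (isd_cst (f ri) t)))).
  by rewrite subr0.
by apply: isd_near_sign2 gd (isd_f1 gen ri) _ f10 f20; rewrite subrr.
Unshelve. all: end_near. Qed.

(** At ri the Wronskian is - f'' Lam', hence W * Lam' is close to - f'' Lam'^2. *)
Lemma sgn_near_crit_f ri : crit L f ri -> \forall r \near ri^', 0 < - f2 ri * sgn r.
Proof.
move=> cr; have hr := crit_f_itv gen cr; have [_ f10] := cr.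
have H1 := isd_near_sign (isd_f1 gen ri) f10 (crit_f_f2 gen cr).
have H2 := near_same_sign (wronsk_continuous gen) (crit_f_wronsk gen cr).
have H3 := near_same_sign (l1_continuous gen) (crit_f_l1 gen cr).
apply: filterS2 (dnbhs_and H1 H2) (dnbhs_and (near_f_gt0 hr) H3) => t [h1 h2] [h3 h4].
apply: sgn_type_gt0E => //; first exact: neq0_mul_gt0 h1.
have p := mulr_gt0 h2 h4.
apply: (sq_factor_gt0 (c := l1 ri) p).
by rewrite {1}/wronsk f10; jring.
Qed.

Lemma sgn_crit_f ri : crit L f ri ->
  [/\ local_max f ri \/ local_min f ri,
      local_max f ri -> \forall r \near ri^', 0 < sgn r &
      local_min f ri -> \forall r \near ri^', sgn r < 0].
Proof.
move=> cr; have [m1 m2 m3 _] := crit_f_extremum cr.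
have H := sgn_near_crit_f cr; split; first by case: m3; [right|left].
  move=> /m2 f2n; apply: filterS H => t.
  by rewrite pmulr_rgt0 // oppr_gt0.
move=> /m1 f2p; apply: filterS H => t.
by rewrite nmulr_rgt0 // oppr_lt0.
Qed.

Lemma near_infl r0 : infl L f Lam r0 ->
  \forall t \near r0^', [/\ 0 < W1 r0 * (t - r0) * W t,
    0 < f1 r0 * f1 t, 0 < l1 r0 * l1 t, 0 < f t &
    0 < f1 r0 * (t - r0) * (f t - f r0)].
Proof.
move=> ir; have hr := infl_itv gen ir.
have F := infl_f1 gen ir; have [_ W0] := ir.
have H1 := isd_near_sign (isd_wronsk gen r0) W0 (infl_wronsk1 gen ir).
have H2 := near_same_sign (f1_continuous gen) F.
have H3 := near_same_sign (l1_continuous gen) (infl_l1 gen ir).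
have H4 := near_diff_sign (isd_f gen r0) F.
apply: filterS2 (dnbhs_and H1 H2) (dnbhs_and (dnbhs_and H3 (near_f_gt0 hr)) H4).
by move=> t [? ?] [[? ?] ?].
Qed.

Lemma sgn_near_infl r0 : infl L f Lam r0 ->
  \forall t \near r0^', 0 < W1 r0 * l1 r0 * (t - r0) * sgn t.
Proof.
move=> ir; apply: filterS (near_infl ir) => t [h1 h2 h3 h4 _].
apply: sgn_type_gt0E => //; first exact: neq0_mul_gt0 h2.
by move: (mulr_gt0 h1 h3); congr (_ < _); jring.
Qed.

Lemma sgn_infl_sides r0 : infl L f Lam r0 ->
  \forall r \near r0^'- & s \near r0^'+, Num.sg (sgn r) * Num.sg (sgn s) = -1.
Proof.
move=> ir; have H := sgn_near_infl ir.
have Hl := left_and (dnbhs_left H) (nbhs_left_lt r0).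
have Hr := right_and (dnbhs_right H) (nbhs_right_gt r0).
near=> r s; apply: opposite_sign.
have [h1 rr] : 0 < W1 r0 * l1 r0 * (r - r0) * sgn r /\ r < r0 by near: r.
have [h2 rs] : 0 < W1 r0 * l1 r0 * (s - r0) * sgn s /\ r0 < s by near: s.
rewrite -oppr_gt0.
have p : 0 < (W1 r0 * l1 r0 * (r - r0) * sgn r) * (W1 r0 * l1 r0 * (s - r0) * sgn s)
   / ((r0 - r) * (s - r0)).
  by rewrite divr_gt0 // mulr_gt0 // subr_gt0.
apply: (sq_factor_gt0 (c := W1 r0 * l1 r0) p).
have n1 : r0 - r != 0 by rewrite subr_eq0 gt_eqF.
have n2 : s - r0 != 0 by rewrite subr_eq0 gt_eqF.
move: (sgn r) (sgn s) => x y.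
by jfield; rewrite n1 n2.
Unshelve. all: end_near. Qed.

Lemma a_infl_neq0 r0 : infl L f Lam r0 -> a r0 != 0.
Proof.
by move=> ir; rewrite /afun mulf_neq0 ?invr_eq0 ?(infl_f1 gen ir) ?(infl_l1 gen ir).
Qed.

Lemma dda_infl r0 : infl L f Lam r0 -> dda r0 = W1 r0 / f1 r0 ^+ 2.
Proof. by move=> [_ W0]; rewrite /dda W0; jring. Qed.

Lemma dda_infl_neq0 r0 : infl L f Lam r0 -> dda r0 != 0.
Proof.
move=> ir; rewrite dda_infl // mulf_neq0 ?(infl_wronsk1 gen ir) //.
by rewrite invr_eq0 expf_neq0 ?(infl_f1 gen ir).
Qed.

Lemma da_infl r0 : infl L f Lam r0 -> da r0 = 0.
Proof. by move=> [_ W0]; rewrite /da W0 mul0r. Qed.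

(** The derivative of a^2 / 2 is a a'. It vanishes at r0 because W does, and the second derivative
    there is a a'' != 0. *)
Lemma abs_a_infl r0 : infl L f Lam r0 ->
  [/\ local_min (fun r => `|a r|) r0 <-> 0 < a r0 * dda r0,
      local_max (fun r => `|a r|) r0 <-> a r0 * dda r0 < 0,
      local_min (fun r => `|a r|) r0 \/ local_max (fun r => `|a r|) r0 &
      ~ (local_min (fun r => `|a r|) r0 /\ local_max (fun r => `|a r|) r0)].
Proof.
move=> ir; have F := infl_f1 gen ir; have da0 := da_infl ir.
have c0 : a r0 * dda r0 != 0 by rewrite mulf_neq0 ?a_infl_neq0 ?dda_infl_neq0.
apply: (@local_extremum_dnbhs _ _ h) => //.
- have gd : \forall t \near r0, is_derive (t : R) 1 (fun t => h t - h r0) (a t * da t).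
    apply: filterS (near_f1_neq0 gen F) => t ft.
    apply: (is_derive_eq (isdD (isd_h gen ft) (isdN (isd_cst (h r0) t)))).
    by rewrite subr0.
  have gdd : is_derive r0 1 (fun t => a t * da t) (a r0 * dda r0).
    by apply: (is_derive_eq (isd_dh gen F)); rewrite da0 expr0n add0r.
  by apply: isd_near_sign2 gd gdd _ _ c0; rewrite ?subrr // da0 mulr0.
- by move=> t; rewrite norm_le_sqr_half.
- by move=> t; rewrite norm_le_sqr_half.
Qed.

(** To first order the sign function is a positive multiple of W' Lam' (t - r0), and f - f(r0) is f'
    (t - r0). Their product has the sign of W' Lam' f', which is f'^4 * (a a'') at r0. *)
Lemma sgn_infl_f r0 : infl L f Lam r0 ->
  \forall t \near r0^', 0 < a r0 * dda r0 * (sgn t * (f t - f r0)).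
Proof.
move=> ir; have F := infl_f1 gen ir.
apply: filterS2 (near_infl ir) (sgn_near_infl ir) => t [_ _ _ _ h5] h.
have p := mulr_gt0 h h5.
rewrite dda_infl // /afun.
have tn : t - r0 != 0.
  by apply: contraTN h => /eqP ->; rewrite mulr0 mul0r ltxx.
apply: (sq_factor_gt0 (c := f1 r0 ^+ 2 * (t - r0)) p).
move: F tn; move: (sgn t) => y.
by gen_jets => *; field.
Qed.

Lemma sgn_infl r0 : infl L f Lam r0 ->
  [/\ local_min (fun r => `|a r|) r0 \/ local_max (fun r => `|a r|) r0,
    local_min (fun r => `|a r|) r0 ->
      \forall r \near r0^', (0 < sgn r <-> f r0 < f r) /\ (sgn r < 0 <-> f r < f r0) &
    local_max (fun r => `|a r|) r0 ->
      \forall r \near r0^', (0 < sgn r <-> f r < f r0) /\ (sgn r < 0 <-> f r0 < f r)].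
Proof.
move=> ir; have [m1 m2 m3 _] := abs_a_infl ir; have H := sgn_infl_f ir.
split => //.
  move=> /m1 p; apply: filterS H => t; rewrite pmulr_rgt0 //.
  by move=> /same_sign[]; rewrite subr_gt0 subr_lt0.
move=> /m2 p; apply: filterS H => t; rewrite nmulr_rgt0 // -oppr_gt0 -mulrN opprB.
by move=> /same_sign[]; rewrite subr_gt0 subr_lt0.
Qed.

End LocalForms.

(** * Local forms of the bifurcation curve *)

Section QuotientLimits.
Context {R : realType}.
Implicit Types (F : set_system R) (n d : R -> R) (x c : R).

Lemma near_all x (P : set R) : (forall t, P t) -> \forall t \near x, P t.
Proof. by move=> Pt; exact: filterE. Qed.

Lemma quotient_pinfty F {FF : Filter F} n d (n0 : R) : n0 != 0 ->
  n t @[t --> F] --> n0 -> d t @[t --> F] --> 0 ->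
  (\forall t \near F, 0 < n t / d t) -> n t / d t @[t --> F] --> +oo.
Proof.
move=> n00 nc dc pos; apply/(gtr0_cvgV0 pos).
have -> : unstable.inv_fun (fun t => n t / d t) = (fun t => d t * (n t)^-1).
  by apply/funext => t; rewrite /unstable.inv_fun /= invfM invrK mulrC.
rewrite -[X in _ --> X](mul0r n0^-1).
by apply: cvgM => //; exact: cvgV.
Qed.

Lemma quotient_ninfty F {FF : Filter F} n d (n0 : R) : n0 != 0 ->
  n t @[t --> F] --> n0 -> d t @[t --> F] --> 0 ->
  (\forall t \near F, n t / d t < 0) -> n t / d t @[t --> F] --> -oo.
Proof.
move=> n00 nc dc neg; apply/(ltr0_cvgV0 neg).
have -> : unstable.inv_fun (fun t => n t / d t) = (fun t => d t * (n t)^-1).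
  by apply/funext => t; rewrite /unstable.inv_fun /= invfM invrK mulrC.
rewrite -[X in _ --> X](mul0r n0^-1).
by apply: cvgM => //; exact: cvgV.
Qed.

Lemma cvg_at_left x d (l : R) : d t @[t --> x] --> l -> d t @[t --> x^'-] --> l.
Proof. exact: cvg_at_left_filter. Qed.

Lemma cvg_at_right x d (l : R) : d t @[t --> x] --> l -> d t @[t --> x^'+] --> l.
Proof. exact: cvg_at_right_filter. Qed.

Lemma quotient_sides x n d c : n x != 0 -> d x = 0 ->
  n t @[t --> x] --> n x -> d t @[t --> x] --> d x ->
  (\forall t \near x^', 0 < c * (t - x) * d t) ->
  (0 < n x * c -> (n t / d t @[t --> x^'-] --> -oo) /\ (n t / d t @[t --> x^'+] --> +oo)) /\
  (n x * c < 0 -> (n t / d t @[t --> x^'-] --> +oo) /\ (n t / d t @[t --> x^'+] --> -oo)).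
Proof.
move=> n0 d0 nc dc hc.
have hn := near_dnbhs (cvg_near_neq0 nc n0).
rewrite d0 in dc.
have H : \forall t \near x^', 0 < (n x * c) * ((t - x) * (n t / d t)).
  apply: filterS2 hn hc => t h1 h2.
  have dt : d t != 0 by apply: contraTN h2 => /eqP ->; rewrite mulr0 ltxx.
  have dt2 : 0 < d t ^+ 2 by rewrite exprn_even_gt0.
  have p := divr_gt0 (mulr_gt0 h1 h2) dt2.
  by apply: (sq_factor_gt0 (c := 1) p); field.
have Hl := left_and (dnbhs_left H) (nbhs_left_lt x).
have Hr := right_and (dnbhs_right H) (nbhs_right_gt x).
split=> hs; split.
- apply: (quotient_ninfty n0 (cvg_at_left nc) (cvg_at_left dc)).
  by apply: filterS Hl => t [+ tx]; rewrite pmulr_rgt0 // nmulr_rgt0 // subr_lt0.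
- apply: (quotient_pinfty n0 (cvg_at_right nc) (cvg_at_right dc)).
  by apply: filterS Hr => t [+ tx]; rewrite pmulr_rgt0 // pmulr_rgt0 // subr_gt0.
- apply: (quotient_pinfty n0 (cvg_at_left nc) (cvg_at_left dc)).
  by apply: filterS Hl => t [+ tx]; rewrite nmulr_rgt0 // nmulr_rlt0 // subr_lt0.
- apply: (quotient_ninfty n0 (cvg_at_right nc) (cvg_at_right dc)).
  by apply: filterS Hr => t [+ tx]; rewrite nmulr_rgt0 // pmulr_rlt0 // subr_gt0.
Qed.

End QuotientLimits.

Section BifurcationCurve.
Context {R : realType}.
Variables (L : R) (f Lam : R -> R).
Hypotheses (L_gt0 : 0 < L) (gen : generic L f Lam).

Local Notation f1 := (f^`()).
Local Notation f2 := (f^`(2)).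
Local Notation l1 := (Lam^`()).
Local Notation l2 := (Lam^`(2)).
Local Notation W := (wronsk f Lam).
Local Notation a := (afun f Lam).
Local Notation h := (hfun f Lam).
Local Notation k := (kfun f Lam).
Local Notation sgn := (sgn_type f Lam).
Local Notation da := (da f Lam).
Local Notation dda := (dda f Lam).
Local Notation ddda := (ddda f Lam).

Lemma regular_fl r : 0 <= r <= L -> regular f Lam r.
Proof. by move=> hr [e1 e2]; exact: (not_both_zero gen hr e1 e2). Qed.

Lemma curvature_neq0 (x z : R -> R) r : regular x z r ->
  x^`() r * z^`(2) r - z^`() r * x^`(2) r != 0 -> curvature x z r != 0.
Proof.
move=> rg n0; rewrite /curvature mulf_neq0 // invr_eq0 expf_neq0 // sqrtr_eq0 -ltNge.
rewrite lt_neqAle addr_ge0 ?sqr_ge0 // andbT eq_sym paddr_eq0 ?sqr_ge0 // !sqrf_eq0.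
by apply/negP => /andP[/eqP e1 /eqP e2]; apply: rg; rewrite e1 e2.
Qed.

Lemma curvature_fl r : 0 <= r <= L -> W r != 0 -> curvature f Lam r != 0.
Proof.
move=> hr W0; apply: curvature_neq0; first exact: regular_fl.
by move: W0; rewrite /wronsk [l1 r * _]mulrC.
Qed.

Lemma near_curvature_fl r : 0 < r < L -> W r != 0 ->
  \forall t \near r, regular f Lam t /\ curvature f Lam t != 0.
Proof.
move=> hr W0; have := cvg_near_neq0 (@wronsk_continuous _ _ _ _ gen r) W0.
apply: filterS2 (near_itv hr) => t /andP[t0 tL] /neq0_mul_gt0 Wt.
by split; [apply: regular_fl | apply: curvature_fl]; rewrite ?ltW.
Qed.

Lemma near_regular_ak r : f1 r != 0 -> W r != 0 -> \forall t \near r, regular a k t.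
Proof.
move=> F W0; have := cvg_near_neq0 (@wronsk_continuous _ _ _ _ gen r) W0.
apply: filterS2 (near_f1_neq0 gen F) => t ft /neq0_mul_gt0 Wt [+ _].
case: (derive_a gen ft) => -> _ _ /eqP.
by rewrite /da mulf_eq0 (negbTE Wt) invr_eq0 expf_eq0 (negbTE ft).
Qed.

Lemma da_neq0 r : f1 r != 0 -> W r != 0 -> da r != 0.
Proof. by move=> F W0; rewrite /da mulf_neq0 // invr_eq0 expf_neq0. Qed.

Lemma crit_l_forms r0 : crit L Lam r0 -> 0 < r0 < L ->
  [/\ (\forall r \near r0, regular f Lam r /\ curvature f Lam r != 0) /\
        horizontal_tangent f Lam r0,
      [/\ \forall r \near r0, regular a k r, a r0 = 0, k r0 = Lam r0,
          a^`() r0 != 0 & k^`() r0 / a^`() r0 = - f r0 /\ - f r0 < 0],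
      \forall r \near r0, 0 <= h r,
      h r0 = 0 /\ k r0 = Lam r0 &
      [/\ h^`() r0 = 0, k^`() r0 != 0 & h^`(2) r0 != 0]].
Proof.
move=> cr hr; have [_ l10] := cr.
have F := crit_l_f1 gen cr; have W0 := crit_l_wronsk gen cr.
have d0 := da_neq0 F W0.
have [a1 _ _] := derive_a gen F; have [k1 _ _] := derive_k gen F.
have [h1 h2 _] := derive_h gen F.
have a0 : a r0 = 0 by rewrite /afun l10 mul0r.
have k0 : k r0 = Lam r0 by rewrite /kfun l10 mul0r mulr0 subr0.
have h0 : h r0 = 0 by rewrite /hfun a0 expr0n /= mul0r.
split.
- split; first exact: near_curvature_fl.
  by case/andP: hr => r0p rL; split => //; apply: regular_fl; rewrite !ltW.
- split => //; first exact: near_regular_ak.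
    by rewrite a1.
  by rewrite a1 k1 mulNr mulfK // oppr_lt0 (f_gt0 gen).
- by apply: near_all => t; rewrite /hfun divr_ge0 ?sqr_ge0.
- by [].
- split; first by rewrite h1 a0 mul0r.
    by rewrite k1 oppr_eq0 mulf_neq0 // (f_neq0 gen).
  by rewrite h2 a0 mul0r addr0 expf_neq0.
Qed.

Lemma end_forms r0 : r0 = 0 \/ r0 = L ->
  [/\ f r0 = 0, a r0 = 0, k r0 = Lam r0,
      horizontal_tangent f Lam r0 /\ curvature f Lam r0 != 0 &
      horizontal_tangent a k r0 /\ curvature a k r0 != 0].
Proof.
move=> e; have hr : 0 <= r0 <= L by case: e => ->; rewrite lexx ltW.
have l10 : l1 r0 = 0 by case: e => ->; [exact: (l1_0 gen) | exact: (l1_L gen)].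
have f0 : f r0 = 0 by case: e => ->; [exact: (f_0 gen) | exact: (f_L gen)].
have cr : crit L Lam r0 by [].
have F := crit_l_f1 gen cr; have W0 := crit_l_wronsk gen cr.
have d0 := da_neq0 F W0.
have [a1 a2 _] := derive_a gen F; have [k1 k2 _] := derive_k gen F.
have rg : regular a k r0.
  by rewrite /regular a1 k1 => -[/eqP]; rewrite (negbTE d0).
split => //.
- by rewrite /afun l10 mul0r.
- by rewrite /kfun f0 mul0r subr0.
- by split; [split => //; exact: regular_fl | exact: curvature_fl].
- split; first by split => //; rewrite k1 f0 mul0r oppr0.
  apply: curvature_neq0 => //; rewrite a1 a2 k1 k2 f0 !mul0r addr0 oppr0 mul0r subr0.
  by rewrite mulrN oppr_eq0 mulf_neq0 // mulf_neq0.
Qed.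

(** At a zero of a' one has k'' = - f a'' and k''' = - 2 f' a'' - f a'''. In the cusp determinant of
    (a, k) the terms with a''' cancel and - 2 f' a''^2 remains; for (h, k), where h'' = a a'' and
    h''' = a a''', the result is a times as large. *)
Lemma infl_forms r0 : infl L f Lam r0 ->
  [/\ inflection f Lam r0 /\
        ~ horizontal_tangent f Lam r0 /\ ~ vertical_tangent f Lam r0,
      [/\ Ireg L f r0, a r0 != 0, ordinary_cusp a k r0,
          a^`(2) r0 != 0 & k^`(2) r0 / a^`(2) r0 = - f r0],
      ordinary_cusp h k r0 /\ 0 < h r0,
      0 < a r0 \/ a r0 < 0 &
      (local_min (fun r => `|a r|) r0 /\ ~ local_max (fun r => `|a r|) r0) \/
      (local_max (fun r => `|a r|) r0 /\ ~ local_min (fun r => `|a r|) r0)].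
Proof.
move=> ir; have [hr W0] := ir.
have F := infl_f1 gen ir; have l10 := infl_l1 gen ir.
have a0 := a_infl_neq0 gen ir.
have d0 := da_infl ir; have dd0 := dda_infl_neq0 gen ir.
have [a1 a2 a3] := derive_a gen F; have [k1 k2 k3] := derive_k gen F.
have [h1 h2 h3] := derive_h gen F.
have cusp : ordinary_cusp a k r0.
  split; rewrite ?a1 ?k1 ?d0 ?mulr0 ?oppr0 // a2 a3 k2 k3 d0.
  have -> : dda r0 * - (f2 r0 * 0 + 2 * f1 r0 * dda r0 + f r0 * ddda r0) -
    - (f1 r0 * 0 + f r0 * dda r0) * ddda r0 = - 2 * f1 r0 * dda r0 ^+ 2.
    by move: (dda r0) (ddda r0) => x y; jring.
  by do !apply: mulf_neq0 => //; rewrite ?oppr_eq0 ?pnatr_eq0.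
split.
- split.
    split; first exact: regular_fl.
      by rewrite -[RHS]W0 /wronsk [l1 r0 * _]mulrC.
    by rewrite [l1 r0 * _]mulrC (infl_wronsk1 gen ir).
  by split => -[_ e]; [move: l10 | move: F]; rewrite e eqxx.
- split => //.
  + by split => // -[_ e]; move: F; rewrite e eqxx.
  + by rewrite a2.
  + by rewrite a2 k2 d0 mulr0 add0r mulNr mulfK.
- split; last by rewrite /hfun divr_gt0 // exprn_even_gt0.
  split; rewrite ?h1 ?k1 ?d0 ?mulr0 ?oppr0 // h2 h3 k2 k3 d0.
  have -> : (0 ^+ 2 + a r0 * dda r0) * - (f2 r0 * 0 + 2 * f1 r0 * dda r0 + f r0 * ddda r0) -
    - (f1 r0 * 0 + f r0 * dda r0) * (3 * 0 * dda r0 + a r0 * ddda r0)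
    = - 2 * f1 r0 * dda r0 ^+ 2 * a r0.
    by move: (dda r0) (ddda r0) => x y; jring.
  by do !apply: mulf_neq0 => //; rewrite ?oppr_eq0 ?pnatr_eq0.
- by have [||/eqP] := ltgtP (a r0) 0; [right|left|rewrite (negbTE a0)].
- have [_ _ m1 m2] := abs_a_infl gen ir.
  by case: m1 => m; [left|right]; split => // m'; apply: m2.
Qed.

(** The signed distance in the k direction from (a, k) to the asymptote. It measures the distance to
    the asymptotic parabola as well. *)
Definition asym_defect ri r := f ri * a r - Lam ri + k r.

Lemma asym_defectE ri r :
  asym_defect ri r = - (f r - f ri) * a r + (Lam r - Lam ri).
Proof. by rewrite /asym_defect /kfun -/(a r); jring. Qed.

(** The product (f - f(ri)) * a is Lam' times the slope of f over the slope of f', so it tends to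
    Lam' f' / f'' at ri, which is 0. *)
Lemma asym_defect_cvg ri : crit L f ri ->
  asym_defect ri r @[r --> ri^'] --> (0 : R).
Proof.
move=> cr; have [_ f10] := cr; have f20 := crit_f_f2 gen cr.
have c1 := isd_slope (isd_f gen ri); have c2 := isd_slope (isd_f1 gen ri).
have c3 : l1 t @[t --> ri^'] --> l1 ri.
  by apply: cvg_within_filter; exact: (l1_continuous gen).
have c4 : Lam t @[t --> ri^'] --> Lam ri.
  by apply: cvg_within_filter; exact: (l_continuous gen).
have H : - ((f t - f ri) / (t - ri)) * ((f1 t - f1 ri) / (t - ri))^-1 * l1 t
   + (Lam t - Lam ri) @[t --> ri^'] --> - f1 ri * (f2 ri)^-1 * l1 ri + (Lam ri - Lam ri).
  apply: cvgD; last by apply: cvgB => //; exact: cvg_cst.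
  by apply: cvgM => //; apply: cvgM; [exact: cvgN | exact: cvgV].
rewrite f10 oppr0 !mul0r subrr addr0 in H.
apply: cvg_trans H; apply: near_eq_cvg.
apply: filterS (nbhs_dnbhs_neq ri) => t tn.
rewrite asym_defectE addr0 /afun invfM invrK; congr (_ + _).
have n : t - ri != 0 by rewrite subr_eq0.
by move: (f1 t)^-1 (l1 t) => u v; field.
Qed.

(** After multiplication by f' the defect becomes a smooth function n with n = n' = 0 and n'' = Lam'
    f'' at ri. Dividing back by f', which behaves like f'' * (t - ri), gives the sign change. *)
Lemma asym_defect_sign ri : crit L f ri ->
  \forall t \near ri^', 0 < l1 ri * (t - ri) * asym_defect ri t.
Proof.
move=> cr; have [_ f10] := cr; have f20 := crit_f_f2 gen cr.
have l10 := crit_f_l1 gen cr.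
pose n t := - (f t - f ri) * l1 t + (Lam t - Lam ri) * f1 t.
pose n1 t := - (f t - f ri) * l2 t + (Lam t - Lam ri) * f2 t.
have D1 (t : R) : is_derive t 1 n (n1 t).
  apply: (is_derive_eq (isdD
    (isdM (isdN (isdD (isd_f gen t) (isdN (isd_cst (f ri) t)))) (isd_l1 gen t))
    (isdM (isdD (isd_l gen t) (isdN (isd_cst (Lam ri) t))) (isd_f1 gen t)))).
  by rewrite /n1; jring.
have D2 : is_derive ri 1 n1 (l1 ri * f2 ri).
  apply: (is_derive_eq (isdD
    (isdM (isdN (isdD (isd_f gen ri) (isdN (isd_cst (f ri) ri)))) (isd_l2 gen ri))
    (isdM (isdD (isd_l gen ri) (isdN (isd_cst (Lam ri) ri))) (isd_f2 gen ri)))).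
  by rewrite f10; jring.
have N1 : n ri = 0 by rewrite /n (subrr (f ri)) (subrr (Lam ri)) oppr0 !mul0r addr0.
have N2 : n1 ri = 0 by rewrite /n1; move: (l2 ri) (f2 ri) => x y; ring.
have H1 := isd_near_sign2 (near_all ri D1) D2 N1 N2 (mulf_neq0 l10 f20).
have H2 := isd_near_sign (isd_f1 gen ri) f10 f20.
apply: filterS2 H1 H2 => t h1 h2.
have ft := neq0_mul_gt0 h2.
apply: (sq_factor_gt0 (c := f2 ri * f1 t) (mulr_gt0 h1 h2)).
by rewrite asym_defectE /n /afun; jfield.
Qed.

Lemma h_pinfty ri : crit L f ri -> h r @[r --> ri^'] --> +oo.
Proof.
move=> cr; have [_ f10] := cr; have f20 := crit_f_f2 gen cr.
have l10 := crit_f_l1 gen cr.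
(* The identity also holds at the zeros of f', where both sides are 0 since division by 0 gives
   0. *)
have e : h = (fun t => l1 t ^+ 2 / (2 * f1 t ^+ 2)).
  apply/funext => t; rewrite /hfun /afun; move: (l1 t) (f1 t) => x y.
  have [->|y0] := eqVneq y 0; last by field.
  by rewrite expr0n /= mulr0 invr0 !mulr0 expr0n mul0r.
rewrite e.
have n0 : l1 ri ^+ 2 != 0 by rewrite expf_neq0.
have c1 : f1 t @[t --> ri^'] --> f1 ri.
  by apply: cvg_within_filter; exact: (f1_continuous gen).
have c2 : l1 t @[t --> ri^'] --> l1 ri.
  by apply: cvg_within_filter; exact: (l1_continuous gen).
apply: (@quotient_pinfty _ _ _ (fun t => l1 t ^+ 2) (fun t => 2 * f1 t ^+ 2) _ n0).
- by rewrite expr2; under eq_fun do rewrite expr2; exact: cvgM.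
- have -> : (0 : R) = 2 * (f1 ri * f1 ri) by rewrite f10 !mulr0.
  under eq_fun do rewrite expr2.
  by apply: cvgM; [exact: cvg_cst | exact: cvgM].
have H1 := near_same_sign (l1_continuous gen) l10.
have H2 := isd_near_sign (isd_f1 gen ri) f10 f20.
apply: filterS2 H1 H2 => t /neq0_mul_gt0 h1 /neq0_mul_gt0 h2.
apply: divr_gt0; first by rewrite exprn_even_gt0.
by apply: mulr_gt0 => //; rewrite exprn_even_gt0.
Qed.

(** Both a = Lam' / f' and k = (Lam f' - f Lam') / f' have a numerator that does not vanish at ri
    and a denominator with a simple zero there. *)
Lemma ak_infty ri : crit L f ri ->
  ((a r @[r --> ri^'-] --> +oo /\ a r @[r --> ri^'+] --> -oo) \/
   (a r @[r --> ri^'-] --> -oo /\ a r @[r --> ri^'+] --> +oo)) /\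
  ((k r @[r --> ri^'-] --> +oo /\ k r @[r --> ri^'+] --> -oo) \/
   (k r @[r --> ri^'-] --> -oo /\ k r @[r --> ri^'+] --> +oo)).
Proof.
move=> cr; have hr := crit_f_itv gen cr; have [_ f10] := cr.
have f20 := crit_f_f2 gen cr; have l10 := crit_f_l1 gen cr.
have H2 := isd_near_sign (isd_f1 gen ri) f10 f20.
have fc := @f1_continuous _ _ _ _ gen ri.
split.
  have [P1 P2] := quotient_sides l10 f10 (@l1_continuous _ _ _ _ gen ri) fc H2.
  have [/P2|/P1|/eqP] := ltgtP (l1 ri * f2 ri) 0; [by left|by right|].
  by rewrite mulf_eq0 (negbTE l10) (negbTE f20).
pose n t := Lam t * f1 t - f t * l1 t.
have n0 : n ri != 0.
  by rewrite /n f10 mulr0 sub0r oppr_eq0 mulf_neq0 // (f_neq0 gen).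
have nc : n t @[t --> ri] --> n ri.
  apply: cvgB; apply: cvgM.
  - exact: (l_continuous gen).
  - exact: (f1_continuous gen).
  - exact: (f_continuous gen).
  - exact: (l1_continuous gen).
have E : \forall t \near ri^', n t / f1 t = k t.
  apply: filterS H2 => t /neq0_mul_gt0 ft.
  by rewrite /n /kfun mulrBl mulfK // mulrA.
have [P1 P2] := quotient_sides n0 f10 nc fc H2.
have El (l : set_system R) : n t / f1 t @[t --> ri^'-] --> l -> k t @[t --> ri^'-] --> l.
  by apply: cvg_trans; apply: near_eq_cvg; exact: dnbhs_left.
have Er (l : set_system R) : n t / f1 t @[t --> ri^'+] --> l -> k t @[t --> ri^'+] --> l.
  by apply: cvg_trans; apply: near_eq_cvg; exact: dnbhs_right.
have [/P2|/P1|/eqP] := ltgtP (n ri * f2 ri) 0.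
- by case=> /El ? /Er ?; left.
- by case=> /El ? /Er ?; right.
- by rewrite mulf_eq0 (negbTE n0) (negbTE f20).
Qed.

Lemma dist2_snd (x y z : R) : dist2 (x, y) (x, z) = `|y - z|.
Proof. by rewrite /dist2 /= subrr expr0n /= add0r sqrtr_sqr. Qed.

Lemma crit_f_forms ri : crit L f ri ->
  let l := fun r => f ri * a r - Lam ri + k r in
  [/\ (\forall r \near ri, regular f Lam r /\ curvature f Lam r != 0) /\
        vertical_tangent f Lam ri,
      (a r @[r --> ri^'-] --> +oo /\ a r @[r --> ri^'+] --> -oo) \/
      (a r @[r --> ri^'-] --> -oo /\ a r @[r --> ri^'+] --> +oo),
      asymptotic ri^' (fun r => (a r, k r))
        [set P : R * R | f ri * P.1 - Lam ri + P.2 = 0] /\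
      (\forall r \near ri^'- & s \near ri^'+, l r * l s < 0),
      h r @[r --> ri^'] --> +oo /\
      ((k r @[r --> ri^'-] --> +oo /\ k r @[r --> ri^'+] --> -oo) \/
       (k r @[r --> ri^'-] --> -oo /\ k r @[r --> ri^'+] --> +oo)) &
      asymptotic ri^' (fun r => (h r, k r))
        [set P : R * R | P.1 = (P.2 - Lam ri) ^+ 2 / (2 * f ri ^+ 2)]].
Proof.
move=> cr l; have hr := crit_f_itv gen cr; have [hr' f10] := cr.
have [ai ki] := ak_infty cr; have dc := asym_defect_cvg cr.
have fi : f ri != 0 by exact: (f_neq0 gen).
have near_l e : 0 < e -> \forall t \near ri^', `|l t| < e.
  move=> e0; move/cvgrPdist_lt: dc => /(_ e e0); apply: filterS => t.
  by rewrite sub0r normrN.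
have lE t : `|k t - (Lam ri - f ri * a t)| = `|l t|.
  by congr `|_|; rewrite /l; jring.
split => //.
- split; first by apply: near_curvature_fl => //; exact: (crit_f_wronsk gen).
  by split => //; exact: regular_fl.
- split.
    move=> e /near_l; apply: filterS => t lt.
    exists (a t, Lam ri - f ri * a t); first by rewrite /=; jring.
    by rewrite dist2_snd lE.
  have H := asym_defect_sign cr.
  have Hl := left_and (dnbhs_left H) (nbhs_left_lt ri).
  have Hr := right_and (dnbhs_right H) (nbhs_right_gt ri).
  near=> r s.
  have [h1 rr] : 0 < l1 ri * (r - ri) * asym_defect ri r /\ r < ri by near: r.
  have [h2 rs] : 0 < l1 ri * (s - ri) * asym_defect ri s /\ ri < s by near: s.
  rewrite /= -[l r]/(asym_defect ri r) -[l s]/(asym_defect ri s) -oppr_gt0.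
  have n1 : ri - r != 0 by rewrite subr_eq0 gt_eqF.
  have n2 : s - ri != 0 by rewrite subr_eq0 gt_eqF.
  have p := divr_gt0 (mulr_gt0 h1 h2) (mulr_gt0 (etrans (subr_gt0 _ _) rr) (etrans (subr_gt0 _ _)
      rs)).
  apply: (sq_factor_gt0 (c := l1 ri) p).
  move: (asym_defect ri r) (asym_defect ri s) => x y.
  by gen_jets; field; apply/andP.
- by split => //; exact: h_pinfty.
- move=> e /near_l; apply: filterS => t lt.
  (* This is the point of the parabola with the same h: as h = a^2 / 2, its second coordinate is
     that of the asymptote over a t. *)
  exists (h t, Lam ri - f ri * a t); last by rewrite dist2_snd lE.
  by rewrite /= /hfun; gen_jets; field.
Unshelve. all: end_near. Qed.

Lemma tangent_lineE r s w : f1 r != 0 -> a r = - s * w -> 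
  tangent_line f Lam r = [set P : R * R | P.2 = k r - s * w * P.1].
Proof.
move=> F ar; have lE : l1 r = a r * f1 r by rewrite /afun divfK.
have kE : k r = Lam r - f r * a r by [].
rewrite eqEsubset; split => [P [u ->] /=|[x y] /= yE].
  by rewrite kE lE ar; jring.
exists ((x - f r) / f1 r); congr (_, _); first by rewrite divfK // addrC subrK.
by rewrite yE kE lE ar; jfield.
Qed.

(* g = Lam - k - a f vanishes to second order at rho, and a * g <= 0 near rho. *)
Lemma hyperbolic_sector (rho w : R) : 0 < rho < L -> f1 rho != 0 -> sgn rho < 0 ->
  w = `|a rho| -> \forall r \near rho, `|Lam r - k rho| <= w * f r.
Proof.
move=> hr F sn wE; have lE : l1 rho = a rho * f1 rho by rewrite /afun divfK.
have a0 : a rho != 0.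
  apply/eqP => e; move: sn; rewrite (sgn_typeE gen F) lE e mul0r mulr0 mul0r.
  by rewrite ltxx.
pose g t := Lam t - k rho - a rho * f t.
pose g1 t := l1 t - a rho * f1 t.
have D1 (t : R) : is_derive t 1 g (g1 t).
  apply: (is_derive_eq (isdD (isdD (isd_l gen t) (isdN (isd_cst (k rho) t)))
     (isdN (isdM (isd_cst (a rho) t) (isd_f gen t))))).
  by rewrite /g1; jring.
have D2 : is_derive rho 1 g1 (W rho / f1 rho).
  apply: (is_derive_eq (isdD (isd_l1 gen rho)
     (isdN (isdM (isd_cst (a rho) rho) (isd_f1 gen rho))))).
  by rewrite /wronsk /afun; jfield.
have N1 : g rho = 0 by rewrite /g /kfun -/(a rho); jring.
have N2 : g1 rho = 0 by rewrite /g1 lE subrr.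
have sn' : W rho / f1 rho * a rho < 0.
  have p : 0 < - sgn rho by rewrite oppr_gt0.
  rewrite -oppr_gt0; have fp := f_gt0 gen hr.
  apply: (sq_factor_gt0 (c := 1) (divr_gt0 p fp)).
  rewrite (sgn_typeE gen F) lE; have fn := lt0r_neq0 fp.
  by gen_jets; field; apply/andP.
have W0 : W rho / f1 rho != 0.
  by apply: contraTN sn' => /eqP ->; rewrite mul0r ltxx.
have H := isd_near_sign2 (near_all rho D1) D2 N1 N2 W0.
have H' : \forall t \near rho, a rho * g t <= 0.
  move: H; rewrite near_withinE; apply: filterS => t.
  have [->|tr /(_ isT) h1] := eqVneq t rho; first by move=> _; rewrite N1 mulr0 lexx.
  rewrite -oppr_ge0 ltW //; apply: (sq_factor_gt0 (c := W rho / f1 rho)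
     (mulr_gt0 h1 (etrans (oppr_gt0 _) sn'))).
  by move: (g t) => x; jring.
have ak : Lam rho - k rho = a rho * f rho by rewrite /kfun -/(a rho); jring.
have fp := f_gt0 gen hr.
(* Near rho the difference Lam - k(rho) keeps the sign of a(rho). This turns the one-sided estimate
   for g into a bound on the absolute value. *)
have cl : \forall t \near rho, 0 < (Lam rho - k rho) * (Lam t - k rho).
  apply: (@cvg_near_neq0 _ (fun t => Lam t - k rho)).
    by apply: cvgB; [exact: (l_continuous gen) | exact: cvg_cst].
  by rewrite ak mulf_neq0 // gt_eqF.
apply: filterS2 H' cl => t h1; rewrite ak [a rho * f rho]mulrC -mulrA pmulr_rgt0 // => h2.
rewrite /g in h1; rewrite wE; move: h1 h2.
move: (a rho) (Lam t - k rho) (f t) a0 => x y z x0 h1 h2.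
have [xp|xn|/eqP] := ltgtP 0 x; last by rewrite eq_sym (negbTE x0).
  rewrite pmulr_rgt0 // in h2; rewrite pmulr_rle0 // subr_le0 in h1.
  by rewrite gtr0_norm // gtr0_norm.
rewrite nmulr_rgt0 // in h2; rewrite nmulr_rle0 // subr_ge0 in h1.
by rewrite ltr0_norm // ltr0_norm // mulNr lerN2.
Qed.

End BifurcationCurve.

(** * Gaussian curvature *)

Section GaussCurvature.
Context {R : realType}.
Implicit Types (x z : R -> R).

Lemma row3_ext (u v : 'rV[R]_3) :
  u 0 0 = v 0 0 -> u 0 1 = v 0 1 -> u 0 2 = v 0 2 -> u = v.
Proof.
move=> e0 e1 e2; apply/rowP => -[[|[|[|//]]] i].
- by have -> : Ordinal i = 0 by exact: val_inj.
- by have -> : Ordinal i = 1 by exact: val_inj.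
- by have -> : Ordinal i = 2 by exact: val_inj.
Qed.

Lemma row3E (a b c : R) :
  [/\ row3 a b c 0 0 = a, row3 a b c 0 1 = b & row3 a b c 0 2 = c].
Proof. by rewrite /row3 !mxE. Qed.

Lemma dot3E (u v : 'rV[R]_3) :
  dot3 u v = u 0 0 * v 0 0 + u 0 1 * v 0 1 + u 0 2 * v 0 2.
Proof.
rewrite /dot3 mxE !big_ord_recl big_ord0 !mxE addr0 addrA.
have -> : lift ord0 ord0 = 1 :> 'I_3 by exact: val_inj.
by have -> : lift ord0 (lift ord0 ord0) = 2 :> 'I_3 by exact: val_inj.
Qed.

Lemma det_mx33 (M : 'M[R]_3) : \det M =
  M 0 0 * (M 1 1 * M 2 2 - M 1 2 * M 2 1)
  - M 0 1 * (M 1 0 * M 2 2 - M 1 2 * M 2 0)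
  + M 0 2 * (M 1 0 * M 2 1 - M 1 1 * M 2 0).
Proof.
pose m i j := M (inord i) (inord j).
have E (i j : 'I_3) : M i j = m i j by rewrite /m !inord_val.
rewrite (expand_det_row _ 0) !big_ord_recl big_ord0 /cofactor.
rewrite !(expand_det_row _ 0) !big_ord_recl !big_ord0 /cofactor !det_mx11 !mxE /=.
rewrite !E /bump /= ?add0n ?addn0 ?add1n ?expr0 ?expr1.
ring.
Qed.

Lemma det3_row3 (a b c d e f g h i : R) :
  det3 (row3 a b c) (row3 d e f) (row3 g h i) =
  a * (e * i - f * h) - b * (d * i - f * g) + c * (d * h - e * g).
Proof.
rewrite /det3 det_mx33.
have r0 : (0 : 'I_(1 + (1 + 1))) = lshift _ 0 by exact: val_inj.
have r1 : (1 : 'I_(1 + (1 + 1))) = rshift 1 (lshift 1 0) by exact: val_inj.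
have r2 : (2 : 'I_(1 + (1 + 1))) = rshift 1 (rshift 1 0) by exact: val_inj.
set M := col_mx _ _.
have M0 j : M 0 j = row3 a b c 0 j by rewrite /M r0 col_mxEu.
have M1 j : M 1 j = row3 d e f 0 j by rewrite /M r1 col_mxEd col_mxEu.
have M2 j : M 2 j = row3 g h i 0 j by rewrite /M r2 !col_mxEd.
by rewrite !M0 !M1 !M2 !mxE.
Qed.

Lemma du_row3 (p q r : R -> R -> R) u v (X := fun u v => row3 (p u v) (q u v) (r u v)) :
  du X u v = row3 (derive1 (fun s => p s v) u) (derive1 (fun s => q s v) u)
    (derive1 (fun s => r s v) u).
Proof.
by apply: row3_ext; rewrite !mxE /=; congr derive1; apply/funext => s; rewrite /X mxE.
Qed.

Lemma dv_row3 (p q r : R -> R -> R) u v (X := fun u v => row3 (p u v) (q u v) (r u v)) :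
  dv X u v = row3 (derive1 (fun s => p u s) v) (derive1 (fun s => q u s) v)
    (derive1 (fun s => r u s) v).
Proof.
by apply: row3_ext; rewrite !mxE /=; congr derive1; apply/funext => s; rewrite /X mxE.
Qed.

Lemma isd_cos (v : R) : is_derive v 1 cos (- sin v).
Proof. exact: is_derive_cos. Qed.

Lemma isd_sin (v : R) : is_derive v 1 sin (cos v).
Proof. exact: is_derive_sin. Qed.

Lemma isdMc c (g : R -> R) (u d : R) :
  is_derive u 1 g d -> is_derive u 1 (fun t => g t * c) (d * c).
Proof.
by move=> gd; apply: (is_derive_eq (isdM gd (isd_cst c u))); rewrite mulr0 addr0.
Qed.

Lemma isdcM c (g : R -> R) (u d : R) :
  is_derive u 1 g d -> is_derive u 1 (fun t => c * g t) (c * d).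
Proof.
by move=> gd; apply: (is_derive_eq (isdM (isd_cst c u) gd)); rewrite mul0r add0r.
Qed.

(** The derivatives x1 and z1 are assumed near u, not only at u, because the second partial
    derivative in u differentiates [du] of the surface. The curvature equals x z' (x' z'' - z' x'')
    up to the positive factor x^2 / (E G - F^2)^2. *)
Lemma gauss_revolution x z (x1 z1 : R -> R) (x2 z2 u phi : R) :
  (\forall t \near u, is_derive (t : R) 1 x (x1 t)) -> is_derive u 1 x1 x2 ->
  (\forall t \near u, is_derive (t : R) 1 z (z1 t)) -> is_derive u 1 z1 z2 ->
  x u != 0 -> 0 < x1 u ^+ 2 + z1 u ^+ 2 ->
  Num.sg (gauss_curvature (revolution x z) u phi) =
  Num.sg (x u * z1 u * (x1 u * z2 - z1 u * x2)).
Proof.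
move=> hx hx1 hz hz1 x0 p0.
have nx : is_derive u 1 x (x1 u) by exact: nbhs_singleton hx.
have nz : is_derive u 1 z (z1 u) by exact: nbhs_singleton hz.
have Xu (v : R) : du (revolution x z) u v = row3 (x1 u * cos v) (x1 u * sin v) (z1 u).
  rewrite du_row3; congr row3; [exact: isd_derive1 (isdMc _ nx) | exact: isd_derive1 (isdMc _ nx)
    | exact: isd_derive1 nz].
have Xv (v : R) : dv (revolution x z) u v = row3 (x u * - sin v) (x u * cos v) 0.
  rewrite dv_row3; congr row3; [exact: isd_derive1 (isdcM _ (isd_cos _))
    | exact: isd_derive1 (isdcM _ (isd_sin _)) | exact: isd_derive1 (isd_cst _ _)].
have Xuv : dv (du (revolution x z)) u phi = row3 (x1 u * - sin phi) (x1 u * cos phi) 0.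
  have -> : dv (du (revolution x z)) u phi =
     dv (fun u v => row3 (x1 u * cos v) (x1 u * sin v) (z1 u)) u phi.
    apply/rowP => i; rewrite !mxE; congr (derive1 _ phi); apply/funext => s.
    by rewrite Xu.
  rewrite dv_row3; congr row3; [exact: isd_derive1 (isdcM _ (isd_cos _))
    | exact: isd_derive1 (isdcM _ (isd_sin _)) | exact: isd_derive1 (isd_cst _ _)].
have Xvv : dv (dv (revolution x z)) u phi = row3 (x u * - cos phi) (x u * - sin phi) 0.
  have -> : dv (dv (revolution x z)) u phi =
     dv (fun u v => row3 (x u * - sin v) (x u * cos v) 0) u phi.
    apply/rowP => i; rewrite !mxE; congr (derive1 _ phi); apply/funext => s.
    by rewrite Xv.
  rewrite dv_row3; congr row3; [exact: isd_derive1 (isdcM _ (isdN (isd_sin _)))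
    | exact: isd_derive1 (isdcM _ (isd_cos _)) | exact: isd_derive1 (isd_cst _ _)].
have Xuu : du (du (revolution x z)) u phi = row3 (x2 * cos phi) (x2 * sin phi) z2.
  have E (s : R) i : is_derive s 1 x (x1 s) -> is_derive s 1 z (z1 s) ->
      du (revolution x z) s phi 0 i = row3 (x1 s * cos phi) (x1 s * sin phi) (z1 s) 0 i.
    move=> xs zs; congr (_ _ _ i); rewrite du_row3; congr row3; [exact: isd_derive1 (isdMc _ xs)
      | exact: isd_derive1 (isdMc _ xs) | exact: isd_derive1 zs].
  apply: row3_ext; rewrite !mxE /=; apply: isd_derive1.
  - apply: (@isd_near _ _ (fun s => x1 s * cos phi)); last exact: isdMc hx1.
    by apply: filterS2 hx hz => s xs zs; rewrite E // mxE.
  - apply: (@isd_near _ _ (fun s => x1 s * sin phi)); last exact: isdMc hx1.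
    by apply: filterS2 hx hz => s xs zs; rewrite E // mxE.
  - apply: (@isd_near _ _ z1) => //.
    by apply: filterS2 hx hz => s xs zs; rewrite E // mxE.
have e1 := cos2Dsin2 phi.
have W : dot3 (du (revolution x z) u phi) (du (revolution x z) u phi)
    * dot3 (dv (revolution x z) u phi) (dv (revolution x z) u phi)
    - dot3 (du (revolution x z) u phi) (dv (revolution x z) u phi) ^+ 2
    = x u ^+ 2 * (x1 u ^+ 2 + z1 u ^+ 2).
  rewrite Xu Xv !dot3E !mxE /=.
  transitivity (x u ^+ 2 * (cos phi ^+ 2 + sin phi ^+ 2) *
    (x1 u ^+ 2 * (cos phi ^+ 2 + sin phi ^+ 2) + z1 u ^+ 2)); first by ring.
  by rewrite e1 !mulr1.
rewrite /gauss_curvature W Xuu Xuv Xvv Xu Xv !det3_row3.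
set w := x u ^+ 2 * _.
have w0 : 0 < w by rewrite mulr_gt0 // exprn_even_gt0.
have ss : Num.sqrt w ^+ 2 = w by rewrite sqr_sqrtr // ltW.
have s0 : Num.sqrt w != 0 by rewrite sqrtr_eq0 -ltNge.
move: (Num.sqrt w) s0 ss => s s0 ss.
transitivity (Num.sg (x u ^+ 2 / w ^+ 2 * (x u * z1 u * (x1 u * z2 - z1 u * x2)))).
  congr Num.sg.
  transitivity (x u ^+ 3 * (cos phi ^+ 2 + sin phi ^+ 2) ^+ 2 * z1 u *
     (x1 u * z2 - z1 u * x2) / (s ^+ 2 * w)).
    by have wn := lt0r_neq0 w0; field; apply/andP.
  by rewrite e1 ss; have wn := lt0r_neq0 w0; field.
rewrite sgrM gtr0_sg ?mul1r // divr_gt0 //; first by rewrite exprn_even_gt0.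
by rewrite exprn_gt0.
Qed.

End GaussCurvature.

Section GaussSigns.
Context {R : realType}.
Variables (L : R) (f Lam : R -> R).
Hypotheses (gen : generic L f Lam).
Local Notation f1 := (f^`()).
Local Notation a := (afun f Lam).
Local Notation k := (kfun f Lam).
Local Notation sgn := (sgn_type f Lam).
Local Notation da := (da f Lam).

Lemma sg_scale (x y c : R) : c != 0 -> y = c ^+ 2 * x -> Num.sg y = Num.sg x.
Proof. by move=> c0 ->; rewrite sgrM gtr0_sg ?mul1r // exprn_even_gt0. Qed.

Lemma gauss_fl r phi : 0 < r < L -> f1 r != 0 ->
  Num.sg (gauss_curvature (revolution f Lam) r phi) = Num.sg (sgn r).
Proof.
move=> hr F; have f0 := f_neq0 gen hr.
rewrite (gauss_revolution phi (near_all r (isd_f gen)) (isd_f1 gen r)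
  (near_all r (isd_l gen)) (isd_l1 gen r)) //; last first.
  by rewrite addrC; apply: (generic_immersed gen); case/andP: hr => h1 h2; rewrite !ltW.
apply: (sg_scale F); rewrite (sgn_typeE gen F) /wronsk.
by gen_jets; field.
Qed.

(** With z' = k' = - f a', the expression x z' (x' z'' - z' x'') collapses to a f f' a'^3 = a'^2 *
    (f a' Lam'), the last factor being the sign function. Its non-vanishing keeps the surface
    regular, since then a != 0 and a' != 0. *)
Lemma gauss_ak r phi : 0 < r < L -> f1 r != 0 -> sgn r != 0 ->
  Num.sg (gauss_curvature (revolution a k) r phi) = Num.sg (sgn r).
Proof.
move=> hr F sn; have sE := sgn_type_da gen F.
have d0 : da r != 0.
  by apply: contraNN sn; rewrite sE => /eqP ->; rewrite mulr0 mul0r.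
have a0 : a r != 0.
  apply: contraNN sn; rewrite sE /afun mulf_eq0 invr_eq0 (negbTE F) orbF => /eqP ->.
  by rewrite mulr0.
rewrite (gauss_revolution phi
  (filterS (@isd_a _ _ _ _ gen) (near_f1_neq0 gen F)) (isd_da gen F)
  (filterS (@isd_k _ _ _ _ gen) (near_f1_neq0 gen F)) (isd_dk gen F)) //; last first.
  by rewrite ltr_pwDl ?exprn_even_gt0 ?sqr_ge0.
apply: (sg_scale d0); rewrite sE /afun.
move: (da r) (dda f Lam r) => x y; gen_jets; field.
by [].
Qed.

End GaussSigns.

(** * Charts and differentials *)

Section Coordinates.
Context {R : realType}.

Definition vec4 (a b c d : R) : 'rV[R]_4 := \row_i nth 0 [:: a; b; c; d] i.

Lemma vec4_ext (u v : 'rV[R]_4) : u 0 0 = v 0 0 -> u 0 1 = v 0 1 ->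
  u 0 2 = v 0 2 -> u 0 3 = v 0 3 -> u = v.
Proof.
move=> e0 e1 e2 e3; apply/rowP => -[[|[|[|[|//]]]] i].
- by have -> : Ordinal i = 0 by exact: val_inj.
- by have -> : Ordinal i = 1 by exact: val_inj.
- by have -> : Ordinal i = 2 by exact: val_inj.
- by have -> : Ordinal i = 3 by exact: val_inj.
Qed.

Lemma vec4E (y : 'rV[R]_4) : y = vec4 (y 0 0) (y 0 1) (y 0 2) (y 0 3).
Proof. by apply: vec4_ext; rewrite mxE. Qed.

Lemma partialE (F : 'rV[R]_4 -> R) (g : R -> R) (y v : 'rV[R]_4) (x d : R) :
  (forall s, F (s *: v + y) = g (s + x)) -> is_derive x 1 g d -> 'D_v F y = d.
Proof.
move=> Fg gd; rewrite -(isd_derive1 gd) derive1E /derive.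
have E : (fun h : R => h^-1 *: ((F \o shift y) (h *: v) - F y)) =
    (fun h : R => h^-1 *: ((g \o shift x) (h *: 1) - g x)).
  apply/funext => s /=; congr (_ *: (_ - _)).
    by rewrite Fg /GRing.scale /= mulr1.
  by rewrite -[in RHS](add0r x) -Fg scale0r add0r.
by rewrite E.
Qed.

Lemma partial0 (F : 'rV[R]_4 -> R) (a b c d e : R) :
  is_derive a 1 (fun t => F (vec4 t b c d)) e ->
  'D_(delta_mx 0 0) F (vec4 a b c d) = e.
Proof.
apply: partialE => s; congr F.
by apply: vec4_ext; rewrite !mxE /= ?mulr1 ?mulr0 ?add0r.
Qed.

Lemma partial1 (F : 'rV[R]_4 -> R) (a b c d e : R) :
  is_derive b 1 (fun t => F (vec4 a t c d)) e ->
  'D_(delta_mx 0 1) F (vec4 a b c d) = e.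
Proof.
apply: partialE => s; congr F.
by apply: vec4_ext; rewrite !mxE /= ?mulr1 ?mulr0 ?add0r.
Qed.

Lemma partial2 (F : 'rV[R]_4 -> R) (a b c d e : R) :
  is_derive c 1 (fun t => F (vec4 a b t d)) e ->
  'D_(delta_mx 0 2) F (vec4 a b c d) = e.
Proof.
apply: partialE => s; congr F.
by apply: vec4_ext; rewrite !mxE /= ?mulr1 ?mulr0 ?add0r.
Qed.

Lemma partial3 (F : 'rV[R]_4 -> R) (a b c d e : R) :
  is_derive d 1 (fun t => F (vec4 a b c t)) e ->
  'D_(delta_mx 0 3) F (vec4 a b c d) = e.
Proof.
apply: partialE => s; congr F.
by apply: vec4_ext; rewrite !mxE /= ?mulr1 ?mulr0 ?add0r.
Qed.

Lemma dlocE (L : R) (G : phase -> R) (c : chart_name) (y0 y1 y2 y3 d0 d1 d2 d3 : R)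
    (F := G \o chart L c) :
  is_derive y0 1 (fun t => F (vec4 t y1 y2 y3)) d0 ->
  is_derive y1 1 (fun t => F (vec4 y0 t y2 y3)) d1 ->
  is_derive y2 1 (fun t => F (vec4 y0 y1 t y3)) d2 ->
  is_derive y3 1 (fun t => F (vec4 y0 y1 y2 t)) d3 ->
  dloc L G c (vec4 y0 y1 y2 y3) = vec4 d0 d1 d2 d3.
Proof.
move=> h0 h1 h2 h3; apply: vec4_ext; rewrite !mxE /=.
- exact: partial0.
- exact: partial1.
- exact: partial2.
- exact: partial3.
Qed.

Lemma mx4_ext (A B : 'M[R]_4) : (forall i, row i A = row i B) -> A = B.
Proof. by move=> h; apply/row_matrixP. Qed.

Lemma ord4P (P : 'I_4 -> Prop) : P 0 -> P 1 -> P 2 -> P 3 -> forall i, P i.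
Proof.
move=> e0 e1 e2 e3 [[|[|[|[|//]]]] i].
- by have -> : Ordinal i = 0 by exact: val_inj.
- by have -> : Ordinal i = 1 by exact: val_inj.
- by have -> : Ordinal i = 2 by exact: val_inj.
- by have -> : Ordinal i = 3 by exact: val_inj.
Qed.

Lemma sum4E (V : zmodType) (g : 'I_4 -> V) : \sum_i g i = g 0 + g 1 + g 2 + g 3.
Proof.
rewrite !big_ord_recl big_ord0 addr0 !addrA.
have -> : lift ord0 ord0 = 1 :> 'I_4 by exact: val_inj.
have -> : lift ord0 (lift ord0 ord0) = 2 :> 'I_4 by exact: val_inj.
by have -> : lift ord0 (lift ord0 (lift ord0 ord0)) = 3 :> 'I_4 by exact: val_inj.
Qed.

Lemma vec4_Omega (L : R) (Lam : R -> R) c y (a b u v : R) (t := twist L Lam c y) :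
  vec4 a b u v *m Omega L Lam c y = vec4 (- u) (- v) (a - t * v) (b + t * u).
Proof.
apply: vec4_ext; rewrite !mxE sum4E !mxE -/t /=; ring.
Qed.

Lemma Omega_unit (L : R) (Lam : R -> R) c y : Omega L Lam c y \in unitmx.
Proof.
set t := twist L Lam c y.
pose J : 'M[R]_4 := \matrix_(i < 4) nth (vec4 0 0 0 0)
  [:: vec4 0 t (-1) 0; vec4 (- t) 0 0 (-1); vec4 1 0 0 0; vec4 0 1 0 0] i.
suff /mulmx1_unit[] : J *m Omega L Lam c y = 1%:M by [].
apply: mx4_ext; apply: ord4P; rewrite row_mul rowK /= vec4_Omega -/t;
  apply: vec4_ext; rewrite !mxE /=; ring.
Qed.

Lemma hamvfE (L : R) (Lam : R -> R) (G : phase -> R) c y (d0 d1 d2 d3 : R)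
    (t := twist L Lam c y) :
  dloc L G c y = vec4 d0 d1 d2 d3 ->
  hamvf L Lam G c y = vec4 (- d2 + t * d1) (- d3 - t * d0) d0 d1.
Proof.
move=> dE; rewrite /hamvf dE.
have -> : - vec4 d0 d1 d2 d3 =
    vec4 (- d2 + t * d1) (- d3 - t * d0) d0 d1 *m Omega L Lam c y.
  by rewrite vec4_Omega -/t; apply: vec4_ext; rewrite !mxE /=; ring.
by rewrite mulmxK // Omega_unit.
Qed.

Lemma linearization_rows (L : R) (Lam : R -> R) G c (y0 y1 y2 y3 : R) (X : 'I_4 -> 'rV[R]_4)
    (V := hamvf L Lam G c) :
  (forall j, is_derive y0 1 (fun t => V (vec4 t y1 y2 y3) 0 j) (X 0 0 j)) ->
  (forall j, is_derive y1 1 (fun t => V (vec4 y0 t y2 y3) 0 j) (X 1 0 j)) ->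
  (forall j, is_derive y2 1 (fun t => V (vec4 y0 y1 t y3) 0 j) (X 2 0 j)) ->
  (forall j, is_derive y3 1 (fun t => V (vec4 y0 y1 y2 t) 0 j) (X 3 0 j)) ->
  linearization L Lam G c (vec4 y0 y1 y2 y3) = \matrix_i X i.
Proof.
move=> h0 h1 h2 h3; apply/matrixP => i j; rewrite !mxE; move: i; apply: ord4P.
- exact: (partial0 (h0 j)).
- exact: (partial1 (h1 j)).
- exact: (partial2 (h2 j)).
- exact: (partial3 (h3 j)).
Qed.

Lemma isd_vec4 (y : R) (p0 p1 p2 p3 : R -> R) (V : R -> 'rV[R]_4) (e0 e1 e2 e3 : R) :
  (\forall t \near y, V t = vec4 (p0 t) (p1 t) (p2 t) (p3 t)) ->
  is_derive y 1 p0 e0 -> is_derive y 1 p1 e1 -> is_derive y 1 p2 e2 ->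
  is_derive y 1 p3 e3 ->
  forall j, is_derive y 1 (fun t => V t 0 j) (vec4 e0 e1 e2 e3 0 j).
Proof.
move=> H h0 h1 h2 h3; apply: ord4P; rewrite mxE /=.
- by apply: isd_near h0; apply: filterS H => t ->; rewrite mxE.
- by apply: isd_near h1; apply: filterS H => t ->; rewrite mxE.
- by apply: isd_near h2; apply: filterS H => t ->; rewrite mxE.
- by apply: isd_near h3; apply: filterS H => t ->; rewrite mxE.
Qed.

Lemma polar (c s : R) : c ^+ 2 + s ^+ 2 = 1 -> exists phi, c = cos phi /\ s = sin phi.
Proof.
move=> e; have c1 : -1 <= c <= 1.
  by rewrite -ler_norml -(expr_le1 (n := 2)) // real_normK ?num_real // -e lerDl sqr_ge0.
have s2 : s ^+ 2 = 1 - c ^+ 2 by rewrite -e addrC addKr.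
have [s0|s0] := leP 0 s.
  exists (acos c); rewrite acosK ?in_itv //; split => //.
  by rewrite sin_acos // -s2 sqrtr_sqr ger0_norm.
exists (- acos c); rewrite cosN sinN acosK ?in_itv //; split => //.
by rewrite sin_acos // -s2 sqrtr_sqr ltr0_norm // opprK.
Qed.

End Coordinates.

Section Charts.
Context {R : realType}.
Variables (L : R) (f Lam : R -> R).
Hypotheses (L_gt0 : 0 < L) (gen : generic L f Lam).

Lemma rad0_gt0 : 0 < rad0 L.
Proof. by rewrite divr_gt0 // pi_gt0. Qed.

Lemma rad0_neq0 : rad0 L != 0.
Proof. by rewrite gt_eqF // rad0_gt0. Qed.

Lemma HK_covector (r c s pr pf : R) : 0 < r < L -> c ^+ 2 + s ^+ 2 = 1 ->
  let z := covector_at L r c s pr pf in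
  [/\ TM L z, Hfun L f z = pr ^+ 2 / 2 + pf ^+ 2 / (2 * f r ^+ 2),
      Kfun L Lam z = pf + Lam r & rcoord L z = r].
Proof.
move=> hr /polar[phi [-> ->]] z.
have [h1 h2 h3] := HK_point f Lam L_gt0 phi pr pf hr.
split => //; apply: rcoord_point => //; by case/andP: hr => a b; rewrite !ltW.
Qed.

Lemma north_neq_south : northM L <> southM L :> 'rV[R]_3.
Proof.
move=> /(congr1 (fun M : 'rV[R]_3 => M 0 2)); rewrite !mxE /= => e.
by have h := rad0_gt0; lra.
Qed.

Lemma rcoord_north (p : 'rV[R]_3) : rcoord L (northM L, p) = 0.
Proof. by rewrite /rcoord /= mxE /= divff ?rad0_neq0 // acos1 mulr0. Qed.

Lemma rcoord_south (p : 'rV[R]_3) : rcoord L (southM L, p) = L.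
Proof.
rewrite /rcoord /= mxE /= mulNr divff ?rad0_neq0 // acosN1 /rad0.
by rewrite divfK // gt_eqF // pi_gt0.
Qed.

Lemma pole_HK (M : 'rV[R]_3) (q0 q1 : R) : M = northM L \/ M = southM L ->
  let z := (M, row3 q0 q1 0) in
  [/\ TM L z, Hfun L f z = (q0 ^+ 2 + q1 ^+ 2) / 2,
      Kfun L Lam z = Lam (rcoord L z) & p_phi z = 0].
Proof.
move=> hM; have [M0 M1 M2] : [/\ M 0 0 = 0, M 0 1 = 0 & M 0 2 ^+ 2 = rad0 L ^+ 2].
  by case: hM => ->; rewrite !mxE /= ?sqrrN.
have p0 : p_phi (M, row3 q0 q1 0) = 0 by rewrite /p_phi /= M0 M1 !mul0r subrr.
split => //.
- rewrite /TM /= !dot3E M0 M1 !mul0r !add0r -expr2 M2; split => //.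
  by rewrite !mxE /= mulr0.
- rewrite /Hfun /= (_ : (_ || _) = true); last by case: hM => ->; rewrite eqxx ?orbT.
  by rewrite dot3E !mxE /= mul0r addr0 -!expr2.
- by rewrite /Kfun p0 add0r.
Qed.

Lemma near_cyl (r : R) : 0 < r < L -> \forall t \near r, 0 < t < L.
Proof. exact: near_itv. Qed.

Lemma Hcyl (p q r phi : R) : 0 < r < L ->
  Hfun L f (chart L Cyl (vec4 p q r phi)) = p ^+ 2 / 2 + q ^+ 2 / (2 * f r ^+ 2).
Proof.
move=> hr; rewrite /chart !mxE /=.
by have [] := HK_covector p q hr (cos2Dsin2 phi).
Qed.

Lemma Kcyl (p q r phi : R) : 0 < r < L ->
  Kfun L Lam (chart L Cyl (vec4 p q r phi)) = q + Lam r.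
Proof.
move=> hr; rewrite /chart !mxE /=.
by have [] := HK_covector p q hr (cos2Dsin2 phi).
Qed.

Local Notation f1 := (f^`()).
Local Notation f2 := (f^`(2)).
Local Notation l1 := (Lam^`()).
Local Notation l2 := (Lam^`(2)).

(** The combination is treated at once because the operator at a rank-1 point is the linearization
    of such a combination; H and K are the cases (1, 0) and (0, 1). *)
Lemma dloc_cyl (al be p q r phi : R) : 0 < r < L ->
  dloc L (fun z => al * Hfun L f z + be * Kfun L Lam z) Cyl (vec4 p q r phi) =
  vec4 (al * p) (al * (q / f r ^+ 2) + be)
    (al * - (q ^+ 2 * f1 r / f r ^+ 3) + be * l1 r) 0.
Proof.
move=> hr; have f0 := f_neq0 gen hr.
have E (u v t psi : R) : 0 < t < L ->
  ((fun z => al * Hfun L f z + be * Kfun L Lam z) \o chart L Cyl) (vec4 u v t psi)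
  = al * (u ^+ 2 / 2 + v ^+ 2 / (2 * f t ^+ 2)) + be * (v + Lam t).
  by move=> h /=; rewrite Hcyl // Kcyl.
apply: dlocE.
- apply: (@isd_near _ _ (fun t => al * (t ^+ 2 / 2 + q ^+ 2 / (2 * f r ^+ 2))
    + be * (q + Lam r))); first by apply: near_all => t; rewrite E.
  apply: (is_derive_eq (isdD (isdcM al (isdD (isdMc 2^-1 (isdX 1 (isd_id p)))
    (isd_cst _ p))) (isd_cst _ p))).
  by rewrite expr1; field.
- apply: (@isd_near _ _ (fun t => al * (p ^+ 2 / 2 + t ^+ 2 / (2 * f r ^+ 2))
    + be * (t + Lam r))); first by apply: near_all => t; rewrite E.
  apply: (is_derive_eq (isdD (isdcM al (isdD (isd_cst _ q)
    (isdMc (2 * f r ^+ 2)^-1 (isdX 1 (isd_id q)))))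
    (isdcM be (isdD (isd_id q) (isd_cst _ q))))).
  by rewrite expr1; field.
- apply: (@isd_near _ _ (fun t => al * (p ^+ 2 / 2 + q ^+ 2 / 2 * (f t ^+ 2)^-1)
    + be * (q + Lam t))).
    by apply: filterS (near_cyl hr) => t ht; rewrite E // invfM !mulrA.
  apply: (is_derive_eq (isdD (isdcM al (isdD (isd_cst _ r)
    (isdcM (q ^+ 2 / 2) (isd_invX 1 f0 (isd_f gen r)))))
    (isdcM be (isdD (isd_cst _ r) (isd_l gen r))))).
  by jfield.
- have H : \forall t \near phi,
      ((fun z => al * Hfun L f z + be * Kfun L Lam z) \o chart L Cyl) (vec4 p q r t)
      = al * (p ^+ 2 / 2 + q ^+ 2 / (2 * f r ^+ 2)) + be * (q + Lam r).
    by apply: near_all => t; rewrite E.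
  exact: isd_near H (isd_cst _ phi).
Qed.

Lemma combination_H : (fun z => 1 * Hfun L f z + 0 * Kfun L Lam z) = Hfun L f.
Proof. by apply/funext => z; rewrite mul1r mul0r addr0. Qed.

Lemma combination_K : (fun z => 0 * Hfun L f z + 1 * Kfun L Lam z) = Kfun L Lam.
Proof. by apply/funext => z; rewrite mul1r mul0r add0r. Qed.

Lemma dlocH_cyl (p q r phi : R) : 0 < r < L ->
  dloc L (Hfun L f) Cyl (vec4 p q r phi) =
  vec4 p (q / f r ^+ 2) (- (q ^+ 2 * f1 r / f r ^+ 3)) 0.
Proof.
by move=> hr; rewrite -combination_H dloc_cyl // !mul1r mul0r !addr0.
Qed.

Lemma dlocK_cyl (p q r phi : R) : 0 < r < L ->
  dloc L (Kfun L Lam) Cyl (vec4 p q r phi) = vec4 0 1 (l1 r) 0.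
Proof.
by move=> hr; rewrite -combination_K dloc_cyl // !mul0r mul1r !add0r.
Qed.

Lemma hamvf_cyl (al be p q r phi : R) : 0 < r < L ->
  hamvf L Lam (fun z => al * Hfun L f z + be * Kfun L Lam z) Cyl (vec4 p q r phi) =
  vec4 (al * (q ^+ 2 * f1 r / f r ^+ 3) + al * l1 r * (q / f r ^+ 2))
    (- (al * l1 r * p)) (al * p) (al * (q / f r ^+ 2) + be).
Proof.
move=> hr; rewrite (hamvfE Lam (dloc_cyl al be p q phi hr)) /= mxE /=.
by congr vec4; jring.
Qed.

(** It is computed at p_r = 0 only, which holds on all critical circles. The last row vanishes
    because phi is a cyclic coordinate. *)
Lemma linearization_cyl (al be q r phi : R) : 0 < r < L ->
  linearization L Lam (fun z => al * Hfun L f z + be * Kfun L Lam z) Cyl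
    (vec4 0 q r phi) =
  \matrix_(i < 4) nth (vec4 0 0 0 0)
   [:: vec4 0 (- (al * l1 r)) al 0;
       vec4 (2 * al * q * f1 r / f r ^+ 3 + al * l1 r / f r ^+ 2) 0 0 (al / f r ^+ 2);
       vec4 (al * q ^+ 2 * (f2 r / f r ^+ 3 - 3 * f1 r ^+ 2 / f r ^+ 4)
             + al * q * (l2 r / f r ^+ 2 - 2 * l1 r * f1 r / f r ^+ 3)) 0 0
            (- 2 * al * q * f1 r / f r ^+ 3);
       vec4 0 0 0 0] i.
Proof.
move=> hr; have f0 := f_neq0 gen hr.
apply: (linearization_rows (X := fun i : 'I_4 => nth _ _ i)) => /=.
- apply: (isd_vec4 (near_all 0 (fun t => hamvf_cyl al be t q phi hr))
    (isd_cst _ _) _ _ (isd_cst _ _)).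
  + by apply: (is_derive_eq (isdN (isdcM (al * l1 r) (isd_id 0)))); rewrite mulr1.
  + by apply: (is_derive_eq (isdcM al (isd_id 0))); rewrite mulr1.
- apply: (isd_vec4 (near_all q (fun t => hamvf_cyl al be 0 t phi hr))
    _ _ (isd_cst _ _) _).
  + apply: (is_derive_eq (isdD (isdcM al (isdMc (f r ^+ 3)^-1
      (isdMc (f1 r) (isdX 1 (isd_id q)))))
      (isdcM (al * l1 r) (isdMc (f r ^+ 2)^-1 (isd_id q))))).
    by rewrite expr1; jfield.
  + apply: (is_derive_eq (isdD (isdcM al (isdMc (f r ^+ 2)^-1 (isd_id q)))
      (isd_cst be q))).
    by jfield.
- apply: (isd_vec4 (filterS (fun t => hamvf_cyl al be 0 q phi) (near_cyl hr))
    _ _ (isd_cst _ _) _).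
  + apply: (is_derive_eq (isdD (isdcM al (isdM (isdcM (q ^+ 2) (isd_f1 gen r))
        (isd_invX 2 f0 (isd_f gen r))))
      (isdM (isdcM al (isd_l1 gen r)) (isdcM q (isd_invX 1 f0 (isd_f gen r)))))).
    by rewrite -[f1^`() r]/(f2 r) -[l1^`() r]/(l2 r); jfield.
  + apply: (is_derive_eq (isdN (isdMc 0 (isdcM al (isd_l1 gen r))))).
    by rewrite mulr0 oppr0.
  + apply: (is_derive_eq (isdD (isdcM al (isdcM q (isd_invX 1 f0 (isd_f gen r))))
      (isd_cst be r))).
    by jfield.
- exact: (isd_vec4 (near_all phi (fun t => hamvf_cyl al be 0 q t hr))
    (isd_cst _ _) (isd_cst _ _) (isd_cst _ _) (isd_cst _ _)).
Qed.

End Charts.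

(** * H and K along the axes of a pole chart *)

Section PoleFunctions.
Context {R : realType}.

Definition q_rho (y : 'rV[R]_4) := (y 0 0 * y 0 2 + y 0 1 * y 0 3) / rho y.
Definition q_phi (y : 'rV[R]_4) := y 0 2 * y 0 1 - y 0 3 * y 0 0.

(** The profile g stands for f at N and for f(L - t) at S, so that both poles share one computation;
    l plays the same part for Lam in [Kpole]. *)
Definition Hpole (g : R -> R) (y : 'rV[R]_4) :=
  if rho y == 0 then (y 0 0 ^+ 2 + y 0 1 ^+ 2) / 2
  else q_rho y ^+ 2 / 2 + q_phi y ^+ 2 / (2 * g (rho y) ^+ 2).

Definition Kpole (l : R -> R) (y : 'rV[R]_4) := q_phi y + l (rho y).

Lemma rho0 (a b : R) : rho (vec4 a b 0 0) = 0.
Proof. by rewrite /rho !mxE /= expr0n addr0 sqrtr0. Qed.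

Lemma rho_u (a b u : R) : rho (vec4 a b u 0) = `|u|.
Proof. by rewrite /rho !mxE /= [0 ^+ 2]expr0n addr0 sqrtr_sqr. Qed.

Lemma rho_v (a b v : R) : rho (vec4 a b 0 v) = `|v|.
Proof. by rewrite /rho !mxE /= [0 ^+ 2]expr0n add0r sqrtr_sqr. Qed.

Lemma rho_uv (a b u v : R) : rho (vec4 a b u v) = Num.sqrt (u ^+ 2 + v ^+ 2).
Proof. by rewrite /rho !mxE. Qed.

Lemma rho_neq0 (y : 'rV[R]_4) : rho y != 0 ->
  (y 0 2 / rho y) ^+ 2 + (y 0 3 / rho y) ^+ 2 = 1.
Proof.
move=> r0; rewrite !expr_div_n -mulrDl.
have -> : rho y ^+ 2 = y 0 2 ^+ 2 + y 0 3 ^+ 2.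
  by rewrite /rho sqr_sqrtr // addr_ge0 ?sqr_ge0.
rewrite divff //; apply: contraNN r0 => /eqP e; by rewrite /rho e sqrtr0.
Qed.

Lemma rho_ge0 (y : 'rV[R]_4) : 0 <= rho y.
Proof. exact: sqrtr_ge0. Qed.

Lemma rho_gt0 (y : 'rV[R]_4) : rho y != 0 -> 0 < rho y.
Proof. by move=> r0; rewrite lt_neqAle eq_sym r0 rho_ge0. Qed.

End PoleFunctions.

Section AbstractPole.
Context {R : realType}.
Variables (g g1 g2 l l1 : R -> R).
Hypotheses (gd : forall t : R, is_derive t 1 g (g1 t))
  (g1d : forall t : R, is_derive t 1 g1 (g2 t))
  (ld : forall t : R, is_derive t 1 l (l1 t))
  (g_odd : forall t, g (- t) = - g t) (l_even : forall t, l (- t) = l t)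
  (l1_odd : forall t, l1 (- t) = - l1 t)
  (g0 : g 0 = 0) (g10 : g1 0 = 1) (g20 : g2 0 = 0) (l10 : l1 0 = 0).

Lemma l_norm t : l `|t| = l t.
Proof.
by have [t0|t0] := leP 0 t; [rewrite ger0_norm | rewrite ltr0_norm // l_even].
Qed.

Lemma g_norm t : g `|t| ^+ 2 = g t ^+ 2.
Proof.
by have [t0|t0] := leP 0 t; [rewrite ger0_norm | rewrite ltr0_norm // g_odd sqrrN].
Qed.

(* [g t = t + o(t^2)], so [(t / g t)^2 - 1 = o(t)]. *)
Definition sq_ratio t := if t == 0 then 1 else t ^+ 2 / g t ^+ 2.

(** The functions e t^2 + s (t - g t) with s = 1 and s = -1 vanish at 0 together with their first
    derivatives, and have second derivative 2 e > 0 there because g''(0) = 0. *)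
Lemma g_defect e : 0 < e -> \forall t \near 0^', `|t - g t| < e * t ^+ 2.
Proof.
move=> e0.
have dpos (s : R) : \forall t \near 0^', 0 < (2 * e) * (e * t ^+ 2 + s * (t - g t)).
  have d1 : \forall t \near (0 : R), is_derive (t : R) 1
      (fun t => e * t ^+ 2 + s * (t - g t)) (2 * e * t + s * (1 - g1 t)).
    apply: near_all => t.
    apply: (is_derive_eq (isdD (isdcM e (isdX 1 (isd_id t)))
      (isdcM s (isdD (isd_id t) (isdN (gd t)))))).
    by rewrite expr1; ring.
  have d2 : is_derive (0 : R) 1 (fun t => 2 * e * t + s * (1 - g1 t)) (2 * e).
    apply: (is_derive_eq (isdD (isdcM (2 * e) (isd_id 0))
      (isdcM s (isdD (isd_cst 1 0) (isdN (g1d 0)))))).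
    by rewrite g20; ring.
  apply: isd_near_sign2 d1 d2 _ _ _.
  - by rewrite g0 subrr mulr0 addr0 expr0n mulr0.
  - by rewrite g10 subrr !mulr0 addr0.
  - by rewrite mulf_neq0 // gt_eqF.
have e2 : 0 < 2 * e by rewrite mulr_gt0.
apply: filterS2 (dpos 1) (dpos (-1)) => t; rewrite !pmulr_rgt0 // => h1 h2.
by rewrite ltr_norml; apply/andP; split; lra.
Qed.

Lemma g_slope : g t / t @[t --> 0^'] --> (1 : R).
Proof.
have := isd_slope (gd 0); rewrite g10 g0.
by under eq_fun do rewrite !subr0.
Qed.

Lemma isd_of_slope (F : R -> R) (x d : R) :
  (F t - F x) / (t - x) @[t --> x^'] --> d -> is_derive x 1 F d.
Proof.
move=> H.
have H' : h^-1 *: ((F \o shift x) (h *: (1 : R)) - F x) @[h --> 0^'] --> d.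
  apply/cvgrPdist_lt => e e0; move/cvgrPdist_lt: H => /(_ e e0).
  rewrite /= !near_withinE => /nbhs_ballP[d0 /= d00 H0].
  apply/nbhs_ballP; exists d0 => // h hx hn.
  have := H0 (h + x); rewrite /ball /= opprD addrCA subrr addr0 normrN.
  rewrite /ball /= sub0r normrN in hx.
  move=> /(_ hx); rewrite addrK => H1.
  rewrite /GRing.scale /= mulr1 mulrC; apply: H1.
  by rewrite -subr_eq0 addrK.
apply: DeriveDef; first by apply/cvg_ex; exists d.
exact: cvg_lim.
Qed.

(** The slope at 0 factors as ((t - g) / t^2) * (1 + g / t) * (g / t)^-2, and the three factors tend
    to 0, 2 and 1. *)
Lemma isd_sq_ratio : is_derive (0 : R) 1 sq_ratio 0.
Proof.
apply: isd_of_slope.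
have c1 : (t - g t) / t ^+ 2 @[t --> 0^'] --> (0 : R).
  apply/cvgrPdist_lt => e e0; apply: filterS2 (g_defect e0) (nbhs_dnbhs_neq (0 : R)) => t h tn.
  have t2 : 0 < t ^+ 2 by rewrite exprn_even_gt0.
  by rewrite sub0r normrN normrM normfV (gtr0_norm t2) ltr_pdivrMr.
have c2 := g_slope.
have c3 : (g t / t)^-1 @[t --> 0^'] --> (1 : R)^-1.
  by apply: cvgV => //; rewrite oner_eq0.
have H : ((t - g t) / t ^+ 2) * (1 + g t / t) * ((g t / t)^-1 * (g t / t)^-1) @[t --> 0^']
   --> (0 * (1 + 1) * (1^-1 * 1^-1) : R).
  apply: cvgM; last exact: cvgM.
  by apply: cvgM => //; apply: cvgD => //; exact: cvg_cst.
rewrite !mul0r in H; apply: cvg_trans H; apply: near_eq_cvg.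
have gn : \forall t \near 0^', g t != 0.
  have := isd_near_sign (gd 0) g0; rewrite g10 oner_eq0 => /(_ isT).
  by apply: filterS => t; apply: neq0_mul_gt0.
apply: filterS2 gn (nbhs_dnbhs_neq (0 : R)) => t gt tn.
rewrite /sq_ratio (negbTE tn) eqxx subr0.
by field; rewrite gt tn.
Qed.

Lemma sq_ratioE (u c : R) : u != 0 -> u ^+ 2 * c / (2 * g u ^+ 2) = c / 2 * sq_ratio u.
Proof.
by move=> u0; rewrite /sq_ratio (negbTE u0) invfM; move: (g u ^+ 2)^-1 => w; field.
Qed.

(** Only restrictions to the position axes are computed: the differential and the linearization at a
    pole use partial derivatives along coordinate lines, so a formula off the axes is avoided. *)
Lemma Hpole_u (q0 q1 u : R) : Hpole g (vec4 q0 q1 u 0) =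
  q0 ^+ 2 / 2 + q1 ^+ 2 / 2 * sq_ratio u.
Proof.
rewrite /Hpole rho_u normr_eq0; have [->|u0] := eqVneq u 0.
  by rewrite !mxE /= /sq_ratio eqxx mulr1 mulrDl.
rewrite g_norm /q_rho /q_phi rho_u !mxE /= !mulr0 mul0r subr0 addr0.
rewrite expr_div_n real_normK ?num_real // !exprMn mulfK ?expf_neq0 //.
by rewrite sq_ratioE.
Qed.

Lemma Hpole_v (q0 q1 v : R) : Hpole g (vec4 q0 q1 0 v) =
  q1 ^+ 2 / 2 + q0 ^+ 2 / 2 * sq_ratio v.
Proof.
rewrite /Hpole rho_v normr_eq0; have [->|v0] := eqVneq v 0.
  by rewrite !mxE /= /sq_ratio eqxx mulr1 mulrDl addrC.
rewrite g_norm /q_rho /q_phi rho_v !mxE /= !mulr0 !mul0r add0r sub0r sqrrN.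
rewrite expr_div_n real_normK ?num_real // !exprMn mulfK ?expf_neq0 //.
by rewrite sq_ratioE.
Qed.

Lemma Hpole_zero (u v : R) : Hpole g (vec4 0 0 u v) = 0.
Proof.
rewrite /Hpole /q_rho /q_phi !mxE /= !mul0r !mulr0 subrr addr0 !expr0n /= !mul0r.
by case: ifP => _; rewrite ?expr0n /= ?addr0 ?mul0r.
Qed.

Lemma Kpole_u (q0 q1 u : R) : Kpole l (vec4 q0 q1 u 0) = u * q1 + l u.
Proof. by rewrite /Kpole rho_u l_norm /q_phi !mxE /= mul0r subr0. Qed.

Lemma Kpole_v (q0 q1 v : R) : Kpole l (vec4 q0 q1 0 v) = - (v * q0) + l v.
Proof. by rewrite /Kpole rho_v l_norm /q_phi !mxE /= mul0r sub0r. Qed.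

Variables (L : R) (G : phase (R := R) -> R) (c : chart_name).
Hypothesis (L_gt0 : 0 < L).

Lemma isd_near_small (F F' : R -> R) (x d : R) :
  `|x| < L -> (forall t, `|t| < L -> F t = F' t) ->
  is_derive x 1 F' d -> is_derive x 1 F d.
Proof.
move=> xL FF; apply: isd_near.
have : x \in `]-L, L[ by rewrite in_itv /= -ltr_norml.
by move=> /near_in_itvoo; apply: filterS => t; rewrite in_itv /= -ltr_norml; exact: FF.
Qed.

Lemma isd_l_sqrt (s : R) : s != 0 ->
  is_derive (0 : R) 1 (fun t => l (Num.sqrt (s ^+ 2 + t ^+ 2))) 0.
Proof.
move=> s0; have p : 0 < s ^+ 2 + 0 ^+ 2 by rewrite [0 ^+ 2]expr0n addr0 exprn_even_gt0.
have d1 := isdD (isd_cst (s ^+ 2) 0) (isdX 1 (isd_id (0 : R))).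
have d2 := isd_comp d1 (is_derive1_sqrt p).
apply: (is_derive_eq (isd_comp d2 (ld _))).
by rewrite expr1 mulr0 mul0r addr0 !mulr0.
Qed.

Lemma small0 : `|0 : R| < L. Proof. by rewrite normr0. Qed.

Section DlocH.
Hypothesis GE : forall y, rho y < L -> G (chart L c y) = Hpole g y.

Lemma dlocH_pole (q0 q1 : R) : dloc L G c (vec4 q0 q1 0 0) = vec4 q0 q1 0 0.
Proof.
have E a b : G (chart L c (vec4 a b 0 0)) = (a ^+ 2 + b ^+ 2) / 2.
  by rewrite GE ?rho0 // Hpole_u /sq_ratio eqxx mulr1 mulrDl.
apply: dlocE.
- apply: (isd_near (near_all q0 (fun t => E t q1))).
  apply: (is_derive_eq (isdMc 2^-1 (isdD (isdX 1 (isd_id q0)) (isd_cst _ q0)))).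
  by rewrite expr1; field.
- apply: (isd_near (near_all q1 (E q0))).
  apply: (is_derive_eq (isdMc 2^-1 (isdD (isd_cst _ q1) (isdX 1 (isd_id q1))))).
  by rewrite expr1; field.
- apply: (isd_near_small small0 (F' := fun u => q0 ^+ 2 / 2 + q1 ^+ 2 / 2 * sq_ratio u)).
    by move=> t tL; rewrite /= GE ?rho_u // Hpole_u.
  apply: (is_derive_eq (isdD (isd_cst _ 0) (isdcM (q1 ^+ 2 / 2) isd_sq_ratio))).
  by rewrite mulr0 addr0.
- apply: (isd_near_small small0 (F' := fun u => q1 ^+ 2 / 2 + q0 ^+ 2 / 2 * sq_ratio u)).
    by move=> t tL; rewrite /= GE ?rho_v // Hpole_v.
  apply: (is_derive_eq (isdD (isd_cst _ 0) (isdcM (q0 ^+ 2 / 2) isd_sq_ratio))).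
  by rewrite mulr0 addr0.
Qed.

Lemma near_rho_u (u : R) : `|u| < L -> \forall t \near (0 : R), Num.sqrt (u ^+ 2 + t ^+ 2) < L.
Proof.
move=> uL; have c1 : Num.sqrt (u ^+ 2 + t ^+ 2) @[t --> (0 : R)] --> Num.sqrt (u ^+ 2 + 0 ^+ 2).
  apply: continuous_comp; last exact: sqrt_continuous.
  by apply: cvgD; [exact: cvg_cst | apply: cvgM].
rewrite expr0n addr0 sqrtr_sqr in c1.
exact: (cvgr_lt _ c1).
Qed.

(** H is quadratic in the momenta, so its differential vanishes on the zero section. Points of the
    axis other than the pole are needed because the linearization differentiates the Hamiltonian
    field along u. *)
Lemma dlocH_u (u : R) : `|u| < L -> dloc L G c (vec4 0 0 u 0) = vec4 0 0 0 0.
Proof.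
move=> uL; apply: dlocE.
- have E t : G (chart L c (vec4 t 0 u 0)) = t ^+ 2 / 2.
    by rewrite GE ?rho_u // Hpole_u expr0n !mul0r addr0.
  apply: (isd_near (near_all 0 E)).
  apply: (is_derive_eq (isdMc 2^-1 (isdX 1 (isd_id (0 : R))))).
  by rewrite expr1 mulr0 !mul0r.
- have E t : G (chart L c (vec4 0 t u 0)) = t ^+ 2 * (2^-1 * sq_ratio u).
    by rewrite GE ?rho_u // Hpole_u expr0n !mul0r add0r mulrA.
  apply: (isd_near (near_all 0 E)).
  apply: (is_derive_eq (isdMc (2^-1 * sq_ratio u) (isdX 1 (isd_id (0 : R))))).
  by rewrite expr1 mulr0 !mul0r.
- apply: (isd_near _ (isd_cst 0 u)); near=> t.
  rewrite /= GE ?Hpole_zero // rho_u; near: t.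
  by apply: (cvgr_lt `|u|) => //; apply: cvg_norm.
- apply: (isd_near _ (isd_cst 0 0)); near=> t.
  by rewrite /= GE ?Hpole_zero // rho_uv; near: t; exact: near_rho_u.
Unshelve. all: end_near. Qed.

Lemma dlocH_v (u : R) : `|u| < L -> dloc L G c (vec4 0 0 0 u) = vec4 0 0 0 0.
Proof.
move=> uL; apply: dlocE.
- have E t : G (chart L c (vec4 t 0 0 u)) = t ^+ 2 * (2^-1 * sq_ratio u).
    by rewrite GE ?rho_v // Hpole_v expr0n !mul0r add0r mulrA.
  apply: (isd_near (near_all 0 E)).
  apply: (is_derive_eq (isdMc (2^-1 * sq_ratio u) (isdX 1 (isd_id (0 : R))))).
  by rewrite expr1 mulr0 !mul0r.
- have E t : G (chart L c (vec4 0 t 0 u)) = t ^+ 2 / 2.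
    by rewrite GE ?rho_v // Hpole_v expr0n !mul0r addr0.
  apply: (isd_near (near_all 0 E)).
  apply: (is_derive_eq (isdMc 2^-1 (isdX 1 (isd_id (0 : R))))).
  by rewrite expr1 mulr0 !mul0r.
- apply: (isd_near _ (isd_cst 0 0)); near=> t.
  by rewrite /= GE ?Hpole_zero // rho_uv addrC; near: t; exact: near_rho_u.
- apply: (isd_near _ (isd_cst 0 u)); near=> t.
  rewrite /= GE ?Hpole_zero // rho_v; near: t.
  by apply: (cvgr_lt `|u|) => //; apply: cvg_norm.
Unshelve. all: end_near. Qed.

End DlocH.

Section DlocK.
Hypothesis GE : forall y, rho y < L -> G (chart L c y) = Kpole l y.

Lemma dlocK_pole (q0 q1 : R) : dloc L G c (vec4 q0 q1 0 0) = vec4 0 0 q1 (- q0).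
Proof.
have E a b : G (chart L c (vec4 a b 0 0)) = l 0.
  by rewrite GE ?rho0 // Kpole_u mul0r add0r.
apply: dlocE.
- exact: (isd_near (near_all q0 (fun t => E t q1)) (isd_cst _ _)).
- exact: (isd_near (near_all q1 (E q0)) (isd_cst _ _)).
- apply: (isd_near_small small0 (F' := fun u => u * q1 + l u)).
    by move=> t tL; rewrite /= GE ?rho_u // Kpole_u.
  apply: (is_derive_eq (isdD (isdMc q1 (isd_id 0)) (ld 0))).
  by rewrite l10 mul1r addr0.
- apply: (isd_near_small small0 (F' := fun u => - (u * q0) + l u)).
    by move=> t tL; rewrite /= GE ?rho_v // Kpole_v.
  apply: (is_derive_eq (isdD (isdN (isdMc q0 (isd_id 0))) (ld 0))).
  by rewrite l10 mul1r addr0.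
Qed.

Lemma dlocK_u (u : R) : `|u| < L -> dloc L G c (vec4 0 0 u 0) = vec4 0 u (l1 u) 0.
Proof.
move=> uL; have [u0|u0] := eqVneq u 0.
  by rewrite u0 dlocK_pole l10 oppr0.
have E a b : G (chart L c (vec4 a b u 0)) = u * b + l u.
  by rewrite GE ?rho_u // Kpole_u.
apply: dlocE.
- exact: (isd_near (near_all 0 (fun t => E t 0)) (isd_cst _ _)).
- apply: (isd_near (near_all 0 (E 0))).
  by apply: (is_derive_eq (isdD (isdcM u (isd_id 0)) (isd_cst (l u) 0))); rewrite mulr1 addr0.
- apply: (isd_near_small uL _ (ld u)).
  by move=> t tL; rewrite /= GE ?rho_u // Kpole_u mulr0 add0r.
- apply: (isd_near _ (isd_l_sqrt u0)); near=> t.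
  have h : Num.sqrt (u ^+ 2 + t ^+ 2) < L by near: t; exact: near_rho_u.
  by rewrite /= GE ?rho_uv // /Kpole rho_uv /q_phi !mxE /= !mulr0 subrr add0r.
Unshelve. all: end_near. Qed.

Lemma dlocK_v (u : R) : `|u| < L -> dloc L G c (vec4 0 0 0 u) = vec4 (- u) 0 0 (l1 u).
Proof.
move=> uL; have [u0|u0] := eqVneq u 0.
  by rewrite u0 dlocK_pole l10 oppr0.
have E a b : G (chart L c (vec4 a b 0 u)) = - (u * a) + l u.
  by rewrite GE ?rho_v // Kpole_v.
apply: dlocE.
- apply: (isd_near (near_all 0 (fun t => E t 0))).
  apply: (is_derive_eq (isdD (isdN (isdcM u (isd_id 0))) (isd_cst (l u) 0))).
  by rewrite mulr1 addr0.
- exact: (isd_near (near_all 0 (E 0)) (isd_cst _ _)).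
- apply: (isd_near _ (isd_l_sqrt u0)); near=> t.
  have h : Num.sqrt (u ^+ 2 + t ^+ 2) < L by near: t; exact: near_rho_u.
  have hr : rho (vec4 0 0 t u) = Num.sqrt (u ^+ 2 + t ^+ 2) by rewrite rho_uv addrC.
  by rewrite /= GE ?hr // /Kpole hr /q_phi !mxE /= !mulr0 subrr add0r.
- apply: (isd_near_small uL _ (ld u)).
  by move=> t tL; rewrite /= GE ?rho_v // Kpole_v mulr0 oppr0 add0r.
Unshelve. all: end_near. Qed.

End DlocK.

End AbstractPole.

(** * Non-degeneracy of the poles *)

Section ExplicitMatrices.
Context {R : realType}.

(** Sixteen explicit entries turn matrix identities into scalar ones, within reach of [ring] and
    [lra]. *)
Definition mx16 (a00 a01 a02 a03 a10 a11 a12 a13 a20 a21 a22 a23 a30 a31 a32 a33 : R) : 'M[R]_4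
    := \matrix_(i < 4) nth 0
  [:: vec4 a00 a01 a02 a03; vec4 a10 a11 a12 a13;
      vec4 a20 a21 a22 a23; vec4 a30 a31 a32 a33] i.

Lemma mx16_eta (M : 'M[R]_4) : M = mx16 (M 0 0) (M 0 1) (M 0 2) (M 0 3) (M 1 0) (M 1 1) (M 1 2)
    (M 1 3) (M 2 0) (M 2 1) (M 2 2) (M 2 3) (M 3 0) (M 3 1) (M 3 2) (M 3 3).
Proof. by apply/matrixP; apply: ord4P; apply: ord4P; rewrite !mxE. Qed.

Lemma mx16D a00 a01 a02 a03 a10 a11 a12 a13 a20 a21 a22 a23 a30 a31 a32 a33 b00 b01 b02 b03 b10
    b11 b12 b13 b20 b21 b22 b23 b30 b31 b32 b33 : mx16 a00 a01 a02 a03 a10 a11 a12 a13 a20 a21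
    a22 a23 a30 a31 a32 a33 + mx16 b00 b01 b02 b03 b10 b11 b12 b13 b20 b21 b22 b23 b30 b31 b32 b33 =
  mx16 (a00 + b00) (a01 + b01) (a02 + b02) (a03 + b03) (a10 + b10) (a11 + b11) (a12 + b12) (a13 +
      b13) (a20 + b20) (a21 + b21) (a22 + b22) (a23 + b23) (a30 + b30) (a31 + b31) (a32 + b32)
      (a33 + b33).
Proof. by apply/matrixP; apply: ord4P; apply: ord4P; rewrite !mxE. Qed.

Lemma mx16N a00 a01 a02 a03 a10 a11 a12 a13 a20 a21 a22 a23 a30 a31 a32 a33 : - mx16 a00 a01 a02
    a03 a10 a11 a12 a13 a20 a21 a22 a23 a30 a31 a32 a33 =
  mx16 (- a00) (- a01) (- a02) (- a03) (- a10) (- a11) (- a12) (- a13) (- a20) (- a21) (- a22) (-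
      a23) (- a30) (- a31) (- a32) (- a33).
Proof. by apply/matrixP; apply: ord4P; apply: ord4P; rewrite !mxE. Qed.

Lemma mx16Z s a00 a01 a02 a03 a10 a11 a12 a13 a20 a21 a22 a23 a30 a31 a32 a33 : s *: mx16 a00 a01
    a02 a03 a10 a11 a12 a13 a20 a21 a22 a23 a30 a31 a32 a33 =
  mx16 (s * a00) (s * a01) (s * a02) (s * a03) (s * a10) (s * a11) (s * a12) (s * a13) (s * a20)
      (s * a21) (s * a22) (s * a23) (s * a30) (s * a31) (s * a32) (s * a33).
Proof. by apply/matrixP; apply: ord4P; apply: ord4P; rewrite !mxE. Qed.

Lemma mx16T a00 a01 a02 a03 a10 a11 a12 a13 a20 a21 a22 a23 a30 a31 a32 a33 : (mx16 a00 a01 a02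
    a03 a10 a11 a12 a13 a20 a21 a22 a23 a30 a31 a32 a33)^T =
  mx16 a00 a10 a20 a30 a01 a11 a21 a31 a02 a12 a22 a32 a03 a13 a23 a33.
Proof. by apply/matrixP; apply: ord4P; apply: ord4P; rewrite !mxE. Qed.

Lemma mx16M a00 a01 a02 a03 a10 a11 a12 a13 a20 a21 a22 a23 a30 a31 a32 a33
    b00 b01 b02 b03 b10 b11 b12 b13 b20 b21 b22 b23 b30 b31 b32 b33 :
  mx16 a00 a01 a02 a03 a10 a11 a12 a13 a20 a21 a22 a23 a30 a31 a32 a33 *m
  mx16 b00 b01 b02 b03 b10 b11 b12 b13 b20 b21 b22 b23 b30 b31 b32 b33 = mx16
    (a00 * b00 + a01 * b10 + a02 * b20 + a03 * b30) (a00 * b01 + a01 * b11 + a02 * b21 + a03 *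
        b31) (a00 * b02 + a01 * b12 + a02 * b22 + a03 * b32) (a00 * b03 + a01 * b13 + a02 * b23 +
        a03 * b33)
    (a10 * b00 + a11 * b10 + a12 * b20 + a13 * b30) (a10 * b01 + a11 * b11 + a12 * b21 + a13 *
        b31) (a10 * b02 + a11 * b12 + a12 * b22 + a13 * b32) (a10 * b03 + a11 * b13 + a12 * b23 +
        a13 * b33)
    (a20 * b00 + a21 * b10 + a22 * b20 + a23 * b30) (a20 * b01 + a21 * b11 + a22 * b21 + a23 *
        b31) (a20 * b02 + a21 * b12 + a22 * b22 + a23 * b32) (a20 * b03 + a21 * b13 + a22 * b23 +
        a23 * b33)
    (a30 * b00 + a31 * b10 + a32 * b20 + a33 * b30) (a30 * b01 + a31 * b11 + a32 * b21 + a33 *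
        b31) (a30 * b02 + a31 * b12 + a32 * b22 + a33 * b32) (a30 * b03 + a31 * b13 + a32 * b23 +
        a33 * b33).
Proof.
by apply/matrixP; apply: ord4P; apply: ord4P; rewrite mxE sum4E !mxE.
Qed.

Lemma mx16_0 : 0 = mx16 0 0 0 0 0 0 0 0 0 0 0 0 0 0 0 0.
Proof. by rewrite [0 in LHS]mx16_eta !mxE. Qed.

Lemma mx16_inj a00 a01 a02 a03 a10 a11 a12 a13 a20 a21 a22 a23 a30 a31 a32 a33
    b00 b01 b02 b03 b10 b11 b12 b13 b20 b21 b22 b23 b30 b31 b32 b33 :
  mx16 a00 a01 a02 a03 a10 a11 a12 a13 a20 a21 a22 a23 a30 a31 a32 a33 =
  mx16 b00 b01 b02 b03 b10 b11 b12 b13 b20 b21 b22 b23 b30 b31 b32 b33 ->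
  [/\ [/\ a00 = b00, a01 = b01, a02 = b02 & a03 = b03], [/\ a10 = b10, a11 = b11, a12 = b12 & a13
      = b13], [/\ a20 = b20, a21 = b21, a22 = b22 & a23 = b23] & [/\ a30 = b30, a31 = b31, a32 =
      b32 & a33 = b33]].
Proof.
move=> /matrixP e; split; split.
- by have := e 0 0; rewrite !mxE.
- by have := e 0 1; rewrite !mxE.
- by have := e 0 2; rewrite !mxE.
- by have := e 0 3; rewrite !mxE.
- by have := e 1 0; rewrite !mxE.
- by have := e 1 1; rewrite !mxE.
- by have := e 1 2; rewrite !mxE.
- by have := e 1 3; rewrite !mxE.
- by have := e 2 0; rewrite !mxE.
- by have := e 2 1; rewrite !mxE.
- by have := e 2 2; rewrite !mxE.
- by have := e 2 3; rewrite !mxE.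
- by have := e 3 0; rewrite !mxE.
- by have := e 3 1; rewrite !mxE.
- by have := e 3 2; rewrite !mxE.
- by have := e 3 3; rewrite !mxE.
Qed.

End ExplicitMatrices.

Section PoleLinearization.
Context {R : realType}.
Variables (L : R) (Lam : R -> R) (G : phase (R := R) -> R) (c : chart_name).
Variables (l1 : R -> R) (tau : R).
Hypothesis L_gt0 : 0 < L.
Hypothesis tw0 : forall a b, twist L Lam c (vec4 a b 0 0) = tau.

(** With J the rotation block, s AH + t AK is block upper triangular with diagonal blocks (t - s
    tau) J and t J; here [tau] is the value of the magnetic form at the pole, up to a sign fixed by
    the chart. *)
Definition AH : 'M[R]_4 :=
  mx16 0 (- tau) 1 0 tau 0 0 1 0 0 0 0 0 0 0 0.

Definition AK : 'M[R]_4 :=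
  mx16 0 1 0 0 (-1) 0 0 0 0 0 0 1 0 0 (-1) 0.

Lemma near_small : \forall t \near (0 : R), `|t| < L.
Proof.
have : 0 \in `]-L, L[ by rewrite in_itv /= oppr_lt0 L_gt0.
by move=> /near_in_itvoo; apply: filterS => t; rewrite in_itv /= -ltr_norml.
Qed.

Lemma linearizationH_pole :
  (forall q0 q1, dloc L G c (vec4 q0 q1 0 0) = vec4 q0 q1 0 0) ->
  (forall u, `|u| < L -> dloc L G c (vec4 0 0 u 0) = vec4 0 0 0 0) ->
  (forall u, `|u| < L -> dloc L G c (vec4 0 0 0 u) = vec4 0 0 0 0) ->
  linearization L Lam G c (vec4 0 0 0 0) = AH.
Proof.
move=> d0 du dv.
have V0 q0 q1 : hamvf L Lam G c (vec4 q0 q1 0 0) = vec4 (tau * q1) (- (tau * q0)) q0 q1.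
  by rewrite (hamvfE Lam (d0 q0 q1)) tw0; congr vec4; ring.
have Vu u : `|u| < L -> hamvf L Lam G c (vec4 0 0 u 0) = vec4 0 0 0 0.
  by move=> uL; rewrite (hamvfE Lam (du u uL)); congr vec4; ring.
have Vv u : `|u| < L -> hamvf L Lam G c (vec4 0 0 0 u) = vec4 0 0 0 0.
  by move=> uL; rewrite (hamvfE Lam (dv u uL)); congr vec4; ring.
apply: (linearization_rows (X := fun i : 'I_4 => nth _ _ i)) => /=.
- apply: (isd_vec4 (near_all 0 (fun t => V0 t 0)) (isd_cst _ _) _ (isd_id 0) (isd_cst _ _)).
  by apply: (is_derive_eq (isdN (isdcM tau (isd_id 0)))); rewrite mulr1.
- apply: (isd_vec4 (near_all 0 (fun t => V0 0 t)) _ (isd_cst _ _) (isd_cst _ _) (isd_id 0)).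
  by apply: (is_derive_eq (isdcM tau (isd_id 0))); rewrite mulr1.
- exact: (isd_vec4 (filterS Vu near_small) (isd_cst _ _) (isd_cst _ _) (isd_cst _ _) (isd_cst _ _)).
- exact: (isd_vec4 (filterS Vv near_small) (isd_cst _ _) (isd_cst _ _) (isd_cst _ _) (isd_cst _ _)).
Qed.

(** The assumption [twist * u = l1 u] makes the magnetic term cancel the derivative of Lam, which
    leaves for the field of K the rotation of momenta and positions. *)
Lemma linearizationK_pole :
  (forall u, `|u| < L -> twist L Lam c (vec4 0 0 u 0) * u = l1 u) ->
  (forall u, `|u| < L -> twist L Lam c (vec4 0 0 0 u) * u = l1 u) ->
  (forall q0 q1, dloc L G c (vec4 q0 q1 0 0) = vec4 0 0 q1 (- q0)) ->
  (forall u, `|u| < L -> dloc L G c (vec4 0 0 u 0) = vec4 0 u (l1 u) 0) ->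
  (forall u, `|u| < L -> dloc L G c (vec4 0 0 0 u) = vec4 (- u) 0 0 (l1 u)) ->
  linearization L Lam G c (vec4 0 0 0 0) = AK.
Proof.
move=> twu twv d0 du dv.
have V0 q0 q1 : hamvf L Lam G c (vec4 q0 q1 0 0) = vec4 (- q1) q0 0 0.
  by rewrite (hamvfE Lam (d0 q0 q1)) tw0; congr vec4; ring.
have Vu u : `|u| < L -> hamvf L Lam G c (vec4 0 0 u 0) = vec4 0 0 0 u.
  by move=> uL; rewrite (hamvfE Lam (du u uL)) twu //; congr vec4; ring.
have Vv u : `|u| < L -> hamvf L Lam G c (vec4 0 0 0 u) = vec4 0 0 (- u) 0.
  by move=> uL; rewrite (hamvfE Lam (dv u uL)) mulrN twv //; congr vec4; ring.
have dN : is_derive (0 : R) 1 (fun t => - t) (- 1) by exact: isdN (isd_id 0).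
apply: (linearization_rows (X := fun i : 'I_4 => nth _ _ i)) => /=.
- exact: (isd_vec4 (near_all 0 (fun t => V0 t 0)) (isd_cst _ _) (isd_id 0) (isd_cst _ _) (isd_cst
    _ _)).
- exact: (isd_vec4 (near_all 0 (fun t => V0 0 t)) dN (isd_cst _ _) (isd_cst _ _) (isd_cst _ _)).
- exact: (isd_vec4 (filterS Vu near_small) (isd_cst _ _) (isd_cst _ _) (isd_cst _ _) (isd_id 0)).
- exact: (isd_vec4 (filterS Vv near_small) (isd_cst _ _) (isd_cst _ _) dN (isd_cst _ _)).
Qed.

Hypothesis tau0 : tau != 0.

Definition OmegaP : 'M[R]_4 := wedge 0 2 + wedge 1 3 + tau *: wedge 2 3.

Lemma OmegaPE :
  OmegaP = mx16 0 0 1 0 0 0 0 1 (-1) 0 0 tau 0 (-1) (- tau) 0.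
Proof.
apply/matrixP; apply: ord4P; apply: ord4P; rewrite !mxE /=; ring.
Qed.

Lemma span2E s t : s *: AH + t *: AK =
  mx16 0 (t - s * tau) s 0 (s * tau - t) 0 0 s 0 0 0 t 0 0 (- t) 0.
Proof. rewrite /AH /AK !mx16Z mx16D; congr mx16; ring. Qed.

Lemma sp_span s t : sp OmegaP (s *: AH + t *: AK).
Proof.
rewrite /sp /= span2E OmegaPE mx16T !mx16M mx16D mx16_0; congr mx16; ring.
Qed.

Lemma span_commute s t s' t' :
  lie_bracket (s *: AH + t *: AK) (s' *: AH + t' *: AK) = 0.
Proof.
rewrite /lie_bracket !span2E !mx16M mx16N mx16D mx16_0; congr mx16; ring.
Qed.

Lemma mul_tau0 x : tau * x = 0 -> x = 0.
Proof. by move/eqP; rewrite mulf_eq0 (negbTE tau0) => /eqP. Qed.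

(* In 2x2 blocks A = [[P, Q], [S, T]], commuting with AK makes the blocks commute
   with J; commuting with AH gives S = 0 and P - T + tau J Q = 0; the symplectic
   condition gives Q symmetric and P + tau Q J + T^T = 0. *)
Lemma self_normalizing A : sp OmegaP A ->
  span2 AH AK (lie_bracket A AH) -> span2 AH AK (lie_bracket A AK) -> span2 AH AK A.
Proof.
rewrite [A]mx16_eta.
move: (A 0 0) (A 0 1) (A 0 2) (A 0 3) (A 1 0) (A 1 1) (A 1 2) (A 1 3) (A 2 0) (A 2 1) (A 2 2) (A
    2 3) (A 3 0) (A 3 1) (A 3 2) (A 3 3) => a00 a01 a02 a03 a10 a11 a12 a13 a20 a21 a22 a23 a30
    a31 a32 a33.
rewrite /sp /= /lie_bracket OmegaPE mx16T !mx16M mx16D mx16_0.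
move=> /mx16_inj spA [s [t]] + [s' [t']].
rewrite !span2E !mx16N !mx16D => /mx16_inj eH /mx16_inj eK.
case: spA => [[S00 S01 S02 S03] [S10 S11 S12 S13] _ _].
case: eH => [[H00 H01 H02 H03] [H10 H11 H12 H13] [H20 H21 H22 H23] [H30 H31 H32 H33]].
case: eK => [[K00 K01 K02 K03] [K10 K11 K12 K13] [K20 K21 K22 K23] [K30 K31 K32 K33]].
have z20 : a20 = 0 by apply: mul_tau0; lra.
have z21 : a21 = 0 by apply: mul_tau0; lra.
have z30 : a30 = 0 by apply: mul_tau0; lra.
have z31 : a31 = 0 by apply: mul_tau0; lra.
subst a20 a21 a30 a31.
(* Once the lower left block of A is zero, all four coefficients of the two brackets vanish, so A
   commutes with AH and AK. *)
have et : t = 0 by lra.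
have es : s = 0 by apply: mul_tau0; lra.
have et' : t' = 0 by lra.
have es' : s' = 0 by lra.
rewrite ?es' ?et' in K00 K01 K02 K03 K10 K11 K12 K13 K22 K23 K32 K33.
rewrite ?es ?et in H00 H01 H02 H03 H10 H11 H12 H13.
clear es et es' et' S10 S11 H20 H21 H22 H23 H30 H31 H32 H33 K20 K21 K30 K31.
have e03 : a03 = 0 by lra.
have e12 : a12 = 0 by lra.
have e13 : a13 = a02 by lra.
have e11 : a11 = a00 by lra.
have e10 : a10 = - a01 by lra.
have e33 : a33 = a22 by lra.
have e32 : a32 = - a23 by lra.
subst a03 a12 a13 a11 a10 a33 a32.
exists a02, a23; rewrite span2E; congr mx16; lra.
Qed.

Lemma cartan_pole : cartan_subalgebra (sp OmegaP) (span2 AH AK).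
Proof.
split.
- by move=> A [s [t ->]]; exact: sp_span.
- split; first by exists 0, 0; rewrite !scale0r addr0.
  move=> s t A B [s1 [t1 ->]] [s2 [t2 ->]]; exists (s * s1 + t * s2), (s * t1 + t * t2).
  by rewrite !scalerDr !scalerA !scalerDl addrACA.
- move=> A B [s1 [t1 ->]] [s2 [t2 ->]]; rewrite span_commute.
  by exists 0, 0; rewrite !scale0r addr0.
- exists 1%N => -[//|x [|//]] A _ hx [s [t ->]] /=.
  have [s' [t' ->]] : span2 AH AK x by apply: hx; rewrite inE.
  exact: span_commute.
- move=> A spA nA; apply: self_normalizing => //; apply: nA.
    by exists 1, 0; rewrite scale1r scale0r addr0.
  by exists 0, 1; rewrite scale1r scale0r add0r.
Qed.

Lemma neg_sq_imaginary (z : R[i]) (x : R) :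
  z ^+ 2 = - (real_complex R x) ^+ 2 -> complex.Re z = 0.
Proof.
case: z => u v /eqP; rewrite expr2 expr2 eq_complex /= => /andP[/eqP h1 /eqP h2].
rewrite !mul0r ?mulr0 subr0 in h1.
have h3 : u * v = 0 by lra.
have /orP[/eqP->//|/eqP v0] : (u == 0) || (v == 0) by rewrite -mulf_eq0 h3.
move: h1; rewrite v0 mulr0 subr0 => h1.
have := sqr_ge0 u; have := sqr_ge0 x; rewrite !expr2 => h4 h5.
have : u * u = 0 by lra.
by move/eqP; rewrite mulf_eq0 orbb => /eqP.
Qed.

(** Block triangularity decouples the first two coordinates of a row eigenvector, which give z^2 = -
    m^2 unless they vanish; in that case the last two give z^2 = - t^2. *)
Lemma imaginary_pole A : span2 AH AK A -> imaginary_spectrum A.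
Proof.
move=> [s [t ->]] z /eigenvalueP[v vE v0].
pose C := real_complex R.
pose m := t - s * tau.
have E j : \sum_i v 0 i * C ((s *: AH + t *: AK) i j) = z * v 0 j.
  move: vE => /(congr1 (fun M : 'rV_4 => M 0 j)); rewrite !mxE => <-.
  by apply: eq_bigr => i _; rewrite !mxE.
rewrite span2E in E.
have c0 : C 0 = 0 by exact: rmorph0.
have cN x : C (- x) = - C x by exact: rmorphN.
have F0 : z * v 0 0 = - C m * v 0 1.
  by rewrite -E sum4E !mxE /= -[s * tau - t]opprB -/m cN c0; ring.
have F1 : z * v 0 1 = C m * v 0 0 by rewrite -E sum4E !mxE /= -/m c0; ring.
have F2 : z * v 0 2 = C s * v 0 0 - C t * v 0 3.
  by rewrite -E sum4E !mxE /= cN c0; ring.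
have F3 : z * v 0 3 = C s * v 0 1 + C t * v 0 2.
  by rewrite -E sum4E !mxE /= c0; ring.
have sq x : (z ^+ 2 + (C m) ^+ 2) * x = z * (z * x) + (C m) ^+ 2 * x by ring.
have G0 : (z ^+ 2 + (C m) ^+ 2) * v 0 0 = 0 by rewrite sq F0 mulrCA F1; ring.
have G1 : (z ^+ 2 + (C m) ^+ 2) * v 0 1 = 0 by rewrite sq F1 mulrCA F0; ring.
have [zm|zm] := eqVneq (z ^+ 2 + (C m) ^+ 2) 0.
  by apply: (@neg_sq_imaginary z m); apply/eqP; rewrite -addr_eq0 zm.
have v00 : v 0 0 = 0 by move/eqP: G0; rewrite mulf_eq0 (negbTE zm) => /eqP.
have v01 : v 0 1 = 0 by move/eqP: G1; rewrite mulf_eq0 (negbTE zm) => /eqP.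
rewrite v00 mulr0 sub0r in F2; rewrite v01 mulr0 add0r in F3.
have sq' x : (z ^+ 2 + (C t) ^+ 2) * x = z * (z * x) + (C t) ^+ 2 * x by ring.
have G2 : (z ^+ 2 + (C t) ^+ 2) * v 0 2 = 0 by rewrite sq' F2 mulrN mulrCA F3; ring.
have G3 : (z ^+ 2 + (C t) ^+ 2) * v 0 3 = 0 by rewrite sq' F3 mulrCA F2; ring.
have [zt|zt] := eqVneq (z ^+ 2 + (C t) ^+ 2) 0.
  by apply: (@neg_sq_imaginary z t); apply/eqP; rewrite -addr_eq0 zt.
have v02 : v 0 2 = 0 by move/eqP: G2; rewrite mulf_eq0 (negbTE zt) => /eqP.
have v03 : v 0 3 = 0 by move/eqP: G3; rewrite mulf_eq0 (negbTE zt) => /eqP.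
case/eqP: v0; apply/rowP; apply: ord4P; rewrite mxE //.
Qed.

End PoleLinearization.

(** * Non-degeneracy of the critical circles *)

Section CircleType.
Context {R : realType}.
Variables (L : R) (f Lam : R -> R).
Hypotheses (L_gt0 : 0 < L) (gen : generic L f Lam).

Local Notation f1 := (f^`()).
Local Notation f2 := (f^`(2)).
Local Notation l1 := (Lam^`()).
Local Notation l2 := (Lam^`(2)).
Local Notation H := (Hfun L f).
Local Notation K := (Kfun L Lam).

Lemma circle_orbitE r kappa : 0 < r < L -> circle_orbit L Lam r kappa =
  [set z | exists phi : R, z = covector_at L r (cos phi) (sin phi) 0 (kappa - Lam r)].
Proof. by move=> /andP[r0 rL]; rewrite /circle_orbit gt_eqF // lt_eqF. Qed.

Lemma pole_coords c (y : 'rV[R]_4) : y 0 2 = 0 -> y 0 3 = 0 ->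
  match c with
  | Cyl => True
  | PoleN => chart L c y = (northM L, row3 (y 0 0) (y 0 1) 0)
  | PoleS => chart L c y = (southM L, row3 (y 0 0) (y 0 1) 0)
  end.
Proof.
move=> e2 e3; have r0 : rho y = 0 by rewrite /rho e2 e3 expr0n addr0 sqrtr0.
by case: c; rewrite //= r0 eqxx.
Qed.

Lemma coords_cases z c (y : 'rV[R]_4) : coords_at L z c y ->
  [\/ c = Cyl /\ 0 < y 0 2 < L /\
      z = chart L Cyl (vec4 (y 0 0) (y 0 1) (y 0 2) (y 0 3)),
      c = PoleN /\ y = vec4 (y 0 0) (y 0 1) 0 0 /\
      z = (northM L, row3 (y 0 0) (y 0 1) 0) |
      c = PoleS /\ y = vec4 (y 0 0) (y 0 1) 0 0 /\
      z = (southM L, row3 (y 0 0) (y 0 1) 0)].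
Proof.
move=> [zE]; case: c zE => zE h.
- by apply: Or31; split => //; split => //; rewrite -zE -vec4E.
- apply: Or32; case: h => e2 e3; rewrite -zE (pole_coords PoleN e2 e3).
  by do 2! split => //; rewrite {1}[y]vec4E e2 e3.
- apply: Or33; case: h => e2 e3; rewrite -zE (pole_coords PoleS e2 e3).
  by do 2! split => //; rewrite {1}[y]vec4E e2 e3.
Qed.

Lemma circle_HK r kappa z : 0 < r < L -> circle_orbit L Lam r kappa z ->
  [/\ TM L z, H z = (kappa - Lam r) ^+ 2 / (2 * f r ^+ 2), K z = kappa & rcoord L z = r].
Proof.
move=> hr; rewrite circle_orbitE // => -[phi ->].
have [h1 h2 h3 h4] := HK_covector f Lam L_gt0 0 (kappa - Lam r) hr (cos2Dsin2 phi).
by split => //; rewrite ?h2 ?h3 ?subrK // expr0n mul0r add0r.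
Qed.

Lemma circle_coords r kappa z c (y : 'rV[R]_4) : 0 < r < L ->
  circle_orbit L Lam r kappa z -> coords_at L z c y ->
  c = Cyl /\ y = vec4 0 (kappa - Lam r) r (y 0 3).
Proof.
move=> hr Oz cy; have [_ Hz Kz rz] := circle_HK hr Oz.
have /andP[r0 rL] := hr.
case: (coords_cases cy) => [[-> [hy zE]]|[_ [_ zE]]|[_ [_ zE]]].
- split => //; move: zE; rewrite /chart !mxE /= => zE.
  have [_ h2 h3 h4] := HK_covector f Lam L_gt0 (y 0 0) (y 0 1) hy (cos2Dsin2 (y 0 3)).
  rewrite -zE in h2 h3 h4.
  have y2 : y 0 2 = r by rewrite -h4 rz.
  have y1 : y 0 1 = kappa - Lam r by rewrite -Kz h3 y2 addrK.
  have y0 : y 0 0 = 0.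
    move: h2; rewrite Hz y2 y1 => /eqP; rewrite -subr_eq subrr eq_sym.
    by rewrite mulf_eq0 invr_eq0 pnatr_eq0 orbF expf_eq0 => /eqP.
  by rewrite {1}[y]vec4E y0 y1 y2.
- by move: rz; rewrite zE rcoord_north // => e; move: r0; rewrite -e ltxx.
- by move: rz; rewrite zE rcoord_south // => e; move: rL; rewrite -e ltxx.
Qed.

Lemma circle_has_coords r kappa z : 0 < r < L -> circle_orbit L Lam r kappa z ->
  exists phi, coords_at L z Cyl (vec4 0 (kappa - Lam r) r phi).
Proof.
move=> hr; rewrite circle_orbitE // => -[phi ->]; exists phi.
by split; rewrite /chart !mxE.
Qed.

(* The discriminant of the induced operator on W^perp / W: its eigenvalues are
   the square roots of [al ^ 2 * discr r q]. *)
Definition discr r q : R :=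
  q ^+ 2 * (f2 r / f r ^+ 3 - 3 * f1 r ^+ 2 / f r ^+ 4)
  + q * (l2 r / f r ^+ 2 - 4 * l1 r * f1 r / f r ^+ 3) - l1 r ^+ 2 / f r ^+ 2.

(** The induced operator in the coordinates (p_r, r), with Q = al * discr; its square is the scalar
    al * Q. *)
Definition C0 (al Q : R) : 'M[R]_2 :=
  \matrix_(i < 2, j < 2) (if (i == 0) && (j == 1) then al else
                          if (i == 1) && (j == 0) then Q else 0).

Lemma ord2P (P : 'I_2 -> Prop) : P 0 -> P 1 -> forall i, P i.
Proof.
move=> e0 e1 [[|[|//]] i].
- by have -> : Ordinal i = 0 by exact: val_inj.
- by have -> : Ordinal i = 1 by exact: val_inj.
Qed.

Lemma sum2E (V : zmodType) (g : 'I_2 -> V) : \sum_i g i = g 0 + g 1.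
Proof.
rewrite !big_ord_recl big_ord0 addr0.
by have -> : lift ord0 ord0 = 1 :> 'I_2 by exact: val_inj.
Qed.

(** On a critical circle W is spanned by d/dphi, and W^perp is the hyperplane v_1 = - Lam' v_2. The
    coordinates (v_0, v_2) therefore identify W^perp / W with the plane, and the rows of [transv]
    lift the standard basis. *)
Definition pick02 : 'M[R]_(4, 2) :=
  \matrix_(i < 4, j < 2) (((i == 0) && (j == 0)) || ((i == 2) && (j == 1)))%:R.

Lemma pick02E n (M : 'M[R]_(n, 4)) i :
  (M *m pick02) i 0 = M i 0 /\ (M *m pick02) i 1 = M i 2.
Proof. by split; rewrite mxE sum4E !mxE /= ?mulr0 ?mulr1 ?addr0 ?add0r. Qed.

Definition transv (t : R) : 'M[R]_(2, 4) :=
  \matrix_(i < 2) (if i == 0 then vec4 1 0 0 0 else vec4 0 (- t) 1 0).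

Lemma transv_pick t : transv t *m pick02 = 1%:M.
Proof.
apply/matrixP => i; apply: ord2P; have [e0 e1] := pick02E (transv t) i.
- by rewrite e0; move: i {e0 e1}; apply: ord2P; rewrite !mxE.
- by rewrite e1; move: i {e0 e1}; apply: ord2P; rewrite !mxE.
Qed.

Variables (r q phi : R).
Hypothesis (hr : 0 < r < L).
Local Notation y := (vec4 0 q r phi).
Local Notation W := (col_mx (hamvf L Lam H Cyl y) (hamvf L Lam K Cyl y)).

Lemma hamvfK_circle : hamvf L Lam K Cyl y = vec4 0 0 0 1.
Proof.
rewrite -(combination_K L f Lam) (hamvf_cyl L_gt0 gen 0 1 0 q phi hr).
by congr vec4; rewrite ?mul0r ?oppr0 ?addr0 ?add0r.
Qed.

Lemma hamvfH_circle : hamvf L Lam H Cyl y =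
  vec4 (q ^+ 2 * f1 r / f r ^+ 3 + l1 r * (q / f r ^+ 2)) 0 0 (q / f r ^+ 2).
Proof.
rewrite -(combination_H L f Lam) (hamvf_cyl L_gt0 gen 1 0 0 q phi hr).
by congr vec4; rewrite ?mul0r ?mulr0 ?mul1r ?oppr0 ?addr0 ?add0r.
Qed.

(** The condition, with q = p_phi and p_r = 0, for dH to be a multiple of dK. *)
Definition critical_q := q * (q * f1 r + f r * l1 r) = 0.

Lemma hamvfH_crit : critical_q -> hamvf L Lam H Cyl y = vec4 0 0 0 (q / f r ^+ 2).
Proof.
have f0 := f_neq0 gen hr.
move=> cq; rewrite hamvfH_circle; congr vec4.
have -> : q ^+ 2 * f1 r / f r ^+ 3 + l1 r * (q / f r ^+ 2)
  = q * (q * f1 r + f r * l1 r) / f r ^+ 3 by jfield.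
by rewrite cq mul0r.
Qed.

Lemma combination_crit al be : (al, be) <> (0, 0) ->
  al *: dloc L H Cyl y + be *: dloc L K Cyl y = 0 ->
  [/\ al != 0, be = - (al * q / f r ^+ 2) & critical_q].
Proof.
have f0 := f_neq0 gen hr.
move=> n0; rewrite (dlocH_cyl L_gt0 gen _ _ _ hr) (dlocK_cyl L_gt0 gen _ _ _ hr).
move=> e; have e1 := congr1 (fun M : 'rV[R]_4 => M 0 1) e.
have e2 := congr1 (fun M : 'rV[R]_4 => M 0 2) e.
rewrite !mxE /= in e1 e2.
have bE : be = - (al * q / f r ^+ 2) by rewrite -mulrA; lra.
have a0 : al != 0.
  by apply/eqP => a0; apply: n0; rewrite bE a0 !mul0r oppr0.
split => //; rewrite /critical_q.
have : al * (q * (q * f1 r + f r * l1 r)) = 0.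
  have -> : al * (q * (q * f1 r + f r * l1 r)) =
    - (f r ^+ 3) * (al * - (q ^+ 2 * f1 r / f r ^+ 3) - (al * q / f r ^+ 2) * l1 r).
    by jfield.
  have -> : al * - (q ^+ 2 * f1 r / f r ^+ 3) - al * q / f r ^+ 2 * l1 r = 0.
    by rewrite -e2 bE mulNr.
  by rewrite mulr0.
by move/eqP; rewrite mulf_eq0 (negbTE a0) => /eqP.
Qed.

Lemma critical_combination : critical_q ->
  1 *: dloc L H Cyl y + - (q / f r ^+ 2) *: dloc L K Cyl y = 0.
Proof.
have f0 := f_neq0 gen hr.
move=> cq; rewrite (dlocH_cyl L_gt0 gen _ _ _ hr) (dlocK_cyl L_gt0 gen _ _ _ hr).
apply/rowP; apply: ord4P; rewrite !mxE /=.
- by rewrite !mulr0 addr0.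
- by rewrite mul1r mulr1 subrr.
- have -> : 1 * - (q ^+ 2 * f1 r / f r ^+ 3) + - (q / f r ^+ 2) * l1 r =
    - (q * (q * f1 r + f r * l1 r)) / f r ^+ 3 by jfield.
  by rewrite cq oppr0 mul0r.
- by rewrite !mulr0 addr0.
Qed.

Local Notation Ag al be := (linearization L Lam (fun z => al * H z + be * K z) Cyl y).

Lemma linearization_mx16 al be : exists x u w s : R,
  Ag al be = mx16 0 (- (al * l1 r)) al 0 x 0 0 u w 0 0 s 0 0 0 0 /\
  w - l1 r * x = al * discr r q.
Proof.
have f0 := f_neq0 gen hr.
rewrite (linearization_cyl L_gt0 gen al be q phi hr).
do 4 eexists; split; first by apply/row_matrixP; apply: ord4P; rewrite !rowK.
by rewrite /discr; jfield.
Qed.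

(* On vectors annihilated by [Omega (., d/dphi)], i.e. with v_1 = - l1 v_2, the
   linearization acts on the coordinates (v_0, v_2) by C0. *)
Lemma linearization_pick al be n (B : 'M[R]_(n, 4)) :
  (forall i, B i 1 = - l1 r * B i 2) ->
  B *m Ag al be *m pick02 = (B *m pick02) *m C0 al (al * discr r q).
Proof.
move=> hB; have [x [u [w [s [-> e]]]]] := linearization_mx16 al be.
rewrite -e; apply/matrixP => i; apply: ord2P.
  rewrite (pick02E _ i).1 [RHS]mxE sum2E (pick02E B i).1 (pick02E B i).2 !mxE /=.
  rewrite sum4E !mxE /= hB.
  by move: (B i 0) (B i 2) (B i 3) (l1 r) => *; ring.
rewrite (pick02E _ i).2 [RHS]mxE sum2E (pick02E B i).1 (pick02E B i).2 !mxE /=.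
rewrite sum4E !mxE /=.
by move: (B i 0) (B i 1) (B i 2) (B i 3) => *; ring.
Qed.

Lemma W_pick : critical_q -> W *m pick02 = 0.
Proof.
move=> cq; rewrite mul_col_mx hamvfH_crit // hamvfK_circle.
have z (t : R) : vec4 0 0 0 t *m pick02 = 0.
  apply/matrixP => i; rewrite (ord1 i); apply: ord2P.
    by rewrite (pick02E _ 0).1 !mxE.
  by rewrite (pick02E _ 0).2 !mxE.
by rewrite !z col_mx0.
Qed.

Lemma Omega_WT (v : 'rV[R]_4) : v *m Omega L Lam Cyl y *m (vec4 0 0 0 1)^T =
  (v 0 1 + l1 r * v 0 2)%:M.
Proof.
have tw : twist L Lam Cyl y = l1 r by rewrite /= mxE.
rewrite [v in LHS]vec4E vec4_Omega tw; apply/matrixP => i j; rewrite (ord1 i) (ord1 j).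
by rewrite !mxE sum4E !mxE /= ?mulr1n; jring.
Qed.

Lemma scalar_mx1_eq0 (x : R) : ((x%:M : 'M[R]_1) == 0) = (x == 0).
Proof.
apply/eqP/eqP => [/matrixP/(_ 0 0)|->]; last by rewrite raddf0.
by rewrite !mxE mulr1n.
Qed.

(** Both Hamiltonian fields are multiples of d/dphi at a critical point, so the orthogonality
    conditions reduce to a single scalar equation. *)
Lemma in_Wo n (B : 'M[R]_(n, 4)) : critical_q ->
  (B <= kermx (Omega L Lam Cyl y *m W^T))%MS <-> (forall i, B i 1 = - l1 r * B i 2).
Proof.
move=> cq; rewrite hamvfH_crit // hamvfK_circle.
have key i : (row i B *m Omega L Lam Cyl y *m (vec4 0 0 0 1)^T == 0) =
    (B i 1 == - l1 r * B i 2).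
  by rewrite Omega_WT !mxE scalar_mx1_eq0 mulNr addr_eq0.
have WT : (col_mx (vec4 0 0 0 (q / f r ^+ 2)) (vec4 0 0 0 1))^T =
   (vec4 0 0 0 1)^T *m row_mx (q / f r ^+ 2)%:M 1%:M.
  rewrite tr_col_mx mul_mx_row mulmx1 mul_mx_scalar; congr row_mx.
  by apply/matrixP => i j; rewrite (ord1 j) !mxE; move: i; apply: ord4P; rewrite /= ?mulr0 ?mulr1.
split=> [/sub_kermxP e i|h].
  apply/eqP; rewrite -key; apply/eqP.
  move: e; rewrite WT !mulmxA => /(congr1 (row i)); rewrite !row_mul => /(congr1 rsubmx).
  by rewrite mul_mx_row row_mxKr mulmx1 row0 => ->; apply/matrixP => a b; rewrite !mxE.
apply/sub_kermxP; rewrite WT !mulmxA; apply/row_matrixP => i; rewrite !row_mul.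
by have /eqP -> : row i B *m Omega L Lam Cyl y *m (vec4 0 0 0 1)^T == 0;
  [rewrite key h | rewrite mul0mx row0].
Qed.

Lemma rank_parallel (a : R) (v : 'rV[R]_4) : v != 0 -> \rank (col_mx (a *: v) v) = 1%N.
Proof.
move=> v0; rewrite -addsmxE (addsmx_idPr (scalemx_sub a (submx_refl v))).
by rewrite rank_rV v0.
Qed.

Lemma e3_neq0 : vec4 0 0 0 1 != 0 :> 'rV[R]_4.
Proof. by apply/eqP => /rowP/(_ 3); rewrite !mxE /= => /eqP; rewrite oner_eq0. Qed.

Lemma e3_sub_W (t : R) : (vec4 0 0 0 t <= W)%MS.
Proof.
rewrite hamvfK_circle -addsmxE; apply: (submx_trans _ (addsmxSr _ _)).
have -> : vec4 0 0 0 t = t *: vec4 0 0 0 1.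
  by apply: vec4_ext; rewrite !mxE /= ?mulr0 ?mulr1.
exact: scalemx_sub.
Qed.

Lemma rank_W : critical_q -> \rank W = 1%N.
Proof.
move=> cq; rewrite hamvfH_crit // hamvfK_circle.
have -> : vec4 0 0 0 (q / f r ^+ 2) = (q / f r ^+ 2) *: vec4 0 0 0 1.
  by apply: vec4_ext; rewrite !mxE /= ?mulr0 ?mulr1.
exact: rank_parallel e3_neq0.
Qed.

Lemma W_sub_Wo : critical_q -> (W <= kermx (Omega L Lam Cyl y *m W^T))%MS.
Proof.
move=> cq; rewrite {1}hamvfH_crit // {1}hamvfK_circle col_mx_sub.
by apply/andP; split; apply/in_Wo => // i; rewrite (ord1 i) !mxE /= mulr0.
Qed.

Lemma transv_rows t : row 0 (transv t) = vec4 1 0 0 0 /\ row 1 (transv t) = vec4 0 (- t) 1 0.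
Proof. by rewrite /transv !rowK. Qed.

Lemma transv_sub_Wo : critical_q ->
  (transv (l1 r) <= kermx (Omega L Lam Cyl y *m W^T))%MS.
Proof.
move=> cq; apply/in_Wo => //; apply: ord2P; rewrite !mxE /= ?mulr0 ?mulr1 //.
Qed.

Lemma Wo_sub : critical_q ->
  (kermx (Omega L Lam Cyl y *m W^T) <= W + transv (l1 r))%MS.
Proof.
move=> cq; apply/rV_subP => v /in_Wo - /(_ cq 0) hv.
have -> : v = vec4 0 0 0 (v 0 3) + (v 0 0 *: row 0 (transv (l1 r)) + v 0 2 *: row 1 (transv (l1
    r))).
  have [-> ->] := transv_rows (l1 r).
  by apply: vec4_ext; rewrite !mxE /= ?hv; ring.
apply: addmx_sub; first exact: submx_trans (e3_sub_W _) (addsmxSl _ _).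
apply: submx_trans (addsmxSr _ _).
by apply: addmx_sub; apply: scalemx_sub; exact: row_sub.
Qed.

Lemma W_transv_rank : critical_q -> \rank (W + transv (l1 r))%MS = (\rank W + 2)%N.
Proof.
move=> cq; have fr : row_free (transv (l1 r)).
  by apply/row_freeP; exists pick02; exact: transv_pick.
rewrite mxrank_disjoint_sum; first by rewrite (eqP fr).
apply/eqP; rewrite -submx0; apply/rV_subP => v; rewrite sub_capmx => /andP[vW].
move=> /submxP[x vE]; have : v *m pick02 = 0.
  by case/submxP: vW => w ->; rewrite -mulmxA W_pick // mulmx0.
by rewrite vE -mulmxA transv_pick mulmx1 => ->; rewrite mul0mx sub0mx.
Qed.

Lemma induced_exists z : critical_q -> coords_at L z Cyl y ->
  induced_operator L f Lam z (C0 1 (discr r q)).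
Proof.
move=> cq cy; have f0 := f_neq0 gen hr.
exists Cyl, y, 1, (- (q / f r ^+ 2)), (transv (l1 r)) => G A W0 Wo.
have [x [u [w [s [AE e]]]]] := linearization_mx16 1 (- (q / f r ^+ 2)).
rewrite mul1r in e AE.
have e3A (t : R) : vec4 0 0 0 t *m A = 0.
  by rewrite /A AE; apply: vec4_ext; rewrite !mxE sum4E !mxE /=; ring.
split.
- by split => //; exact: rank_W.
- by split; [move=> [/eqP]; rewrite oner_eq0 | exact: critical_combination].
- split; last exact: W_transv_rank.
  by apply/andP; split; [rewrite addsmx_sub W_sub_Wo // transv_sub_Wo | exact: Wo_sub].
- rewrite /W0 mul_col_mx {1}hamvfH_crit // {1}hamvfK_circle !e3A col_mx0.
  exact: sub0mx.
- have t1 : row 1 (transv (l1 r) *m A - C0 1 (discr r q) *m transv (l1 r))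
     = vec4 0 0 0 (s - l1 r * u).
    rewrite -[discr r q]mul1r -e /A AE; move: (l1 r) => v.
    by apply: vec4_ext; rewrite !mxE sum4E sum2E !mxE /=; ring.
  have t0 : row 0 (transv (l1 r) *m A - C0 1 (discr r q) *m transv (l1 r)) = vec4 0 0 0 0.
    rewrite /A AE; move: (l1 r) (discr r q) => v d.
    by apply: vec4_ext; rewrite !mxE sum4E sum2E !mxE /=; ring.
  by apply/row_subP; apply: ord2P; rewrite ?t0 ?t1; exact: e3_sub_W.
Qed.

(** The matrix of the induced operator in an arbitrary basis B is conjugate to [C0] by P = B *m
    pick02. This P is invertible because [transv], which [pick02] maps to the identity, lies in W +
    B. *)
Lemma induced_similar al be (B : 'M[R]_(2, 4)) (C : 'M[R]_2)
    (Wo := kermx (Omega L Lam Cyl y *m W^T)) : critical_q ->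
  (W + B == Wo)%MS -> (B *m Ag al be - C *m B <= W)%MS ->
  exists2 P, P \in unitmx & P *m C0 al (al * discr r q) = C *m P.
Proof.
move=> cq /andP[s1 s2] s3; exists (B *m pick02).
  have : (transv (l1 r) <= W + B)%MS by apply: submx_trans s2; exact: transv_sub_Wo.
  move=> /sub_addsmxP[[u v] /= e]; move: (congr1 (mulmx^~ pick02) e).
  rewrite /= transv_pick mulmxDl -!mulmxA W_pick // mulmx0 add0r => /esym.
  by move=> /mulmx1_unit[].
have hB : forall i, B i 1 = - l1 r * B i 2.
  by apply/in_Wo => //; apply: submx_trans s1; exact: addsmxSr.
rewrite -(linearization_pick al be) //.
case/submxP: s3 => X /(congr1 (mulmx^~ pick02)) /=.
rewrite mulmxBl -[X *m _ *m _]mulmxA W_pick // mulmx0 => /eqP; rewrite subr_eq0 => /eqP ->.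
by rewrite mulmxA.
Qed.

End CircleType.

Section InducedSpectrum.
Context {R : realType}.
Implicit Types (al Q : R) (C P : 'M[R]_2).

Lemma det_mx22 (V : comNzRingType) (M : 'M[V]_2) : \det M = M 0 0 * M 1 1 - M 0 1 * M 1 0.
Proof.
rewrite (expand_det_row _ 0) sum2E /cofactor !det_mx11 !mxE /=.
have -> : lift 0 0 = 1 :> 'I_2 by exact: val_inj.
have -> : lift 1 0 = 0 :> 'I_2 by exact: val_inj.
by rewrite expr0 expr1 mul1r mulN1r mulrN.
Qed.

Lemma C0_unit al Q P C : P \in unitmx -> P *m C0 al Q = C *m P ->
  (C \in unitmx) = (al * Q != 0).
Proof.
move=> uP e; have : \det P * \det (C0 al Q) = \det C * \det P by rewrite -!det_mulmx e.
rewrite mulrC det_mx22 !mxE /= mul0r sub0r => dE.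
have dP : \det P != 0 by rewrite -unitfE -unitmxE.
have -> : al * Q = - \det C by rewrite -[LHS]opprK (mulIf dP dE).
by rewrite oppr_eq0 unitmxE unitfE.
Qed.

(** Conversely, a square root z of al * Q has the row eigenvector (z, al) for [C0], nonzero because
    al is. *)
Lemma C0_eigenvalue al Q P C (z : R[i]) : P \in unitmx -> P *m C0 al Q = C *m P ->
  al != 0 ->
  eigenvalue (map_mx (real_complex R) C) z <-> z ^+ 2 = real_complex R (al * Q).
Proof.
move=> uP e al0; pose m := real_complex R.
have uP' : map_mx m P \in unitmx by rewrite map_unitmx.
have e' : map_mx m P *m map_mx m (C0 al Q) = map_mx m C *m map_mx m P.
  by rewrite -!map_mxM e.
have mal : m al != 0 by rewrite fmorph_eq0.
have act (u : 'rV[R[i]]_2) : (u *m map_mx m (C0 al Q)) 0 0 = u 0 1 * m Q /\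
    (u *m map_mx m (C0 al Q)) 0 1 = u 0 0 * m al.
  have m0 : m 0 = 0 by exact: rmorph0.
  by split; rewrite mxE sum2E !mxE /= m0 mulr0 ?addr0 ?add0r.
split.
  move=> /eigenvalueP[v vE v0].
  have [u uE u0] : exists2 u : 'rV[R[i]]_2, u *m map_mx m (C0 al Q) = z *: u & u != 0.
    exists (v *m map_mx m P); first by rewrite -mulmxA e' mulmxA vE -scalemxAl.
    apply: contraNN v0 => /eqP uz; rewrite -(mulmxK uP' v) uz mul0mx; exact: eqxx.
  have [a0 a1] := act u; rewrite uE mxE in a0; rewrite uE mxE in a1.
  have q0 : (z ^+ 2 - m (al * Q)) * u 0 0 = 0.
    rewrite mulrBl /m rmorphM /= expr2 -mulrA a0 [z * (u 0 1 * _)]mulrA a1; ring.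
  have q1 : (z ^+ 2 - m (al * Q)) * u 0 1 = 0.
    rewrite mulrBl /m rmorphM /= expr2 -mulrA a1 [z * (u 0 0 * _)]mulrA a0; ring.
  have [/eqP|n0] := eqVneq (z ^+ 2 - m (al * Q)) 0.
    by rewrite subr_eq0 => /eqP.
  move/eqP: q0; move/eqP: q1; rewrite !mulf_eq0 (negbTE n0) /= => /eqP q1 /eqP q0.
  by case/eqP: u0; apply/rowP; apply: ord2P; rewrite mxE.
move=> zE; pose u : 'rV[R[i]]_2 := \row_i (if i == 0 then z else m al).
have uE : u *m map_mx m (C0 al Q) = z *: u.
  apply/rowP; apply: ord2P; rewrite ?(act u).1 ?(act u).2 !mxE /=.
    by rewrite -expr2 zE /m rmorphM.
  by [].
apply/eigenvalueP; exists (u *m invmx (map_mx m P)).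
  have -> : map_mx m C = map_mx m P *m map_mx m (C0 al Q) *m invmx (map_mx m P).
    by rewrite e' mulmxK.
  by rewrite !mulmxA mulmxKV // uE -scalemxAl.
apply/eqP => /(congr1 (mulmx^~ (map_mx m P))); rewrite /= mulmxKV // mul0mx.
by move=> /rowP/(_ 1); rewrite !mxE /= => /eqP; rewrite (negbTE mal).
Qed.

Lemma sq_neg_imaginary (z : R[i]) (x : R) : z ^+ 2 = real_complex R x -> x < 0 ->
  complex.Re z = 0.
Proof.
move=> zE x0; apply: (@neg_sq_imaginary _ z (Num.sqrt (- x))).
rewrite zE -rmorphXn /= sqr_sqrtr ?oppr_ge0 ?ltW // rmorphN /= opprK.
by [].
Qed.

Lemma sq_pos_real (z : R[i]) (x : R) : z ^+ 2 = real_complex R x -> 0 < x ->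
  complex.Im z = 0.
Proof.
case: z => u v /eqP; rewrite expr2 eq_complex /= => /andP[/eqP h1 /eqP h2] x0.
have h3 : u * v = 0 by lra.
have /orP[/eqP u0|/eqP->//] : (u == 0) || (v == 0) by rewrite -mulf_eq0 h3.
move: h1; rewrite u0 mul0r sub0r => h1.
have := sqr_ge0 v; rewrite expr2 => h4; lra.
Qed.

(** The eigenvalues are the square roots of al^2 * D, so the sign of D decides the type whatever
    combination of H and K was chosen. The two negative clauses make the elliptic and hyperbolic
    types exclusive. *)
Lemma induced_spectrum al D P C : al != 0 -> P \in unitmx ->
  P *m C0 al (al * D) = C *m P ->
  [/\ (C \in unitmx) = (D != 0), D < 0 -> imaginary_spectrum C,
      0 < D -> real_spectrum C, 0 < D -> ~ imaginary_spectrum C &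
      D < 0 -> ~ real_spectrum C].
Proof.
move=> al0 uP e; have a2 : 0 < al ^+ 2 by rewrite exprn_even_gt0.
have aE : al * (al * D) = al ^+ 2 * D by rewrite mulrA -expr2.
have E z := C0_eigenvalue z uP e al0.
split.
- by rewrite (C0_unit uP e) aE mulf_eq0 (gt_eqF a2).
- by move=> D0 z /E h; apply: sq_neg_imaginary h _; rewrite aE pmulr_rlt0.
- by move=> D0 z /E h; apply: sq_pos_real h _; rewrite aE pmulr_rgt0.
- move=> D0; have p : 0 < al * (al * D) by rewrite aE pmulr_rgt0.
  move=> h; have /eqP : complex.Re (real_complex R (Num.sqrt (al * (al * D)))) = 0.
    by apply: h; apply/E; rewrite -rmorphXn /= sqr_sqrtr // ltW.
  by rewrite /= sqrtr_eq0 leNgt p.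
- move=> D0; have p : 0 < - (al * (al * D)) by rewrite aE -mulrN pmulr_rgt0 // oppr_gt0.
  move=> h; have /eqP : complex.Im (Complex 0 (Num.sqrt (- (al * (al * D))))) = 0.
    apply: h; apply/E; apply/eqP; rewrite expr2 eq_complex /= !mul0r !mulr0 addr0 sub0r eqxx andbT.
    by rewrite -expr2 sqr_sqrtr ?opprK // ltW.
  by rewrite /= sqrtr_eq0 leNgt p.
Qed.

End InducedSpectrum.

Section CircleClassification.
Context {R : realType}.
Variables (L : R) (f Lam : R -> R).
Hypotheses (L_gt0 : 0 < L) (gen : generic L f Lam).

Local Notation f1 := (f^`()).
Local Notation l1 := (Lam^`()).
Local Notation O := (circle_orbit L Lam).
Local Notation k := (kfun f Lam).
Local Notation sgn := (sgn_type f Lam).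
Local Notation discr := (discr f Lam).

(** The types are existential over the induced operators. The explicit operator [C0 1 discr] proves
    the directions from the sign; similarity of every other induced operator to a [C0] proves the
    converses. *)
Lemma circle_type r kappa z (q := kappa - Lam r) : 0 < r < L -> O r kappa z ->
  critical_q f Lam r q ->
  [/\ nondegenerate1 L f Lam z <-> discr r q != 0,
      elliptic L f Lam z <-> discr r q < 0 & hyperbolic L f Lam z <-> 0 < discr r q].
Proof.
move=> hr Oz cq; have [phi cz] := circle_has_coords hr Oz.
have ex := induced_exists L_gt0 gen hr cq cz.
have [|u0 i0 r0 _ _] := @induced_spectrum R 1 (discr r q) 1%:M (C0 1 (discr r q)) (oner_neq0 _)
    (unitmx1 _ _).
  by rewrite mul1mx mulmx1 mul1r.
have sim C : induced_operator L f Lam z C -> exists al P,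
    [/\ al != 0, P \in unitmx & P *m C0 al (al * discr r q) = C *m P].
  move=> [c [y [al [be [B [[cy _] [n0 lc] [WB _] _ BC]]]]]].
  have [ec ey] := circle_coords f L_gt0 hr Oz cy; subst c.
  move: ey WB lc BC; set phi' := y 0 3 => ->; rewrite -/q => WB lc BC.
  have [al0 _ _] := combination_crit L_gt0 gen hr n0 lc.
  have [P uP e] := induced_similar L_gt0 gen hr cq WB BC.
  by exists al, P.
split; split.
- move=> [C /sim[al [P [al0 uP e]]] uC].
  by have [<- _ _ _ _] := induced_spectrum al0 uP e.
- by move=> D0; exists (C0 1 (discr r q)) => //; rewrite u0.
- move=> [C [/sim[al [P [al0 uP e]]] uC sC]].
  have [D0 _ _ nI _] := induced_spectrum al0 uP e; rewrite uC in D0.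
  by have [//|D1|D1] := ltgtP (discr r q) 0; [case: (nI D1) | rewrite D1 eqxx in D0].
- move=> D0; exists (C0 1 (discr r q)); split => //; last exact: i0.
  by rewrite u0 lt_eqF.
- move=> [C [/sim[al [P [al0 uP e]]] uC sC]].
  have [D0 _ _ _ nR] := induced_spectrum al0 uP e; rewrite uC in D0.
  by have [D1|//|D1] := ltgtP (discr r q) 0; [case: (nR D1) | rewrite D1 eqxx in D0].
- move=> D0; exists (C0 1 (discr r q)); split => //; last exact: r0.
  by rewrite u0 gt_eqF.
Qed.

Lemma circle_nonempty r kappa : 0 < r < L -> exists z, O r kappa z.
Proof.
move=> hr; rewrite (circle_orbitE _ _ hr).
by exists (covector_at L r (cos 0) (sin 0) 0 (kappa - Lam r)), 0.
Qed.

Lemma circle_type_all r kappa (q := kappa - Lam r) : 0 < r < L ->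
  critical_q f Lam r q ->
  [/\ O r kappa `<=` nondegenerate1 L f Lam <-> discr r q != 0,
      O r kappa `<=` elliptic L f Lam <-> discr r q < 0 &
      O r kappa `<=` hyperbolic L f Lam <-> 0 < discr r q].
Proof.
move=> hr cq; have [z0 Oz0] := circle_nonempty kappa hr.
have T z Oz := @circle_type r kappa z hr Oz cq.
by split; split => [/(_ _ Oz0)|h z /T[? ? ?]]; have [? ? ?] := T z0 Oz0; tauto.
Qed.

Lemma critical_k r : f1 r != 0 -> critical_q f Lam r (k r - Lam r).
Proof. by move=> F; rewrite /critical_q /kfun; jfield. Qed.

Lemma critical_Lam r : critical_q f Lam r (Lam r - Lam r).
Proof. by rewrite /critical_q subrr mul0r. Qed.

Lemma discr_k r : 0 < r < L -> f1 r != 0 ->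
  discr r (k r - Lam r) = - (sgn r / f r ^+ 2).
Proof.
move=> hr F; have f0 := f_neq0 gen hr; rewrite (sgn_typeE gen F) /discr /kfun /wronsk.
by gen_jets; field; apply/andP.
Qed.

Lemma discr_Lam r : 0 < r < L -> discr r (Lam r - Lam r) = - (l1 r / f r) ^+ 2.
Proof.
move=> hr; have f0 := f_neq0 gen hr; rewrite subrr /discr.
by jfield.
Qed.

(** If q f' + f Lam' = 0 with f' = 0, then Lam' = 0 as well, against the immersion condition; so
    this factor can be solved for q. *)
Lemma critical_qE r q : 0 < r < L -> critical_q f Lam r q ->
  q = 0 \/ (f1 r != 0 /\ q = k r - Lam r).
Proof.
move=> hr /eqP; rewrite mulf_eq0 => /orP[/eqP->|/eqP e]; [by left | right].
have F : f1 r != 0.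
  apply/eqP => F; move: e; rewrite F mulr0 add0r => /eqP.
  rewrite mulf_eq0 (negbTE (f_neq0 gen hr)) /= => /eqP l10.
  by case/andP: (hr) => h1 h2; apply: (not_both_zero gen _ F l10); rewrite !ltW.
split => //; rewrite /kfun.
have e' : q * f1 r = - (f r * l1 r) by apply/eqP; rewrite -addr_eq0 e.
by rewrite -[LHS](mulfK F) e'; clear e e'; jfield.
Qed.

End CircleClassification.

(** * Points of rank 0 and 1 *)

Section RankSets.
Context {R : realType}.
Variables (L : R) (f Lam : R -> R).
Hypotheses (L_gt0 : 0 < L) (gen : generic L f Lam).

Local Notation f1 := (f^`()).
Local Notation f2 := (f^`(2)).
Local Notation l1 := (Lam^`()).
Local Notation l2 := (Lam^`(2)).
Local Notation H := (Hfun L f).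
Local Notation K := (Kfun L Lam).
Local Notation O := (circle_orbit L Lam).
Local Notation k := (kfun f Lam).

(** The reflection r |-> L - r brings S to the pole at 0, so the abstract pole computations apply to
    it unchanged. *)
Definition fS t := f (L - t).
Definition LamS t := Lam (L - t).
Definition lS1 t := - l1 (L - t).

Lemma isd_reflect (g : R -> R) (t d : R) : is_derive (L - t) 1 g d ->
  is_derive t 1 (fun t => g (L - t)) (- d).
Proof.
move=> gd; apply: (is_derive_eq (isd_comp (isdD (isd_cst L t) (isdN (isd_id t))) gd)).
by rewrite add0r mulrN1.
Qed.

Lemma isd_fS (t : R) : is_derive t 1 fS (- f1 (L - t)).
Proof. exact: isd_reflect (isd_f gen _). Qed.

Lemma isd_fS1 (t : R) : is_derive t 1 (fun t => - f1 (L - t)) (f2 (L - t)).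
Proof.
by apply: (is_derive_eq (isdN (isd_reflect (isd_f1 gen (L - t))))); rewrite opprK.
Qed.

Lemma isd_LamS (t : R) : is_derive t 1 LamS (lS1 t).
Proof. exact: isd_reflect (isd_l gen _). Qed.

Lemma fS_odd t : fS (- t) = - fS t.
Proof. by rewrite /fS opprK (f_reflect gen). Qed.

Lemma LamS_even t : LamS (- t) = LamS t.
Proof. by rewrite /LamS opprK (Lam_reflect gen). Qed.

Lemma lS1_odd t : lS1 (- t) = - lS1 t.
Proof. by rewrite /lS1 opprK (l1_reflect gen). Qed.

(** The function f' is even about L because f is odd about L. *)
Lemma f2_L : f2 L = 0.
Proof.
have d1 t : - f1 (L - (- t)) = - f1 (L - t).
  have h := isd_comp (isdN (isd_id t)) (isd_fS (- t)).
  have e : (fun t => fS (- t)) = (fun t => - fS t) by apply/funext => u; rewrite fS_odd.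
  move: h; rewrite e => /isd_derive1; have /isd_derive1 -> := isdN (isd_fS t).
  by rewrite mulrN1 => /oppr_inj ->.
have h := isd_comp (isdN (isd_id 0)) (isd_fS1 (- 0)).
have e : (fun t => - f1 (L - (- t))) = (fun t => - f1 (L - t)) by apply/funext.
move: h; rewrite e => /isd_derive1; have /isd_derive1 -> := isd_fS1 0.
have z1 : L - 0 = L by rewrite subr0.
have z2 : L - - 0 = L by rewrite opprK addr0.
by rewrite z1 z2; move: (f2 L) => x hx; lra.
Qed.

Lemma fS_0 : fS 0 = 0. Proof. by rewrite /fS subr0 (f_L gen). Qed.
Lemma fS1_0 : - f1 (L - 0) = 1. Proof. by rewrite subr0 (generic_f'L gen) opprK. Qed.
Lemma fS2_0 : f2 (L - 0) = 0. Proof. by rewrite subr0 f2_L. Qed.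
Lemma lS1_0 : lS1 0 = 0. Proof. by rewrite /lS1 subr0 (l1_L gen) oppr0. Qed.

Lemma rho_eq0 (y : 'rV[R]_4) : rho y = 0 -> y 0 2 = 0 /\ y 0 3 = 0.
Proof.
move=> /eqP; rewrite sqrtr_eq0 le_eqVlt ltNge addr_ge0 ?sqr_ge0 // orbF.
by rewrite paddr_eq0 ?sqr_ge0 // !sqrf_eq0 => /andP[/eqP -> /eqP ->].
Qed.

Lemma chartN_HK (y : 'rV[R]_4) : rho y < L ->
  H (chart L PoleN y) = Hpole f y /\ K (chart L PoleN y) = Kpole Lam y.
Proof.
move=> yL; rewrite /Hpole /Kpole /chart; case: ifPn => [/eqP r0|r0].
  have [_ -> -> _] := pole_HK f Lam (y 0 0) (y 0 1) (or_introl (erefl (northM L))).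
  have [e2 e3] := rho_eq0 r0.
  by rewrite rcoord_north // r0 /q_phi e2 e3 !mul0r subrr add0r.
have hr : 0 < rho y < L by rewrite rho_gt0.
have [_ -> -> _] := HK_covector f Lam L_gt0 (q_rho y) (q_phi y) hr (rho_neq0 r0).
by [].
Qed.

Lemma chartS_HK (y : 'rV[R]_4) : rho y < L ->
  H (chart L PoleS y) = Hpole fS y /\ K (chart L PoleS y) = Kpole LamS y.
Proof.
move=> yL; rewrite /Hpole /Kpole /chart; case: ifPn => [/eqP r0|r0].
  have [_ -> -> _] := pole_HK f Lam (y 0 0) (y 0 1) (or_intror (erefl (southM L))).
  have [e2 e3] := rho_eq0 r0.
  by rewrite rcoord_south // r0 /q_phi e2 e3 !mul0r subrr add0r /LamS subr0.
have hr : 0 < L - rho y < L by rewrite subr_gt0 yL /= gtrBl rho_gt0.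
have [_ -> -> _] := HK_covector f Lam L_gt0 (- q_rho y) (q_phi y) hr (rho_neq0 r0).
by rewrite sqrrN.
Qed.

Definition pole_chart c := c = PoleN \/ c = PoleS.

Lemma dlocHK_pole c q0 q1 : pole_chart c ->
  dloc L H c (vec4 q0 q1 0 0) = vec4 q0 q1 0 0 /\
  dloc L K c (vec4 q0 q1 0 0) = vec4 0 0 q1 (- q0).
Proof.
case=> ->; split.
- exact: (dlocH_pole (isd_f gen) (isd_f1 gen) (generic_f_odd gen) (f_0 gen)
    (generic_f'0 gen) (f2_0 gen) L_gt0 (fun y h => (chartN_HK h).1)).
- exact: (dlocK_pole (isd_l gen) (generic_Lam_even gen) (l1_0 gen) L_gt0
    (fun y h => (chartN_HK h).2)).
- exact: (dlocH_pole isd_fS isd_fS1 fS_odd fS_0 fS1_0 fS2_0 L_gt0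
    (fun y h => (chartS_HK h).1)).
- exact: (dlocK_pole isd_LamS LamS_even lS1_0 L_gt0 (fun y h => (chartS_HK h).2)).
Qed.

Lemma twist_pole0 a b : twist L Lam PoleN (vec4 a b 0 0) = l2 0 /\
  twist L Lam PoleS (vec4 a b 0 0) = l2 L.
Proof. by rewrite /twist rho0 eqxx. Qed.

Lemma odd_norm (g : R -> R) u : (forall t, g (- t) = - g t) -> u != 0 ->
  g `|u| / `|u| * u = g u.
Proof.
move=> go u0; have [up|un] := leP 0 u; first by rewrite ger0_norm // divfK.
by rewrite ltr0_norm // go invrN mulrNN divfK.
Qed.

Lemma twistN_u (u : R) : twist L Lam PoleN (vec4 0 0 u 0) * u = l1 u /\
  twist L Lam PoleN (vec4 0 0 0 u) * u = l1 u.
Proof.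
rewrite /twist rho_u rho_v normr_eq0; have [->|u0] := eqVneq u 0.
  by rewrite mulr0 (l1_0 gen).
by rewrite (odd_norm (l1_odd gen)).
Qed.

Lemma twistS_u (u : R) : twist L Lam PoleS (vec4 0 0 u 0) * u = lS1 u /\
  twist L Lam PoleS (vec4 0 0 0 u) * u = lS1 u.
Proof.
rewrite /twist rho_u rho_v normr_eq0; have [->|u0] := eqVneq u 0.
  by rewrite mulr0 lS1_0.
by rewrite -[- l1 (L - `|u|)]/(lS1 `|u|) (odd_norm lS1_odd).
Qed.

Lemma linearization_north :
  linearization L Lam H PoleN (vec4 0 0 0 0) = AH (l2 0) /\
  linearization L Lam K PoleN (vec4 0 0 0 0) = AK.
Proof.
split.
  apply: (linearizationH_pole L_gt0 (fun a b => (twist_pole0 a b).1)).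
  - by move=> q0 q1; have [] := dlocHK_pole q0 q1 (or_introl (erefl PoleN)).
  - exact: (dlocH_u (generic_f_odd gen) (fun y h => (chartN_HK h).1)).
  - exact: (dlocH_v (generic_f_odd gen) (fun y h => (chartN_HK h).1)).
apply: (linearizationK_pole L_gt0 (fun a b => (twist_pole0 a b).1)
  (fun u _ => (twistN_u u).1) (fun u _ => (twistN_u u).2)).
- by move=> q0 q1; have [] := dlocHK_pole q0 q1 (or_introl (erefl PoleN)).
- exact: (dlocK_u (isd_l gen) (generic_Lam_even gen) (l1_0 gen) L_gt0 (fun y h => (chartN_HK h).2)).
- exact: (dlocK_v (isd_l gen) (generic_Lam_even gen) (l1_0 gen) L_gt0 (fun y h => (chartN_HK h).2)).
Qed.

Lemma linearization_south :
  linearization L Lam H PoleS (vec4 0 0 0 0) = AH (l2 L) /\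
  linearization L Lam K PoleS (vec4 0 0 0 0) = AK.
Proof.
split.
  apply: (linearizationH_pole L_gt0 (fun a b => (twist_pole0 a b).2)).
  - by move=> q0 q1; have [] := dlocHK_pole q0 q1 (or_intror (erefl PoleS)).
  - exact: (dlocH_u fS_odd (fun y h => (chartS_HK h).1)).
  - exact: (dlocH_v fS_odd (fun y h => (chartS_HK h).1)).
apply: (linearizationK_pole L_gt0 (fun a b => (twist_pole0 a b).2)
  (fun u _ => (twistS_u u).1) (fun u _ => (twistS_u u).2)).
- by move=> q0 q1; have [] := dlocHK_pole q0 q1 (or_intror (erefl PoleS)).
- exact: (dlocK_u isd_LamS LamS_even lS1_0 L_gt0 (fun y h => (chartS_HK h).2)).
- exact: (dlocK_v isd_LamS LamS_even lS1_0 L_gt0 (fun y h => (chartS_HK h).2)).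
Qed.

Lemma row3_0 : row3 0 0 0 = 0 :> 'rV[R]_3.
Proof. by apply: row3_ext; rewrite !mxE. Qed.

Lemma coords_zeroN : coords_at L (zeroN L) PoleN (vec4 0 0 0 0).
Proof. by split; [rewrite /chart rho0 eqxx !mxE /= row3_0 | rewrite !mxE]. Qed.

Lemma coords_zeroS : coords_at L (zeroS L) PoleS (vec4 0 0 0 0).
Proof. by split; [rewrite /chart rho0 eqxx !mxE /= row3_0 | rewrite !mxE]. Qed.

Lemma zero_center_center z : z = zeroN L \/ z = zeroS L ->
  nondegenerate0 L f Lam z /\ center_center L f Lam z.
Proof.
case=> ->.
  have [e1 e2] := linearization_north.
  have C := cartan_pole (l2_0 L_gt0 gen).
  have O0 : Omega L Lam PoleN (vec4 0 0 0 0) = OmegaP (l2 0).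
    by rewrite /Omega (twist_pole0 0 0).1.
  split; exists PoleN, (vec4 0 0 0 0); split; rewrite ?O0 /lin_span ?e1 ?e2 //.
  - exact: coords_zeroN.
  - exact: coords_zeroN.
  - exact: imaginary_pole.
have [e1 e2] := linearization_south.
have C := cartan_pole (l2_L L_gt0 gen).
have O0 : Omega L Lam PoleS (vec4 0 0 0 0) = OmegaP (l2 L).
  by rewrite /Omega (twist_pole0 0 0).2.
split; exists PoleS, (vec4 0 0 0 0); split; rewrite ?O0 /lin_span ?e1 ?e2 //.
- exact: coords_zeroS.
- exact: coords_zeroS.
- exact: imaginary_pole.
Qed.

Lemma zeroN_TM : TM L (zeroN L).
Proof.
have [h _ _ _] := pole_HK f Lam 0 0 (or_introl (erefl (northM L))).
by move: h; rewrite row3_0.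
Qed.

Lemma zeroS_TM : TM L (zeroS L).
Proof.
have [h _ _ _] := pole_HK f Lam 0 0 (or_intror (erefl (southM L))).
by move: h; rewrite row3_0.
Qed.

Lemma zeroN_neq_zeroS : zeroN L <> zeroS L.
Proof. by move=> [] /(north_neq_south L_gt0). Qed.

Lemma dlocK_cyl_neq0 (p q r phi : R) : 0 < r < L ->
  dloc L K Cyl (vec4 p q r phi) != 0.
Proof.
move=> hr; rewrite (dlocK_cyl L_gt0 gen _ _ _ hr); apply/eqP => /rowP/(_ 1).
by rewrite !mxE /= => /eqP; rewrite oner_eq0.
Qed.

(** In cylindrical coordinates dK has the component 1 along p_phi and never vanishes. Over a pole dH
    = (q0, q1, 0, 0), which vanishes for the zero covector only. *)
Lemma rank0E : rank0 L f Lam = [set zeroN L; zeroS L].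
Proof.
rewrite eqEsubset; split => [z [_ [c [y [cy]]]]|z].
  move/eqP; rewrite mxrank_eq0 col_mx_eq0 => /andP[/eqP dH /eqP dK].
  case: (coords_cases cy) => [[ec [hy _]]|[ec [ey zE]]|[ec [ey zE]]]; subst c.
  - have := dlocK_cyl_neq0 (y 0 0) (y 0 1) (y 0 3) hy.
    by rewrite -vec4E dK eqxx.
  - have [h _] := dlocHK_pole (y 0 0) (y 0 1) (or_introl (erefl PoleN)).
    rewrite -ey dH in h; left; rewrite /= zE.
    have -> : y 0 0 = 0 by have /rowP/(_ 0) := h; rewrite !mxE /= => <-.
    have -> : y 0 1 = 0 by have /rowP/(_ 1) := h; rewrite !mxE /= => <-.
    by rewrite row3_0.
  - have [h _] := dlocHK_pole (y 0 0) (y 0 1) (or_intror (erefl PoleS)).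
    rewrite -ey dH in h; right; rewrite /= zE.
    have -> : y 0 0 = 0 by have /rowP/(_ 0) := h; rewrite !mxE /= => <-.
    have -> : y 0 1 = 0 by have /rowP/(_ 1) := h; rewrite !mxE /= => <-.
    by rewrite row3_0.
have r0 c : pole_chart c -> \rank (col_mx (dloc L H c (vec4 0 0 0 0)) (dloc L K c (vec4 0 0 0
    0))) = 0%N.
  move=> pc; apply/eqP; rewrite mxrank_eq0 col_mx_eq0.
  have [-> ->] := dlocHK_pole 0 0 pc.
  by apply/andP; split; apply/eqP/rowP; apply: ord4P; rewrite !mxE //= oppr0.
case=> ->; split.
- exact: zeroN_TM.
- by exists PoleN, (vec4 0 0 0 0); split; [exact: coords_zeroN | apply: r0; left].
- exact: zeroS_TM.
- by exists PoleS, (vec4 0 0 0 0); split; [exact: coords_zeroS | apply: r0; right].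
Qed.

Lemma rank_col_eq1 (u v : 'rV[R]_4) : v != 0 -> \rank (col_mx u v) = 1%N ->
  exists a, u = a *: v.
Proof.
move=> v0; rewrite -addsmxE => r1.
have : (v == u + v)%MS.
  rewrite -(mxrank_leqif_eq (addsmxSr u v)) r1 rank_rV v0.
  by [].
move=> /andP[_ s]; apply/sub_rVP; exact: submx_trans (addsmxSl u v) s.
Qed.

Lemma rank1_circle r kappa : 0 < r < L -> critical_q f Lam r (kappa - Lam r) ->
  O r kappa `<=` rank1 L f Lam.
Proof.
move=> hr cq z Oz; split; first by have [] := circle_HK f L_gt0 hr Oz.
have [phi cz] := circle_has_coords hr Oz.
exists Cyl, (vec4 0 (kappa - Lam r) r phi); split => //.
have := critical_combination L_gt0 gen phi hr cq.
rewrite scale1r scaleNr => /eqP; rewrite subr_eq0 => /eqP ->.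
by apply: rank_parallel; exact: dlocK_cyl_neq0.
Qed.

(** Over a pole dH has only momentum components and dK only position components, both given by (q0,
    q1): the rank is 0 or 2. *)
Lemma pole_rank (q0 q1 : R) :
  \rank (col_mx (vec4 q0 q1 0 0) (vec4 0 0 q1 (- q0))) <> 1%N.
Proof.
have z4 : vec4 0 0 0 0 = 0 :> 'rV[R]_4 by apply/rowP; apply: ord4P; rewrite !mxE.
have [v0|v0] := eqVneq (vec4 0 0 q1 (- q0)) 0.
  have e1 : q1 = 0 by have /rowP/(_ 2) := v0; rewrite !mxE.
  have e0 : q0 = 0.
    by have /rowP/(_ 3) := v0; rewrite !mxE /= => /eqP; rewrite oppr_eq0 => /eqP.
  by rewrite e0 e1 oppr0 z4 col_mx0 mxrank0.
move=> /(rank_col_eq1 v0)[a aE]; case/eqP: v0.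
have e0 : q0 = 0 by have /rowP/(_ 0) := aE; rewrite !mxE /= mulr0.
have e1 : q1 = 0 by have /rowP/(_ 1) := aE; rewrite !mxE /= mulr0.
by rewrite e0 e1 oppr0 z4.
Qed.

Lemma rank1_inv z : rank1 L f Lam z -> exists r kappa,
  [/\ 0 < r < L, O r kappa z & critical_q f Lam r (kappa - Lam r)].
Proof.
move=> [_ [c [y [cy rk]]]].
case: (coords_cases cy) => [[ec [hy zE]]|[ec [ey zE]]|[ec [ey zE]]]; subst c.
- have [a aE] := rank_col_eq1 (dlocK_cyl_neq0 (y 0 0) (y 0 1) (y 0 3) hy)
    (etrans (congr1 (fun v => \rank (col_mx (dloc L H Cyl v) (dloc L K Cyl v))) (esym (vec4E y)))
        rk).
  rewrite (dlocH_cyl L_gt0 gen _ _ _ hy) (dlocK_cyl L_gt0 gen _ _ _ hy) in aE.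
  have f0 := f_neq0 gen hy.
  have a0 : y 0 0 = 0 by have /rowP/(_ 0) := aE; rewrite !mxE /= mulr0.
  have a1 : y 0 1 / f (y 0 2) ^+ 2 = a by have /rowP/(_ 1) := aE; rewrite !mxE /= mulr1.
  have a2 := congr1 (fun M : 'rV[R]_4 => M 0 2) aE; rewrite !mxE /= -a1 in a2.
  exists (y 0 2), (y 0 1 + Lam (y 0 2)); split => //.
    rewrite (circle_orbitE _ _ hy); exists (y 0 3); rewrite zE /chart !mxE /= a0 addrK.
    by [].
  rewrite addrK /critical_q.
  have -> : y 0 1 * (y 0 1 * f1 (y 0 2) + f (y 0 2) * l1 (y 0 2)) =
     f (y 0 2) ^+ 3 * (y 0 1 / f (y 0 2) ^+ 2 * l1 (y 0 2) +
        y 0 1 ^+ 2 * f1 (y 0 2) / f (y 0 2) ^+ 3).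
    by clear aE a2 rk; move: (y 0 1) => q; jfield.
  by rewrite -a2 addNr mulr0.
- have [h1 h2] := dlocHK_pole (y 0 0) (y 0 1) (or_introl (erefl PoleN)).
  by rewrite ey h1 h2 in rk; case: (pole_rank rk).
- have [h1 h2] := dlocHK_pole (y 0 0) (y 0 1) (or_intror (erefl PoleS)).
  by rewrite ey h1 h2 in rk; case: (pole_rank rk).
Qed.

Lemma Ireg_f1 r : 0 < r < L -> Ireg L f r <-> f1 r != 0.
Proof.
move=> /andP[r0 rL]; have hr : 0 <= r <= L by rewrite !ltW.
split=> [[_ n]|F]; first by apply/eqP => F; apply: n.
by split => // -[_ e]; rewrite e eqxx in F.
Qed.

Lemma rank1E : rank1 L f Lam =
  (\bigcup_(r in Ireg L f `&` `]0, L[) O r (k r)) `|` (\bigcup_(r in `]0, L[) O r (Lam r)).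
Proof.
rewrite eqEsubset; split=> [z /rank1_inv[r [kappa [hr Oz cq]]]|z].
  case: (critical_qE gen hr cq) => [/eqP|[F /addIr e]].
    by rewrite subr_eq0 => /eqP e; right; exists r; rewrite -?e //= in_itv.
  by left; exists r; rewrite -?e //; split; [exact/Ireg_f1 | rewrite /= in_itv].
case=> -[r] /=; rewrite in_itv /=.
  by move=> [Ir hr]; apply: rank1_circle => //; apply: critical_k; exact/Ireg_f1.
by move=> hr; apply: rank1_circle => //; exact: critical_Lam.
Qed.

End RankSets.

(** * Types of the critical circles, degenerate circles and saddle atoms *)

Section Assembly.
Context {R : realType}.
Variables (L : R) (f Lam : R -> R).
Hypotheses (L_gt0 : 0 < L) (gen : generic L f Lam).

Local Notation f1 := (f^`()).
Local Notation l1 := (Lam^`()).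
Local Notation O := (circle_orbit L Lam).
Local Notation a := (afun f Lam).
Local Notation h := (hfun f Lam).
Local Notation k := (kfun f Lam).
Local Notation sgn := (sgn_type f Lam).
Local Notation da := (da f Lam).

Lemma circle_k_type r : 0 < r < L -> f1 r != 0 ->
  [/\ O r (k r) `<=` nondegenerate1 L f Lam <-> sgn r != 0,
      O r (k r) `<=` elliptic L f Lam <-> 0 < sgn r &
      O r (k r) `<=` hyperbolic L f Lam <-> sgn r < 0].
Proof.
move=> hr F; have [n e hy] := circle_type_all L_gt0 gen hr (critical_k Lam F).
have f2 : 0 < (f r ^+ 2)^-1 by rewrite invr_gt0 exprn_even_gt0 // (f_neq0 gen).
rewrite (discr_k gen hr F) in n e hy.
rewrite oppr_eq0 mulf_eq0 (gt_eqF f2) orbF in n.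
by rewrite oppr_lt0 pmulr_lgt0 // in e; rewrite oppr_gt0 pmulr_llt0 // in hy.
Qed.

Lemma circle_Lam_type r : 0 < r < L ->
  (O r (Lam r) `<=` nondegenerate1 L f Lam <-> l1 r != 0) /\
  (O r (Lam r) `<=` nondegenerate1 L f Lam -> O r (Lam r) `<=` elliptic L f Lam).
Proof.
move=> hr; have [n e _] := circle_type_all L_gt0 gen hr (critical_Lam f Lam r).
rewrite (discr_Lam gen hr) in n e.
have d : (- (l1 r / f r) ^+ 2 != 0) = (l1 r != 0).
  by rewrite oppr_eq0 expf_eq0 /= mulf_eq0 invr_eq0 (negbTE (f_neq0 gen hr)) orbF.
rewrite d in n; split => // /n l10; apply/e.
by rewrite oppr_lt0 exprn_even_gt0 // mulf_neq0 // invr_eq0 (f_neq0 gen).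
Qed.

Lemma nondegenerate_set r : 0 < r < L -> f1 r != 0 ->
  sgn r != 0 <-> (Ireg L f `\` (crit L Lam `|` infl L f Lam)) r.
Proof.
move=> hr F; have f0 := f_neq0 gen hr.
have hr' : 0 <= r <= L by case/andP: hr => h1 h2; rewrite !ltW.
rewrite (sgn_typeE gen F) !mulf_eq0 invr_eq0 expf_eq0 /= (negbTE f0) (negbTE F) /= orbF.
rewrite negb_or; split.
  move=> /andP[W0 l10]; split; first by apply/(Ireg_f1 _ hr).
  by case=> [[_ e]|[_ e]]; [move: l10 | move: W0]; rewrite e eqxx.
move=> [_ n]; apply/andP; split; apply/eqP => e; apply: n.
  by right.
by left.
Qed.

Lemma circle_k_summary r : Ireg L f r -> 0 < r < L ->
  [/\ O r (k r) `<=` nondegenerate1 L f Lam <-> k^`() r * l1 r != 0,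
      k^`() r * l1 r != 0 <-> (Ireg L f `\` (crit L Lam `|` infl L f Lam)) r &
      O r (k r) `<=` nondegenerate1 L f Lam ->
      [/\ O r (k r) `<=` elliptic L f Lam <-> 0 < sgn r,
          O r (k r) `<=` hyperbolic L f Lam <-> sgn r < 0,
          forall phi, Num.sg (gauss_curvature (revolution f Lam) r phi)
                      = Num.sg (sgn r) &
          forall phi, Num.sg (gauss_curvature (revolution a k) r phi)
                      = Num.sg (sgn r)]].
Proof.
move=> Ir hr; have F : f1 r != 0 by apply/(Ireg_f1 _ hr).
have [n e hy] := circle_k_type hr F.
have d : (k^`() r * l1 r != 0) = (sgn r != 0) by rewrite /sgn_type mulNr oppr_eq0.
rewrite d; split => //; first exact: nondegenerate_set.
move=> /n s0; split => // phi; first exact: (gauss_fl gen).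
exact: (gauss_ak gen).
Qed.

Lemma nondegenerate_setE : Ireg L f `\` (crit L Lam `|` infl L f Lam) =
  [set r | 0 <= r <= L] `\` (crit L f `|` crit L Lam `|` infl L f Lam).
Proof. by rewrite -setUA /Ireg setDDl. Qed.

Lemma rank1_circle_crit r kappa z : 0 < r < L -> O r kappa z -> rank1 L f Lam z ->
  critical_q f Lam r (kappa - Lam r).
Proof.
move=> hr Oz /(rank1_inv L_gt0 gen)[r' [kappa' [hr1 Oz' cq]]].
have [_ _ Kz rz] := circle_HK f L_gt0 hr Oz.
have [_ _ Kz' rz'] := circle_HK f L_gt0 hr1 Oz'.
by rewrite -rz -Kz rz' Kz'.
Qed.

(** A degenerate circle of the family kappa = Lam r has Lam' = 0, and there Lam r = k r, so it
    belongs to the other family too. *)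
Lemma degenerate_circles r kappa : 0 < r < L ->
  (O r kappa `<=` rank1 L f Lam /\ ~ O r kappa `<=` nondegenerate1 L f Lam) <->
  ((crit L Lam `|` infl L f Lam) r /\ kappa = k r).
Proof.
move=> hr; have hr' : 0 <= r <= L by case/andP: hr => h1 h2; rewrite !ltW.
split.
  move=> [r1 nd]; have [z Oz] := circle_nonempty Lam kappa hr.
  have cq := rank1_circle_crit hr Oz (r1 z Oz).
  case: (critical_qE gen hr cq) => [/eqP|[F /addIr e]].
    rewrite subr_eq0 => /eqP e; subst kappa.
    have [n _] := circle_Lam_type hr.
    have [l10|l10] := eqVneq (l1 r) 0; last by case: nd; apply/n.
    by split; [left | rewrite /kfun l10 mul0r mulr0 subr0].
  subst kappa; split => //; have [n _ _] := circle_k_type hr F.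
  apply: contrapT => m; apply: nd; apply/n/(nondegenerate_set hr F).
  by split => //; apply/(Ireg_f1 _ hr).
move=> [cr ->].
have F : f1 r != 0 by case: cr => [/(crit_l_f1 gen)|/(infl_f1 gen)].
split; first by apply: (rank1_circle L_gt0 gen hr); exact: critical_k.
by have [n _ _] := circle_k_type hr F; move=> /n /(nondegenerate_set hr F)[_].
Qed.

Lemma crit_l_horizontal :
  crit L Lam = [set r | 0 <= r <= L /\ horizontal_tangent f Lam r].
Proof.
rewrite eqEsubset; split=> r [hr].
  by move=> e; split => //; split => //; exact: (regular_fl gen).
by case.
Qed.

Lemma infl_inflection :
  infl L f Lam = [set r | 0 <= r <= L /\ inflection f Lam r].
Proof.
rewrite eqEsubset; split=> r.
  move=> ir; have [[i1 _] _ _ _ _] := infl_forms gen ir.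
  by case: ir.
move=> [hr [_ e _]]; split => //; move: e; rewrite /wronsk [l1 r * _]mulrC.
by [].
Qed.

(* hs > 0 rules out the family kappa = Lam r. *)
Lemma saddle_circle rho hs ks z : 0 < rho < L -> 0 < hs ->
  O rho ks `<=` rank1 L f Lam `&` hyperbolic L f Lam ->
  momentum L f Lam z = (hs, ks) -> O rho ks `<=` fibre (TM L) (momentum L f Lam) z ->
  [/\ f1 rho != 0, k rho = ks, h rho = hs & sgn rho < 0].
Proof.
move=> hr hs0 Orh Fz Of; have [y Oy] := circle_nonempty Lam ks hr.
have [_ Hy _ _] := circle_HK f L_gt0 hr Oy.
have f0 := f_neq0 gen hr.
have Fy : momentum L f Lam y = (hs, ks).
  by have := connected_component_sub (Of y Oy); rewrite /= Fz => -[_ <-].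
have hE : (ks - Lam rho) ^+ 2 / (2 * f rho ^+ 2) = hs by case: Fy => <- _; rewrite Hy.
have [r1 hy] := Orh y Oy.
have cq := rank1_circle_crit hr Oy r1.
case: (critical_qE gen hr cq) => [e|[F /addIr e]].
  by move: hs0; rewrite -hE e expr0n mul0r ltxx.
have [_ _ hyp] := circle_k_type hr F.
split => //; last by apply/hyp; rewrite -e => ? /Orh[].
rewrite -hE e /hfun /kfun /afun.
by clear hE e Fy; gen_jets; field; apply/andP.
Qed.

Lemma saddle_forms rho1 rho2 hs ks :
  let s := fun r => - Num.sg (a r) in
  let w := Num.sqrt (2 * hs) in
  0 < rho1 < L -> 0 < rho2 < L -> rho1 < rho2 -> 0 < hs ->
  O rho1 ks `<=` rank1 L f Lam `&` hyperbolic L f Lam ->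
  O rho2 ks `<=` rank1 L f Lam `&` hyperbolic L f Lam ->
  (exists z, [/\ TM L z, momentum L f Lam z = (hs, ks) &
     O rho1 ks `|` O rho2 ks `<=` fibre (TM L) (momentum L f Lam) z]) ->
  [/\ forall rho, rho = rho1 \/ rho = rho2 ->
        [/\ s rho = 1 \/ s rho = -1,
            h rho = hs /\ k rho = ks,
            h^`() rho / k^`() rho = s rho * w / f rho /\
              Num.sg (h^`() rho / k^`() rho) = s rho,
            regular f Lam rho /\
              tangent_line f Lam rho =
              [set P : R * R | P.2 = ks - s rho * w * P.1] &
            [/\ \forall r \near rho, `|Lam r - ks| <= w * f r,
                s rho = 1 -> Lam rho - ks = - (w * f rho) &
                s rho = -1 -> Lam rho - ks = w * f rho]],
      s rho1 = s rho2 ->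
        tangent_line f Lam rho1 = tangent_line f Lam rho2 /\
        (a rho1, k rho1) = (a rho2, k rho2) &
      s rho1 <> s rho2 ->
        [/\ tangent_line f Lam rho2 =
              [set P : R * R | tangent_line f Lam rho1 (- P.1, P.2)],
            (a rho1, k rho1) = (- s rho1 * w, ks) &
            (a rho2, k rho2) = (- s rho2 * w, ks)]].
Proof.
move=> s w h1 h2 _ hs0 O1 O2 [z [_ Fz Oz]].
have S rho : rho = rho1 \/ rho = rho2 ->
    [/\ 0 < rho < L, f1 rho != 0, k rho = ks, h rho = hs & sgn rho < 0].
  have Oz1 : O rho1 ks `<=` fibre (TM L) (momentum L f Lam) z.
    by move=> y Oy; apply: Oz; left.
  have Oz2 : O rho2 ks `<=` fibre (TM L) (momentum L f Lam) z.
    by move=> y Oy; apply: Oz; right.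
  case=> ->; first by have [] := saddle_circle h1 hs0 O1 Fz Oz1; split.
  by have [] := saddle_circle h2 hs0 O2 Fz Oz2; split.
have w0 : 0 < w by rewrite sqrtr_gt0 mulr_gt0.
have A rho : rho = rho1 \/ rho = rho2 ->
    [/\ s rho = 1 \/ s rho = -1, a rho = - s rho * w & w = `|a rho|].
  move=> /S[hr F ke he sn].
  have wE : w = `|a rho| by rewrite /w -he /hfun mulrC divfK // sqrtr_sqr.
  have a0 : a rho != 0 by rewrite -normr_eq0 -wE gt_eqF.
  rewrite /s; split => //; last by rewrite opprK wE -numEsg.
  by have [an|ap|/eqP] := ltgtP (a rho) 0; [left; rewrite ltr0_sg ?opprK | right; rewrite gtr0_sg
      | rewrite (negbTE a0)].
have T rho : rho = rho1 \/ rho = rho2 ->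
    tangent_line f Lam rho = [set P : R * R | P.2 = ks - s rho * w * P.1].
  move=> e; have [hr F ke he sn] := S rho e; have [_ aE _] := A rho e.
  by rewrite (tangent_lineE F aE) ke.
split.
- move=> rho e; have [hr F ke he sn] := S rho e; have [s1 aE wE] := A rho e.
  have f0 := f_gt0 gen hr; have fn := lt0r_neq0 f0.
  have d0 : da rho != 0.
    by apply: contraTN sn => /eqP d0; rewrite (sgn_type_da gen F) d0 mulr0 mul0r ltxx.
  have [kd _ _] := derive_k gen F; have [hd _ _] := derive_h gen F.
  have q : h^`() rho / k^`() rho = s rho * w / f rho.
    rewrite kd hd aE; move: (da rho) d0 (s rho) => x x0 y.
    by field; apply/andP.
  have LE : Lam rho - ks = - s rho * w * f rho.
    by rewrite -aE -ke /kfun -/(a rho) opprB addrC subrK mulrC.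
  split => //.
  + have fi : 0 < (f rho)^-1 by rewrite invr_gt0.
    split => //; rewrite q !sgrM (gtr0_sg w0) (gtr0_sg fi) !mulr1.
    by case: s1 => ->; rewrite ?sgrN sgr1.
  + split; last exact: T.
    by apply: (regular_fl gen); case/andP: hr => r0 rL; rewrite !ltW.
  + split.
    * by rewrite -ke; exact: (hyperbolic_sector gen hr F sn wE).
    * by move=> s2; rewrite LE s2 mulN1r mulNr.
    * by move=> s2; rewrite LE s2 opprK mul1r.
- move=> ss; rewrite !T ?ss; [|by right|by left].
  have [_ _ -> _ _] := S rho1 (or_introl erefl).
  have [_ _ -> _ _] := S rho2 (or_intror erefl).
  have [_ -> _] := A rho1 (or_introl erefl).
  by have [_ -> _] := A rho2 (or_intror erefl); rewrite ss.
- move=> ss; have [_ _ k1 _ _] := S rho1 (or_introl erefl).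
  have [_ _ k2 _ _] := S rho2 (or_intror erefl).
  have [s1 a1 _] := A rho1 (or_introl erefl).
  have [s2 a2 _] := A rho2 (or_intror erefl).
  have sN : s rho2 = - s rho1.
    case: s1 s2 => [e1|e1] [e2|e2]; rewrite e1 e2 ?opprK //.
      by case: ss; rewrite e1 e2.
    by case: ss; rewrite e1 e2.
  split; [|by rewrite k1 a1|by rewrite k2 a2].
  rewrite !T; [|by left|by right]; apply/seteqP; split => -[x y] /= ->.
    by rewrite sN; ring.
  by rewrite sN; ring.
Qed.

End Assembly.

(** * The phase space over [0, L] *)

Section PhaseSpaceParametrization.
Context {R : realType}.
Variables (L : R) (f Lam : R -> R).
Hypotheses (L_gt0 : 0 < L) (gen : generic L f Lam).

Local Notation H := (Hfun L f).
Local Notation K := (Kfun L Lam).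
Local Notation TM := (TM L).
Local Notation S0 := (rad0 L).

(* At r = 0 and r = L, where sin vanishes, [covector_at] is the covector a (cos phi, sin phi)
   up to sign, since division by 0 gives 0. *)
Definition lift kappa r phi a : phase :=
  covector_at L r (cos phi) (sin phi) a (kappa - Lam r).

(** Over a pole p_phi = 0, so the only value of K there is that of Lam. *)
Definition allowed kappa r := [/\ 0 <= r <= L, r = 0 -> kappa = Lam 0 & r = L -> kappa = Lam L].

Lemma allowed_in kappa r : 0 < r < L -> allowed kappa r.
Proof.
move=> /andP[r0 rL]; split; first by rewrite !ltW.
  by move=> e; rewrite e ltxx in r0.
by move=> e; rewrite e ltxx in rL.
Qed.

Lemma itv_cases r : 0 <= r <= L -> [\/ r = 0, r = L | 0 < r < L].
Proof.
case/andP; rewrite !le_eqVlt => /orP[/eqP<-|r0] /orP[/eqP|rL] //.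
- by constructor 2.
- by constructor 1.
- by constructor 2.
- by constructor 3; rewrite r0.
Qed.

Lemma LdivS0 : L / S0 = pi.
Proof. by rewrite /rad0 invf_div mulrCA divff ?mulr1 // gt_eqF. Qed.

Lemma sin_colatitude_gt0 r : 0 < r < L -> 0 < sin (r / S0).
Proof.
move=> /andP[r0 rL]; rewrite sin_gt0_pi // divr_gt0 ?rad0_gt0 //=.
by rewrite -LdivS0 ltr_pM2r // invr_gt0 rad0_gt0.
Qed.

Lemma lift_pole kappa r phi a : r = 0 \/ r = L ->
  lift kappa r phi a = (if r == 0 then northM L else southM L,
    row3 (cos (r / S0) * (a * cos phi)) (cos (r / S0) * (a * sin phi)) 0).
Proof.
have Ln : L == 0 = false by rewrite gt_eqF.
case=> ->; rewrite ?eqxx ?Ln /lift /covector_at ?LdivS0 ?mul0r ?cos0 ?sin0 ?cospi ?sinpi.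
  by congr pair; apply: row3_ext; rewrite !mxE /=; ring.
by congr pair; apply: row3_ext; rewrite !mxE /=; ring.
Qed.

Lemma lift_TM kappa r phi a : allowed kappa r ->
  [/\ TM (lift kappa r phi a),
      H (lift kappa r phi a) = a ^+ 2 / 2 + (kappa - Lam r) ^+ 2 / (2 * f r ^+ 2),
      K (lift kappa r phi a) = kappa & rcoord L (lift kappa r phi a) = r].
Proof.
move=> [hr k0 kL]; case: (itv_cases hr) => [rE|rE|hr'].
- rewrite (lift_pole _ _ _ (or_introl rE)) rE eqxx mul0r cos0 !mul1r.
  have [h1 -> -> _] := pole_HK f Lam (a * cos phi) (a * sin phi) (or_introl (erefl (northM L))).
  rewrite (rcoord_north L_gt0) (k0 rE); split=> //.
  by rewrite !exprMn -mulrDr cos2Dsin2 mulr1 subrr expr0n mul0r addr0.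
- rewrite (lift_pole _ _ _ (or_intror rE)) rE gt_eqF // LdivS0 cospi !mulN1r.
  have [h1 -> -> _] := pole_HK f Lam (- (a * cos phi)) (- (a * sin phi)) (or_intror (erefl
      (southM L))).
  rewrite (rcoord_south L_gt0) (kL rE); split=> //.
  by rewrite !sqrrN !exprMn -mulrDr cos2Dsin2 mulr1 subrr expr0n mul0r addr0.
- have [h1 h2 h3 h4] := HK_covector f Lam L_gt0 a (kappa - Lam r) hr' (cos2Dsin2 phi).
  by split=> //; rewrite h3 subrK.
Qed.

Lemma TM_rcoord z : TM z -> 0 <= rcoord L z <= L.
Proof.
move=> [z1 _]; have S := rad0_gt0 L_gt0.
have x2 : -1 <= z.1 0 2 / S0 <= 1.
  rewrite -ler_norml -(expr_le1 (n := 2)) // real_normK ?num_real // expr_div_n.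
  rewrite ler_pdivrMr ?exprn_gt0 // mul1r -z1 dot3E -!expr2.
  by rewrite lerDr addr_ge0 ?sqr_ge0.
rewrite /rcoord mulr_ge0 ?(ltW S) ?acos_ge0 //=.
by rewrite mulrC -ler_pdivlMr // LdivS0 acos_lepi.
Qed.

Lemma cos_rcoord z : TM z -> z.1 0 2 = S0 * cos (rcoord L z / S0).
Proof.
move=> [z1 _]; have S := rad0_gt0 L_gt0; have S1 := rad0_neq0 L_gt0.
have x2 : -1 <= z.1 0 2 / S0 <= 1.
  rewrite -ler_norml -(expr_le1 (n := 2)) // real_normK ?num_real // expr_div_n.
  rewrite ler_pdivrMr ?exprn_gt0 // mul1r -z1 dot3E -!expr2.
  by rewrite lerDr addr_ge0 ?sqr_ge0.
by rewrite /rcoord [S0 * acos _]mulrC mulfK // acosK ?in_itv // mulrC divfK.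
Qed.

Lemma polar2 (x y : R) : exists phi, exists2 a, x = a * cos phi /\ y = a * sin phi & 0 <= a.
Proof.
have a0 := sqrtr_ge0 (x ^+ 2 + y ^+ 2).
have aE : Num.sqrt (x ^+ 2 + y ^+ 2) ^+ 2 = x ^+ 2 + y ^+ 2 by rewrite sqr_sqrtr // addr_ge0
    ?sqr_ge0.
move: (Num.sqrt _) a0 aE => a a0 aE.
have [az|az] := eqVneq a 0.
  have : x ^+ 2 + y ^+ 2 == 0 by rewrite -aE az expr0n.
  rewrite paddr_eq0 ?sqr_ge0 // !sqrf_eq0 => /andP[/eqP-> /eqP->].
  by exists 0, 0 => //; rewrite !mul0r.
have [|phi [c s]] := @polar _ (x / a) (y / a).
  by rewrite !expr_div_n -mulrDl -aE divff // sqrf_eq0.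
by exists phi, a => //; rewrite -c -s mulrC divfK // mulrC divfK.
Qed.

Lemma TM_pole z : TM z -> rcoord L z = 0 \/ rcoord L z = L ->
  z.1 = (if rcoord L z == 0 then northM L else southM L) /\ z.2 0 2 = 0.
Proof.
move=> Tz rz; have S := rad0_gt0 L_gt0; have S1 := rad0_neq0 L_gt0.
have x2 := cos_rcoord Tz; case: Tz; rewrite !dot3E => z1 z2.
have [cE c2] : cos (rcoord L z / S0) = (if rcoord L z == 0 then 1 else -1)
    /\ cos (rcoord L z / S0) ^+ 2 = 1.
  by case: rz => ->; rewrite ?eqxx ?mul0r ?cos0 ?expr1n ?gt_eqF // LdivS0 cospi sqrrN expr1n.
have [x0 x1] : z.1 0 0 = 0 /\ z.1 0 1 = 0.
  have : z.1 0 0 ^+ 2 + z.1 0 1 ^+ 2 == 0.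
    rewrite -(subr_eq0 _ 0) subr0; apply/eqP; apply: (addIr (z.1 0 2 * z.1 0 2)).
    by rewrite add0r !expr2 z1 -[LHS]mulr1 -c2 x2; ring.
  by rewrite paddr_eq0 ?sqr_ge0 // !sqrf_eq0 => /andP[/eqP-> /eqP->].
split.
  apply: row3_ext; rewrite ?x0 ?x1 ?x2 ?cE; case: ifP => _; rewrite !mxE //= ?mulr1 //.
  by rewrite mulrN1.
move: z2; rewrite x0 x1 !mul0r !add0r => /eqP; rewrite mulf_eq0 x2 mulf_eq0 (negbTE S1) /=.
by case/orP => /eqP // c0; move: c2; rewrite c0 expr0n => /esym/eqP; rewrite oner_eq0.
Qed.

(** With this, every point of T^*M, over a pole or not, is handled by one formula. Off the poles a
    is p_r. *)
Lemma TM_lift z : TM z -> exists phi a, z = lift (K z) (rcoord L z) phi a /\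
  allowed (K z) (rcoord L z).
Proof.
move=> Tz; have hr := TM_rcoord Tz.
have S := rad0_gt0 L_gt0; have S1 := rad0_neq0 L_gt0.
case: (itv_cases hr) => rz.
- have [zM z2] := TM_pole Tz (or_introl rz).
  have [phi [a [x y] _]] := polar2 (z.2 0 0) (z.2 0 1).
  have Kz : K z = Lam 0.
    by rewrite /Kfun /p_phi zM rz eqxx !mxE /= !mul0r subrr add0r.
  exists phi, a; rewrite (lift_pole _ _ _ (or_introl rz)) -zM rz Kz mul0r cos0 !mul1r.
  split; last by split; [rewrite lexx ltW | | move=> <-].
  by rewrite {1}[z]surjective_pairing; congr pair; apply: row3_ext; rewrite !mxE /=.
- have [zM z2] := TM_pole Tz (or_intror rz).
  have [phi [a [x y] _]] := polar2 (- z.2 0 0) (- z.2 0 1).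
  have Kz : K z = Lam L.
    by rewrite /Kfun /p_phi zM rz gt_eqF // !mxE /= !mul0r subrr add0r.
  exists phi, a; rewrite (lift_pole _ _ _ (or_intror rz)) -zM rz Kz LdivS0 cospi !mulN1r.
  split; last by split; [rewrite lexx ltW | move=> e; congr Lam | ].
  rewrite {1}[z]surjective_pairing -x -y !opprK.
  by congr pair; apply: row3_ext; rewrite !mxE /=.
- have sg := sin_colatitude_gt0 rz; have sn := lt0r_neq0 sg.
  have x2 := cos_rcoord Tz; case: Tz; rewrite !dot3E => z1 z2.
  rewrite /lift /covector_at /Kfun addrK.
  have e2 := cos2Dsin2 (rcoord L z / S0); move: (rcoord L z) rz x2 sg sn e2 {hr} => r hr.
  move: (sin _) (cos _) => sn cs x2 sg s0 e2.
  have [|phi [c s]] := @polar _ (z.1 0 0 / (S0 * sn)) (z.1 0 1 / (S0 * sn)).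
    rewrite !expr_div_n -mulrDl; have -> : z.1 0 0 ^+ 2 + z.1 0 1 ^+ 2 = (S0 * sn) ^+ 2.
      rewrite !expr2; apply: (addIr (z.1 0 2 * z.1 0 2)); rewrite z1 x2.
      by rewrite -[LHS]mulr1 -e2; ring.
    by rewrite divff // sqrf_eq0 mulf_neq0.
  have x0 : z.1 0 0 = S0 * sn * cos phi by rewrite -c; field; rewrite S1 s0.
  have x1 : z.1 0 1 = S0 * sn * sin phi by rewrite -s; field; rewrite S1 s0.
  have cs1 := cos2Dsin2 phi; 
  exists phi.
  move: (cos phi) (sin phi) x0 x1 cs1 {c s} => c s x0 x1 cs1.
  (* Orthogonality of the covector to the base point, divided by the radius. *)
  have orth : sn * (c * z.2 0 0 + s * z.2 0 1) + cs * z.2 0 2 = 0.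
    apply: (mulfI S1); rewrite mulr0 -z2 x0 x1 x2; ring.
  pose A := c * z.2 0 0 + s * z.2 0 1.
  (* This is the component of the covector along d/dr; by [orth] the pair (A, z.2 0 2) is this
     number times (cs, - sn). *)
  exists (cs * A - sn * z.2 0 2); split; last exact: allowed_in.
  have aA : cs * (cs * A - sn * z.2 0 2) = A.
    by transitivity (A * (cs ^+ 2 + sn ^+ 2) - sn * (sn * A + cs * z.2 0 2));
      [ring | rewrite e2 orth mulr0 subr0 mulr1].
  have aB : sn * (cs * A - sn * z.2 0 2) = - z.2 0 2.
    by transitivity (cs * (sn * A + cs * z.2 0 2) - z.2 0 2 * (cs ^+ 2 + sn ^+ 2));
      [ring | rewrite e2 orth mulr0 sub0r mulr1].
  rewrite {1}[z]surjective_pairing; congr pair.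
    by apply: row3_ext; rewrite !mxE /= ?x0 ?x1 ?x2.
  have pE : p_phi z = S0 * sn * (c * z.2 0 1 - s * z.2 0 0) by rewrite /p_phi x0 x1; ring.
  apply: row3_ext; rewrite !mxE /= pE.
  - rewrite mulrA [_ * cs]mulrC aA /A.
    transitivity (z.2 0 0 * (c ^+ 2 + s ^+ 2)); first by rewrite cs1 mulr1.
    by field; rewrite S1 s0.
  - rewrite mulrA [_ * cs]mulrC aA /A.
    transitivity (z.2 0 1 * (c ^+ 2 + s ^+ 2)); first by rewrite cs1 mulr1.
    by field; rewrite S1 s0.
  - by rewrite mulr0 addr0 mulrN [_ * sn]mulrC aB opprK.
Qed.

End PhaseSpaceParametrization.

(** * Continuity of the parametrization up to the poles *)

Section PhaseContinuity.
Context {R : realType}.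
Variables (L : R) (f Lam : R -> R).
Hypotheses (L_gt0 : 0 < L) (gen : generic L f Lam).

Local Notation TM := (TM L).
Local Notation S0 := (rad0 L).
Local Notation f1 := (f^`()).
Local Notation l1 := (Lam^`()).
Local Notation lift := (lift L Lam).
Local Notation allowed := (allowed L Lam).

Lemma row3_cvg (T : Type) (F : set_system T) {FF : Filter F} (a b c : T -> R) a0 b0 c0 :
  a t @[t --> F] --> a0 -> b t @[t --> F] --> b0 -> c t @[t --> F] --> c0 ->
  row3 (a t) (b t) (c t) @[t --> F] --> row3 a0 b0 c0.
Proof.
move=> ha hb hc A /= [P nP PA].
suff G : \forall t \near F, forall i j, P i j (row3 (a t) (b t) (c t) i j).
  by apply: filterS G => t; exact: PA.
have [e0 e1 e2] := row3E a0 b0 c0.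
have h0 : \forall t \near F, P 0 0 (a t) := ha _ (eq_ind _ (fun x => nbhs x _) (nP 0 0) _ e0).
have h1 : \forall t \near F, P 0 1 (b t) := hb _ (eq_ind _ (fun x => nbhs x _) (nP 0 1) _ e1).
have h2 : \forall t \near F, P 0 2 (c t) := hc _ (eq_ind _ (fun x => nbhs x _) (nP 0 2) _ e2).
apply: filterS3 h0 h1 h2 => t p0 p1 p2 i; rewrite (ord1 i) => -[[|[|[|//]]] j].
- have -> : Ordinal j = 0 by exact: val_inj.
  by have [-> _ _] := row3E (a t) (b t) (c t).
- have -> : Ordinal j = 1 by exact: val_inj.
  by have [_ -> _] := row3E (a t) (b t) (c t).
- have -> : Ordinal j = 2 by exact: val_inj.
  by have [_ _ ->] := row3E (a t) (b t) (c t).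
Qed.

(** The component of the covector along the unit vector of d/dphi in R^3. It is the only coefficient
    of [lift] that can be singular at a pole. *)
Definition spin kappa r := (kappa - Lam r) / (S0 * sin (r / S0)).

Lemma liftE kappa r phi a : lift kappa r phi a =
  (row3 (S0 * sin (r / S0) * cos phi) (S0 * sin (r / S0) * sin phi) (S0 * cos (r / S0)),
   row3 (a * (cos (r / S0) * cos phi) - spin kappa r * sin phi)
        (a * (cos (r / S0) * sin phi) + spin kappa r * cos phi)
        (- (a * sin (r / S0)))).
Proof.
rewrite /lift /covector_at /spin; congr pair; apply: row3_ext; rewrite !mxE /=.
- move: (S0 * sin _) => u; have [->|n0] := eqVneq u 0; last by field.
  by rewrite !mul0r oppr0 mulr0 invr0 mulr0 mul0r subr0 addr0.
- move: (S0 * sin _) => u; have [->|n0] := eqVneq u 0; last by field.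
  by rewrite !mul0r mulr0 invr0 mulr0 mul0r !addr0.
- by rewrite mulr0 addr0 mulrN.
Qed.

(** The level kappa enters [lift] only through [spin], so convergence is asked of [spin] itself.
    This serves fixed kappa, kappa varying along a critical family and the zero section alike. *)
Lemma lift_cvg (T : Type) (F : set_system T) {FF : Filter F} (kappa r phi a : T -> R) k0 r0 phi0
    a0 :
  spin (kappa t) (r t) @[t --> F] --> spin k0 r0 ->
  r t @[t --> F] --> r0 -> phi t @[t --> F] --> phi0 -> a t @[t --> F] --> a0 ->
  lift (kappa t) (r t) (phi t) (a t) @[t --> F] --> lift k0 r0 phi0 a0.
Proof.
move=> hs hr hp ha; rewrite liftE.
under eq_cvg do rewrite liftE.
have hd : r t / S0 @[t --> F] --> r0 / S0 by apply: cvgMr_tmp.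
have hsin : sin (r t / S0) @[t --> F] --> sin (r0 / S0).
  by apply: (cvg_comp _ _ hd); exact: continuous_sin.
have hcos : cos (r t / S0) @[t --> F] --> cos (r0 / S0).
  by apply: (cvg_comp _ _ hd); exact: continuous_cos.
have hsp : sin (phi t) @[t --> F] --> sin phi0.
  by apply: (cvg_comp _ _ hp); exact: continuous_sin.
have hcp : cos (phi t) @[t --> F] --> cos phi0.
  by apply: (cvg_comp _ _ hp); exact: continuous_cos.
have hSs : S0 * sin (r t / S0) @[t --> F] --> S0 * sin (r0 / S0) by apply: cvgMl_tmp.
apply: (cvg_pair (@row3_cvg _ _ _ _ _ _ _ _ _ _ _ _) (@row3_cvg _ _ _ _ _ _ _ _ _ _ _ _)).
- exact: cvgM.
- exact: cvgM.
- exact: cvgMl_tmp.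
- by apply: cvgB; [apply: cvgM => //; exact: cvgM | exact: cvgM].
- by apply: cvgD; [apply: cvgM => //; exact: cvgM | exact: cvgM].
- by apply: cvgN; exact: cvgM.
Qed.

Lemma quotient_cvg (g d : R -> R) (x g' d' : R) : is_derive x 1 g g' ->
  is_derive x 1 d d' -> g x = 0 -> d x = 0 -> d' != 0 ->
  g t / d t @[t --> x^'] --> g' / d'.
Proof.
move=> /isd_slope hg /isd_slope hd g0 d0 n0.
have : ((g t - g x) / (t - x)) * ((d t - d x) / (t - x))^-1 @[t --> x^'] --> g' * d'^-1.
  by apply: cvgM => //; exact: cvgV.
rewrite g0 d0; apply: cvg_trans; apply: near_eq_cvg.
rewrite near_withinE; apply: near_all => t tx; rewrite !subr0 /= invfM invrK.
by rewrite mulrACA mulVf ?mulr1 // subr_eq0.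
Qed.

(** The value at x is 0 / 0 = 0 by convention, and it agrees with the limit g' / d' because g' =
    0. *)
Lemma quotient_continuous0 (g d : R -> R) (x d' : R) : is_derive x 1 g 0 ->
  is_derive x 1 d d' -> g x = 0 -> d x = 0 -> d' != 0 ->
  g t / d t @[t --> x] --> g x / d x.
Proof.
move=> hg hd g0 d0 n0; apply/(continuous_withinNx (fun t => g t / d t)).
have := quotient_cvg hg hd g0 d0 n0; rewrite mul0r.
by have -> : g x / d x = 0 by rewrite g0 mul0r.
Qed.

Lemma isd_S0sin (x : R) : is_derive x 1 (fun r => S0 * sin (r / S0)) (cos (x / S0)).
Proof.
have h := isdM (isd_cst S0 x) (isd_comp (isdM (isd_id x) (isd_cst S0^-1 x)) (isd_sin (x / S0))).
apply: (is_derive_eq h); have S1 := rad0_neq0 L_gt0.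
by move: (cos _) (sin _) => c s; field.
Qed.

Lemma isd_level kappa (x : R) : is_derive x 1 (fun r => kappa - Lam r) (- l1 x).
Proof. by apply: (is_derive_eq (isdD (isd_cst kappa x) (isdN (isd_l gen x)))); rewrite add0r. Qed.

(** At an allowed pole kappa - Lam vanishes together with its derivative, while d has a simple zero.
    It is applied to d = f and to the Euclidean radius of the parallel. *)
Lemma level_quotient_continuous kappa (d : R -> R) (d0 d' : R) r0 : allowed kappa r0 ->
  (forall x : R, 0 < x < L -> d x != 0) -> continuous d ->
  (r0 = 0 \/ r0 = L -> is_derive r0 1 d d' /\ d r0 = 0 /\ d' != 0) ->
  (kappa - Lam r) / d r @[r --> r0] --> (kappa - Lam r0) / d r0.
Proof.
move=> [hr h0 hL] dn dc de; case: (itv_cases hr) => [e|e|hr'].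
- have [h1 [h2 h3]] := de (or_introl e).
  apply: (quotient_continuous0 (g := fun r => kappa - Lam r) _ h1) => //; last by rewrite h0 // e
      subrr.
  by apply: (is_derive_eq (isd_level kappa r0)); rewrite e (l1_0 gen) oppr0.
- have [h1 [h2 h3]] := de (or_intror e).
  apply: (quotient_continuous0 (g := fun r => kappa - Lam r) _ h1) => //; last by rewrite hL // e
      subrr.
  by apply: (is_derive_eq (isd_level kappa r0)); rewrite e (l1_L gen) oppr0.
- apply: cvgM; first exact: (isd_cvg (isd_level kappa r0)).
  by apply: cvgV; [exact: dn | exact: dc].
Qed.

Lemma spin_continuous kappa r0 : allowed kappa r0 -> spin kappa r @[r --> r0] --> spin kappa r0.
Proof.
move=> al; apply: (level_quotient_continuous (d := fun r => S0 * sin (r / S0)) 0 (d' := cos (r0 /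
    S0)) al).
- move=> x hx; rewrite mulf_neq0 ?rad0_neq0 //; apply: lt0r_neq0; exact: sin_colatitude_gt0.
- by move=> x; exact: (isd_cvg (isd_S0sin x)).
- move=> e; split; first exact: isd_S0sin.
  case: e => ->; rewrite ?(LdivS0 L_gt0) ?mul0r ?sin0 ?cos0 ?sinpi ?cospi ?mulr0; split => //.
Qed.

Definition vel kappa r := (kappa - Lam r) / f r.

Lemma vel_continuous kappa r0 : allowed kappa r0 -> vel kappa r @[r --> r0] --> vel kappa r0.
Proof.
move=> al; apply: (level_quotient_continuous 0 (d' := f1 r0) al).
- by move=> x hx; exact: (f_neq0 gen).
- exact: (f_continuous gen).
- move=> e; split; first exact: (isd_f gen).
  case: e => ->; rewrite ?(f_0 gen) ?(f_L gen) ?(generic_f'0 gen) ?(generic_f'L gen); split => //.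
Qed.

Lemma vel_pole kappa r : allowed kappa r -> r = 0 \/ r = L -> vel kappa r = 0.
Proof.
move=> [_ h0 hL] [e|e]; rewrite /vel.
  by rewrite (h0 e) e subrr mul0r.
by rewrite (hL e) e subrr mul0r.
Qed.

(** The two sheets p_r = +- sqrt (2 h - v^2) are sg = 1 and sg = -1. Where v^2 > 2 h the square root
    is 0, which keeps the map total and continuous. *)
Definition sheet h kappa sg phi r := lift kappa r phi (sg * Num.sqrt (2 * h - vel kappa r ^+ 2)).

Lemma sheet_continuous h kappa sg phi r0 : allowed kappa r0 ->
  sheet h kappa sg phi r @[r --> r0] --> sheet h kappa sg phi r0.
Proof.
move=> al; apply: lift_cvg; first exact: spin_continuous.
- exact: cvg_id.
- exact: cvg_cst.
- have h1 : 2 * h - vel kappa r ^+ 2 @[r --> r0] --> 2 * h - vel kappa r0 ^+ 2.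
    apply: cvgB; first exact: cvg_cst.
    by apply: (@cvgM _ _ _ _ (vel kappa) (vel kappa)); exact: vel_continuous.
  apply: cvgMl_tmp; exact: (cvg_comp _ _ h1 (@sqrt_continuous _ _)).
Qed.

Lemma sheet_momentum h kappa sg phi r : allowed kappa r -> sg ^+ 2 = 1 ->
  vel kappa r ^+ 2 <= 2 * h ->
  TM (sheet h kappa sg phi r) /\ momentum L f Lam (sheet h kappa sg phi r) = (h, kappa).
Proof.
move=> al s1 hv; have [T hH hK _] := lift_TM f L_gt0 phi (sg * Num.sqrt (2 * h - vel kappa r ^+
    2)) al.
split=> //; rewrite /momentum /sheet hH hK; congr pair.
have -> : (kappa - Lam r) ^+ 2 / (2 * f r ^+ 2) = vel kappa r ^+ 2 / 2.
  by rewrite /vel expr_div_n [(2 * _)^-1]invfM [2^-1 * _]mulrC mulrA.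
by rewrite exprMn s1 sqr_sqrtr ?subr_ge0 //; field.
Qed.

End PhaseContinuity.

(** * Connectedness of the fibres *)

Section LastExit.
Context {R : realType}.
Implicit Types (G : R -> R) (r x : R).

(** The point al is the supremum of the set in [0, r] where G > 0, that is, the left end of the
    component of r in {G <= 0} unless that component reaches 0. Points with G > 0 accumulate at al
    from the left. *)
Lemma last_exit G r : continuous G -> 0 <= r -> G r <= 0 ->
  (forall x, 0 <= x <= r -> G x <= 0) \/
  exists al, [/\ 0 < al <= r, G al = 0, forall x, al <= x <= r -> G x <= 0 &
    forall e, 0 < e -> exists x, [/\ 0 <= x, al - e < x < al & 0 < G x]].
Proof.
move=> Gc r0 Gr; have [h|] := pselect (forall x, 0 <= x <= r -> G x <= 0); first by left.
move=> /existsNP[x0] /not_implyP[hx0 /negP]; rewrite -ltNge => G0; right.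
pose A := [set x | 0 <= x <= r /\ 0 < G x].
have sA : has_sup A.
  by split; [exists x0 | exists r => x [/andP[_ xr] _]].
set al := sup A; have ub x : A x -> x <= al by move=> Ax; exact: (sup_upper_bound sA).
have x0al : x0 <= al by apply: ub.
have alr : al <= r by apply: ge_sup; [exists x0 | move=> x [/andP[]]].
have x00 : 0 <= x0 by case/andP: hx0.
have after x : al < x <= r -> G x <= 0.
  move=> /andP[ax xr]; rewrite leNgt; apply/negP => Gx.
  have : x <= al by apply: ub; split => //; rewrite xr (le_trans (le_trans x00 x0al) (ltW ax)).
  by rewrite leNgt ax.
have Gal0 : G al <= 0.
  rewrite leNgt; apply/negP => p; have [e|ne] := eqVneq al r.
    by move: p; rewrite e ltNge Gr.
  have lt : al < r by rewrite lt_neqAle ne.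
  have [x [[px xr] ax]] : exists x, (0 < G x /\ x < r) /\ al < x.
    have h1 : \forall x \near al^'+, 0 < G x.
      by apply: dnbhs_right; apply: near_dnbhs; exact: (cvgr_gt _ (Gc al)).
    exact: (@filter_ex R al^'+ _ _ (right_and (right_and h1 (nbhs_right_lt lt)) (nbhs_right_gt
        al))).
  by have := after x; rewrite ax (ltW xr) leNgt px => /(_ isT).
have adh e : 0 < e -> exists x, [/\ 0 <= x, al - e < x < al & 0 < G x].
  move=> e0; have [x Ax lx] := sup_adherent e0 sA.
  exists x; case: (Ax) => /andP[h0 _] px; split=> //; rewrite lx lt_neqAle ub // andbT.
  by apply: contraTN px => /eqP ->; rewrite -leNgt.
have al0 : 0 < al by have [|x [h0 /andP[_ h1] _]] := adh 1; [|exact: le_lt_trans h1].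
exists al; split => //.
- by rewrite al0.
- apply/eqP; rewrite eq_le Gal0 /= leNgt; apply/negP => n.
  have [e /= e0 he] : exists2 e : R, 0 < e & forall x, `|al - x| < e -> G x < 0.
    have near_n : \forall x \near al, G x < 0 by exact: (cvgr_lt _ (Gc al)).
    by have /nbhs_ballP[e /= e0 he] := near_n; exists e.
  have [x [_ /andP[h1 h2] px]] := adh e e0.
  have : G x < 0 by apply: he; rewrite gtr0_norm ?subr_gt0 // ltrBlDr addrC -ltrBlDr.
  by rewrite ltNge (ltW px).
- by move=> x; rewrite le_eqVlt => /andP[/orP[/eqP<-|h1] h2] //; apply: after; rewrite h1.
Qed.

(** The mirror image of [last_exit] under x |-> L - x. *)
Lemma first_exit G r L : continuous G -> r <= L -> G r <= 0 ->
  (forall x, r <= x <= L -> G x <= 0) \/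
  exists be, [/\ r <= be < L, G be = 0, forall x, r <= x <= be -> G x <= 0 &
    forall e, 0 < e -> exists x, [/\ x <= L, be < x < be + e & 0 < G x]].
Proof.
move=> Gc rL Gr; have cR : continuous (fun x => G (L - x)).
  move=> x; apply: (@continuous_comp _ _ _ (fun x => L - x) G); last exact: Gc.
  by apply: continuousB; [exact: cst_continuous | exact: cvg_id].
have [||h|[al [/andP[a0 ar] Ga hal he]]] := @last_exit _ (L - r) cR.
- by rewrite subr_ge0.
- by rewrite subKr.
- left=> x /andP[h1 h2]; have := h (L - x); rewrite subKr; apply.
  by rewrite subr_ge0 h2 lerD2l lerN2.
right; exists (L - al); split=> //.
- by rewrite lerBrDr addrC -lerBrDr ar ltrBlDr ltrDl.
- move=> x /andP[h1 h2]; have := hal (L - x); rewrite subKr; apply.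
  by rewrite lerD2l lerN2 h1 andbT lerBrDr addrC -lerBrDr.
- move=> e /he[x [h1 /andP[h2 h3] p]]; exists (L - x); split=> //; first by rewrite gerBl.
  by rewrite ltrD2l ltrN2 h3 /= -addrA ltrD2l ltrNl opprD opprK.
Qed.

End LastExit.

Section FibreConnectivity.
Context {R : realType}.
Variables (L : R) (f Lam : R -> R).
Hypotheses (L_gt0 : 0 < L) (gen : generic L f Lam).

Local Notation TM := (TM L).
Local Notation F := (momentum L f Lam).
Local Notation lift := (lift L Lam).
Local Notation allowed := (allowed L Lam).
Local Notation vel := (vel f Lam).
Local Notation sheet := (sheet L f Lam).

Definition level h kappa : set phase := TM `&` [set z | F z = (h, kappa)].

(** This is f^2 * (v^2 - 2 h), in a form that makes sense at the poles: there gap <= 0 says exactly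
    that kappa equals Lam. *)
Definition gap h kappa x := (kappa - Lam x) ^+ 2 - 2 * h * f x ^+ 2.

Lemma gap_continuous h kappa : continuous (gap h kappa).
Proof.
move=> x; have hl := isd_cvg (isd_level gen kappa x); have hf := f_continuous gen (x := x).
apply: cvgB.
  by apply: (@cvgM _ _ _ _ (fun x => kappa - Lam x) (fun x => kappa - Lam x)).
by apply: cvgMl_tmp; apply: (@cvgM _ _ _ _ f f).
Qed.

Lemma gap_allowed h kappa x : 0 <= h -> 0 <= x <= L -> gap h kappa x <= 0 ->
  allowed kappa x /\ vel kappa x ^+ 2 <= 2 * h.
Proof.
move=> h0 hx; rewrite /gap => g.
have al : allowed kappa x.
  have pole : f x = 0 -> kappa = Lam x.
    move=> fx; move: g; rewrite fx expr0n mulr0 subr0 => g.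
    by apply/eqP; rewrite -subr_eq0 -sqrf_eq0 eq_le g sqr_ge0.
  split=> // e; rewrite pole ?e //; first exact: (f_0 gen).
  exact: (f_L gen).
split=> //; case: (itv_cases hx) => [e|e|hx'].
- by rewrite (vel_pole f al (or_introl e)) expr0n mulr_ge0.
- by rewrite (vel_pole f al (or_intror e)) expr0n mulr_ge0.
- have f0 := f_gt0 gen hx'; rewrite /vel expr_div_n ler_pdivrMr ?exprn_gt0 //.
  by rewrite -subr_le0.
Qed.

Lemma level_gap h kappa z : level h kappa z ->
  [/\ 0 <= h, 0 <= rcoord L z <= L & gap h kappa (rcoord L z) <= 0].
Proof.
move=> [Tz [hE kE]]; have [phi [a [zE al]]] := TM_lift Lam L_gt0 Tz.
have [_ + _ _] := lift_TM f L_gt0 phi a al; rewrite -zE hE kE => ->.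
have hr := TM_rcoord L_gt0 Tz; split=> //.
  by rewrite addr_ge0 ?divr_ge0 ?sqr_ge0 // mulr_ge0 ?sqr_ge0.
rewrite kE in al; move: (rcoord L z) al hr => r al hr; rewrite /gap.
case: (itv_cases hr) => [e|e|hr'].
- by case: al => _ k0 _; rewrite (k0 e) e (f_0 gen) subrr expr0n /= mulr0 subr0.
- by case: al => _ _ k0; rewrite (k0 e) e (f_L gen) subrr expr0n /= mulr0 subr0.
- have f0 := f_neq0 gen hr'; rewrite subr_le0.
  have -> : 2 * (a ^+ 2 / 2 + (kappa - Lam r) ^+ 2 / (2 * f r ^+ 2)) * f r ^+ 2 =
    (a * f r) ^+ 2 + (kappa - Lam r) ^+ 2 by field.
  by rewrite lerDr sqr_ge0.
Qed.

Definition linked h kappa z w := connected_component (level h kappa) z w.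

Lemma linked_sheet h kappa sg phi r1 r2 : r1 <= r2 -> sg ^+ 2 = 1 -> 0 <= h ->
  0 <= r1 -> r2 <= L -> (forall x, r1 <= x <= r2 -> gap h kappa x <= 0) ->
  linked h kappa (sheet h kappa sg phi r1) (sheet h kappa sg phi r2).
Proof.
move=> r12 s1 h0 r10 r2L hg.
have al x : r1 <= x <= r2 -> allowed kappa x /\ vel kappa x ^+ 2 <= 2 * h.
  move=> hx; apply: gap_allowed; rewrite ?hg //.
  by case/andP: hx => x1 x2; rewrite (le_trans r10 x1) (le_trans x2 r2L).
suff : sheet h kappa sg phi @` `[r1, r2] `<=`
    connected_component (level h kappa) (sheet h kappa sg phi r1).
  by apply; exists r2 => //; rewrite /= in_itv /= r12 lexx.
apply: connected_component_max.
- by exists r1 => //; rewrite /= in_itv /= r12 lexx.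
- move=> _ [x /= xr <-]; rewrite in_itv /= in xr; have [a1 a2] := al x xr.
  exact: sheet_momentum.
- apply: connected_continuous_connected; first exact: segment_connected.
  apply: continuous_in_subspaceT => x; rewrite inE /= in_itv /= => /al[a1 _].
  exact: sheet_continuous.
Qed.

Lemma linked_circle h kappa r phi1 phi2 a : allowed kappa r ->
  level h kappa (lift kappa r phi1 a) ->
  linked h kappa (lift kappa r phi1 a) (lift kappa r phi2 a).
Proof.
move=> al [T1 h1].
suff : (fun phi => lift kappa r phi a) @` setT `<=`
    connected_component (level h kappa) (lift kappa r phi1 a) by apply; exists phi2.
apply: connected_component_max.
- by exists phi1.
- have [_ e1 e2 _] := lift_TM f L_gt0 phi1 a al.
  move=> _ [x _ <-]; have [T2 e3 e4 _] := lift_TM f L_gt0 x a al; split=> //.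
  by rewrite /= /momentum e3 e4 -e1 -{2}e2.
- apply: connected_continuous_connected; first by apply/connected_intervalP => x y.
  apply: continuous_in_subspaceT => x _; apply: lift_cvg => //; exact: cvg_cst.
Qed.

(** Over a pole (a, phi) are polar coordinates of the covector up to a common sign, so (a, phi) and
    (- a, phi + pi) give the same point. *)
Lemma sheet_pole_turn h kappa sg phi r : r = 0 \/ r = L ->
  sheet h kappa sg phi r = sheet h kappa (- sg) (phi + pi) r.
Proof. by move=> e; rewrite /sheet !(lift_pole _ L_gt0) // cosDpi sinDpi !mulNr !mulrN !opprK. Qed.

(** Both sheets are followed to the left end of the component. At an interior end p_r = 0 and the
    sheets meet; at a pole they are linked by turning phi by pi. *)
Lemma linked_turn h kappa phi r : 0 <= h -> 0 <= r <= L -> gap h kappa r <= 0 ->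
  linked h kappa (sheet h kappa 1 phi r) (sheet h kappa (- 1) phi r).
Proof.
move=> h0 /andP[r0 rL] gr.
have N1 : (- 1) ^+ 2 = 1 :> R by rewrite sqrrN expr1n.
have lev sg x : sg ^+ 2 = 1 -> 0 <= x <= L -> gap h kappa x <= 0 ->
    forall psi, level h kappa (sheet h kappa sg psi x).
  by move=> s1 hx gx psi; have [a1 a2] := gap_allowed h0 hx gx; exact: sheet_momentum.
have back al : 0 <= al <= r -> (forall x, al <= x <= r -> gap h kappa x <= 0) ->
    linked h kappa (sheet h kappa 1 phi al) (sheet h kappa (- 1) phi al) ->
    linked h kappa (sheet h kappa 1 phi r) (sheet h kappa (- 1) phi r).
  move=> /andP[a0 ar] ha hl.
  have s sg : sg ^+ 2 = 1 -> linked h kappa (sheet h kappa sg phi al) (sheet h kappa sg phi r).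
    by move=> s1; apply: linked_sheet.
  apply: connected_component_trans (s _ N1); apply: connected_component_trans hl.
  by apply: connected_component_sym; apply: s; rewrite expr1n.
have [hg|[al [/andP[a0 ar] ga ha _]]] := last_exit (@gap_continuous h kappa) r0 gr.
  have g0 : gap h kappa 0 <= 0 by apply: hg; rewrite lexx.
  have h0L : 0 <= (0 : R) <= L by rewrite lexx ltW.
  apply: (back 0) => //; first by rewrite lexx.
  rewrite (sheet_pole_turn _ _ _ _ (or_introl erefl)).
  have [a1 _] := gap_allowed h0 h0L g0.
  by apply: linked_circle => //; exact: lev.
apply: (back al) => //; first by rewrite (ltW a0).
have aL : 0 <= al <= L by rewrite (ltW a0) (le_trans ar rL).
case: (itv_cases aL) => [e|e|aL'].
- by rewrite e ltxx in a0.
(* The case al = L occurs only when r is itself the south pole. *)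
- rewrite (sheet_pole_turn _ _ _ _ (or_intror e)).
  have [a1 _] := gap_allowed h0 aL (eq_ind _ (fun x => x <= 0) (lexx 0) _ (esym ga)).
  by apply: linked_circle => //; apply: lev; rewrite ?ga.
have -> : sheet h kappa (- 1) phi al = sheet h kappa 1 phi al.
  have f0 := f_neq0 gen aL'.
  rewrite /sheet; suff -> : 2 * h - vel kappa al ^+ 2 = 0 by rewrite sqrtr0 !mulr0.
  have : vel kappa al ^+ 2 * f al ^+ 2 = 2 * h * f al ^+ 2.
    by rewrite /vel -exprMn divfK //; apply/eqP; rewrite -subr_eq0; apply/eqP.
  by move/mulIf => ->; rewrite ?subrr // sqrf_eq0.
by apply: connected_component_refl; apply: lev; rewrite ?ga ?expr1n.
Qed.

(** Each point of a level is linked to a normal form that depends on its r only, with positive sheet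
    and phi = 0. Connecting two points then means moving along one sheet. *)
Lemma linked_standard h kappa z : level h kappa z ->
  linked h kappa z (sheet h kappa 1 0 (rcoord L z)).
Proof.
move=> lz; have [h0 hr g] := level_gap lz; have [a1 a2] := gap_allowed h0 hr g.
case: (lz) => Tz [hE kE]; have [phi [a [zE _]]] := TM_lift Lam L_gt0 Tz; rewrite kE in zE.
have [_ hz _ _] := lift_TM f L_gt0 phi a a1; rewrite -zE hE in hz.
have aE : a ^+ 2 = 2 * h - vel kappa (rcoord L z) ^+ 2.
  by rewrite hz /vel expr_div_n [(2 * _)^-1]invfM; move: (_ ^+ 2) (_ ^- 2) => x y; field.
have circ psi : linked h kappa z (lift kappa (rcoord L z) psi a).
  by rewrite {1}zE; apply: linked_circle => //; rewrite -zE.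
have [ap|an] := leP 0 a.
  have -> : sheet h kappa 1 0 (rcoord L z) = lift kappa (rcoord L z) 0 a; last exact: circ.
  by rewrite /sheet -aE sqrtr_sqr ger0_norm // mul1r.
have e : sheet h kappa (- 1) 0 (rcoord L z) = lift kappa (rcoord L z) 0 a.
  by rewrite /sheet -aE sqrtr_sqr ltr0_norm // mulN1r opprK.
apply: connected_component_trans (circ 0) _; rewrite -e.
by apply: connected_component_sym; exact: linked_turn.
Qed.

Lemma level_linked h kappa z w : level h kappa z -> level h kappa w ->
  (forall x, rcoord L z <= x <= rcoord L w -> gap h kappa x <= 0) ->
  (forall x, rcoord L w <= x <= rcoord L z -> gap h kappa x <= 0) ->
  linked h kappa z w.
Proof.
wlog zw : z w / rcoord L z <= rcoord L w.
  move=> wl lz lw h1 h2; have [zw|/ltW wz] := leP (rcoord L z) (rcoord L w); first exact: wl.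
  by apply: connected_component_sym; exact: wl.
move=> lz lw hg _; have [h0 /andP[r0 _] _] := level_gap lz.
have [_ /andP[_ rL] _] := level_gap lw.
apply: connected_component_trans (linked_standard lz) _.
apply: connected_component_trans (connected_component_sym (linked_standard lw)).
by apply: linked_sheet; rewrite ?expr1n.
Qed.

End FibreConnectivity.

(** * Continuity of the momentum mapping *)

Section MomentumContinuity.
Context {R : realType}.
Variables (L : R) (f Lam : R -> R).
Hypotheses (L_gt0 : 0 < L) (gen : generic L f Lam).

Local Notation phase := (@phase R).
Local Notation H := (Hfun L f).
Local Notation K := (Kfun L Lam).
Local Notation TM := (TM L).
Local Notation F := (momentum L f Lam).
Local Notation S0 := (rad0 L).
Local Notation spin := (spin L Lam).
Local Notation f1 := (f^`()).
Local Notation "z '^TM'" := (within TM (nbhs (z : phase))) (at level 2, format "z '^TM'").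

Lemma colatitude_itv (x : R) : 0 <= x <= L -> x / S0 \in `[0, pi].
Proof.
move=> /andP[x0 xL]; have S := rad0_gt0 L_gt0.
by rewrite in_itv /= divr_ge0 ?(ltW S) //= -(LdivS0 L_gt0) ler_pM2r ?invr_gt0.
Qed.

Lemma S0cos_lt (x y : R) : 0 <= x <= L -> 0 <= y <= L ->
  (S0 * cos (x / S0) < S0 * cos (y / S0)) = (y < x).
Proof.
move=> hx hy; have S := rad0_gt0 L_gt0.
by rewrite ltr_pM2l // ltr_cos ?colatitude_itv // ltr_pM2r ?invr_gt0.
Qed.

Lemma cvg_coord1 (z : phase) (i : 'I_3) : (w : phase).1 0 i @[w --> z] --> z.1 0 i.
Proof.
apply: (@cvg_comp _ _ _ (fun w : phase => w.1) (fun M : 'rV[R]_3 => M 0 i) _ (nbhs z.1)).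
  exact: cvg_fst.
exact: coord_continuous.
Qed.

Lemma cvg_coord2 (z : phase) (i : 'I_3) : (w : phase).2 0 i @[w --> z] --> z.2 0 i.
Proof.
apply: (@cvg_comp _ _ _ (fun w : phase => w.2) (fun M : 'rV[R]_3 => M 0 i) _ (nbhs z.2)).
  exact: cvg_snd.
exact: coord_continuous.
Qed.

(** As cos decreases on [0, pi], a bound on [rcoord] is an open condition on the third coordinate of
    the base point. A bound outside [0, L] holds automatically. *)
Lemma rcoord_cvg z : TM z -> rcoord L w @[w --> z^TM] --> rcoord L z.
Proof.
move=> Tz; have hr := TM_rcoord L_gt0 Tz; apply/cvgrPdist_lt => e e0.
have c := cvg_coord1 (z := z) (i := 2).
have up : \forall w \near z^TM, rcoord L w < rcoord L z + e.
  rewrite near_withinE; have [h|h] := ltP L (rcoord L z + e).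
    by apply: filterE => w /(TM_rcoord L_gt0)/andP[_ w2]; exact: le_lt_trans h.
  have he : 0 <= rcoord L z + e <= L.
    by rewrite h andbT addr_ge0 ?(ltW e0) //; case/andP: hr.
  have cz : S0 * cos ((rcoord L z + e) / S0) < z.1 0 2.
    by rewrite (cos_rcoord L_gt0 Tz) S0cos_lt // ltrDl.
  have : \forall w \near z, S0 * cos ((rcoord L z + e) / S0) < (w : phase).1 0 2 by exact:
      (cvgr_gt _ c).
  apply: filterS => w + Tw; rewrite (cos_rcoord L_gt0 Tw) S0cos_lt //.
  exact: TM_rcoord.
have lo : \forall w \near z^TM, rcoord L z - e < rcoord L w.
  rewrite near_withinE; have [h|h] := ltP (rcoord L z - e) 0.
    by apply: filterE => w /(TM_rcoord L_gt0)/andP[w2 _]; exact: lt_le_trans w2.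
  have he : 0 <= rcoord L z - e <= L.
    by rewrite h lerBlDr (le_trans (y := L)) ?lerDl ?(ltW e0) //; case/andP: hr.
  have cz : z.1 0 2 < S0 * cos ((rcoord L z - e) / S0).
    by rewrite (cos_rcoord L_gt0 Tz) S0cos_lt // ltrBlDr ltrDl.
  have : \forall w \near z, (w : phase).1 0 2 < S0 * cos ((rcoord L z - e) / S0) by exact:
      (cvgr_lt _ c).
  apply: filterS => w + Tw; rewrite (cos_rcoord L_gt0 Tw) S0cos_lt //.
  exact: TM_rcoord.
by apply: filterS2 up lo => w h1 h2; rewrite ltr_norml; apply/andP; split; lra.
Qed.

Lemma p_phi_cvg (z : phase) : p_phi w @[w --> z] --> p_phi z.
Proof. by apply: cvgB; apply: cvgM; [exact: cvg_coord1|exact: cvg_coord2|exact: cvg_coord1|exact: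
    cvg_coord2]. Qed.

Lemma K_cvg z : TM z -> K w @[w --> z^TM] --> K z.
Proof.
move=> Tz; apply: cvgD; first by apply: cvg_within_filter; exact: p_phi_cvg.
by apply: (cvg_comp _ _ (rcoord_cvg Tz)); exact: (l_continuous gen).
Qed.

(** The relative difference, along the parallels, between the dual metric of ds^2 and that of the
    round sphere; it tends to 0 at the poles because |f'| = 1 there. *)
Definition shape_defect r : R :=
  if sin (r / S0) == 0 then 0 else (S0 * sin (r / S0) / f r) ^+ 2 - 1.

Lemma cos_sq_pole r : r = 0 \/ r = L -> cos (r / S0) != 0 /\ S0 * sin (r / S0) = 0.
Proof.
case=> ->; rewrite ?(LdivS0 L_gt0) ?mul0r ?sin0 ?cos0 ?sinpi ?cospi ?mulr0; split => //.
Qed.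

Lemma shape_defect_cvg r : 0 <= r <= L -> shape_defect x @[x --> r] --> shape_defect r.
Proof.
move=> hr; have S1 := rad0_neq0 L_gt0.
have pole : r = 0 \/ r = L -> shape_defect x @[x --> r] --> shape_defect r.
  move=> e; have [c0 s0] := cos_sq_pole e.
  have [fr f1r] : f r = 0 /\ cos (r / S0) / f1 r = 1.
    case: e => ->; rewrite ?(LdivS0 L_gt0) ?mul0r ?cos0 ?cospi.
      by rewrite (f_0 gen) (generic_f'0 gen) divr1.
    by rewrite (f_L gen) (generic_f'L gen) divff // oppr_eq0 oner_neq0.
  have f10 : f1 r != 0.
    by apply: contraTneq isT => f0; move: f1r => /eqP; rewrite f0 invr0 mulr0 eq_sym oner_eq0.
  have s1 : sin (r / S0) == 0 by move/eqP: s0; rewrite mulf_eq0 (negbTE S1).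
  apply/(continuous_withinNx shape_defect); rewrite {2}/shape_defect s1.
  have q := quotient_cvg (isd_S0sin L_gt0 r) (isd_f gen r) s0 fr f10; rewrite f1r in q.
  have q2 : (S0 * sin (x / S0) / f x) ^+ 2 - 1 @[x --> r^'] --> (0 : R).
    rewrite -[X in _ --> X](subrr 1); apply: cvgB; last exact: cvg_cst.
    by rewrite -[X in _ --> X](expr1n R 2); apply: (@cvgM _ _ _ _ (fun x => S0 * sin (x / S0) / f x)
      (fun x => S0 * sin (x / S0) / f x)).
  apply: cvg_trans q2; apply: near_eq_cvg.
  apply: filterS (isd_near_sign (isd_S0sin L_gt0 r) s0 c0) => x hx.
  rewrite /shape_defect ifF //; apply: contraTF hx => /eqP ->.
  by rewrite !mulr0 ltxx.
case: (itv_cases hr) => [e|e|hr']; [by apply: pole; left|by apply: pole; right|].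
have near_eq : \forall x \near r, (S0 * sin (x / S0) / f x) ^+ 2 - 1 = shape_defect x.
  apply: filterS (near_itv hr') => x hx.
  by rewrite /shape_defect gt_eqF // (sin_colatitude_gt0 L_gt0 hx).
rewrite -(nbhs_singleton near_eq).
apply: cvg_trans (near_eq_cvg near_eq) _; apply: cvgB; last exact: cvg_cst.
have h1 : S0 * sin (x / S0) / f x @[x --> r] --> S0 * sin (r / S0) / f r.
  apply: cvgM; first exact: (isd_cvg (isd_S0sin L_gt0 r)).
  apply: cvgV; first exact: (f_neq0 gen).
  exact: (f_continuous gen).
by apply: (@cvgM _ _ _ _ (fun x => S0 * sin (x / S0) / f x) (fun x => S0 * sin (x / S0) / f x)).
Qed.

Definition angular (z : phase) : R := p_phi z / (S0 * sin (rcoord L z / S0)).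

(** At a pole p_r and p_phi / f have no limits of their own. H is therefore written as half the
    Euclidean square norm of the covector plus a bounded quantity times a defect that vanishes at
    the poles. *)
Lemma H_split z : TM z ->
  H z = dot3 z.2 z.2 / 2 + angular z ^+ 2 * shape_defect (rcoord L z) / 2 /\
  angular z ^+ 2 <= dot3 z.2 z.2.
Proof.
move=> Tz; have hr := TM_rcoord L_gt0 Tz; have [phi [a [zE al]]] := TM_lift Lam L_gt0 Tz.
have sE : spin (K z) (rcoord L z) = angular z by rewrite /spin /Kfun addrK.
have dE : dot3 z.2 z.2 = a ^+ 2 + angular z ^+ 2.
  rewrite {1 2}zE liftE sE dot3E !mxE /=.
  have e1 := cos2Dsin2 phi; have e2 := cos2Dsin2 (rcoord L z / S0).
  move: (angular z) (cos phi) (sin phi) (cos (rcoord L z / S0)) (sin (rcoord L z / S0)) e1 e2.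
  move=> b c s cs sn e1 e2.
  transitivity (a ^+ 2 * (cs ^+ 2 * (c ^+ 2 + s ^+ 2) + sn ^+ 2) + b ^+ 2 * (c ^+ 2 + s ^+ 2)).
    by ring.
  by rewrite e1 !mulr1 e2 mulr1.
split; last by rewrite dE lerDr sqr_ge0.
have [_ hz _ _] := lift_TM f L_gt0 phi a al; rewrite -zE in hz.
have q : K z - Lam (rcoord L z) = p_phi z by rewrite /Kfun addrK.
rewrite hz dE q /angular /shape_defect.
have pole : rcoord L z = 0 \/ rcoord L z = L -> p_phi z = 0.
  by move=> e; rewrite -q; case: al => _ k0 kL; case: e => e; rewrite ?(k0 e) ?(kL e) e subrr.
have zero : p_phi z = 0 -> a ^+ 2 / 2 + p_phi z ^+ 2 / (2 * f (rcoord L z) ^+ 2) =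
  (a ^+ 2 + (p_phi z / (S0 * sin (rcoord L z / S0))) ^+ 2) / 2 +
  (p_phi z / (S0 * sin (rcoord L z / S0))) ^+ 2 * shape_defect (rcoord L z) / 2.
  by move=> ->; rewrite !mul0r !expr0n !mul0r !addr0.
case: (itv_cases hr) => [e|e|hr'].
- by apply: zero; apply: pole; left.
- by apply: zero; apply: pole; right.
have sn := lt0r_neq0 (sin_colatitude_gt0 L_gt0 hr'); have f0 := f_neq0 gen hr'.
have S1 := rad0_neq0 L_gt0; rewrite (negbTE sn).
by field; rewrite f0 S1 sn.
Qed.

Lemma dot3_cvg (z : phase) : dot3 w.2 w.2 @[w --> z] --> dot3 z.2 z.2.
Proof.
rewrite dot3E; under eq_cvg do rewrite dot3E.
by apply: cvgD; first apply: cvgD; apply: cvgM; exact: cvg_coord2.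
Qed.

Lemma H_cvg z : TM z -> H w @[w --> z^TM] --> H z.
Proof.
move=> Tz; have hr := TM_rcoord L_gt0 Tz; have [-> _] := H_split Tz.
have near_eq : \forall w \near z^TM,
    dot3 w.2 w.2 / 2 + angular w ^+ 2 * shape_defect (rcoord L w) / 2 = H w.
  by rewrite near_withinE; apply: filterE => w /H_split[-> _].
apply: cvg_trans (near_eq_cvg near_eq) _.
have cN : dot3 w.2 w.2 @[w --> z^TM] --> dot3 z.2 z.2.
  by apply: cvg_within_filter; exact: dot3_cvg.
have cD : shape_defect (rcoord L w) @[w --> z^TM] --> shape_defect (rcoord L z).
  by apply: (cvg_comp _ _ (rcoord_cvg Tz)); exact: shape_defect_cvg.
apply: cvgD; first by apply: cvgMr_tmp.
apply: cvgMr_tmp.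
have pole : rcoord L z = 0 \/ rcoord L z = L ->
  angular w ^+ 2 * shape_defect (rcoord L w) @[w --> z^TM] -->
  angular z ^+ 2 * shape_defect (rcoord L z).
  move=> e; have [_ s0] := cos_sq_pole e.
  have d0 : shape_defect (rcoord L z) = 0.
    by move/eqP: s0; rewrite mulf_eq0 (negbTE (rad0_neq0 L_gt0)) /shape_defect => /= ->.
  rewrite d0 mulr0 in cD *.
  (* Over a pole [angular] may be discontinuous, but its square is at most the square norm; the
     product with the defect is squeezed to 0. *)
  have cM : dot3 w.2 w.2 * `|shape_defect (rcoord L w)| @[w --> z^TM] --> (0 : R).
    rewrite -[X in _ --> X](mulr0 (dot3 z.2 z.2)); apply: cvgM => //.
    by rewrite -[X in _ --> X](@normr0 _ R); exact: cvg_norm.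
  have cMN : - (dot3 w.2 w.2 * `|shape_defect (rcoord L w)|) @[w --> z^TM] --> (0 : R).
    by rewrite -[X in _ --> X](@oppr0 R); exact: cvgN.
  apply: (squeeze_cvgr _ cMN cM).
  rewrite near_withinE; apply: filterE => w /H_split[_ hw].
  rewrite -ler_norml normrM ger0_norm ?sqr_ge0 //.
  by rewrite ler_wpM2r.
case: (itv_cases hr) => [e|e|hr']; [by apply: pole; left|by apply: pole; right|].
apply: cvgM => //.
have cA : angular w @[w --> z^TM] --> angular z.
  apply: cvgM; first by apply: cvg_within_filter; exact: p_phi_cvg.
  apply: cvgV.
    rewrite mulf_neq0 ?rad0_neq0 //; exact: (lt0r_neq0 (sin_colatitude_gt0 L_gt0 hr')).
  exact: (cvg_comp _ _ (rcoord_cvg Tz) (isd_cvg (isd_S0sin L_gt0 (rcoord L z)))).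
by apply: (@cvgM _ _ _ _ angular angular).
Qed.

Lemma dist2_near z (P : R * R) e : TM z -> dist2 (F z) P < e ->
  \forall w \near z^TM, dist2 (F w) P < e.
Proof.
move=> Tz; suff c : dist2 (F w) P @[w --> z^TM] --> dist2 (F z) P by exact: (cvgr_lt _ c).
rewrite /dist2 /=; have s : (H w - P.1) ^+ 2 + (K w - P.2) ^+ 2 @[w --> z^TM] -->
   (H z - P.1) ^+ 2 + (K z - P.2) ^+ 2.
  have h1 : H w - P.1 @[w --> z^TM] --> H z - P.1.
    by apply: cvgB; [exact: H_cvg | exact: cvg_cst].
  have h2 : K w - P.2 @[w --> z^TM] --> K z - P.2.
    by apply: cvgB; [exact: K_cvg | exact: cvg_cst].
  by apply: cvgD; [exact: (@cvgM _ _ _ _ (fun w => H w - P.1) (fun w => H w - P.1)) |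
    exact: (@cvgM _ _ _ _ (fun w => K w - P.2) (fun w => K w - P.2))].
exact: (cvg_comp _ _ s (@sqrt_continuous _ _)).
Qed.

End MomentumContinuity.

(** * Components of {v^2 <= 2 h} *)

Section Barriers.
Context {R : realType}.
Variables (L : R) (f Lam : R -> R).
Hypotheses (L_gt0 : 0 < L) (gen : generic L f Lam).

Local Notation f1 := (f^`()).
Local Notation f2 := (f^`(2)).
Local Notation f3 := (f^`(3)).
Local Notation l1 := (Lam^`()).
Local Notation l2 := (Lam^`(2)).
Local Notation l3 := (Lam^`(3)).
Local Notation allowed := (allowed L Lam).
Local Notation vel := (vel f Lam).
Local Notation gap := (gap f Lam).

Definition numer kappa r := - (l1 r * f r + (kappa - Lam r) * f1 r).
Definition numer1 kappa r := - (l2 r * f r + (kappa - Lam r) * f2 r).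
Definition numer2 kappa r :=
  - (l3 r * f r + l2 r * f1 r - l1 r * f2 r + (kappa - Lam r) * f3 r).

Lemma isd_numer kappa (r : R) : is_derive r 1 (numer kappa) (numer1 kappa r).
Proof.
have h := isdN (isdD (isdM (isd_l1 gen r) (isd_f gen r)) (isdM (isd_level gen kappa r) (isd_f1
    gen r))).
by apply: (is_derive_eq h); rewrite /numer1; jring.
Qed.

Lemma isd_numer1 kappa (r : R) : is_derive r 1 (numer1 kappa) (numer2 kappa r).
Proof.
have h := isdN (isdD (isdM (isd_l2 gen r) (isd_f gen r)) (isdM (isd_level gen kappa r) (isd_f2
    gen r))).
by apply: (is_derive_eq h); rewrite /numer2; jring.
Qed.

Lemma isd_vel kappa (r : R) : f r != 0 -> is_derive r 1 (vel kappa) (numer kappa r / f r ^+ 2).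
Proof.
move=> f0; have h := isdM (isd_level gen kappa r) (isdV f0 (isd_f gen r)).
by apply: (is_derive_eq h); rewrite /numer; jfield.
Qed.

(** From f' N' - f'' N = - f W, a common zero of N and N' inside (0, L) is an inflection point, and
    there f' N'' = - f W' != 0. At a pole N = 0 forces kappa = Lam, and N'' is then Lam'' up to
    sign. *)
Lemma numer_jet kappa r : 0 <= r <= L ->
  numer kappa r = 0 -> numer1 kappa r = 0 -> numer2 kappa r != 0.
Proof.
move=> hr; case: (itv_cases hr) => [->|->|hr'].
- rewrite /numer /numer2 (f_0 gen) (l1_0 gen) (generic_f'0 gen) (f2_0 gen).
  move: (kappa - Lam 0) (f3 0) (l3 0) (l2 0) (l2_0 L_gt0 gen) => q x y z z0.
  rewrite !mul0r add0r mulr1 => /eqP; rewrite oppr_eq0 => /eqP -> _.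
  by rewrite (_ : - _ = - z) ?oppr_eq0 //; ring.
- rewrite /numer /numer2 (f_L gen) (l1_L gen) (generic_f'L gen).
  move: (kappa - Lam L) (f2 L) (f3 L) (l3 L) (l2 L) (l2_L L_gt0 gen) => q w x y z z0.
  rewrite !mul0r add0r mulrN1 opprK => -> _.
  by rewrite (_ : - _ = z) //; ring.
- move=> n0 n1.
  have f0 := f_neq0 gen hr'.
  have W0 : wronsk f Lam r = 0.
    apply: (mulfI f0); rewrite mulr0.
    transitivity (- (f1 r * numer1 kappa r - f2 r * numer kappa r)).
      by rewrite /numer /numer1 /wronsk; jring.
    by rewrite n0 n1 !mulr0 subrr oppr0.
  have ir : infl L f Lam r by [].
  have F := infl_f1 gen ir; have W1 := infl_wronsk1 gen ir.
  have e : f1 r * numer2 kappa r = - (f r * (f1 r * l3 r - f3 r * l1 r)).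
    transitivity (- (f r * (f1 r * l3 r - f3 r * l1 r)) - f1 r * wronsk f Lam r + f3 r * numer
        kappa r).
      by rewrite /numer /numer2 /wronsk; jring.
    by rewrite W0 n0 !mulr0 subr0 addr0.
  apply: contra_neq W1 => n2; apply: (mulfI f0); rewrite mulr0.
  by apply/eqP; rewrite -oppr_eq0 -e n2 mulr0.
Qed.

(** The first non-vanishing one among N, N', N'' fixes the sign on each side; the sides may differ,
    hence the two separate constants. *)
Lemma numer_signs kappa r : 0 <= r <= L ->
  (exists c, \forall t \near r^'-, 0 < c * numer kappa t) /\
  (exists c, \forall t \near r^'+, 0 < c * numer kappa t).
Proof.
move=> hr; have [n0|n0] := eqVneq (numer kappa r) 0; last first.
  have h := near_dnbhs (cvg_near_neq0 (isd_cvg (isd_numer kappa r)) n0).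
  by split; exists (numer kappa r); [exact: dnbhs_left | exact: dnbhs_right].
have [n1|n1] := eqVneq (numer1 kappa r) 0.
  have h := isd_near_sign2 (near_all r (isd_numer kappa)) (isd_numer1 kappa r) n0 n1 (numer_jet
      hr n0 n1).
  by split; exists (numer2 kappa r); [exact: dnbhs_left | exact: dnbhs_right].
have h := isd_near_sign (isd_numer kappa r) n0 n1.
split.
  exists (- numer1 kappa r); apply: filterS (left_and (dnbhs_left h) (nbhs_left_lt r)) => t [h1 h2].
  by move: h1; rewrite mulrAC nmulr_lgt0 ?subr_lt0 // => h1'; rewrite mulNr oppr_gt0.
exists (numer1 kappa r); apply: filterS (right_and (dnbhs_right h) (nbhs_right_gt r)) => t [h1 h2].
by move: h1; rewrite mulrAC pmulr_lgt0 ?subr_gt0.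
Qed.

Lemma numer_isolated kappa r : 0 <= r <= L -> \forall t \near r^', numer kappa t != 0.
Proof.
move=> hr; have [[c hl] [d hd]] := numer_signs kappa hr.
rewrite near_withinE; move: hl hd; rewrite !near_withinE => hl hd.
apply: filterS2 hl hd => t h1 h2 tr; have [tl|tg|e] := ltgtP t r.
- by move: (h1 tl); apply: contraTneq => ->; rewrite mulr0 ltxx.
- by move: (h2 tg); apply: contraTneq => ->; rewrite mulr0 ltxx.
- by rewrite e eqxx in tr.
Qed.

Lemma sq_between (x y z B : R) : x <= y <= z -> x ^+ 2 <= B -> z ^+ 2 <= B -> y ^+ 2 <= B.
Proof.
move=> /andP[xy yz] hx hz; have [y0|y0] := leP 0 y.
  by apply: le_trans hz; rewrite ler_sqr // nnegrE // (le_trans y0).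
apply: le_trans hx; rewrite -sqrrN -[leRHS]sqrrN ler_sqr ?lerN2 // nnegrE oppr_ge0 ?ltW //.
exact: le_lt_trans y0.
Qed.

(** The ends may be poles, where v is continuous but the formula for v' fails. So the derivative is
    used inside only, and admissibility at both ends gives continuity. *)
Lemma vel_monotone kappa c x y : x <= y -> 0 <= x -> y <= L -> allowed kappa x -> allowed kappa y ->
  (forall t, x < t < y -> 0 < c * numer kappa t) -> c * vel kappa x <= c * vel kappa y.
Proof.
rewrite le_eqVlt => /orP[/eqP -> //|xy] x0 yL ax ay hc.
have al t : x <= t <= y -> allowed kappa t.
  case/andP; rewrite !le_eqVlt => /orP[/eqP<- //|xt] /orP[/eqP-> //|ty].
  by apply: allowed_in; rewrite (le_lt_trans x0 xt) (lt_le_trans ty yL).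
have [||z] := @MVT R (fun t => c * vel kappa t) (fun t => c * (numer kappa t / f t ^+ 2)) x y xy.
- move=> t; rewrite in_itv /= => /andP[xt ty].
  have f0 : f t != 0 by apply: (f_neq0 gen); rewrite (le_lt_trans x0 xt) (lt_le_trans ty yL).
  exact: isdcM (isd_vel kappa f0).
- apply: continuous_in_subspaceT => t; rewrite inE /= in_itv /= => /al at_.
  by apply: (@cvgMl_tmp _ _ _ _ (vel kappa)); exact: (vel_continuous gen at_).
rewrite in_itv /= => hz e; rewrite -subr_ge0 e mulr_ge0 ?subr_ge0 ?(ltW xy) //.
by rewrite mulrA divr_ge0 ?sqr_ge0 // ltW // hc.
Qed.

Lemma gap_vel h kappa x : 0 <= x <= L -> allowed kappa x -> vel kappa x ^+ 2 <= 2 * h ->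
  gap h kappa x <= 0.
Proof.
move=> hx al; rewrite /gap; case: (itv_cases hx) => [e|e|hx'].
- by case: al => _ k0 _ _; rewrite (k0 e) e (f_0 gen) subrr expr0n /= mulr0 subr0.
- by case: al => _ _ k0 _; rewrite (k0 e) e (f_L gen) subrr expr0n /= mulr0 subr0.
- have f0 := f_gt0 gen hx'; rewrite /vel expr_div_n ler_pdivrMr ?exprn_gt0 //.
  by rewrite subr_le0.
Qed.

Lemma gap_mono h h' kappa x : h <= h' -> gap h kappa x <= 0 -> gap h' kappa x <= 0.
Proof.
move=> hh; apply: le_trans; rewrite /gap lerD2l lerN2.
by rewrite ler_wpM2r ?sqr_ge0 // ler_pM2l.
Qed.

(* vel is monotone on [x, y], hence vel^2 is quasi-convex there *)
Lemma gap_between h kappa c x v y : 0 <= h -> x <= v <= y -> 0 <= x -> y <= L ->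
  (forall t, x < t < y -> 0 < c * numer kappa t) ->
  gap h kappa x <= 0 -> gap h kappa y <= 0 -> gap h kappa v <= 0.
Proof.
move=> h0 /andP[xv vy] x0 yL hc gx gy.
have hx : 0 <= x <= L by rewrite x0 (le_trans (le_trans xv vy) yL).
have hy : 0 <= y <= L by rewrite (le_trans x0 (le_trans xv vy)) yL.
have hv : 0 <= v <= L by rewrite (le_trans x0 xv) (le_trans vy yL).
have [ax vx] := gap_allowed gen h0 hx gx; have [ay vy2] := gap_allowed gen h0 hy gy.
have [-> //|xv'] := eqVneq v x; have [-> //|vy'] := eqVneq v y.
have xv2 : x < v by rewrite lt_neqAle eq_sym xv' xv.
have vy3 : v < y by rewrite lt_neqAle vy' vy.
have av : allowed kappa v.
  by apply: allowed_in; rewrite (le_lt_trans x0 xv2) (lt_le_trans vy3 yL).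
apply: gap_vel => //; have c0 : 0 < c ^+ 2.
  have cv : 0 < c * numer kappa v by apply: hc; rewrite xv2.
  by rewrite exprn_even_gt0 //=; apply: contraTneq cv => ->; rewrite mul0r ltxx.
(* Multiplying by c^2 replaces v by c v, which increases whatever the sign of c. *)
rewrite -(ler_pM2l c0) -exprMn.
apply: (@sq_between (c * vel kappa x) _ (c * vel kappa y)).
- apply/andP; split; apply: vel_monotone => //.
    by case/andP: hv.
    by move=> t /andP[t1 t2]; apply: hc; rewrite t1 (lt_trans t2).
    by case/andP: hv.
  by move=> t /andP[t1 t2]; apply: hc; rewrite t2 (lt_trans _ t1).
- by rewrite exprMn ler_pM2l.
- by rewrite exprMn ler_pM2l.
Qed.

(** The point x is taken just left of the component of r, with v^2 > 2 h at x and v monotone between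
    x and the component. At any higher level a point between x and r that satisfies the inequality
    is then joined to r. *)
Lemma left_barrier h kappa r : 0 <= h -> 0 <= r <= L -> gap h kappa r <= 0 ->
  exists x, [/\ x < r, 0 <= x -> 0 < gap h kappa x &
    forall h' u v, h <= h' -> x < u -> 0 <= u -> u <= v <= r -> gap h' kappa u <= 0 ->
      gap h' kappa v <= 0].
Proof.
move=> h0 /andP[r0 rL] gr.
have [hg|[al [/andP[a0 ar] ga hg he]]] := last_exit (gap_continuous gen (h := h) (kappa :=
    kappa)) r0 gr.
  (* When the component reaches the pole, -1 serves as a barrier that no point can cross. *)
  exists (-1); split.
  - by apply: lt_le_trans r0; rewrite oppr_lt0.
  - by rewrite lerNr oppr0 ler10.
  move=> h' u v hh _ u0 /andP[uv vr] _; apply: (gap_mono hh); apply: hg.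
  by rewrite (le_trans u0 uv).
have aL : 0 <= al <= L by rewrite (ltW a0) (le_trans ar).
have [[c hc] _] := numer_signs kappa aL.
have [e e0 hce] : exists2 e, 0 < e & forall t, al - e < t < al -> 0 < c * numer kappa t.
  move: hc; rewrite near_withinE => /nbhs_ballP[e /= e0 hce]; exists e => // t /andP[t1 t2].
  by apply: hce => //=; rewrite /ball /= gtr0_norm ?subr_gt0 // ltrBlDr addrC -ltrBlDr.
have [x [x0 /andP[x1 x2] gx]] := he e e0.
exists x; split=> //; first exact: lt_le_trans ar.
move=> h' u v hh xu u0 /andP[uv vr] gu; have [av|va] := leP al v.
  by apply: (gap_mono hh); apply: hg; rewrite av.
apply: (@gap_between h' kappa c u v al) => //.
- exact: le_trans hh.
- by rewrite uv ltW.
- by case/andP: aL.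
- by move=> t /andP[t1 t2]; apply: hce; rewrite t2 (lt_trans x1) // (lt_trans xu).
- by apply: (gap_mono hh); rewrite ga.
Qed.

Lemma right_barrier h kappa r : 0 <= h -> 0 <= r <= L -> gap h kappa r <= 0 ->
  exists y, [/\ r < y, y <= L -> 0 < gap h kappa y &
    forall h' u v, h <= h' -> u < y -> u <= L -> r <= v <= u -> gap h' kappa u <= 0 ->
      gap h' kappa v <= 0].
Proof.
move=> h0 /andP[r0 rL] gr.
have [hg|[be [/andP[rb bL] gb hg he]]] := first_exit (gap_continuous gen (h := h) (kappa :=
    kappa)) rL gr.
  (* The same convention at the south pole: L + 1 lies beyond all values of r. *)
  exists (L + 1); split.
  - by rewrite (le_lt_trans rL) // ltrDl.
  - by rewrite leNgt ltrDl ltr01.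
  move=> h' u v hh _ u0 /andP[rv vu] _; apply: (gap_mono hh); apply: hg.
  by rewrite rv (le_trans vu).
have b0L : 0 <= be <= L by rewrite (le_trans r0) // ltW.
have [_ [c hc]] := numer_signs kappa b0L.
have [e e0 hce] : exists2 e, 0 < e & forall t, be < t < be + e -> 0 < c * numer kappa t.
  move: hc; rewrite near_withinE => /nbhs_ballP[e /= e0 hce]; exists e => // t /andP[t1 t2].
  by apply: hce => //=; rewrite /ball /= ltr0_norm ?subr_lt0 // opprB ltrBlDl.
have [y [yL /andP[y1 y2] gy]] := he e e0.
exists y; split=> //; first exact: le_lt_trans rb _.
move=> h' u v hh uy uL /andP[rv vu] gu; have [vb|bv] := leP v be.
  by apply: (gap_mono hh); apply: hg; rewrite rv.
apply: (@gap_between h' kappa c be v u) => //.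
- exact: le_trans hh.
- by rewrite vu ltW.
- by case/andP: b0L.
- by move=> t /andP[t1 t2]; apply: hce; rewrite t1 (lt_trans t2) // (lt_trans uy).
- by apply: (gap_mono hh); rewrite gb.
Qed.

End Barriers.

(** * The projection onto the space of fibres *)

Section ReebProjection.
Context {T : topologicalType} {S : Type}.
Variables (X : set T) (g : T -> S) (x0 : T).
Hypothesis Xx0 : X x0.

(** Points outside X go to the fibre of x0. This makes the projection a total function, so limits
    can be taken along ordinary filters. *)
Definition reeb_proj x : reeb X g :=
  match pselect (X x) with
  | left h => exist _ (fibre X g x) (ex_intro2 _ _ x h erefl)
  | right _ => exist _ (fibre X g x0) (ex_intro2 _ _ x0 Xx0 erefl)
  end.

Lemma reeb_proj_fibre x : X x -> reeb_fibre (reeb_proj x) x.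
Proof. by rewrite /reeb_proj; case: pselect => // h _ /=; exact: fibre_refl. Qed.

Lemma reeb_proj_eq (p : reeb X g) x : reeb_fibre p x -> reeb_proj x = p.
Proof. by move=> px; exact: (reeb_inj (reeb_proj_fibre (reeb_fibre_sub px)) px). Qed.

Lemma reeb_proj_repr (p : reeb X g) : exists x, [/\ X x, reeb_proj x = p & reeb_fibre p x].
Proof.
case: (svalP p) => x Xx e; exists x; have px : reeb_fibre p x.
  by rewrite /reeb_fibre e; exact: fibre_refl.
by split=> //; exact: reeb_proj_eq.
Qed.

Lemma reeb_proj_cvg (I : Type) (G : set_system I) {FG : Filter G} (u : I -> T) x :
  (\forall t \near G, X (u t)) -> X x -> u t @[t --> G] --> x ->
  reeb_proj (u t) @[t --> G] --> reeb_proj x.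
Proof.
move=> Xu Xx ux U; rewrite nbhsE => -[V [[Q oQ QV] Vx] VU].
have Qx : Q x by have : reeb_union V x by [exists (reeb_proj x) => //; exact: reeb_proj_fibre];
    rewrite -QV => -[].
have nQ : \forall t \near G, Q (u t) by apply: ux; exact: open_nbhs_nbhs.
apply: filterS2 nQ Xu => t Qut Xut; apply: VU.
have : reeb_union V (u t) by rewrite -QV; split.
by case=> q Vq /reeb_proj_eq ->.
Qed.

(** Openness in the quotient is checked upstairs: the open set of T required by [reeb_open] is the
    interior of the condition, read as an implication from X. *)
Lemma reeb_open_near (U : set (reeb X g)) :
  (forall x, X x -> U (reeb_proj x) -> \forall y \near within X (nbhs x), U (reeb_proj y)) ->
  open U.
Proof.
move=> hU; exists (interior [set y | X y -> U (reeb_proj y)]); first exact: open_interior.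
rewrite eqEsubset; split=> [x [Xx /interior_subset /(_ Xx) Ux]|x [p Up px]].
  by exists (reeb_proj x) => //; exact: reeb_proj_fibre.
have Xx := reeb_fibre_sub px; split=> //; rewrite /interior /=.
by have := hU x Xx; rewrite (reeb_proj_eq px) near_withinE => /(_ Up).
Qed.

Lemma reeb_function_continuous (V : topologicalType) (j : reeb X g -> V) (v : T -> V) :
  (forall x, X x -> j (reeb_proj x) = v x) ->
  (forall x, X x -> v y @[y --> within X (nbhs x)] --> v x) -> continuous j.
Proof.
move=> jv vc p B; rewrite nbhsE => -[Q [oQ Qp] QB].
have oj : open (j @^-1` Q).
  apply: reeb_open_near => x Xx; rewrite /= jv // => Qx.
  have : \forall y \near within X (nbhs x), Q (v y) by apply: vc => //; exact: open_nbhs_nbhs.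
  by rewrite !near_withinE; apply: filterS => y h Xy; rewrite /= jv //; exact: h.
by apply: filterS (open_nbhs_nbhs (conj oj Qp)) => q; exact: QB.
Qed.

End ReebProjection.

(** * The bifurcation complex *)

Section ComplexTopology.
Context {R : realType}.
Variables (L : R) (f Lam : R -> R).
Hypotheses (L_gt0 : 0 < L) (gen : generic L f Lam).

Local Notation phase := (@phase R).
Local Notation H := (Hfun L f).
Local Notation K := (Kfun L Lam).
Local Notation TM := (TM L).
Local Notation F := (momentum L f Lam).
Local Notation bcx := (bcomplex L f Lam).
Local Notation level := (level L f Lam).
Local Notation linked := (linked L f Lam).
Local Notation gap := (gap f Lam).
Local Notation sheet := (sheet L f Lam).
Local Notation allowed := (allowed L Lam).
Local Notation bh := (@bh R L f Lam).
Local Notation bk := (@bk R L f Lam).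
Local Notation "z '^TM'" := (within TM (nbhs (z : phase))) (at level 2, format "z '^TM'").

Definition proj : phase -> bcx := reeb_proj F (zeroN_TM L f Lam).

Lemma proj_fibre z : TM z -> reeb_fibre (proj z) z.
Proof. exact: reeb_proj_fibre. Qed.

Lemma proj_eq (p : bcx) z : reeb_fibre p z -> proj z = p.
Proof. exact: reeb_proj_eq. Qed.

Lemma proj_linked h kappa z w : level h kappa z -> linked h kappa z w -> proj z = proj w.
Proof.
move=> [Tz Fz] lk; symmetry; apply: proj_eq.
rewrite (reeb_fibre_eq (proj_fibre Tz)) /fibre; move: lk; rewrite /linked /level.
by rewrite /= in Fz *; rewrite Fz.
Qed.

Lemma proj_repr (p : bcx) : exists z, [/\ TM z, proj z = p & reeb_fibre p z].
Proof. exact: reeb_proj_repr. Qed.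

Lemma fibre_momentum (p : bcx) z : reeb_fibre p z -> [/\ TM z, H z = bh p & K z = bk p].
Proof.
move=> pz; split; first exact: reeb_fibre_sub pz.
  by rewrite /Defs.bh (reeb_valE pz).
by rewrite /Defs.bk (reeb_valE pz).
Qed.

Lemma proj_cvg (T : Type) (G : set_system T) {FG : Filter G} (g : T -> phase) z :
  (forall t, TM (g t)) -> TM z -> g t @[t --> G] --> z -> proj (g t) @[t --> G] --> proj z.
Proof.
by move=> Tg Tz gz; apply: reeb_proj_cvg => //; exact: filterE.
Qed.

Lemma open_near (U : set bcx) :
  (forall z, TM z -> U (proj z) -> \forall w \near z^TM, U (proj w)) -> open U.
Proof. exact: reeb_open_near. Qed.

Lemma dist2_coord (P Q : R * R) e : dist2 P Q < e -> `|P.1 - Q.1| < e /\ `|P.2 - Q.2| < e.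
Proof.
rewrite /dist2 => h; split; apply: le_lt_trans h; rewrite -sqrtr_sqr ler_wsqrtr //.
  by rewrite lerDl sqr_ge0.
by rewrite lerDr sqr_ge0.
Qed.

Lemma gap_stable h kappa x : 0 < gap h kappa x ->
  exists2 e, 0 < e & forall P : R * R, dist2 P (h, kappa) < e -> 0 < gap P.1 P.2 x.
Proof.
move=> g0.
have c : (P.2 - Lam x) ^+ 2 - 2 * P.1 * f x ^+ 2 @[P --> (h, kappa)] --> gap h kappa x.
  have c2 : P.2 - Lam x @[P --> (h, kappa)] --> kappa - Lam x.
    by apply: cvgB; [exact: cvg_snd | exact: cvg_cst].
  apply: cvgB; first exact: (@cvgM _ _ _ _ (fun P : R * R => P.2 - Lam x) (fun P : R * R => P.2 -
      Lam x)).
  by apply: cvgMr_tmp; apply: cvgMl_tmp; exact: cvg_fst.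
have n : \forall P \near (h, kappa), 0 < (P.2 - Lam x) ^+ 2 - 2 * P.1 * f x ^+ 2.
  exact: (cvgr_gt _ c).
have /nbhs_ballP[e /= e0 he] := n; exists e => // -[a b] /dist2_coord[/= h1 h2].
by apply: (he (a, b)); split; rewrite /ball /= distrC.
Qed.

(** At the barriers x and y the strict inequality v^2 > 2 h persists over a small disc, so no fibre
    over the disc meets these two parallels. Between them, at the same k and no smaller h,
    everything belongs to the component of z. *)
Lemma local_window z : TM z -> exists x y e0, [/\ 0 < e0, x < rcoord L z < y,
  forall w, TM w -> dist2 (F w) (F z) < e0 -> rcoord L w <> x /\ rcoord L w <> y &
  forall w, TM w -> x < rcoord L w < y -> H z <= H w -> K w = K z ->
    (forall v, rcoord L w <= v <= rcoord L z -> gap (H w) (K z) v <= 0) /\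
    (forall v, rcoord L z <= v <= rcoord L w -> gap (H w) (K z) v <= 0)].
Proof.
move=> Tz; have lz : level (H z) (K z) z by [].
have [h0 hr gr] := level_gap L_gt0 gen lz.
have [x [xr gx bx]] := left_barrier L_gt0 gen h0 hr gr.
have [y [ry gy yb]] := right_barrier L_gt0 gen h0 hr gr.
(* The proposition [in_u] says that u lies in [0, L] on the relevant side. If it fails, no point
   lies over u and any radius will do. *)
have avoid u (in_u : Prop) : (forall w, TM w -> rcoord L w = u -> in_u) ->
    (in_u -> 0 < gap (H z) (K z) u) ->
    exists2 e, 0 < e & forall w, TM w -> dist2 (F w) (F z) < e -> rcoord L w <> u.
  move=> hu gu; have [iu|niu] := pselect in_u; last first.
    by exists 1 => // w Tw _ e; apply: niu; exact: hu e.
  have [e e0 he] := gap_stable (gu iu); exists e => // w Tw /he g0 wu.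
  have [_ _] := level_gap L_gt0 gen (conj Tw (erefl : F w = (H w, K w))).
  by rewrite wu leNgt g0.
have [e1 e10 he1] : exists2 e, 0 < e & forall w, TM w -> dist2 (F w) (F z) < e -> rcoord L w <> x.
  by apply: (avoid x (0 <= x)) => // w Tw <-; case/andP: (TM_rcoord L_gt0 Tw).
have [e2 e20 he2] : exists2 e, 0 < e & forall w, TM w -> dist2 (F w) (F z) < e -> rcoord L w <> y.
  by apply: (avoid y (y <= L)) => // w Tw <-; case/andP: (TM_rcoord L_gt0 Tw).
exists x, y, (Num.min e1 e2); split.
- by rewrite lt_min e10.
- by rewrite xr.
- by move=> w Tw; rewrite lt_min => /andP[d1 d2]; split; [exact: he1 | exact: he2].
move=> w Tw /andP[xw wy] hh kk; have lw : level (H w) (K w) w by [].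
have [_ /andP[w0 wL] gw] := level_gap L_gt0 gen lw; rewrite kk in gw.
by split=> v hv; [exact: bx hh xw w0 hv gw | exact: yb hh wy wL hv gw].
Qed.

Lemma rcoord_fibre_interval (p : bcx) w w' u : reeb_fibre p w -> reeb_fibre p w' ->
  rcoord L w <= u <= rcoord L w' -> exists2 w'', reeb_fibre p w'' & rcoord L w'' = u.
Proof.
move=> pw pw' hu.
have ci : is_interval (rcoord L @` reeb_fibre p).
  apply/connected_intervalP; apply: connected_continuous_connected.
    by rewrite (reeb_fibre_eq pw); exact: component_connected.
  apply: (@continuous_subspaceW _ _ _ TM); first exact: reeb_fibre_sub.
  by apply/subspace_continuousP => z Tz; exact: rcoord_cvg.
by have [w'' pw'' e] := ci _ _ (imageP _ pw) (imageP _ pw') u hu; exists w''.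
Qed.

(** The ray keeps the base point at [rcoord L z] and raises p_r only, so it follows the component
    that contains this fixed value of r. *)
Definition ray z (h : R) : bcx := proj (sheet h (K z) 1 0 (rcoord L z)).

Lemma allowed_rcoord z : TM z -> allowed (K z) (rcoord L z).
Proof. by move=> Tz; have [phi [a []]] := TM_lift Lam L_gt0 Tz. Qed.

Lemma sheet_TM h z : TM z -> TM (sheet h (K z) 1 0 (rcoord L z)).
Proof.
move=> Tz; pose a := 1 * Num.sqrt (2 * h - vel f Lam (K z) (rcoord L z) ^+ 2).
by have [] := lift_TM f L_gt0 0 a (allowed_rcoord Tz).
Qed.

Lemma ray_continuous z : TM z -> continuous (ray z).
Proof.
move=> Tz h; apply: proj_cvg; [by move=> t; exact: sheet_TM | exact: sheet_TM |].
apply: lift_cvg; try exact: cvg_cst.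
apply: cvgMl_tmp; have c : 2 * t - vel f Lam (K z) (rcoord L z) ^+ 2 @[t --> h] -->
    2 * h - vel f Lam (K z) (rcoord L z) ^+ 2.
  by apply: cvgB; [apply: cvgMl_tmp; exact: cvg_id | exact: cvg_cst].
exact: (cvg_comp _ _ c (@sqrt_continuous _ _)).
Qed.

Lemma ray_start z : TM z -> ray z (H z) = proj z.
Proof.
move=> Tz; have lz : level (H z) (K z) z by [].
by rewrite (proj_linked lz (linked_standard L_gt0 gen lz)).
Qed.

Lemma sheet_level h z : TM z -> H z <= h -> level h (K z) (sheet h (K z) 1 0 (rcoord L z)).
Proof.
move=> Tz hh; have lz : level (H z) (K z) z by [].
have [h0 hr gr] := level_gap L_gt0 gen lz; have [a1 v1] := gap_allowed gen h0 hr gr.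
apply: sheet_momentum => //; first by rewrite expr1n.
by apply: le_trans v1 _; rewrite ler_pM2l.
Qed.

Lemma ray_val z h : TM z -> H z <= h -> bh (ray z h) = h /\ bk (ray z h) = K z.
Proof.
move=> Tz hh; have [T1 [e1 e2]] := sheet_level Tz hh.
by have [_ <- <-] := fibre_momentum (proj_fibre T1).
Qed.

Lemma dist2_self (P : R * R) : dist2 P P = 0.
Proof. by rewrite /dist2 !subrr expr0n addr0 sqrtr0. Qed.

Lemma dist2_fst (a b c : R) : dist2 (a, c) (b, c) = `|a - b|.
Proof. by rewrite /dist2 /= subrr expr0n addr0 sqrtr_sqr. Qed.

Lemma proj_val z : TM z -> (bh (proj z), bk (proj z)) = F z.
Proof. by move=> Tz; have [_ <- <-] := fibre_momentum (proj_fibre Tz). Qed.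

(* The circle {rcoord = x}, resp. {rcoord = y}, misses the fibres over a small disc,
   so the fibres that lie between the two form an open and closed part of its preimage. *)
Lemma local_right z : TM z -> exists2 e0, 0 < e0 & forall e, 0 < e <= e0 ->
  (circular_nbhd (proj z) e `&` right_of (proj z) = ray z @` `]H z, H z + e[) /\
  exists2 U, open_nbhs (proj z) U & U `&` right_of (proj z) `<=` ray z @` `]H z, H z + e[.
Proof.
move=> Tz; have [x [y [e0 [e00 hz avoid inner]]]] := local_window Tz.
exists e0 => // e /andP[ep ee0].
pose D : set bcx := [set q | dist2 (bh q, bk q) (bh (proj z), bk (proj z)) < e].
pose Wn : set bcx := [set q | D q /\ exists2 w, reeb_fibre q w & x < rcoord L w < y].
pose Wo : set bcx := [set q | D q /\ forall w, reeb_fibre q w -> ~ (x < rcoord L w < y)].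
have DF w : TM w -> D (proj w) = (dist2 (F w) (F z) < e).
  by move=> Tw; rewrite /D /= !proj_val.
(* The r-values on a fibre form an interval that avoids x and y, so a fibre over the disc lies
   entirely inside or entirely outside the window. *)
have side (q : bcx) w w' : D q -> reeb_fibre q w -> reeb_fibre q w' ->
    x < rcoord L w < y -> x < rcoord L w' < y.
  move=> Dq qw qw' /andP[xw wy].
  have av w'' : reeb_fibre q w'' -> rcoord L w'' <> x /\ rcoord L w'' <> y.
    move=> qw''; have Tw := reeb_fibre_sub qw''; apply: avoid => //.
    apply: lt_le_trans ee0; rewrite -DF // (proj_eq qw''). exact: Dq.
  apply/andP; split; rewrite ltNge; apply/negP => hw.
    have [w'' qw'' e1] : exists2 w'', reeb_fibre q w'' & rcoord L w'' = x.
      by apply: (rcoord_fibre_interval qw' qw); rewrite hw ltW.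
    by have [] := av _ qw''.
  have [w'' qw'' e1] : exists2 w'', reeb_fibre q w'' & rcoord L w'' = y.
    by apply: (rcoord_fibre_interval qw qw'); rewrite hw ltW.
  by have [] := av _ qw''.
have nearD w : TM w -> D (proj w) -> \forall w' \near w^TM, TM w' /\ D (proj w').
  move=> Tw; rewrite DF // => /(dist2_near L_gt0 gen Tw); rewrite !near_withinE.
  by apply: filterS => w' h Tw'; split=> //; rewrite DF // h.
have oWn : open Wn.
  apply: open_near => w Tw [Dw [w1 q1 h1]].
  have /andP[a1 a2] := side _ _ _ Dw q1 (proj_fibre Tw) h1.
  have n1 : \forall w' \near w^TM, x < rcoord L w' by exact: (cvgr_gt _ (rcoord_cvg L_gt0 Tw)).
  have n2 : \forall w' \near w^TM, rcoord L w' < y by exact: (cvgr_lt _ (rcoord_cvg L_gt0 Tw)).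
  apply: filterS3 (nearD w Tw Dw) n1 n2 => w' [Tw' Dw'] b1 b2; split=> //.
  by exists w'; [exact: proj_fibre | rewrite b1].
have oWo : open Wo.
  apply: open_near => w Tw [Dw hw].
  have nb := hw w (proj_fibre Tw).
  have [nx ny] : rcoord L w <> x /\ rcoord L w <> y.
    by apply: avoid => //; rewrite DF // in Dw; exact: lt_le_trans ee0.
  have n : \forall w' \near w^TM, ~ (x < rcoord L w' < y).
    have [xw|wx|e1] := ltgtP x (rcoord L w).
    - have yw : y < rcoord L w.
        rewrite lt_neqAle; apply/andP; split; first by apply/eqP => e1; apply: ny.
        by rewrite leNgt; apply/negP => wy; apply: nb; rewrite xw.
      have n1 : \forall w' \near w^TM, y < rcoord L w' by exact: (cvgr_gt _ (rcoord_cvg L_gt0 Tw)).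
      by apply: filterS n1 => w' b1 /andP[_ b2]; have := lt_trans b1 b2; rewrite ltxx.
    - have n1 : \forall w' \near w^TM, rcoord L w' < x by exact: (cvgr_lt _ (rcoord_cvg L_gt0 Tw)).
      by apply: filterS n1 => w' b1 /andP[b2 _]; have := lt_trans b1 b2; rewrite ltxx.
    - by case: nx.
  apply: filterS2 (nearD w Tw Dw) n => w' [Tw' Dw'] b1; split=> // w'' qw'' b2.
  by apply: b1; exact: (side _ _ _ Dw' qw'' (proj_fibre Tw') b2).
have Dz : D (proj z) by rewrite DF // dist2_self.
have Wz : Wn (proj z) by split=> //; exists z => //; exact: proj_fibre.
have disj q : Wn q -> Wo q -> False by move=> [_ [w qw hw]] [_ no]; exact: no qw hw.
have circW : circular_nbhd (proj z) e `<=` Wn.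
  move=> q [C [Cz CD cC] Cq]; have cover s : C s -> Wn s \/ Wo s.
    move=> /CD Ds; have [h|h] := pselect (exists2 w, reeb_fibre s w & x < rcoord L w < y).
      by left.
    by right; split=> // w sw hw; apply: h; exists w.
  have CE : C `&` Wn = C.
    apply: cC; first by exists (proj z).
      by exists Wn.
    exists (~` Wo); first exact: open_closedC.
    rewrite eqEsubset; split=> s [Cs Ws]; split=> //; first exact: disj.
    by case: (cover s Cs).
  by move: Cq; rewrite -CE => -[].
have rayI : Wn `&` right_of (proj z) `<=` ray z @` `]H z, H z + e[.
  move=> q [[Dq [w qw hw]] [bhq bkq]].
  have [Tw hE kE] := fibre_momentum qw.
  have [_ hzE kzE] := fibre_momentum (proj_fibre Tz).
  have Hzw : H z < H w by rewrite hzE hE.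
  have kk : K w = K z by rewrite kE kzE.
  have [g1 g2] := inner w Tw hw (ltW Hzw) kk.
  exists (H w).
    rewrite /= in_itv /= Hzw /=; move: Dq.
    rewrite /D /= bkq dist2_fst -hE -hzE gtr0_norm ?subr_gt0 //.
    by rewrite ltrBlDl.
  rewrite -(proj_eq qw); symmetry.
  have ls := sheet_level Tz (ltW Hzw).
  have lw : level (H w) (K z) w by split=> //=; rewrite /momentum kk.
  apply: (proj_linked lw); apply: (level_linked L_gt0 gen lw ls).
    by have [_ _ _ ->] := lift_TM f L_gt0 0 (1 * Num.sqrt (2 * H w - vel f Lam (K z) (rcoord L z)
        ^+ 2)) (allowed_rcoord Tz).
  by have [_ _ _ ->] := lift_TM f L_gt0 0 (1 * Num.sqrt (2 * H w - vel f Lam (K z) (rcoord L z)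
      ^+ 2)) (allowed_rcoord Tz).
split; last by exists Wn.
rewrite eqEsubset; split=> [q [/circW Wq rq]|q [h + <-]]; first exact: rayI.
rewrite /= in_itv /= => /andP[h1 h2].
have [_ hzE kzE] := fibre_momentum (proj_fibre Tz).
have [bE kE] := ray_val Tz (ltW h1).
split; last by rewrite /right_of /= bE kE -hzE -kzE.
(* Conversely, this arc of the ray is connected, starts at the centre and stays over the disc, hence
   lies in the component. *)
suff : ray z @` `[H z, h] `<=` circular_nbhd (proj z) e.
  by apply; exists h => //; rewrite /= in_itv /= lexx ltW.
apply: connected_component_max.
- by exists (H z); rewrite ?ray_start //= in_itv /= lexx ltW.
- move=> _ [t + <-]; rewrite /= in_itv /= => /andP[t1 t2].
  have [-> ->] := ray_val Tz t1; rewrite -kzE dist2_fst -hzE ger0_norm ?subr_ge0 //.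
  by rewrite ltrBlDl (le_lt_trans t2).
- apply: connected_continuous_connected; first exact: segment_connected.
  by apply: continuous_in_subspaceT => t _; exact: ray_continuous.
Qed.

Lemma circular_nbhd_right_connected (p : bcx) :
  \forall e \near 0^'+, connected (circular_nbhd p e `&` right_of p).
Proof.
have [z [Tz <- _]] := proj_repr p; have [e0 e00 he] := local_right Tz.
apply: filterS (right_and (nbhs_right_gt 0) (nbhs_right_le e00)) => e [e1 e2].
have [-> _] := he e (introT andP (conj e1 e2)).
apply: connected_continuous_connected; first by apply/connected_intervalP; exact:
    interval_is_interval.
by apply: continuous_in_subspaceT => t _; exact: ray_continuous.
Qed.

End ComplexTopology.

(** * Faces on the right of a point *)

Section Faces.
Context {R : realType}.
Variables (L : R) (f Lam : R -> R).
Hypotheses (L_gt0 : 0 < L) (gen : generic L f Lam).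

Local Notation H := (Hfun L f).
Local Notation K := (Kfun L Lam).
Local Notation TM := (TM L).
Local Notation F := (momentum L f Lam).
Local Notation bcx := (bcomplex L f Lam).
Local Notation vel := (vel f Lam).
Local Notation numer := (numer f Lam).
Local Notation ray := (ray L f Lam).
Local Notation proj := (proj L f Lam).
Local Notation singular := (@singular R L f Lam).
Local Notation face := (@face R L f Lam).
Local Notation adjacent_right := (@adjacent_right R L f Lam).

(** Positivity of H excludes the poles and the circles on the zero section, so the other critical
    family remains, where N = 0. *)
Lemma critical_point w : (rank0 L f Lam `|` rank1 L f Lam) w -> 0 < H w ->
  [/\ 0 <= rcoord L w <= L, numer (K w) (rcoord L w) = 0 & H w = vel (K w) (rcoord L w) ^+ 2 / 2].
Proof.
case=> [|/(rank1_inv L_gt0 gen)[r [kappa [hr Ow cq]]]].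
  rewrite rank0E // => w0 Hw; exfalso; move: Hw.
  have H0 M : M = northM L \/ M = southM L -> H (M, 0) = 0.
    move=> hM; rewrite -row3_0; have [_ -> _ _] := pole_HK f Lam 0 0 hM.
    by rewrite expr0n addr0 mul0r.
  by case: w0 => ->; rewrite H0 ?ltxx //; [left|right].
have [_ hE kE rE] := circle_HK f L_gt0 hr Ow; rewrite hE kE rE.
have f0 := f_neq0 gen hr.
move=> h0; split; first by case/andP: hr => *; rewrite !ltW.
  have q0 : kappa - Lam r != 0 by apply: contraTneq h0 => ->; rewrite expr0n mul0r ltxx.
  apply/eqP; rewrite oppr_eq0; move/eqP: cq; rewrite mulf_eq0 (negbTE q0) /=.
  by rewrite addrC [f r * _]mulrC.
by rewrite /vel expr_div_n [(2 * _)^-1]invfM [2^-1 * _]mulrC mulrA.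
Qed.

(** Around each r the only possible zero of N is r itself, so a single critical value has to be
    avoided there. Compactness of [0, L] makes the admissible heights uniform. *)
Lemma ray_regular z : TM z -> \forall t \near (H z)^'+, ~ singular (ray z t).
Proof.
move=> Tz; have [h0 _ _] := level_gap L_gt0 gen (conj Tz (erefl : F z = (H z, K z))).
have cov : \forall t \near (H z)^'+,
    `[0, L] `<=` [set r | ~ (numer (K z) r = 0 /\ t = vel (K z) r ^+ 2 / 2)].
  apply: ((compact_near_coveringP _).1 (@segment_compact R 0 L)) => r.
  rewrite /= in_itv /= => hr.
  have n1 : \forall r' \near r, r' != r -> numer (K z) r' != 0.
    by have := numer_isolated L_gt0 gen (K z) hr; rewrite near_withinE.
  (* A critical value at most H z is already below t; one above H z is not yet reached. *)
  have n2 : \forall t \near (H z)^'+, t != vel (K z) r ^+ 2 / 2.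
    have [c|c] := leP (vel (K z) r ^+ 2 / 2) (H z).
      by apply: filterS (nbhs_right_gt (H z)) => t ht; rewrite gt_eqF // (le_lt_trans c).
    by apply: filterS (nbhs_right_lt c) => t ht; rewrite lt_eqF.
  exists ([set r' | r' != r -> numer (K z) r' != 0],
          [set t | t != vel (K z) r ^+ 2 / 2]) => // -[r' t] /= [h1 h2] [e1 e2].
  have [e|ne] := eqVneq r' r; first by move: h2; rewrite e2 e eqxx.
  by move: (h1 ne); rewrite e1 eqxx.
apply: filterS2 cov (nbhs_right_gt (H z)) => t ct ht [w rw cw].
have [Tw hE kE] := fibre_momentum rw; have [bE bkE] := ray_val L_gt0 gen Tz (ltW ht).
rewrite bE in hE; rewrite bkE in kE.
have [|hr n e] := critical_point cw; first by rewrite hE (le_lt_trans h0).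
by apply: (ct (rcoord L w)); rewrite ?kE in n e *; rewrite /= ?in_itv // -hE.
Qed.

Lemma right_rays z : TM z -> exists2 e, 0 < e &
  (forall t, H z < t < H z + e -> ~ singular (ray z t)) /\
  exists2 U, open_nbhs (proj z) U & U `&` right_of (proj z) `<=` ray z @` `]H z, H z + e[.
Proof.
move=> Tz; have [e0 e00 he0] := local_right L_gt0 gen Tz.
have := ray_regular Tz; rewrite near_withinE => /nbhs_ballP[d /= d0 hd].
have e0' : 0 < Num.min e0 d by rewrite lt_min e00.
exists (Num.min e0 d) => //; split.
  move=> t /andP[t1 t2]; apply: hd => //=; rewrite /ball /= ltr0_norm ?subr_lt0 // opprB ltrBlDl.
  by apply: lt_le_trans t2 _; rewrite lerD2l ge_min lexx orbT.
by have [] := he0 (Num.min e0 d); [rewrite e0' ge_min lexx | move=> _].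
Qed.

Lemma face_component A q : face A -> A q -> A = connected_component (~` singular) q.
Proof. by move=> [p _ ->] /same_connected_component. Qed.

Lemma connected_rays z e : TM z -> connected (ray z @` `]H z, H z + e[).
Proof.
move=> Tz; apply: connected_continuous_connected.
  by apply/connected_intervalP; exact: interval_is_interval.
by apply: continuous_in_subspaceT => t _; exact: ray_continuous.
Qed.

(** A short ray to the right is connected and regular, so a face that meets it contains all of it;
    and near p there is nothing else on the right. *)
Lemma adjacent_rays z A : TM z -> face A ->
  adjacent_right A (proj z) <-> \forall t \near (H z)^'+, A (ray z t).
Proof.
move=> Tz fA; split=> [cl|near_A B nB].
  have [e e0 [reg [U [oU Uz] hU]]] := right_rays Tz.
  have [q [[Aq rq] Uq]] := cl U (open_nbhs_nbhs (conj oU Uz)).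
  have [t1 ht1 qE] := hU q (conj Uq rq).
  have sub : ray z @` `]H z, H z + e[ `<=` A.
    rewrite (face_component fA Aq); apply: connected_component_max.
    - by exists t1.
    - by move=> _ [t + <-]; rewrite /= in_itv /=; exact: reg.
    - exact: connected_rays.
  have he : H z < H z + e by rewrite ltrDl.
  apply: filterS2 (nbhs_right_gt (H z)) (nbhs_right_lt he) => t h1 h2.
  by apply: sub; exists t => //; rewrite /= in_itv /= h1.
have cB : \forall t \near (H z)^'+, B (ray z t).
  apply: dnbhs_right; apply: near_dnbhs.
  have c : {for H z, continuous (ray z)} := ray_continuous L_gt0 Tz (x := H z).
  by apply: c; rewrite (ray_start L_gt0 gen Tz).
have [t [[h1 h2] h3]] :=
  @filter_ex R (H z)^'+ _ _ (right_and (right_and near_A cB) (nbhs_right_gt (H z))).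
exists (ray z t); split=> //; split=> //.
have [bE bkE] := ray_val L_gt0 gen Tz (ltW h3).
have [_ hzE kzE] := fibre_momentum (proj_fibre f Lam Tz).
by rewrite /right_of /= bE bkE -hzE -kzE.
Qed.

Lemma right_face_unique (p : bcx) : exists! A, face A /\ adjacent_right A p.
Proof.
have [z [Tz <- _]] := proj_repr p.
have [e e0 [reg _]] := right_rays Tz.
have he : H z < H z + e by rewrite ltrDl.
have ht : H z < H z + e / 2 < H z + e by rewrite ltrDl divr_gt0 //= ltrD2l ltr_pdivrMr // ltr_pMr
    // ltrDl.
pose A := connected_component (~` singular) (ray z (H z + e / 2)).
have fA : face A by exists (ray z (H z + e / 2)) => //; exact: reg.
have sub : ray z @` `]H z, H z + e[ `<=` A.
  apply: connected_component_max.
  - by exists (H z + e / 2) => //; rewrite /= in_itv.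
  - by move=> _ [t + <-]; rewrite /= in_itv /=; exact: reg.
  - exact: connected_rays.
have nA : \forall t \near (H z)^'+, A (ray z t).
  apply: filterS2 (nbhs_right_gt (H z)) (nbhs_right_lt he) => t h1 h2.
  by apply: sub; exists t => //; rewrite /= in_itv /= h1.
exists A; split; first by split=> //; apply/(adjacent_rays Tz fA).
move=> A' [fA' /(adjacent_rays Tz fA') nA'].
have [t [h1 h2]] := @filter_ex R (H z)^'+ _ _ (right_and nA nA').
by rewrite (face_component fA h1) (face_component fA' h2).
Qed.

End Faces.

(** * Families of critical circles and the face on their right *)

Section Edges.
Context {R : realType}.
Variables (L : R) (f Lam : R -> R).
Hypotheses (L_gt0 : 0 < L) (gen : generic L f Lam).

Local Notation H := (Hfun L f).
Local Notation K := (Kfun L Lam).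
Local Notation TM := (TM L).
Local Notation S0 := (rad0 L).
Local Notation bcx := (bcomplex L f Lam).
Local Notation vel := (vel f Lam).
Local Notation lift := (lift L Lam).
Local Notation ray := (ray L f Lam).
Local Notation proj := (proj L f Lam).
Local Notation singular := (@singular R L f Lam).
Local Notation face := (@face R L f Lam).
Local Notation adjacent_right := (@adjacent_right R L f Lam).
Local Notation critical_q := (critical_q f Lam).

(** [proj_cvg] asks for membership at every parameter, including those outside the interval of the
    family. *)
Lemma lift_in_TM kappa r phi a : TM (lift kappa r phi a).
Proof.
rewrite liftE; split; rewrite dot3E !mxE /=; have e1 := cos2Dsin2 phi; have e2 := cos2Dsin2 (r /
    S0).
  transitivity (S0 ^+ 2 * (sin (r / S0) ^+ 2 * (cos phi ^+ 2 + sin phi ^+ 2) + cos (r / S0) ^+ 2)).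
    by ring.
  by rewrite e1 mulr1 [X in _ * X]addrC e2 mulr1.
transitivity (S0 * sin (r / S0) * a * cos (r / S0) * (cos phi ^+ 2 + sin phi ^+ 2 - 1)).
  by ring.
by rewrite e1 subrr mulr0.
Qed.

Lemma monotone_injective (g g1 : R -> R) (r0 c d : R) :
  (forall r : R, `|r - r0| < d -> is_derive r 1 g (g1 r) /\ 0 < c * g1 r) ->
  forall r r' : R, `|r - r0| < d -> `|r' - r0| < d -> g r = g r' -> r = r'.
Proof.
move=> hg; suff lt r r' : `|r - r0| < d -> `|r' - r0| < d -> r < r' -> g r <> g r'.
  move=> r r' h1 h2 e; have [h|h|//] := ltgtP r r'; first by case: (lt r r' h1 h2 h).
  by case: (lt r' r h2 h1 h).
move=> h1 h2 rr e.
have mid t : r <= t <= r' -> `|t - r0| < d.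
  move: h1 h2; rewrite !ltr_norml => /andP[a1 _] /andP[_ a2] /andP[b1 b2].
  by apply/andP; split; lra.
have [||t ht] := @MVT R g g1 r r' rr.
- by move=> t; rewrite in_itv /= => /andP[a1 a2]; have [] := hg t (mid t _); rewrite ?ltW.
- apply: continuous_in_subspaceT => t; rewrite inE /= in_itv /= => ht.
  by have [/isd_cvg] := hg t (mid t ht).
move: ht; rewrite in_itv /= e subrr => /andP[a1 a2] /esym/eqP.
have htt : r <= t <= r' by rewrite !ltW.
have [_ g0] := hg t (mid t htt).
rewrite mulf_eq0 subr_eq0 (gt_eqF rr) orbF => /eqP g10.
by rewrite g10 mulr0 ltxx in g0.
Qed.

Section CriticalFamily.
Variables (kap kap1 : R -> R) (r0 c d : R).
Hypothesis (d0 : 0 < d).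
Hypothesis kapP : forall r : R, `|r - r0| < d ->
  [/\ 0 < r < L, is_derive r 1 kap (kap1 r), 0 < c * kap1 r & critical_q r (kap r - Lam r)].

(** Here v is p_r: the point is singular at v = 0, and for v > 0 it lies on the ray to the right of
    that singular point, at height v^2 / 2 above it. *)
Definition family r v : bcx := proj (lift (kap r) r 0 v).

Lemma family_cvg (T : Type) (G : set_system T) {FG : Filter G} (r v : T -> R) r1 v1 :
  `|r1 - r0| < d -> r t @[t --> G] --> r1 -> v t @[t --> G] --> v1 ->
  family (r t) (v t) @[t --> G] --> family r1 v1.
Proof.
move=> /kapP[hr dk _ _] cr cv.
apply: proj_cvg; [by move=> t; exact: lift_in_TM | exact: lift_in_TM |].
apply: lift_cvg => //; last exact: cvg_cst.
have ck : kap (r t) @[t --> G] --> kap r1 by exact: (cvg_comp _ _ cr (isd_cvg dk)).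
have cl : Lam (r t) @[t --> G] --> Lam r1 by exact: (cvg_comp _ _ cr (@l_continuous _ _ _ _ gen
    r1)).
have cs : S0 * sin (r t / S0) @[t --> G] --> S0 * sin (r1 / S0).
  exact: (cvg_comp _ _ cr (isd_cvg (isd_S0sin L_gt0 r1))).
apply: cvgM; first exact: cvgB.
apply: cvgV => //; rewrite mulf_neq0 ?rad0_neq0 //.
exact: lt0r_neq0 (sin_colatitude_gt0 L_gt0 hr).
Qed.

Lemma family_HK r v : `|r - r0| < d ->
  [/\ H (lift (kap r) r 0 v) = v ^+ 2 / 2 + (kap r - Lam r) ^+ 2 / (2 * f r ^+ 2),
      K (lift (kap r) r 0 v) = kap r & rcoord L (lift (kap r) r 0 v) = r].
Proof. by move=> /kapP[hr _ _ _]; have [] := lift_TM f L_gt0 0 v (allowed_in Lam (kap r) hr). Qed.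

Lemma family_val r v : `|r - r0| < d ->
  bh (family r v) = v ^+ 2 / 2 + (kap r - Lam r) ^+ 2 / (2 * f r ^+ 2) /\
  bk (family r v) = kap r.
Proof.
move=> hr; have [e1 e2 _] := family_HK v hr.
have [_ b1 b2] := fibre_momentum (proj_fibre f Lam (lift_in_TM (kap r) r 0 v)).
by rewrite /family -b1 -b2 e1 e2.
Qed.

Lemma family_singular r : `|r - r0| < d -> singular (family r 0).
Proof.
move=> /kapP[hr _ _ cq]; exists (lift (kap r) r 0 0).
  exact: (proj_fibre f Lam (lift_in_TM _ _ _ _)).
right; apply: (rank1_circle L_gt0 gen hr cq); rewrite circle_orbitE //.
by exists 0.
Qed.

(** K is strictly monotone along the family and determines r; then H determines v^2. *)
Lemma family_inj r v r' : `|r - r0| < d -> `|r' - r0| < d ->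
  family r v = family r' 0 -> r = r' /\ v = 0.
Proof.
move=> hr hr' e; have [h1 k1] := family_val v hr; have [h2 k2] := family_val 0 hr'.
have re : r = r'.
  apply: (@monotone_injective kap kap1 r0 c d) => //; last by rewrite -k1 -k2 e.
  by move=> t /kapP[].
split=> //; move: h1; rewrite e h2 re => /esym/addIr/eqP.
by rewrite expr0n mul0r mulf_eq0 invr_eq0 pnatr_eq0 orbF sqrf_eq0 => /eqP.
Qed.

Lemma ray_family r v : `|r - r0| < d -> 0 <= v ->
  ray (lift (kap r) r 0 0) (H (lift (kap r) r 0 0) + v ^+ 2 / 2) = family r v.
Proof.
move=> hr v0; have [hH hK hR] := family_HK 0 hr; rewrite /ray hK hR hH.
rewrite /family /sheet; congr (proj (lift _ _ _ _)).
suff -> : 2 * (0 ^+ 2 / 2 + (kap r - Lam r) ^+ 2 / (2 * f r ^+ 2) + v ^+ 2 / 2)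
    - vel (kap r) r ^+ 2 = v ^+ 2 by rewrite sqrtr_sqr ger0_norm // mul1r.
rewrite /vel expr_div_n [(2 * _)^-1]invfM; move: ((kap r - Lam r) ^+ 2) (f r ^- 2) => x y.
by rewrite expr0n mul0r add0r; field.
Qed.

(** The change of variable t = H z + v^2 / 2, a homeomorphism of right neighbourhoods. *)
Lemma family_rays r A : `|r - r0| < d ->
  (\forall t \near (H (lift (kap r) r 0 0))^'+, A (ray (lift (kap r) r 0 0) t)) <->
  (\forall v \near 0^'+, A (family r v)).
Proof.
move=> hr; set z := lift _ _ _ _; split=> [nA|nA].
  have cc : H z + v ^+ 2 / 2 @[v --> (0 : R)^'+] --> (H z)^'+.
    move=> B hB; have : \forall t \near (H z)^'+, B t := hB.
    rewrite near_withinE => /nbhs_ballP[e /= e0 he].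
    have cs : v ^+ 2 / 2 @[v --> (0 : R)] --> (0 : R) ^+ 2 / 2.
      by apply: cvgMr_tmp; exact: (@cvgM _ _ _ _ id id).
    rewrite expr0n mul0r in cs.
    have n1 : \forall v \near (0 : R)^'+, v ^+ 2 / 2 < e.
      by apply: dnbhs_right; apply: near_dnbhs; exact: (cvgr_lt _ cs).
    apply: filterS2 n1 (nbhs_right_gt 0) => v h1 h2; apply: he.
      by rewrite /ball /= opprD addNKr normrN ger0_norm // divr_ge0 // sqr_ge0.
    by rewrite ltrDl divr_gt0 // exprn_gt0.
  have := cc _ nA; apply: filterS2 (nbhs_right_gt 0) => v v0.
  by rewrite /= ray_family // ltW.
move: nA; rewrite near_withinE => /nbhs_ballP[e /= e0 he].
have e2 : H z < H z + e ^+ 2 / 2 by rewrite ltrDl divr_gt0 // exprn_gt0.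
apply: filterS2 (nbhs_right_gt (H z)) (nbhs_right_lt e2) => t h1 h2.
pose v := Num.sqrt (2 * (t - H z)).
have p : 0 < 2 * (t - H z) by rewrite mulr_gt0 // subr_gt0.
have v0 : 0 < v by rewrite sqrtr_gt0.
have -> : t = H z + v ^+ 2 / 2 by rewrite sqr_sqrtr ?ltW // mulrC mulKf // addrC subrK.
rewrite ray_family ?ltW //; apply: he => //.
rewrite /ball /= sub0r normrN gtr0_norm // -[X in _ < X]gtr0_norm // -sqrtr_sqr ltr_sqrt
    ?exprn_gt0 //.
by rewrite -ltr_pdivlMl // mulrC ltrBlDl.
Qed.

(* The points family r v with v > 0 small are regular, and they connect the rays
   that start at the points family r 0. *)
Lemma family_common_face (V : set bcx) : nbhs (family r0 0) V ->
  (forall q, V q -> singular q -> exists2 r, `|r - r0| < d & q = family r 0) ->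
  exists2 A, face A & \forall r \near r0, adjacent_right A (family r 0).
Proof.
move=> nV hV; have hr0 : `|r0 - r0| < d by rewrite subrr normr0.
have cc : family P.1 P.2 @[P --> (r0, (0 : R))] --> family r0 0.
  by apply: family_cvg => //; [exact: cvg_fst | exact: cvg_snd].
have /nbhs_ballP[e0 /= e00 he0] : \forall P \near (r0, (0 : R)), V (family P.1 P.2) by exact: cc.
pose e := Num.min e0 d; have e_gt0 : 0 < e by rewrite lt_min e00.
have inV r v : `|r - r0| < e -> `|v| < e -> `|r - r0| < d /\ V (family r v).
  rewrite !lt_min => /andP[a1 a2] /andP[b1 b2]; split=> //.
  by apply: (he0 (r, v)); split; rewrite /ball /= ?sub0r ?normrN // distrC.
(* The singular fibres in V all have the form [family r' 0], so by injectivity those with v > 0 are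
   regular. *)
have reg r v : `|r - r0| < e -> 0 < v < e -> ~ singular (family r v).
  move=> h1 /andP[v0 v1] sg; have v2 : `|v| < e by rewrite gtr0_norm.
  have [hr Vq] := inV r v h1 v2.
  have [r' hr' E] := hV _ Vq sg.
  have [_ vE] := family_inj hr hr' E.
  by rewrite vE ltxx in v0.
pose v1 := e / 2; have hv1 : 0 < v1 < e.
  by rewrite divr_gt0 //= ltr_pdivrMr // ltr_pMr // ltrDl.
pose A := connected_component (~` singular) (family r0 v1).
have hr0e : `|r0 - r0| < e by rewrite subrr normr0.
have fA : face A by exists (family r0 v1) => //; exact: reg.
have inA r v : `|r - r0| < e -> 0 < v < e -> A (family r v).
  move=> h1 hv.
  (* The straight path from (r0, v1) to (r, v); the parameter rectangle is convex. *)
  pose pr s := r0 + s * (r - r0); pose pv s := v1 + s * (v - v1).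
  have bnd s : 0 <= s <= 1 -> `|pr s - r0| < e /\ 0 < pv s < e.
    move=> /andP[s0 s1]; split.
      rewrite /pr [r0 + _]addrC addrK normrM ger0_norm //.
      by apply: le_lt_trans h1; rewrite ler_piMl.
    case/andP: hv hv1 => a1 a2 /andP[b1 b2].
    have -> : pv s = (1 - s) * v1 + s * v by rewrite /pv; ring.
    have s1' : 0 <= 1 - s by rewrite subr_ge0.
    have [->|sn] := eqVneq s 0; first by rewrite subr0 mul1r mul0r addr0 b1.
    have sp : 0 < s by rewrite lt_neqAle eq_sym sn.
    apply/andP; split.
      by apply: ltr_wpDl; [exact: mulr_ge0 s1' (ltW b1) | exact: mulr_gt0].
    have x1 : (1 - s) * v1 <= (1 - s) * e by rewrite ler_wpM2l // ltW.
    have x2 : s * v < s * e by rewrite ltr_pM2l.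
    by apply: (lt_le_trans (ler_ltD x1 x2)); rewrite -mulrDl subrK mul1r.
  suff sub : (fun s => family (pr s) (pv s)) @` `[0, 1] `<=` A.
    apply: sub; exists 1; first by rewrite /= in_itv /= ler01 lexx.
    by rewrite /pr /pv !mul1r ![_ + (_ - _)]addrC !subrK.
  apply: connected_component_max.
  - exists 0; first by rewrite /= in_itv /= ler01 lexx.
    by rewrite /pr /pv !mul0r !addr0.
  - move=> _ [s + <-]; rewrite /= in_itv /= => /bnd[a1 a2]; exact: reg.
  - apply: connected_continuous_connected; first exact: segment_connected.
    apply: continuous_in_subspaceT => s; rewrite inE /= in_itv /= => /bnd[a1 a2].
    have ad : `|pr s - r0| < d by move: a1; rewrite lt_min => /andP[].
    apply: family_cvg => //.
      by apply: cvgD; [exact: cvg_cst | apply: cvgMr_tmp; exact: cvg_id].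
    by apply: cvgD; [exact: cvg_cst | apply: cvgMr_tmp; exact: cvg_id].
exists A => //; apply/nbhs_ballP; exists e => // r; rewrite /ball /= distrC => hr.
have hrd : `|r - r0| < d by move: hr; rewrite lt_min => /andP[].
apply/(adjacent_rays L_gt0 gen (lift_in_TM _ _ _ _) fA); apply/(family_rays A hrd).
apply: filterS2 (nbhs_right_gt 0) (nbhs_right_lt e_gt0) => v a1 a2.
by apply: inA; rewrite ?a1.
Qed.

End CriticalFamily.

End Edges.

(** * The common face along an edge *)

Section EdgeFaces.
Context {R : realType}.
Variables (L : R) (f Lam : R -> R).
Hypotheses (L_gt0 : 0 < L) (gen : generic L f Lam).

Local Notation H := (Hfun L f).
Local Notation bcx := (bcomplex L f Lam).
Local Notation proj := (proj L f Lam).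
Local Notation k := (kfun f Lam).
Local Notation l1 := (Lam^`()).
Local Notation da := (da f Lam).
Local Notation singular := (@singular R L f Lam).
Local Notation face := (@face R L f Lam).
Local Notation edge := (@edge R L f Lam).
Local Notation adjacent_right := (@adjacent_right R L f Lam).
Local Notation critical_q := (critical_q f Lam).
Local Notation family := (family L f Lam).

Lemma near_abs (r0 : R) (P : set R) : (\forall r \near r0, P r) ->
  exists2 d, 0 < d & forall r, `|r - r0| < d -> P r.
Proof.
by move=> /nbhs_ballP[d /= d0 hd]; exists d => // r hr; apply: hd; rewrite /ball /= distrC.
Qed.

(** Non-degeneracy makes kap' nonzero in both families: Lam' != 0 for kap = Lam, and a' != 0 for kap
    = k, where k' = - f a'. The constant c is kap'(r0) and records its sign nearby. *)
Lemma critical_family w : rank1 L f Lam w -> nondegenerate1 L f Lam w ->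
  exists (kap kap1 : R -> R) (r0 c d : R), [/\ 0 < d,
    forall r : R, `|r - r0| < d ->
      [/\ 0 < r < L, is_derive r 1 kap (kap1 r), 0 < c * kap1 r & critical_q r (kap r - Lam r)] &
    proj w = family kap r0 0].
Proof.
move=> r1 nd; have [r0 [kappa [hr Ow cq]]] := rank1_inv L_gt0 gen r1.
have [nd0 _ _] := circle_type L_gt0 gen hr Ow cq; have {nd0} := nd0.1 nd => disc0.
have pw : proj w = proj (lift L Lam kappa r0 0 0).
  move: (Ow); rewrite circle_orbitE // => -[phi wE].
  have [Tw _ kE _] := circle_HK f L_gt0 hr Ow.
  have lw : level L f Lam (H w) kappa w by split=> //=; rewrite /momentum kE.
  rewrite wE in lw *; apply: (proj_linked lw).
  by apply: (linked_circle L_gt0 (phi1 := phi)) => //; exact: allowed_in.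
have nr : \forall r \near r0, 0 < r < L by exact: near_itv.
have [/eqP|[F /addIr e]] := critical_qE gen hr cq.
  rewrite subr_eq0 => /eqP e; rewrite {}e in disc0 pw.
  have l0 : l1 r0 != 0.
    move: disc0; rewrite (discr_Lam gen hr); apply: contraNneq => ->.
    by rewrite mul0r expr0n oppr0.
  have [d d0 hd] := near_abs (filterI nr (cvg_near_neq0 (@l1_continuous _ _ _ _ gen r0) l0)).
  exists Lam, l1, r0, (l1 r0), d; split=> // r /hd[h1 h2]; split=> //; first exact: (isd_l gen).
  exact: critical_Lam.
rewrite {}e in disc0 pw.
have da0 : da r0 != 0.
  move: disc0; rewrite (discr_k gen hr F) (sgn_type_da gen F); apply: contraNneq => ->.
  by rewrite mulr0 mul0r mul0r oppr0.
have k10 : - (f r0 * da r0) != 0 by rewrite oppr_eq0 mulf_neq0 // (f_neq0 gen hr).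
have ck : - (f r * da r) @[r --> r0] --> - (f r0 * da r0).
  by apply: cvgN; apply: cvgM; [exact: (@f_continuous _ _ _ _ gen r0) | exact: isd_cvg (isd_da
      gen F)].
have [d d0 hd] := near_abs (filterI (filterI nr (near_f1_neq0 gen F)) (cvg_near_neq0 ck k10)).
exists k, (fun r => - (f r * da r)), r0, (- (f r0 * da r0)), d; split=> // r /hd[[h1 h2] h3].
by split=> //; [exact: (isd_k gen) | exact: critical_k].
Qed.

(** The edge is known only through c and its inverse j, while the faces are controlled along the
    explicit family. T = j o family compares the two: it is continuous and injective in r, so the
    family covers all parameters near t0. *)
Lemma edge_local (E U : set bcx) (c : R -> bcx) (j : bcx -> R) (t0 : R) :
  E `<=` @nondegenerate_singular R L f Lam -> open U -> E = U `&` singular -> E = c @` `]0, 1[ ->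
  {within E, continuous j} -> (forall t, 0 < t < 1 -> j (c t) = t) -> 0 < t0 < 1 ->
  exists2 A, face A & \forall t \near t0, adjacent_right A (c t).
Proof.
move=> Ens oU EU Ec jc jK ht0.
have Ec0 : E (c t0) by rewrite Ec; exists t0 => //; rewrite /= in_itv.
have cj q : E q -> c (j q) = q.
  by rewrite Ec => -[t + <-]; rewrite /= in_itv /= => ht; rewrite jK.
have jE q : E q -> forall B : set R, nbhs (j q) B -> \forall p \near q, E p -> B (j p).
  have jc' : forall x, E x -> j y @[y --> within E (nbhs x)] --> j x by apply/subspace_continuousP.
  by move=> Eq B nB; exact: (jc' q Eq B nB).
have [[w pw cw] no0 nd] := Ens _ Ec0.
have r1w : rank1 L f Lam w.
  by case: cw => // r0w; have : (reeb_fibre (c t0) `&` rank0 L f Lam) w by []; rewrite no0.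
have [kap [kap1 [r0 [cc [d [d0 kapP wE]]]]]] := critical_family r1w (nd w (conj pw r1w)).
rewrite (proj_eq pw) in wE.
pose Q r : bcx := family kap r 0.
have Qcvg r : `|r - r0| < d -> Q s @[s --> r] --> Q r.
  by move=> hr; apply: (family_cvg L_gt0 gen kapP hr); [exact: cvg_id | exact: cvg_cst].
have hr0 : `|r0 - r0| < d by rewrite subrr normr0.
have nU : nbhs (c t0) U by apply: open_nbhs_nbhs; split=> //; move: Ec0; rewrite EU => -[].
have nUr : \forall r \near r0, U (Q r) by apply: (Qcvg r0 hr0); rewrite /Q -wE.
have [d1 d10 hd1] := near_abs nUr.
pose d' := Num.min d d1; have d'0 : 0 < d' by rewrite lt_min d0.
have ltd r : `|r - r0| < d' -> `|r - r0| < d by rewrite lt_min => /andP[].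
have QE r : `|r - r0| < d' -> E (Q r).
  rewrite lt_min => /andP[h1 h2]; rewrite EU; split; first exact: hd1.
  exact: (family_singular L_gt0 gen kapP h1).
pose T r := j (Q r).
have Tc r : `|r - r0| < d' -> T s @[s --> r] --> T r.
  move=> hr B nB; have hB := jE _ (QE r hr) B nB.
  have n1 : \forall s \near r, E (Q s) -> B (j (Q s)) := Qcvg r (ltd r hr) _ hB.
  have n2 : \forall s \near r, `|s - r0| < d'.
    have cs : `|s - r0| @[s --> r] --> `|r - r0|.
      by apply: cvg_norm; apply: cvgB; [exact: cvg_id | exact: cvg_cst].
    exact: (cvgr_lt _ cs).
  by apply: filterS2 n1 n2 => s h1 h2; apply: h1; exact: QE.
have Tinj r r' : `|r - r0| < d' -> `|r' - r0| < d' -> T r = T r' -> r = r'.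
  move=> hr hr' e; have : Q r = Q r' by rewrite -(cj _ (QE r hr)) -(cj _ (QE r' hr')) -/(T r) e.
  by move/(family_inj L_gt0 kapP (ltd r hr) (ltd r' hr'))=> [].
have T0 : T r0 = t0 by rewrite /T /Q -wE jK.
have Tsurj e : 0 < e -> \forall t \near t0, exists r, [/\ `|r - r0| < e, `|r - r0| < d' & T r = t].
  move=> e0; pose m := Num.min e d' / 2.
  have m0 : 0 < m by rewrite divr_gt0 // lt_min e0.
  have inm r : r0 - m <= r <= r0 + m -> `|r - r0| < e /\ `|r - r0| < d'.
    move=> /andP[a1 a2]; apply/andP; rewrite -lt_min.
    apply: (@le_lt_trans _ _ m); first by rewrite ler_norml; apply/andP; split; lra.
    by rewrite ltr_pdivrMr // ltr_pMr ?ltrDl // lt_min e0.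
  have ab : r0 - m <= r0 + m by lra.
  have cont : {within `[r0 - m, r0 + m], continuous T}.
    by apply: continuous_in_subspaceT => r; rewrite inE /= in_itv /= => /inm[_ /Tc].
  have inj : {in `[r0 - m, r0 + m] &, injective T}.
    by move=> r r'; rewrite !in_itv /= => /inm[_ h1] /inm[_ h2]; exact: Tinj.
  (* A continuous injection of an interval is strictly monotone, so its value t0 at the midpoint
     lies strictly between its values at the ends. *)
  have strict : Num.min (T (r0 - m)) (T (r0 + m)) < t0 < Num.max (T (r0 - m)) (T (r0 + m)).
    have i1 : r0 - m \in `[r0 - m, r0 + m] by rewrite in_itv /= lexx.
    have i2 : r0 + m \in `[r0 - m, r0 + m] by rewrite in_itv /= lexx andbT.
    have i3 : r0 \in `[r0 - m, r0 + m] by rewrite in_itv /=; apply/andP; split; lra.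
    have l1 : r0 - m < r0 by lra.
    have l2 : r0 < r0 + m by lra.
    rewrite -T0 gt_min lt_max.
    have [mono|mono] := itv_continuous_inj_mono cont inj.
      by rewrite (mono _ _ i1 i3 l1) (mono _ _ i3 i2 l2) orbT.
    by rewrite (mono _ _ i3 i1 l1) (mono _ _ i2 i3 l2) !orbT.
  have nt : \forall t \near t0, Num.min (T (r0 - m)) (T (r0 + m)) < t < Num.max (T (r0 - m)) (T
      (r0 + m)).
    exact: near_itv.
  apply: filterS nt => t /andP[t1 t2].
  have [r + Tr] := IVT ab cont (introT andP (conj (ltW t1) (ltW t2))).
  by rewrite in_itv /= => /inm[h1 h2]; exists r.
(* A neighbourhood in which every singular point belongs to the family: inside U a singular point is
   in E, and its parameter is attained by T. *)
pose V := U `&` [set q | E q -> exists r, [/\ `|r - r0| < d, `|r - r0| < d' & T r = j q]].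
have nV : nbhs (family kap r0 0) V.
  rewrite -wE; apply: filterI => //.
  have n1 : \forall t \near j (c t0), exists r, [/\ `|r - r0| < d, `|r - r0| < d' & T r = t].
    by rewrite jK //; exact: Tsurj.
  exact: (jE _ Ec0 _ n1).
have hV q : V q -> singular q -> exists2 r, `|r - r0| < d & q = family kap r 0.
  move=> [Uq hq] sq; have Eq : E q by rewrite EU.
  have [r [h1 h2 e]] := hq Eq; exists r => //.
  by rewrite -(cj _ Eq) -e -[RHS](cj _ (QE r h2)).
have [A fA nA] := family_common_face L_gt0 gen d0 kapP nV hV.
have [e e0 he] := near_abs nA.
exists A => //; apply: filterS (Tsurj e e0) => t [r [h1 h2 <-]].
by rewrite (cj _ (QE r h2)); exact: he.
Qed.

(** The parameters at which A is adjacent form an open and closed subset of ]0, 1[. Both parts come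
    from the local face and the uniqueness of the face on the right of a point. *)
Lemma edge_unique_face (E : set bcx) : edge E ->
  exists! A, face A /\ forall p, E p -> adjacent_right A p.
Proof.
move=> [Ens [U oU EU] [c [j [Ec cc jc jK]]]].
have loc (t : R) : 0 < t < 1 -> exists2 A, face A & \forall s \near t, adjacent_right A (c s).
  exact: (edge_local Ens oU EU Ec jc jK).
have uniq p A B : face A -> face B -> adjacent_right A p -> adjacent_right B p -> A = B.
  move=> fA fB aA aB; have [C [_ CU]] := right_face_unique L_gt0 gen p.
  by rewrite -(CU A (conj fA aA)) -(CU B (conj fB aB)).
have h2 : 0 < (2^-1 : R) < 1 by rewrite invr_gt0 ltr0n /= invf_lt1 // ltr1n.
have [A fA nA] := loc _ h2.
have all (t0 : R) : 0 < t0 < 1 -> adjacent_right A (c t0).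
  have cI : connected (`]0, 1[ : set R) by apply/connected_intervalP; exact: interval_is_interval.
  pose B := `]0, 1[%classic `&` [set t | adjacent_right A (c t)].
  have near_in (s : R) : 0 < s < 1 -> adjacent_right A (c s) -> \forall t \near s, adjacent_right
      A (c t).
    move=> hs As; have [A' fA' nA'] := loc s hs.
    by rewrite (uniq _ _ _ fA fA' As (nbhs_singleton nA')).
  have near_out (s : R) : 0 < s < 1 -> ~ adjacent_right A (c s) -> \forall t \near s, ~
      adjacent_right A (c t).
    move=> hs nAs; have [A' fA' nA'] := loc s hs; have As' := nbhs_singleton nA'.
    apply: filterS nA' => t At' At.
    by apply: nAs; rewrite (uniq _ _ _ fA fA' At At').
  have BE : B = `]0, 1[%classic.
    apply: cI.
    - by exists 2^-1; split; [rewrite /= in_itv | exact: nbhs_singleton].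
    - exists (interior [set t | adjacent_right A (c t)]); first exact: open_interior.
      rewrite eqEsubset; split=> t [/= it ht]; split=> //; last exact: interior_subset.
      by apply: near_in => //; rewrite in_itv in it.
    - exists (~` interior [set t | ~ adjacent_right A (c t)]).
        by apply: open_closedC; exact: open_interior.
      rewrite eqEsubset; split=> t [/= it ht]; split=> //.
        by move=> /interior_subset.
      by apply: contrapT => nt; apply: ht; apply: near_out => //; rewrite in_itv in it.
  by move=> ht; have [] : B t0 by rewrite BE /= in_itv.
exists A; split.
  by split=> // p; rewrite Ec => -[t + <-]; rewrite /= in_itv /=; exact: all.
move=> A' [fA' hA']; apply: (uniq (c 2^-1)) => //; first exact: all.
by apply: hA'; rewrite Ec; exists 2^-1 => //; rewrite /= in_itv.
Qed.

End EdgeFaces.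

(** * The zero section *)

Section SortedSequences.
Context {R : realType}.
Implicit Types (s : seq R) (x y : R).

Lemma sorted_head s x : sorted <%R s -> x \in s -> (forall y, y \in s -> x <= y) -> head 0 s = x.
Proof.
case: s => //= a s ps; rewrite inE => /orP[/eqP -> //|xs] /(_ a); rewrite mem_head => /(_ isT) xa.
have /allP/(_ x xs) := order_path_min lt_trans ps.
by move=> ax; have := le_lt_trans xa ax; rewrite ltxx.
Qed.

Lemma sorted_last s x : sorted <%R s -> x \in s -> (forall y, y \in s -> y <= x) -> last 0 s = x.
Proof.
case: s => // a s ps xs hx; have i := index_mem x (a :: s); rewrite xs in i.
rewrite -nth_last; apply/eqP; rewrite eq_le; apply/andP; split.
  by apply: hx; rewrite mem_nth.
by rewrite -{1}(nth_index 0 xs) (lt_sorted_leq_nth 0 ps) // inE.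
Qed.

Lemma sorted_consecutive s j x : sorted <%R s -> (j.+1 < size s)%N -> x \in s ->
  nth 0 s j < x < nth 0 s j.+1 -> False.
Proof.
move=> ps js xs; have i : (index x s < size s)%N by rewrite index_mem.
rewrite -{1 2}(nth_index 0 xs) !(lt_sorted_ltn_nth 0 ps) ?inE //; last exact: ltnW.
by move=> /andP[h1]; rewrite ltnS leqNgt h1.
Qed.

End SortedSequences.

Section CriticalPointsOfLambda.
Context {R : realType}.
Variables (L : R) (f Lam : R -> R).
Hypotheses (L_gt0 : 0 < L) (gen : generic L f Lam).

Local Notation l1 := (Lam^`()).

Lemma near_crit r : 0 <= r <= L -> \forall t \near r, t != r -> l1 t != 0.
Proof.
move=> hr; have [l0|l0] := eqVneq (l1 r) 0.
  have := isd_near_sign (isd_l1 gen r) l0 (crit_l_l2 gen (conj hr l0)).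
  by rewrite near_withinE; apply: filterS => t h /h; apply: contraTneq => ->; rewrite mulr0 ltxx.
apply: filterS (cvg_near_neq0 (@l1_continuous _ _ _ _ gen r) l0) => t h _.
by apply: contraTneq h => ->; rewrite mulr0 ltxx.
Qed.

(** Critical points of a Morse function are isolated, whereas constancy would make the whole
    interval critical. *)
Lemma Lam_not_locally_constant x y c : x < y -> 0 <= x -> y <= L ->
  (forall t, x <= t <= y -> Lam t = c) -> False.
Proof.
move=> xy x0 yL hc.
have l10 (t : R) : x < t < y -> l1 t = 0.
  move=> ht; apply: (isd_derive1 (d := 0)).
  apply: (isd_near _ (isd_cst c t)); apply: filterS (near_itv ht) => s /andP[s1 s2].
  by rewrite hc // !ltW.
pose m := (x + y) / 2; have hm : x < m < y by rewrite /m; apply/andP; split; lra.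
have h0L : 0 <= m <= L by case/andP: hm => a b; apply/andP; split; lra.
have n1 : \forall t \near m, l1 t = 0 by apply: filterS (near_itv hm); exact: l10.
apply: (@dnbhs_false _ m (fun=> False)); last by move=> ? [].
apply: filterS2 (near_dnbhs n1) (near_crit h0L) => t h1 h2.
by rewrite h1 eqxx in h2.
Qed.

(** Each point of [0, L] has a neighbourhood with at most one critical point, its centre; a finite
    subcover bounds their number. *)
Lemma crit_finite : finite_set (crit L Lam).
Proof.
have := @segment_compact R 0 L; rewrite compact_cover => cov.
have [||D _ hD] := cov R [set r | 0 <= r <= L]
    (fun r => interior [set t | t != r -> l1 t != 0]).
- by move=> r _; exact: open_interior.
- move=> r; rewrite /= in_itv /= => hr; exists r => //; exact: near_crit.
apply: (sub_finite_set _ (finite_fset D)) => r [hr l0].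
have [|s sD /interior_subset hs] := hD r; first by rewrite /= in_itv.
have [->//|/hs] := eqVneq r s; by rewrite l0 eqxx.
Qed.

Lemma Lam_monotone_image r1 r2 : r1 < r2 -> 0 <= r1 -> r2 <= L ->
  (forall t, r1 < t < r2 -> ~ crit L Lam t) ->
  Lam @` `[r1, r2] = [set t | Num.min (Lam r1) (Lam r2) <= t <= Num.max (Lam r1) (Lam r2)].
Proof.
move=> r12 r10 r2L nc.
have cL : {within `[r1, r2], continuous Lam}.
  by apply: continuous_subspaceT; exact: (l_continuous gen).
have lt x y : r1 <= x -> x < y -> y <= r2 -> Lam x <> Lam y.
  move=> rx xy yr e; have [||t] := @MVT R Lam l1 x y xy.
  - by move=> t _; exact: isd_l gen t.
  - by apply: continuous_subspaceT; exact: (l_continuous gen).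
  rewrite in_itv /= e subrr => /andP[t1 t2] /esym/eqP.
  rewrite mulf_eq0 subr_eq0 (gt_eqF xy) orbF => /eqP l0.
  apply: (nc t); first by rewrite (le_lt_trans rx t1) (lt_le_trans t2 yr).
  by split=> //; apply/andP; split; lra.
have inj : {in `[r1, r2] &, injective Lam}.
  move=> x y; rewrite !in_itv /= => /andP[x1 x2] /andP[y1 y2] e.
  have [h|h|//] := ltgtP x y; first by case: (lt x y).
  by case: (lt y x).
have i1 : r1 \in `[r1, r2] by rewrite in_itv /= lexx ltW.
have i2 : r2 \in `[r1, r2] by rewrite in_itv /= lexx ltW.
rewrite eqEsubset; split=> [_ [t ti <-]|t ht]; last first.
  by have [c ci <-] := IVT (ltW r12) cL ht; exists c.
rewrite /= ge_min le_max.
have /unstable.strict_monotonicW[mono|mono] := itv_continuous_inj_mono cL inj.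
  move: (ti); rewrite /= in_itv /= => /andP[t1 t2].
  by rewrite (mono _ _ i1 ti t1) (mono _ _ ti i2 t2) orbT.
move: (ti); rewrite /= in_itv /= => /andP[t1 t2].
by rewrite (mono _ _ ti i1 t1) (mono _ _ i2 ti t2) !orbT.
Qed.

Lemma crit_sequence : exists s : seq R,
  [/\ sorted <%R s, [set` s] = crit L Lam, head 0 s = 0 & last 0 s = L].
Proof.
have /finite_seqP[s0 s0E] := crit_finite.
have mem r : (r \in sort <=%O (undup s0)) <-> crit L Lam r.
  by rewrite mem_sort mem_undup s0E.
have ss : sorted <%R (sort <=%O (undup s0)) by rewrite sort_lt_sorted undup_uniq.
exists (sort <=%O (undup s0)); split=> //.
- by rewrite eqEsubset; split=> r /= /mem.
- apply: sorted_head => // [|y /mem[/andP[]] //].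
  by apply/mem; split; [rewrite lexx ltW | exact: (l1_0 gen)].
- apply: sorted_last => // [|y /mem[/andP[]] //].
  by apply/mem; split; [rewrite lexx ltW | exact: (l1_L gen)].
Qed.

End CriticalPointsOfLambda.

Section ZeroSection.
Context {R : realType}.
Variables (L : R) (f Lam : R -> R).
Hypotheses (L_gt0 : 0 < L) (gen : generic L f Lam).

Local Notation phase := (@phase R).
Local Notation H := (Hfun L f).
Local Notation K := (Kfun L Lam).
Local Notation TM := (TM L).
Local Notation O := (circle_orbit L Lam).
Local Notation lift := (lift L Lam).
Local Notation X0 := (TM `&` [set z | H z = 0]).
Local Notation I0 := [set r : R | 0 <= r <= L].

(** H is a sum of two nonnegative terms, so H = 0 kills both p_r and kappa - Lam. *)
Lemma zero_sectionE z : X0 z -> K z = Lam (rcoord L z) /\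
  exists phi, z = lift (Lam (rcoord L z)) (rcoord L z) phi 0.
Proof.
move=> [Tz /= Hz]; have [phi [a [zE al]]] := TM_lift Lam L_gt0 Tz.
have [_ hz _ _] := lift_TM f L_gt0 phi a al; rewrite -zE Hz in hz.
have a0 : a = 0.
  apply/eqP; rewrite -sqrf_eq0 eq_le sqr_ge0 andbT.
  have := divr_ge0 (sqr_ge0 (K z - Lam (rcoord L z))) (mulr_ge0 (ler0n R 2) (sqr_ge0 (f (rcoord L
      z)))).
  by move: hz; move: (_ / (2 * f _ ^+ 2)) => b; lra.
have kE : K z = Lam (rcoord L z).
  case: (itv_cases (TM_rcoord L_gt0 Tz)) => [e|e|hr].
  - by rewrite e; case: al => _ k0 _; exact: k0.
  - by rewrite e; case: al => _ _ k0; exact: k0.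
  have f0 := f_neq0 gen hr; move: hz; rewrite a0 expr0n mul0r add0r => /esym/eqP.
  have d0 : 2 * f (rcoord L z) ^+ 2 != 0 by rewrite mulf_neq0 ?pnatr_eq0 // sqrf_eq0.
  by rewrite mulf_eq0 invr_eq0 (negbTE d0) orbF sqrf_eq0 subr_eq0 => /eqP.
by split=> //; exists phi; rewrite {1}zE a0 kE.
Qed.

Lemma zero_section_lift r phi : 0 <= r <= L ->
  X0 (lift (Lam r) r phi 0) /\ rcoord L (lift (Lam r) r phi 0) = r.
Proof.
move=> hr; have al : allowed L Lam (Lam r) r by split=> // ->.
have [h1 h2 _ h4] := lift_TM f L_gt0 phi 0 al; split=> //; split=> //=.
by rewrite h2 subrr expr0n !mul0r addr0.
Qed.

Lemma zero_section_lift_cvg (T : Type) (G : set_system T) {FG : Filter G} (r phi : T -> R) r0 phi0 :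
  r t @[t --> G] --> r0 -> phi t @[t --> G] --> phi0 ->
  lift (Lam (r t)) (r t) (phi t) 0 @[t --> G] --> lift (Lam r0) r0 phi0 0.
Proof.
move=> cr cp; apply: lift_cvg => //; last exact: cvg_cst.
rewrite /spin subrr mul0r; under eq_cvg do rewrite subrr mul0r.
exact: cvg_cst.
Qed.

(** This makes the fibres of K on the zero section single parallels: [rcoord] maps a connected fibre
    onto an interval on which Lam is constant. *)
Lemma constant_interval_point (A : set R) c x y : is_interval A -> A `<=` I0 ->
  (forall t, A t -> Lam t = c) -> A x -> A y -> x = y.
Proof.
move=> iA AI hc; wlog : x y / x < y.
  by move=> wl Ax Ay; have [h|h|//] := ltgtP x y; [exact: wl | symmetry; exact: wl].
move=> xy Ax Ay; exfalso; have /andP[x0 _] := AI x Ax; have /andP[_ yL] := AI y Ay.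
apply: (@Lam_not_locally_constant _ L f Lam gen x y c) => // t ht; apply: hc.
exact: (iA x y).
Qed.

Lemma zero_section_fibre z w : X0 z -> fibre X0 K z w <-> X0 w /\ rcoord L w = rcoord L z.
Proof.
move=> Xz; have [kz [phi zE]] := zero_sectionE Xz; split=> [fw|[Xw rw]].
  have [Xw _] := connected_component_sub fw; split=> //.
  apply: (@constant_interval_point (rcoord L @` fibre X0 K z) (K z)).
  - apply/connected_intervalP; apply: connected_continuous_connected.
      exact: component_connected.
    apply: (@continuous_subspaceW _ _ _ TM).
      by move=> t /connected_component_sub[[]].
    by apply/subspace_continuousP => t Tt; exact: rcoord_cvg.
  - by move=> _ [t /connected_component_sub[[Tt _] _] <-]; exact: (TM_rcoord L_gt0).
  - move=> _ [t /connected_component_sub[Xt kt] <-].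
    by have [<- _] := zero_sectionE Xt.
  - by exists w.
  - by exists z => //; apply: connected_component_refl.
have [_ [psi wE]] := zero_sectionE Xw; rewrite rw in wE.
have hr := TM_rcoord L_gt0 Xz.1.
suff : (fun phi => lift (Lam (rcoord L z)) (rcoord L z) phi 0) @` setT `<=` fibre X0 K z.
  by apply; exists psi.
apply: connected_component_max.
- by exists phi.
- move=> _ [t _ <-]; have [Xt rt] := zero_section_lift t hr; split=> //=.
  by have [-> _] := zero_sectionE Xt; rewrite rt kz.
- apply: connected_continuous_connected; first by apply/connected_intervalP => x y.
  apply: continuous_in_subspaceT => t _; apply: zero_section_lift_cvg; first exact: cvg_cst.
  exact: cvg_id.
Qed.

Lemma segment_fibre r s : I0 r -> fibre I0 Lam r s <-> s = r.
Proof.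
move=> hr; split=> [fs|->]; last exact: fibre_refl.
apply: (@constant_interval_point (fibre I0 Lam r) (Lam r)).
- by apply/connected_intervalP; exact: component_connected.
- by move=> t /connected_component_sub[].
- by move=> t /connected_component_sub[].
- by [].
- exact: fibre_refl.
Qed.

Lemma I0_0 : I0 0. Proof. by rewrite /= lexx ltW. Qed.

Lemma X0_0 : X0 (lift (Lam 0) 0 0 0).
Proof. by have [] := zero_section_lift 0 I0_0. Qed.

Let projK := reeb_proj K X0_0.
Let projI := reeb_proj Lam I0_0.
Let sec r : phase := lift (Lam r) r 0 0.

Lemma sec_in r : I0 r -> X0 (sec r) /\ rcoord L (sec r) = r.
Proof. exact: zero_section_lift. Qed.

(** The coordinate on the Reeb graph is read off a chosen representative; [height_rE] shows
    independence of the choice, since [rcoord] is constant on a fibre. *)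
Definition height_r (p : reeb X0 K) : R := rcoord L (projT1 (cid (reeb_proj_repr X0_0 p))).
Definition seg_r (q : reeb I0 Lam) : R := projT1 (cid (reeb_proj_repr I0_0 q)).

Lemma height_rE p z : reeb_fibre p z -> height_r p = rcoord L z.
Proof.
rewrite /height_r; case: cid => w [Xw pE pw] /= pz.
by move: pz; rewrite (reeb_fibre_eq pw) => /(zero_section_fibre _ Xw)[].
Qed.

Lemma seg_rE q r : reeb_fibre q r -> seg_r q = r.
Proof.
rewrite /seg_r; case: cid => s [Is qE qs] /= qr.
by move: qr; rewrite (reeb_fibre_eq qs) => /(segment_fibre _ Is).
Qed.

Lemma height_r_itv p : I0 (height_r p).
Proof. by rewrite /height_r; case: cid => w [[Tw _] _ _] /=; exact: (TM_rcoord L_gt0). Qed.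

Lemma seg_r_itv q : I0 (seg_r q).
Proof. by rewrite /seg_r; case: cid => w []. Qed.

Lemma height_r_continuous : continuous height_r.
Proof.
apply: (@reeb_function_continuous _ _ _ _ _ X0_0 R height_r (rcoord L)) => z Xz.
  exact: height_rE (reeb_proj_fibre _ _ Xz).
apply: cvg_trans (rcoord_cvg L_gt0 Xz.1); apply: cvg_app.
move=> B hB; have : nbhs z (fun w => TM w -> B w) := hB.
by apply: filterS => w hw [Tw _]; exact: hw.
Qed.

Lemma seg_r_continuous : continuous seg_r.
Proof.
apply: (@reeb_function_continuous _ _ _ _ _ I0_0 R seg_r id) => r Ir.
  exact: seg_rE (reeb_proj_fibre _ _ Ir).
by apply: cvg_within_filter; exact: cvg_id.
Qed.

Lemma projK_sec p : projK (sec (height_r p)) = p.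
Proof.
have [z [Xz pE pz]] := reeb_proj_repr X0_0 p; rewrite (height_rE pz).
apply: reeb_proj_eq; rewrite (reeb_fibre_eq pz); apply/(zero_section_fibre _ Xz).
exact: sec_in (TM_rcoord L_gt0 Xz.1).
Qed.

Lemma projI_seg q : projI (seg_r q) = q.
Proof. by apply: reeb_proj_eq; rewrite /seg_r; case: cid => s []. Qed.

(** In position coordinates dK is Lam' dr on the zero section. Over the poles its differential
    vanishes, in agreement with Lam' = 0 at 0 and L. *)
Lemma critK0E z : X0 z -> critK0 L f Lam z <-> crit L Lam (rcoord L z).
Proof.
move=> Xz; have hr := TM_rcoord L_gt0 Xz.1.
have dK c y i : dloc L K c y 0 i = 'D_(delta_mx 0 i) (K \o chart L c) y by rewrite mxE.
split=> [[_ _ [c [y [cy d2 _]]]]|[_ lr]].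
  split=> //; case: (coords_cases cy) => [[ec [hy zE]]|[_ [_ zE]]|[_ [_ zE]]].
  - have [_ _ _ rE] := HK_covector f Lam L_gt0 (y 0 0) (y 0 1) hy (cos2Dsin2 (y 0 3)).
    have -> : rcoord L z = y 0 2 by rewrite zE /chart !mxE.
    move: d2; rewrite -dK ec [y]vec4E (dlocK_cyl L_gt0 gen) ?mxE //=.
  - by rewrite zE (rcoord_north L_gt0) (l1_0 gen).
  - by rewrite zE (rcoord_south L_gt0) (l1_L gen).
case: (Xz) => Tz Hz; split=> //; have [_ [phi zE]] := zero_sectionE Xz.
case: (itv_cases hr) => e.
- exists PoleN, (vec4 0 0 0 0); rewrite -!dK; split.
  + have -> : z = zeroN L; last exact: coords_zeroN.
    rewrite zE (lift_pole Lam L_gt0 _ _ _ (or_introl e)) e eqxx !mul0r !mulr0.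
    by rewrite row3_0.
  + by have [_ ->] := dlocHK_pole L_gt0 gen 0 0 (or_introl (erefl PoleN)); rewrite mxE.
  + by have [_ ->] := dlocHK_pole L_gt0 gen 0 0 (or_introl (erefl PoleN)); rewrite mxE /= oppr0.
- exists PoleS, (vec4 0 0 0 0); rewrite -!dK; split.
  + have -> : z = zeroS L; last exact: coords_zeroS.
    rewrite zE (lift_pole Lam L_gt0 _ _ _ (or_intror e)) e (gt_eqF L_gt0) !mul0r !mulr0.
    by rewrite row3_0.
  + by have [_ ->] := dlocHK_pole L_gt0 gen 0 0 (or_intror (erefl PoleS)); rewrite mxE.
  + by have [_ ->] := dlocHK_pole L_gt0 gen 0 0 (or_intror (erefl PoleS)); rewrite mxE /= oppr0.
- exists Cyl, (vec4 0 0 (rcoord L z) phi); rewrite -!dK (dlocK_cyl L_gt0 gen) // !mxE /=; split=>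
    //.
  by split; rewrite /chart !mxE //= [RHS]zE /lift subrr.
Qed.

Lemma reeb_K_val p : reeb_val p = Lam (height_r p).
Proof.
have [z [Xz pE pz]] := reeb_proj_repr X0_0 p; rewrite (height_rE pz) (reeb_valE pz).
by have [] := zero_sectionE Xz.
Qed.

(** Both Reeb spaces are copies of [0, L]: the map goes down by [height_r], and its inverse goes up
    by the meridian section [sec] with phi = 0. *)
Lemma reeb_K_homeomorphism : exists Phi : reeb X0 K -> reeb I0 Lam,
  [/\ homeomorphism Phi,
      forall p, reeb_val (Phi p) = reeb_val p,
      Phi @` reeb_vertices (critK0 L f Lam) = reeb_vertices (crit L Lam) &
      forall p z, reeb_fibre p z -> reeb_fibre (Phi p) (rcoord L z)].
Proof.
have fib p : reeb_fibre (projI (height_r p)) (height_r p).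
  by apply: reeb_proj_fibre; exact: height_r_itv.
exists (projI \o height_r); split.
- exists (projK \o sec \o seg_r); split.
  + move=> p; apply: (@reeb_proj_cvg _ _ _ _ _ I0_0 _ (nbhs p) _ height_r (height_r p)).
    * by apply: filterE; exact: height_r_itv.
    * exact: height_r_itv.
    * exact: height_r_continuous.
  + move=> q; apply: (@reeb_proj_cvg _ _ _ _ _ X0_0 _ (nbhs q) _ (sec \o seg_r) (sec (seg_r q))).
    * by apply: filterE => t; have [] := sec_in (seg_r_itv t).
    * by have [] := sec_in (seg_r_itv q).
    * by apply: zero_section_lift_cvg; [exact: seg_r_continuous | exact: cvg_cst].
  + by move=> p /=; rewrite (seg_rE (fib p)) projK_sec.
  + move=> q /=; have [Xs rs] := sec_in (seg_r_itv q).
    by rewrite (height_rE (reeb_proj_fibre K X0_0 Xs)) rs projI_seg.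
- by move=> p; rewrite /= (reeb_valE (fib p)) reeb_K_val.
- rewrite eqEsubset; split=> [_ [p [z cz pz] <-]|q [r cr qr]].
    exists (rcoord L z); last by rewrite /= -(height_rE pz); exact: fib.
    by apply/critK0E => //; exact: reeb_fibre_sub pz.
  have [Xs rs] := sec_in (reeb_fibre_sub qr).
  exists (projK (sec r)).
    exists (sec r); last exact: reeb_proj_fibre.
    by apply/critK0E; rewrite ?rs.
  by rewrite /= (height_rE (reeb_proj_fibre K X0_0 Xs)) rs; exact: reeb_proj_eq.
- by move=> p z pz; rewrite -(height_rE pz); exact: fib.
Qed.

Lemma reeb_K_broken_line (s : seq R) : [set` s] = crit L Lam ->
  exists j : reeb X0 K -> R,
    broken_line j (reeb_vertices (critK0 L f Lam)) (@reeb_val _ _ _ _) L s Lam /\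
    forall p z, reeb_fibre p z -> j p = rcoord L z.
Proof.
move=> sE; exists height_r; split; last exact: height_rE.
have fib r : I0 r -> reeb_fibre (projK (sec r)) (sec r).
  by move=> hr; apply: reeb_proj_fibre; have [] := sec_in hr.
exists (projK \o sec); split.
- split; last exact: height_r_continuous.
  apply/subspace_continuousP => r; rewrite /= in_itv /= => hr.
  apply: (@reeb_proj_cvg _ _ _ _ _ X0_0 _ (within `[0, L] (nbhs r)) _ sec (sec r)).
  + rewrite near_withinE; apply: filterE => t; rewrite /= in_itv /= => ht.
    by have [] := sec_in ht.
  + by have [] := sec_in hr.
  + apply: cvg_within_filter; apply: zero_section_lift_cvg; first exact: cvg_id.
    exact: cvg_cst.
- by move=> r hr; rewrite /= (height_rE (fib r hr)); have [] := sec_in hr.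
- by move=> p; split; [exact: height_r_itv | exact: projK_sec].
- rewrite sE eqEsubset; split=> [p [z cz pz]|_ [r cr <-]].
    exists (height_r p); last exact: projK_sec.
    by rewrite (height_rE pz); apply/critK0E => //; exact: reeb_fibre_sub pz.
  have [Xs rs] := sec_in cr.1; exists (sec r); last exact: fib cr.1.
  by apply/critK0E; rewrite ?rs.
- exact: reeb_K_val.
Qed.

Lemma circle_Lam_image r1 r2 : 0 <= r1 -> r2 <= L ->
  K @` (\bigcup_(r in `[r1, r2]) O r (Lam r)) = Lam @` `[r1, r2].
Proof.
move=> r10 r2L.
have val r z : 0 <= r <= L -> O r (Lam r) z -> K z = Lam r.
  move=> hr; case: (itv_cases hr) => [->|->|hr'].
  - rewrite /circle_orbit eqxx => ->.
    have [_ _ + _] := pole_HK f Lam 0 0 (or_introl (erefl (northM L))).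
    by rewrite row3_0 (rcoord_north L_gt0).
  - rewrite /circle_orbit (gt_eqF L_gt0) eqxx => ->.
    have [_ _ + _] := pole_HK f Lam 0 0 (or_intror (erefl (southM L))).
    by rewrite row3_0 (rcoord_south L_gt0).
  - by move=> Oz; have [] := circle_HK f L_gt0 hr' Oz.
have itv r : r \in `[r1, r2] -> 0 <= r <= L.
  by rewrite in_itv /= => /andP[a b]; rewrite (le_trans r10 a) (le_trans b r2L).
have nonempty r : 0 <= r <= L -> exists z, O r (Lam r) z.
  move=> hr; case: (itv_cases hr) => [->|->|hr'].
  - by exists (zeroN L); rewrite /circle_orbit eqxx.
  - by exists (zeroS L); rewrite /circle_orbit (gt_eqF L_gt0) eqxx.
  - exact: circle_nonempty.
rewrite eqEsubset; split=> [_ [z [r hr Oz] <-]|_ [r hr <-]].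
  by exists r => //; rewrite (val r z (itv r hr) Oz).
have [z Oz] := nonempty r (itv r hr).
by exists z; [exists r | exact: val (itv r hr) Oz].
Qed.

End ZeroSection.

Theorem theorem5p14 (R : realType) (L : R) (f Lam : R -> R)
    (L_gt0 : 0 < L) (gen : generic L f Lam) :
  let a := afun f Lam in
  let h := hfun f Lam in
  let k := kfun f Lam in
  let abs_a : R -> R := fun r => `|a r| in
  let H := Hfun L f in
  let K := Kfun L Lam in
  let F := momentum L f Lam in
  let O := circle_orbit L Lam in
  let sgn_type := fun r : R => - k^`() r * Lam^`() r in
  (* 1 *)
  [/\ (rank0 L f Lam = [set zeroN L; zeroS L] /\ zeroN L <> zeroS L) /\
      (forall z, rank0 L f Lam z ->
         nondegenerate0 L f Lam z /\ center_center L f Lam z),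
  (* 2 *)
  [/\ rank1 L f Lam =
        (\bigcup_(r in Ireg L f `&` `]0, L[) O r (k r))
        `|` (\bigcup_(r in `]0, L[) O r (Lam r)),
      (forall r, Ireg L f r -> 0 < r < L ->
        [/\ O r (k r) `<=` nondegenerate1 L f Lam <->
              k^`() r * Lam^`() r != 0,
            k^`() r * Lam^`() r != 0 <->
              (Ireg L f `\` (crit L Lam `|` infl L f Lam)) r &
            O r (k r) `<=` nondegenerate1 L f Lam ->
            [/\ O r (k r) `<=` elliptic L f Lam <-> 0 < sgn_type r,
                O r (k r) `<=` hyperbolic L f Lam <-> sgn_type r < 0,
                forall phi, Num.sg (gauss_curvature (revolution f Lam) r phi)
                            = Num.sg (sgn_type r) &
                forall phi, Num.sg (gauss_curvature (revolution a k) r phi)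
                            = Num.sg (sgn_type r)]]) /\
      Ireg L f `\` (crit L Lam `|` infl L f Lam)
        = [set r | 0 <= r <= L]
          `\` (crit L f `|` crit L Lam `|` infl L f Lam),
      [/\ forall r0, crit L Lam r0 -> 0 < r0 < L ->
            \forall r \near r0^',
              [/\ f r <> f r0, f r0 < f r -> 0 < sgn_type r &
                  f r < f r0 -> sgn_type r < 0],
          \forall r \near 0^'+, 0 < sgn_type r &
          \forall r \near L^'-, 0 < sgn_type r],
      (forall ri, crit L f ri ->
        [/\ local_max f ri \/ local_min f ri,
            local_max f ri -> \forall r \near ri^', 0 < sgn_type r &
            local_min f ri -> \forall r \near ri^', sgn_type r < 0]) /\
      (forall r0, infl L f Lam r0 ->
        [/\ \forall r \near r0^'- & s \near r0^'+,
              Num.sg (sgn_type r) * Num.sg (sgn_type s) = -1,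
            local_min abs_a r0 \/ local_max abs_a r0,
            local_min abs_a r0 ->
              \forall r \near r0^', (0 < sgn_type r <-> f r0 < f r) /\
                                    (sgn_type r < 0 <-> f r < f r0) &
            local_max abs_a r0 ->
              \forall r \near r0^', (0 < sgn_type r <-> f r < f r0) /\
                                    (sgn_type r < 0 <-> f r0 < f r)]) &
      forall r, 0 < r < L ->
        (O r (Lam r) `<=` nondegenerate1 L f Lam <-> Lam^`() r != 0) /\
        (O r (Lam r) `<=` nondegenerate1 L f Lam ->
         O r (Lam r) `<=` elliptic L f Lam)],
  (* 3 *)
  [/\ [/\ forall r kappa, 0 < r < L ->
            (O r kappa `<=` rank1 L f Lam /\
             ~ O r kappa `<=` nondegenerate1 L f Lam) <->
            ((crit L Lam `|` infl L f Lam) r /\ kappa = k r),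
          crit L Lam =
            [set r | 0 <= r <= L /\ horizontal_tangent f Lam r] &
          infl L f Lam = [set r | 0 <= r <= L /\ inflection f Lam r]],
      (forall r0, crit L Lam r0 -> 0 < r0 < L ->
        [/\ (\forall r \near r0, regular f Lam r /\ curvature f Lam r != 0) /\
              horizontal_tangent f Lam r0,
            [/\ \forall r \near r0, regular a k r, a r0 = 0, k r0 = Lam r0,
                a^`() r0 != 0 & k^`() r0 / a^`() r0 = - f r0 /\ - f r0 < 0],
            \forall r \near r0, 0 <= h r,
            h r0 = 0 /\ k r0 = Lam r0 &
            [/\ h^`() r0 = 0, k^`() r0 != 0 & h^`(2) r0 != 0]]) /\
      (forall r0, r0 = 0 \/ r0 = L ->
        [/\ f r0 = 0, a r0 = 0, k r0 = Lam r0,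
            horizontal_tangent f Lam r0 /\ curvature f Lam r0 != 0 &
            horizontal_tangent a k r0 /\ curvature a k r0 != 0]),
      forall ri, crit L f ri ->
        let l := fun r => f ri * a r - Lam ri + k r in
        [/\ (\forall r \near ri, regular f Lam r /\ curvature f Lam r != 0) /\
              vertical_tangent f Lam ri,
            (a r @[r --> ri^'-] --> +oo /\ a r @[r --> ri^'+] --> -oo) \/
            (a r @[r --> ri^'-] --> -oo /\ a r @[r --> ri^'+] --> +oo),
            asymptotic ri^' (fun r => (a r, k r))
              [set P : R * R | f ri * P.1 - Lam ri + P.2 = 0] /\
            (\forall r \near ri^'- & s \near ri^'+, l r * l s < 0),
            h r @[r --> ri^'] --> +oo /\
            ((k r @[r --> ri^'-] --> +oo /\ k r @[r --> ri^'+] --> -oo) \/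
             (k r @[r --> ri^'-] --> -oo /\ k r @[r --> ri^'+] --> +oo)) &
            asymptotic ri^' (fun r => (h r, k r))
              [set P : R * R | P.1 = (P.2 - Lam ri) ^+ 2 / (2 * f ri ^+ 2)]],
      forall r0, infl L f Lam r0 ->
        [/\ inflection f Lam r0 /\
              ~ horizontal_tangent f Lam r0 /\ ~ vertical_tangent f Lam r0,
            [/\ Ireg L f r0, a r0 != 0, ordinary_cusp a k r0,
                a^`(2) r0 != 0 & k^`(2) r0 / a^`(2) r0 = - f r0],
            ordinary_cusp h k r0 /\ 0 < h r0,
            0 < a r0 \/ a r0 < 0 &
            (local_min abs_a r0 /\ ~ local_max abs_a r0) \/
            (local_max abs_a r0 /\ ~ local_min abs_a r0)] &
      forall rho1 rho2 hs ks : R,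
        let s := fun r => - Num.sg (a r) in
        let w := Num.sqrt (2 * hs) in
        0 < rho1 < L -> 0 < rho2 < L -> rho1 < rho2 -> 0 < hs ->
        O rho1 ks `<=` rank1 L f Lam `&` hyperbolic L f Lam ->
        O rho2 ks `<=` rank1 L f Lam `&` hyperbolic L f Lam ->
        (exists z, [/\ TM L z, F z = (hs, ks) &
           O rho1 ks `|` O rho2 ks `<=` fibre (TM L) F z]) ->
        [/\ forall rho, rho = rho1 \/ rho = rho2 ->
              [/\ s rho = 1 \/ s rho = -1,
                  h rho = hs /\ k rho = ks,
                  h^`() rho / k^`() rho = s rho * w / f rho /\
                    Num.sg (h^`() rho / k^`() rho) = s rho,
                  regular f Lam rho /\
                    tangent_line f Lam rho =
                    [set P : R * R | P.2 = ks - s rho * w * P.1] &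
                  [/\ \forall r \near rho, `|Lam r - ks| <= w * f r,
                      s rho = 1 -> Lam rho - ks = - (w * f rho) &
                      s rho = -1 -> Lam rho - ks = w * f rho]],
            s rho1 = s rho2 ->
              tangent_line f Lam rho1 = tangent_line f Lam rho2 /\
              (a rho1, k rho1) = (a rho2, k rho2) &
            s rho1 <> s rho2 ->
              [/\ tangent_line f Lam rho2 =
                    [set P : R * R | tangent_line f Lam rho1 (- P.1, P.2)],
                  (a rho1, k rho1) = (- s rho1 * w, ks) &
                  (a rho2, k rho2) = (- s rho2 * w, ks)]]] &
  (* 4 *)
  [/\ (exists Phi : reeb (TM L `&` [set z | H z = 0]) K
                    -> reeb [set r : R | 0 <= r <= L] Lam,
        [/\ homeomorphism Phi,
            forall p, reeb_val (Phi p) = reeb_val p,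
            Phi @` reeb_vertices (critK0 L f Lam)
              = reeb_vertices (crit L Lam) &
            forall p z, reeb_fibre p z -> reeb_fibre (Phi p) (rcoord L z)]) /\
      (exists rs : seq R,
        [/\ sorted <%R rs /\ [set` rs] = crit L Lam,
            head 0 rs = 0 /\ last 0 rs = L,
            (exists j : reeb (TM L `&` [set z | H z = 0]) K -> R,
              broken_line j (reeb_vertices (critK0 L f Lam)) (@reeb_val _ _ _ _)
                L rs Lam
              /\ forall p z, reeb_fibre p z -> j p = rcoord L z) &
            forall j, (j.+1 < size rs)%N ->
              let r1 := nth 0 rs j in let r2 := nth 0 rs j.+1 in
              K @` (\bigcup_(r in `[r1, r2]) O r (Lam r)) = Lam @` `[r1, r2] /\
              Lam @` `[r1, r2] =
                [set t | Num.min (Lam r1) (Lam r2) <= t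
                         <= Num.max (Lam r1) (Lam r2)]]),
      forall p : bcomplex L f Lam, \forall e \near 0^'+,
        connected (circular_nbhd p e `&` right_of p),
      forall p : bcomplex L f Lam, vertex p ->
        exists! A, face A /\ adjacent_right A p &
      forall E : set (bcomplex L f Lam), edge E ->
        exists! A, face A /\ forall p, E p -> adjacent_right A p]].
Proof.
move=> a h k abs_a H K F O sgn_type; split.
- split; first by split; [exact: rank0E | exact: zeroN_neq_zeroS].
  by move=> z; rewrite (rank0E L_gt0 gen); exact: zero_center_center.
- split.
  + exact: rank1E.
  + by split; [exact: circle_k_summary | exact: nondegenerate_setE].
  + by split; [exact: sgn_near_crit_l | exact (sgn_near_0 L_gt0 gen) |
      exact (sgn_near_L L_gt0 gen)].
  + split=> [ri cri|r0 ir]; first exact: (sgn_crit_f gen).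
    by have [m1 m2 m3] := sgn_infl gen ir; split=> //; exact (sgn_infl_sides gen ir).
  + exact (circle_Lam_type L_gt0 gen).
- split.
  + by split; [exact (degenerate_circles L_gt0 gen) | exact (crit_l_horizontal gen) |
      exact (infl_inflection gen)].
  + by split; [exact (crit_l_forms gen) | exact (end_forms L_gt0 gen)].
  + exact (crit_f_forms gen).
  + exact (infl_forms gen).
  + exact (saddle_forms L_gt0 gen).
- split.
  + split; first exact: reeb_K_homeomorphism.
    have [s [ss sE s0 sL]] := crit_sequence L_gt0 gen.
    exists s; split=> //; first exact: reeb_K_broken_line.
    move=> j js r1 r2.
    have crit_nth i : (i < size s)%N -> crit L Lam (nth 0 s i).
      by move=> hi; rewrite -sE /=; exact: mem_nth.
    have [/andP[r10 _] _] := crit_nth j (ltnW js).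
    have [/andP[_ r2L] _] := crit_nth j.+1 js.
    split; first exact: circle_Lam_image.
    apply: (Lam_monotone_image gen) => //.
      by rewrite /r1 /r2 (lt_sorted_ltn_nth 0 ss) ?inE // ltnW.
    move=> t ht; rewrite -sE /= => ts; exact: (sorted_consecutive ss js ts ht).
  + exact (circular_nbhd_right_connected L_gt0 gen).
  + by move=> p _; exact: right_face_unique.
  + exact: edge_unique_face.
Qed.
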